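(* There exist an analytic self-map $\phi\colon\mathbb{D}\to\mathbb{D}$ and an Orlicz function $\Psi$ such that the composition operator $C_\phi\colon H^\Psi\to H^\Psi$ is compact, and moreover $C_\phi$ (acting on the Hardy space $H^2$) belongs to the Schatten class $S_p(H^2)$ for every $p>0$, whereas the composition operator $C_\phi\colon\mathfrak{B}^\Psi\to\mathfrak{B}^\Psi$ is not compact.
   Context: $\mathbb{D}$ is the open unit disk of $\mathbb{C}$, $\mathbb{T}=\partial\mathbb{D}$, $m$ is normalized Lebesgue measure on $\mathbb{T}$, and $\mathcal{A}$ is normalized area measure on $\mathbb{D}$ ($d\mathcal{A}=dx\,dy/\pi$). An Orlicz function is a non-decreasing convex function $\Psi\colon[0,\infty)\to[0,\infty)$ with $\Psi(0)=0$, $\Psi(x)>0$ for $x>0$, and $\Psi(x)\to\infty$ as $x\to\infty$. For a finite measure space $(S,\mu)$, $L^\Psi(\mu)$ is the space of (classes of) measurable $f\colon S\to\mathbb{C}$ with $\int_S\Psi(|f|/C)\,d\mu<\infty$ for some $C>0$, with norm $\|f\|_\Psi=\inf\{C>0:\int_S\Psi(|f|/C)\,d\mu\le 1\}$. The Bergman-Orlicz space is $\mathfrak{B}^\Psi=\{f\in L^\Psi(\mathbb{D},\mathcal{A}): f\text{ analytic}\}$ with the norm of $L^\Psi(\mathbb{D},\mathcal{A})$. The Hardy-Orlicz space is $H^\Psi=\{f\in H^1: f^*\in L^\Psi(\mathbb{T},m)\}$ with norm $\|f\|_{H^\Psi}=\|f^*\|_{L^\Psi(m)}$, where $f^*$ is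 the boundary value function of $f$; $H^1,H^2$ are the classical Hardy spaces on $\mathbb{D}$. Every analytic $\phi\colon\mathbb{D}\to\mathbb{D}$ induces bounded composition operators $C_\phi(f)=f\circ\phi$ on $H^\Psi$, $\mathfrak{B}^\Psi$ and $H^2$. *)

(* Defs.v *)
From HB Require Import structures.
From mathcomp Require Import all_boot all_order all_algebra.
From mathcomp Require Import all_classical all_reals all_analysis.
From mathcomp Require Import complex.

Set Implicit Arguments.
Unset Strict Implicit.
Unset Printing Implicit Defensive.

Import Order.TTheory GRing.Theory Num.Theory.
Import numFieldNormedType.Exports.

Local Open Scope classical_set_scope.
Local Open Scope complex_scope.
Local Open Scope ring_scope.

(* In [R[i]] the norm [`|z|] is itself a complex number. *)
Definition cabs (R : realType) (z : R[i]) : R := complex.Re `|z|.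

Section AnalyticFunctions.
Variable R : realType.
Implicit Types f phi : R[i] -> R[i].

Definition disk : set R[i] := [set z | cabs z < 1].

(* [R[i]^o] is [R[i]] as a normed space over itself, so [derivable _ z 1] is
   complex differentiability. *)
Definition analytic f :=
  forall z, disk z -> derivable (f : R[i]^o -> R[i]^o) z 1.

Definition analytic_self_map phi :=
  analytic phi /\ forall z, disk z -> disk (phi z).

Definition composition_operator phi f : R[i] -> R[i] := f \o phi.

End AnalyticFunctions.
Arguments disk {R}.

Section OrliczSpaces.
Variable R : realType.

Record orlicz_function (Psi : R -> R) : Prop := OrliczFunction {
  orlicz_homo : forall x y : R, 0 <= x -> x <= y -> Psi x <= Psi y;
  orlicz_convex : forall x y t : R, 0 <= x -> 0 <= y -> 0 <= t -> t <= 1 ->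
    Psi (t * x + (1 - t) * y) <= t * Psi x + (1 - t) * Psi y;
  orlicz0 : Psi 0 = 0;
  orlicz_gt0 : forall x : R, 0 < x -> 0 < Psi x;
  orlicz_cvg : Psi x @[x --> +oo] --> +oo }.

Variables (d : measure_display) (S : measurableType d).
Variables (mu : {measure set S -> \bar R}) (D : set S) (Psi : R -> R).
Implicit Type f : S -> R[i].

(* The measure space is [D] with the restriction of [mu]. *)
Definition orlicz_modular f (C : R) : \bar R :=
  (\int[mu]_(x in D) (Psi (cabs (f x) / C))%:E)%E.

Definition orlicz_space : set (S -> R[i]) := [set f |
  [/\ measurable_fun D (fun x => complex.Re (f x)),
      measurable_fun D (fun x => complex.Im (f x)) &
      exists2 C, 0 < C & (orlicz_modular f C < +oo)%E]].

(* Extended-valued, so that it is [+oo] (and not the inf of an empty set of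
   reals, which is [0]) when no [C] is admissible. *)
Definition orlicz_norm f : \bar R :=
  ereal_inf [set C%:E | C in [set C | 0 < C /\ (orlicz_modular f C <= 1)%E]].

End OrliczSpaces.

Section CircleAndDisk.
Variable R : realType.

Lemma circle_scale_ge0 : 0 <= (2 * pi)^-1 :> R.
Proof. by rewrite invr_ge0 mulr_ge0// pi_ge0. Qed.

(* The unit circle is parametrized by [expi] on [0, 2 pi]; normalized Lebesgue
   measure becomes [circle_measure] restricted to that interval. *)
Definition expi (t : R) : R[i] := cos t +i* sin t.

Definition angles : set R := `[0, 2 * pi].

Definition circle_measure : {measure set (measurableTypeR R) -> \bar R} :=
  mscale (NngNum circle_scale_ge0) (@lebesgue_measure R).

Lemma area_scale_ge0 : 0 <= pi^-1 :> R.
Proof. by rewrite invr_ge0 pi_ge0. Qed.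

Definition complex_of_pair (w : R * R) : R[i] := w.1 +i* w.2.

Definition plane_disk : set (R * R) := [set w | disk (complex_of_pair w)].

Definition area_measure :
    {measure set (measurableTypeR R * measurableTypeR R)%type -> \bar R} :=
  mscale (NngNum area_scale_ge0)
    (product_measure1 (@lebesgue_measure R) (@lebesgue_measure R)).

End CircleAndDisk.

Section FunctionSpaces.
Variable R : realType.
Implicit Types (f g : R[i] -> R[i]) (Psi : R -> R).

Definition bergman_orlicz Psi : set (R[i] -> R[i]) := [set f | analytic f /\
  orlicz_space (area_measure R) (@plane_disk R) Psi (f \o @complex_of_pair R)].

Definition bergman_orlicz_norm Psi f : \bar R :=
  orlicz_norm (area_measure R) (@plane_disk R) Psi (f \o @complex_of_pair R).

Definition hardy_norm (p : R) f : \bar R :=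
  ereal_sup [set ((\int[circle_measure R]_(t in @angles R)
                     (cabs (f (r%:C * expi t)) `^ p)%:E) `^ p^-1)%E
            | r in [set r : R | 0 <= r < 1]].

Definition hardy (p : R) : set (R[i] -> R[i]) :=
  [set f | analytic f /\ (hardy_norm p f < +oo)%E].

(* The boundary function [t |-> f^*(e^{it})], as a radial limit; [lim] takes
   a default value where the limit does not exist, a null set for [f] in
   [hardy 1]. *)
Definition boundary f (t : R) : R[i] :=
  lim ((f (r%:C * expi t) : R[i]^o) @[r --> (1 : R)^'-]).

Definition hardy_orlicz Psi : set (R[i] -> R[i]) := [set f | hardy 1 f /\
  orlicz_space (circle_measure R) (@angles R) Psi (boundary f)].

Definition hardy_orlicz_norm Psi f : \bar R :=
  orlicz_norm (circle_measure R) (@angles R) Psi (boundary f).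

Definition hardy2_dot f g : R[i] :=
  let h t := boundary f t * (boundary g t)^* in
  Rintegral (circle_measure R) (@angles R) (fun t => complex.Re (h t)) +i*
  Rintegral (circle_measure R) (@angles R) (fun t => complex.Im (h t)).

End FunctionSpaces.

Section Operators.
Variable R : realType.
Local Notation fct := (R[i] -> R[i]).

(* A function space is given by its set of elements and its norm; the elements
   are functions on [R[i]] of which only the values on the disk matter. *)
Definition norm_cvg (N : fct -> \bar R) (u : nat -> fct) (g : fct) :=
  N (u n \- g) @[n --> \oo] --> 0%E.

(* Relative compactness of [A] in the metric space [Y], in sequential form. *)
Definition relatively_compact (Y : set fct) (N : fct -> \bar R) (A : set fct) :=
  forall u : nat -> fct, (forall n, A (u n)) ->
    exists (k : nat -> nat) (g : fct),
      [/\ {homo k : m n / (m < n)%N}, Y g & norm_cvg N (u \o k) g].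

Definition compact_operator (X : set fct) (N : fct -> \bar R) (T : fct -> fct) :=
  (forall f, X f -> X (T f)) /\
  relatively_compact X N [set T f | f in [set f | X f /\ (N f <= 1)%E]].

(* [v = T^* u] for an operator [T] of the Hilbert space [H^2]. *)
Definition adjoint_value (T : fct -> fct) (u v : fct) :=
  hardy 2 v /\ forall g, hardy 2 g -> hardy2_dot (T g) u = hardy2_dot g v.

(* The eigenspace [ker (T^* T - s^2)] in [H^2]. *)
Definition singular_space (T : fct -> fct) (s : R) : set fct :=
  [set f | hardy 2 f /\ adjoint_value T (T f) ((s ^+ 2)%:C \*o f)].

Definition free_on_disk (n : nat) (e : 'I_n -> fct) :=
  forall c : 'I_n -> R[i],
    (forall z, disk z -> \sum_(i < n) c i * e i z = 0) -> forall i, c i = 0.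

(* The multiplicity of [s] as a singular value of [T]: the dimension of
   [singular_space T s], linear independence being that of functions on the
   disk. *)
Definition singular_multiplicity (T : fct -> fct) (s : R) : \bar R :=
  ereal_sup [set n%:R%:E | n in [set n | exists e : 'I_n -> fct,
    (forall i, singular_space T s (e i)) /\ free_on_disk e]].

(* The sum of the [p]-th powers of the singular values, repeated according to
   multiplicity, is finite. *)
Definition schatten (p : R) (T : fct -> fct) :=
  compact_operator (hardy 2) (hardy_norm 2) T /\
  (\esum_(s in [set s : R | (0 < s)%R]) ((s `^ p)%:E * singular_multiplicity T s)
     < +oo)%E.

End Operators.

(* Main.v *)
(* The symbol is phi = 1 - 1/(2 - Log(1 - z)).  On the circle 1 - |phi| is at
   least a multiple of 1/log(1/|1 - z|), so every power of 1/(1 - |phi|), and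
   even a small exponential of it, is integrable; but
   |1 - z| <= e^(-L) forces |1 - phi| <= 1/L.

   Hardy side.  A function in H^1 factors as b h^2 with |b| <= 1 and h in H^2
   (take limits of the factorization of polynomials), hence is the Poisson
   integral of its boundary values.  For f in the unit ball of the
   Hardy-Orlicz space, Jensen's inequality in the Poisson formula bounds
   Psi(|f|/2) by 2/(1 - |z|); since Psi(C x) <= K exp(Psi(x)/8), the functions
   Psi(C |f o phi|) have a common integrable majorant, and compactness follows
   from Montel's theorem and dominated convergence.  On H^2, if the first N
   coefficients of f vanish then |f|^2 <= |f|_2^2 |z|^(2N)/(1 - |z|^2), so the
   N-th singular value decays faster than every power of N.

   Bergman side.  Psi is piecewise affine with breaks at the factorials, the
   increments of its slope being so large that, with L^2 an upper bound of
   Psi(n!), Psi(2 n!) >= 40 e^(2L).  The functions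
   (n!/8)(eps/(1 + eps - z))^4 with eps = 1/L lie in the unit ball, while their
   compositions with phi are at least n!/128 on the part of the disk within
   e^(-L) of 1, whose area is of the order of e^(-2L); hence no subsequence
   converges. *)

Require Import Defs.
From mathcomp Require Import all_boot all_order all_algebra.
From mathcomp Require Import all_classical all_reals all_analysis.
From mathcomp Require Import measurable_realfun complex ring lra.

Set Implicit Arguments.
Unset Strict Implicit.
Unset Printing Implicit Defensive.

Import Order.TTheory GRing.Theory Num.Theory.
Import numFieldNormedType.Exports.

Local Open Scope classical_set_scope.
Local Open Scope complex_scope.
Local Open Scope ring_scope.

(** What separates the two spaces is the size of point evaluations. At distance 1/L from the circle,
    f in the Hardy-Orlicz unit ball has Psi(|f|/2) of order at most L, while in the Bergman-Orlicz
    unit ball order L^2 is allowed. As phi sends points within e^(-L) of 1 to points within 1/L of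
    1, two demands on Psi result. For every C, Psi(C x) must stay below a multiple of e^(Psi(x)/8),
    so that the Hardy side only integrates a small exponential of L. At infinitely many places, Psi
    must jump from P to at least a multiple of e^(2 sqrt P), the reciprocal of the area e^(-2L) for
    L^2 = P. They are compatible because 2 sqrt P is eventually below P/8. The breaks are at
    factorials so that, for large x, at most one break lies between x and C x, and the jumps do not
    accumulate under a dilation. The function theory is developed from Goursat's theorem. Boundary
    values exist only almost everywhere, as radial limits, so estimates on circles of radius less
    than 1 reach the unit circle through Fatou's lemma. *)

Local Notation Re := complex.Re.
Local Notation Im := complex.Im.

(** * Complex absolute value and complex derivatives *)

Section Modulus.
Variable R : realType.
Implicit Types (z w : R[i]) (x : R).

Lemma cabsE z : cabs z = Num.sqrt (Re z ^+ 2 + Im z ^+ 2).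
Proof. by rewrite /cabs normc_def. Qed.

Lemma normc_cabs z : `|z| = (cabs z)%:C.
Proof. by rewrite normc_def cabsE. Qed.

Lemma sqr_cabs z : cabs z ^+ 2 = Re z ^+ 2 + Im z ^+ 2.
Proof. by rewrite cabsE sqr_sqrtr// addr_ge0// sqr_ge0. Qed.

Lemma cabs_ge0 z : 0 <= cabs z.
Proof. by rewrite cabsE sqrtr_ge0. Qed.

Lemma cabsM z w : cabs (z * w) = cabs z * cabs w.
Proof. by apply: (@complexI R); rewrite rmorphM/= -!normc_cabs normrM. Qed.

Lemma cabsD z w : cabs (z + w) <= cabs z + cabs w.
Proof. by rewrite -lecR rmorphD/= -!normc_cabs ler_normD. Qed.

Lemma cabsN z : cabs (- z) = cabs z.
Proof. by rewrite /cabs normrN. Qed.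

Lemma cabsBC z w : cabs (z - w) = cabs (w - z).
Proof. by rewrite /cabs distrC. Qed.

Lemma cabsB z w : cabs (z - w) <= cabs z + cabs w.
Proof. by rewrite (le_trans (cabsD _ _))// cabsN. Qed.

Lemma cabs0 : cabs (0 : R[i]) = 0.
Proof. by rewrite /cabs normr0. Qed.

Lemma cabs1 : cabs (1 : R[i]) = 1.
Proof. by rewrite /cabs normr1. Qed.

Lemma cabs_eq0 z : (cabs z == 0) = (z == 0).
Proof. by rewrite -[RHS]normr_eq0 normc_cabs -(inj_eq (@complexI R)). Qed.

Lemma cabs_gt0 z : (0 < cabs z) = (z != 0).
Proof. by rewrite lt_def cabs_eq0 cabs_ge0 andbT. Qed.

Lemma cabsV z : cabs z^-1 = (cabs z)^-1.
Proof.
have [->|z0] := eqVneq z 0; first by rewrite invr0 cabs0 invr0.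
have cz : cabs z != 0 by rewrite cabs_eq0.
by apply: (mulfI cz); rewrite -cabsM !divff// cabs1.
Qed.

Lemma cabsX z n : cabs (z ^+ n) = cabs z ^+ n.
Proof. by elim: n => [|n IH]; rewrite ?expr0 ?cabs1// !exprS cabsM IH. Qed.

Lemma cabs_real x : cabs x%:C = `|x|.
Proof. by rewrite cabsE/= expr0n/= addr0 sqrtr_sqr. Qed.

Lemma cabs_sum I (r : seq I) (P : pred I) (F : I -> R[i]) :
  cabs (\sum_(i <- r | P i) F i) <= \sum_(i <- r | P i) cabs (F i).
Proof.
elim/big_rec2: _ => [|i y1 y2 _ H]; first by rewrite cabs0.
by rewrite (le_trans (cabsD _ _))// lerD2l.
Qed.

Lemma ler_cabsB z w : cabs z - cabs w <= cabs (z - w).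
Proof. by rewrite lerBlDr -{1}(subrK w z) cabsD. Qed.

Lemma Re_le_cabs z : `|Re z| <= cabs z.
Proof.
by rewrite cabsE -sqrtr_sqr ler_wsqrtr// lerDl sqr_ge0.
Qed.

Lemma Im_le_cabs z : `|Im z| <= cabs z.
Proof. by rewrite cabsE -sqrtr_sqr ler_wsqrtr// lerDr sqr_ge0. Qed.

Lemma Re_le z : Re z <= cabs z.
Proof. exact: le_trans (ler_norm _) (Re_le_cabs _). Qed.

Lemma cabs_le_ReIm z : cabs z <= `|Re z| + `|Im z|.
Proof.
case: z => x y; rewrite (_ : cabs _ = cabs (x%:C + 'i * y%:C)); last by simpc.
have i1 : cabs ('i : R[i]) = 1 by rewrite cabsE/= expr0n/= expr1n add0r sqrtr1.
by rewrite (le_trans (cabsD _ _))// cabsM !cabs_real i1 mul1r.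
Qed.

Lemma cabs_conj z : cabs z^* = cabs z.
Proof. by rewrite /cabs normcJ. Qed.

Lemma cReD z w : Re (z + w) = Re z + Re w. Proof. by case: z w => ? ? []. Qed.
Lemma cImD z w : Im (z + w) = Im z + Im w. Proof. by case: z w => ? ? []. Qed.
Lemma cReN z : Re (- z) = - Re z. Proof. by case: z. Qed.
Lemma cImN z : Im (- z) = - Im z. Proof. by case: z. Qed.
Lemma cReM z w : Re (z * w) = Re z * Re w - Im z * Im w.
Proof. by case: z w => ? ? []. Qed.
Lemma cImM z w : Im (z * w) = Re z * Im w + Im z * Re w.
Proof. by case: z w => ? ? []. Qed.
Lemma cReB z w : Re (z - w) = Re z - Re w. Proof. by rewrite cReD cReN. Qed.
Lemma cImB z w : Im (z - w) = Im z - Im w. Proof. by rewrite cImD cImN. Qed.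
Lemma cRe_sum I (r : seq I) (P : pred I) (F : I -> R[i]) :
  Re (\sum_(i <- r | P i) F i) = \sum_(i <- r | P i) Re (F i).
Proof. by elim/big_rec2: _ => // i y1 y2 _ <-; rewrite cReD. Qed.
Lemma complex_eq z w : Re z = Re w -> Im z = Im w -> z = w.
Proof. by case: z w => ? ? [? ?] /= -> ->. Qed.

Lemma mul_conj z : z * z^* = (cabs z ^+ 2)%:C.
Proof. by rewrite sqr_cabs; apply: complex_eq; case: z => x y /=; ring. Qed.

Lemma rC_mul x z : x%:C * z = (x * Re z) +i* (x * Im z).
Proof. by case: z => a b; apply: complex_eq; rewrite /=; ring. Qed.

End Modulus.

(** * Complex differentiability as a first-order expansion *)

Section ComplexDerivative.
Variable R : realType.
Implicit Types (f g : R[i] -> R[i]) (z w D : R[i]).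

(** An expansion with real tolerances: the non-strict bound admits h = 0 and no quotient by h
    occurs, so that sums, products and compositions are plain estimates. *)
Definition cderiv f z D := forall e : R, 0 < e -> exists2 d : R, 0 < d &
  forall h, cabs h < d -> cabs (f (z + h) - f z - D * h) <= e * cabs h.

Definition ccont f z := forall e : R, 0 < e -> exists2 d : R, 0 < d &
  forall w, cabs (w - z) < d -> cabs (f w - f z) < e.

(** Norms and radii on [R[i]] are complex numbers. A positive one has zero imaginary part, so taking
    real parts turns the limit of difference quotients into the expansion, and back. *)
Lemma derivableP f z : derivable (f : R[i]^o -> R[i]^o) z 1 <-> exists D, cderiv f z D.
Proof.
split.
- move=> /cvg_ex[D HD]; exists D => e e0.
  move/cvgrPdist_lt : HD => /(_ e%:C); rewrite ltcR => /(_ e0).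
  move=> [d /= d0 Hd]; move: d0; rewrite ltcE/= => /andP[/eqP imd red].
  exists (Re d) => // h hd.
  have [->|h0] := eqVneq h 0.
    by rewrite addr0 subrr mulr0 subr0 cabs0 mulr0.
  have := Hd h; rewrite /ball_/= sub0r normrN => /(_ _ h0).
  have -> : `|h| < d = true.
    by rewrite normc_cabs ltcE/= imd eqxx.
  move=> /(_ isT); rewrite normc_cabs ltcR => H.
  rewrite -[leLHS]mulr1 -(divff (_ : cabs h != 0)) ?cabs_eq0// mulrA mulrAC.
  rewrite ler_wpM2r ?cabs_ge0// -cabsV -cabsM -cabsN ltW//.
  apply: le_lt_trans H; rewrite le_eqVlt; apply/orP; left; apply/eqP; congr cabs.
  have -> : h *: (1 : R[i]^o) = h by rewrite /GRing.scale/= mulr1.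
  rewrite [in RHS]/GRing.scale/= (addrC h z).
  by field.
- move=> [D HD]; apply/cvg_ex; exists D; apply/cvgrPdist_lt => e.
  rewrite ltcE/= => /andP[/eqP ime ree].
  have e2 : 0 < Re e / 2 by rewrite divr_gt0.
  have [d d0 Hd] := HD _ e2.
  exists d%:C => /=; first by rewrite ltcR.
  move=> h; rewrite /ball_/= sub0r normrN normc_cabs ltcR => hd h0.
  rewrite normc_cabs ltcE/= ime eqxx/=.
  have -> : h *: (1 : R[i]^o) = h by rewrite /GRing.scale/= mulr1.
  rewrite /GRing.scale/= (addrC h z).
  have := Hd _ hd; rewrite -ler_pdivrMr ?cabs_gt0// -cabsV -cabsM => H.
  have -> : D - h^-1 * (f (z + h) - f z) = - ((f (z + h) - f z - D * h) * h^-1).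
    by field.
  by rewrite cabsN (le_lt_trans H)// ltr_pdivrMr// mulr_natr mulr2n ltrDl.
Qed.

Lemma analyticP f : analytic f <-> forall z, disk z -> exists D, cderiv f z D.
Proof. by split=> H z /H /derivableP. Qed.

Lemma cderiv_bound f z D : cderiv f z D -> exists2 d : R, 0 < d &
  forall h, cabs h < d -> cabs (f (z + h) - f z) <= (cabs D + 1) * cabs h.
Proof.
move=> /(_ 1 ltr01)[d d0 Hd]; exists d => // h /Hd H.
rewrite -(subrK (D * h) (f (z + h) - f z)) (le_trans (cabsD _ _))// cabsM.
by rewrite mulrDl [leLHS]addrC lerD2l.
Qed.

Lemma cderiv_cont f z D : cderiv f z D -> ccont f z.
Proof.
move=> /cderiv_bound[d d0 Hd] e e0.
have D1 : 0 < cabs D + 1 by rewrite ltr_wpDl ?cabs_ge0.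
exists (Num.min d (e / (cabs D + 1))); first by rewrite lt_min d0 divr_gt0.
move=> w; rewrite lt_min => /andP[/Hd]; rewrite (addrC z) subrK => H.
by rewrite ltr_pdivlMr// mulrC => /(le_lt_trans H).
Qed.

Lemma cderiv_cst c z : cderiv (fun=> c) z 0.
Proof.
move=> e e0; exists 1 => // h _.
by rewrite subrr mul0r subr0 cabs0 mulr_ge0 ?cabs_ge0 ?ltW.
Qed.

Lemma cderiv_id z : cderiv id z 1.
Proof.
move=> e e0; exists 1 => // h _.
have -> : z + h - z - 1 * h = 0 by ring.
by rewrite cabs0 mulr_ge0 ?cabs_ge0 ?ltW.
Qed.

Lemma cderivD f g z D E : cderiv f z D -> cderiv g z E ->
  cderiv (fun w => f w + g w) z (D + E).
Proof.
move=> Hf Hg e e0; have e2 : 0 < e / 2 by rewrite divr_gt0.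
have [d1 d10 H1] := Hf _ e2; have [d2 d20 H2] := Hg _ e2.
exists (Num.min d1 d2); first by rewrite lt_min d10.
move=> h; rewrite lt_min => /andP[/H1 {}H1 /H2 {}H2].
have -> : f (z + h) + g (z + h) - (f z + g z) - (D + E) * h =
  (f (z + h) - f z - D * h) + (g (z + h) - g z - E * h) by ring.
rewrite (le_trans (cabsD _ _))// (le_trans (lerD H1 H2))//.
by rewrite -mulrDl -splitr.
Qed.

Lemma cderivM f g z D E : cderiv f z D -> cderiv g z E ->
  cderiv (fun w => f w * g w) z (D * g z + f z * E).
Proof.
move=> Hf Hg e e0.
have gc := cderiv_cont Hg.
(* K collects the coefficients of e' in the bounds A1, A2 and A3 below; e' <= 1 keeps |g (z + h)|
   below |g z| + 1. *)
pose K := cabs D + cabs (g z) + 1 + cabs (f z).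
have K0 : 0 < K by rewrite /K ltr_wpDr ?cabs_ge0// ltr_wpDl// addr_ge0 ?cabs_ge0.
have e1 : 0 < Num.min 1 (e / K) by rewrite lt_min ltr01 divr_gt0.
set e' := Num.min 1 (e / K) in e1.
have [d1 d10 H1] := Hf _ e1; have [d2 d20 H2] := Hg _ e1; have [d3 d30 H3] := gc _ e1.
exists (Num.min d1 (Num.min d2 d3)); first by rewrite !lt_min d10 d20.
move=> h; rewrite !lt_min => /and3P[/H1 {}H1 /H2 {}H2 h3].
have {}H3 : cabs (g (z + h) - g z) < e'.
  by apply: H3; rewrite addrC addKr.
have -> : f (z + h) * g (z + h) - f z * g z - (D * g z + f z * E) * h =
  (f (z + h) - f z - D * h) * g (z + h) + f z * (g (z + h) - g z - E * h)
  + D * h * (g (z + h) - g z) by ring.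
have H4 : cabs (g (z + h)) <= cabs (g z) + 1.
  rewrite -(subrK (g z) (g (z + h))) (le_trans (cabsD _ _))// addrC lerD2l.
  by rewrite (le_trans (ltW H3))// /e' ge_min lexx.
have h0 := cabs_ge0 h.
have e'K : e' * K <= e by rewrite -ler_pdivlMr// /e' ge_min lexx orbT.
apply: (@le_trans _ _ (e' * K * cabs h)); last by rewrite ler_wpM2r.
have A1 : cabs ((f (z + h) - f z - D * h) * g (z + h)) <= e' * cabs h * (cabs (g z) + 1).
  by rewrite cabsM ler_pM ?cabs_ge0.
have A2 : cabs (f z * (g (z + h) - g z - E * h)) <= cabs (f z) * (e' * cabs h).
  by rewrite cabsM ler_pM ?cabs_ge0.
have A3 : cabs (D * h * (g (z + h) - g z)) <= cabs D * cabs h * e'.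
  by rewrite !cabsM ler_pM ?cabs_ge0 ?mulr_ge0 ?cabs_ge0// ltW.
rewrite (le_trans (cabsD _ _))// (le_trans (lerD (le_trans (cabsD _ _) (lerD A1 A2)) A3))//.
by rewrite /K le_eqVlt; apply/orP; left; apply/eqP; ring.
Qed.

Lemma cderiv_comp f g z D E : cderiv f z D -> cderiv g (f z) E ->
  cderiv (fun w => g (f w)) z (E * D).
Proof.
move=> Hf Hg e e0.
have [d1 d10 H1] := cderiv_bound Hf.
pose K := cabs D + 1.
have K0 : 0 < K by rewrite /K ltr_wpDl ?cabs_ge0.
have e1 : 0 < e / 2 / K by rewrite !divr_gt0.
have [d2 d20 H2] := Hg _ e1.
have e2 : 0 < e / 2 / (cabs E + 1) by rewrite !divr_gt0// ltr_wpDl ?cabs_ge0.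
have [d3 d30 H3] := Hf _ e2.
exists (Num.min d1 (Num.min (d2 / K) d3)); first by rewrite !lt_min d10 d30 divr_gt0.
move=> h; rewrite !lt_min => /and3P[/H1 {}H1 h2 /H3 {}H3].
have h0 := cabs_ge0 h.
have := H2 (f (z + h) - f z); rewrite (addrC (f z)) subrK => {}H2.
have {}H2 : cabs (g (f (z + h)) - g (f z) - E * (f (z + h) - f z)) <= e / 2 * cabs h.
  apply: le_trans (H2 _) _.
    by apply: le_lt_trans H1 _; rewrite mulrC -ltr_pdivlMr.
  apply: le_trans (ler_wpM2l (ltW e1) H1) _.
  by rewrite mulrA divfK ?gt_eqF.
have -> : g (f (z + h)) - g (f z) - E * D * h =
  (g (f (z + h)) - g (f z) - E * (f (z + h) - f z)) + E * (f (z + h) - f z - D * h) by ring.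
rewrite (le_trans (cabsD _ _))// [in leRHS](splitr e) mulrDl lerD// cabsM.
apply: le_trans (ler_wpM2l (cabs_ge0 _) H3) _.
rewrite mulrA ler_wpM2r//.
rewrite mulrA ler_pdivrMr ?ltr_wpDl ?cabs_ge0// mulrC ler_pM2l ?divr_gt0//.
by rewrite lerDl.
Qed.

(** The remainder is exactly h^2 / (z^2 (z + h)), and |z + h| stays above |z|/2. *)
Lemma cderivV z : z != 0 -> cderiv (fun w => w^-1) z (- z ^- 2).
Proof.
move=> z0 e e0.
have cz : 0 < cabs z by rewrite cabs_gt0.
exists (Num.min (cabs z / 2) (e * cabs z ^+ 3 / 2)).
  by rewrite lt_min !divr_gt0// mulr_gt0// exprn_gt0.
move=> h; rewrite lt_min => /andP[h1 h2].
have zh : cabs z / 2 <= cabs (z + h).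
  have := ler_cabsB z (- h); rewrite opprK cabsN; apply: le_trans.
  by rewrite [in leRHS](splitr (cabs z)); lra.
have zh0 : z + h != 0 by rewrite -cabs_gt0 (lt_le_trans _ zh)// divr_gt0.
have -> : (z + h)^-1 - z^-1 - - z ^- 2 * h = h * (h * (z ^- 2 * (z + h)^-1)).
  by field; rewrite zh0.
rewrite cabsM mulrC ler_wpM2r ?cabs_ge0// !cabsM !cabsV cabsX.
apply: (@le_trans _ _ (cabs h * (cabs z ^- 2 * (cabs z / 2)^-1))).
  rewrite ler_wpM2l ?cabs_ge0// ler_wpM2l ?invr_ge0 ?exprn_ge0 ?cabs_ge0//.
  by rewrite lef_pV2// posrE ?divr_gt0// cabs_gt0.
have -> : cabs z ^- 2 * (cabs z / 2)^-1 = (cabs z ^+ 3 / 2)^-1.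
  by field; rewrite gt_eqF.
by rewrite ler_pdivrMr ?divr_gt0 ?exprn_gt0// mulrA ltW.
Qed.

Lemma cderiv_local f g z D r : 0 < r ->
  (forall w, cabs (w - z) < r -> f w = g w) -> cderiv f z D -> cderiv g z D.
Proof.
move=> r0 fg Hf e /Hf[d d0 Hd].
exists (Num.min d r); first by rewrite lt_min d0.
move=> h; rewrite lt_min => /andP[/Hd {}Hd hr].
by rewrite -!fg ?subrr ?cabs0// addrC addKr.
Qed.

Lemma cderiv_div f g z D E : g z != 0 -> cderiv f z D -> cderiv g z E ->
  exists F, cderiv (fun w => f w / g w) z F.
Proof.
move=> gz Hf Hg; have := cderivM Hf (cderiv_comp Hg (cderivV gz)).
by move=> H; eexists; exact: H.
Qed.

Definition cdiff f z := exists D, cderiv f z D.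

Lemma cdiff_cst c z : cdiff (fun=> c) z.
Proof. by exists 0; exact: cderiv_cst. Qed.
Lemma cdiff_id z : cdiff id z.
Proof. by exists 1; exact: cderiv_id. Qed.
Lemma cdiffD f g z : cdiff f z -> cdiff g z -> cdiff (fun w => f w + g w) z.
Proof. by move=> [D HD] [E HE]; eexists; exact: (cderivD HD HE). Qed.
Lemma cdiffM f g z : cdiff f z -> cdiff g z -> cdiff (fun w => f w * g w) z.
Proof. by move=> [D HD] [E HE]; eexists; exact: (cderivM HD HE). Qed.
Lemma cdiffN f z : cdiff f z -> cdiff (fun w => - f w) z.
Proof.
move=> fz; have := cdiffM (cdiff_cst (-1) z) fz.
by rewrite (_ : (fun w => _) = (fun w => - f w))//; apply/funext => w; rewrite mulN1r.
Qed.
Lemma cdiffB f g z : cdiff f z -> cdiff g z -> cdiff (fun w => f w - g w) z.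
Proof. by move=> ? ?; apply: cdiffD => //; exact: cdiffN. Qed.
Lemma cdiff_div f g z : g z != 0 -> cdiff f z -> cdiff g z ->
  cdiff (fun w => f w / g w) z.
Proof. by move=> g0 [D HD] [E HE]; exact: (cderiv_div g0 HD HE). Qed.
Lemma cdiff_comp f g z : cdiff f z -> cdiff g (f z) -> cdiff (fun w => g (f w)) z.
Proof. by move=> [D HD] [E HE]; eexists; exact: (cderiv_comp HD HE). Qed.
Lemma cdiffX f z n : cdiff f z -> cdiff (fun w => f w ^+ n) z.
Proof.
move=> fz; elim: n => [|n IH]; first exact: cdiff_cst.
rewrite (_ : (fun w => _) = (fun w => f w * f w ^+ n)); first exact: cdiffM.
by apply/funext => w; rewrite exprS.
Qed.
Lemma cdiff_sum (I : Type) (r : seq I) (F : I -> R[i] -> R[i]) z :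
  (forall i, cdiff (F i) z) -> cdiff (fun w => \sum_(i <- r) F i w) z.
Proof.
move=> FH; elim: r => [|i r IH].
  by rewrite (_ : (fun w => _) = (fun=> 0)); [exact: cdiff_cst|apply/funext => w; rewrite big_nil].
rewrite (_ : (fun w => _) = (fun w => F i w + \sum_(i <- r) F i w)); first exact: cdiffD.
by apply/funext => w; rewrite big_cons.
Qed.
Lemma cdiff_local f g z r : 0 < r ->
  (forall w, cabs (w - z) < r -> f w = g w) -> cdiff f z -> cdiff g z.
Proof. by move=> r0 fg [D H]; exists D; exact: cderiv_local fg H. Qed.

Lemma cdiff_cont f z : cdiff f z -> ccont f z.
Proof. by move=> [D]; exact: cderiv_cont. Qed.

End ComplexDerivative.

Local Opaque analytic.

(** * Integrals of complex-valued functions *)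

Section ComplexIntegral.
Context d (T : measurableType d) (R : realType).
Variables (mu : {measure set T -> \bar R}) (D : set T).
Hypothesis mD : measurable D.
Implicit Types (f g : T -> R[i]) (c : R[i]).

Definition cintegrable f := mu.-integrable D (EFin \o (fun x => Re (f x))) /\
  mu.-integrable D (EFin \o (fun x => Im (f x))).

Definition cint f : R[i] :=
  Rintegral mu D (fun x => Re (f x)) +i* Rintegral mu D (fun x => Im (f x)).

Lemma EFin_integrableD (f g : T -> R) : mu.-integrable D (EFin \o f) ->
  mu.-integrable D (EFin \o g) -> mu.-integrable D (EFin \o (fun x => f x + g x)).
Proof.
move=> intf intg.
rewrite (_ : _ \o _ = ((EFin \o f) \+ (EFin \o g))%E); last by apply/funext => x.
exact: integrableD.
Qed.

Lemma EFin_integrableZ (k : R) (f : T -> R) : mu.-integrable D (EFin \o f) ->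
  mu.-integrable D (EFin \o (fun x => k * f x)).
Proof.
move=> intf.
rewrite (_ : _ \o _ = (fun x => k%:E * (EFin \o f) x)%E); last by apply/funext => x.
exact: integrableZl.
Qed.

Lemma EFin_integrableB (f g : T -> R) : mu.-integrable D (EFin \o f) ->
  mu.-integrable D (EFin \o g) -> mu.-integrable D (EFin \o (fun x => f x - g x)).
Proof.
move=> intf intg.
rewrite (_ : _ \o _ = ((EFin \o f) \- (EFin \o g))%E); last by apply/funext => x.
exact: integrableB.
Qed.

Lemma cintegrableD f g : cintegrable f -> cintegrable g ->
  cintegrable (fun x => f x + g x).
Proof.
move=> [f1 f2] [g1 g2]; split.
  under [X in _.-integrable _ (_ \o X)]eq_fun do rewrite cReD.
  exact: EFin_integrableD.
under [X in _.-integrable _ (_ \o X)]eq_fun do rewrite cImD.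
exact: EFin_integrableD.
Qed.

Lemma cintegrableZ c f : cintegrable f -> cintegrable (fun x => c * f x).
Proof.
move=> [f1 f2]; split.
  under [X in _.-integrable _ (_ \o X)]eq_fun do rewrite cReM.
  by apply: EFin_integrableB; exact: EFin_integrableZ.
under [X in _.-integrable _ (_ \o X)]eq_fun do rewrite cImM.
by apply: EFin_integrableD; exact: EFin_integrableZ.
Qed.

Lemma cintD f g : cintegrable f -> cintegrable g ->
  cint (fun x => f x + g x) = cint f + cint g.
Proof.
move=> [f1 f2] [g1 g2]; apply: complex_eq; rewrite ?cReD ?cImD /=.
  under eq_Rintegral do rewrite cReD.
  exact: RintegralD.
under eq_Rintegral do rewrite cImD.
exact: RintegralD.
Qed.

Lemma cintZ c f : cintegrable f -> cint (fun x => c * f x) = c * cint f.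
Proof.
move=> [f1 f2]; apply: complex_eq; rewrite ?cReM ?cImM /=.
  under eq_Rintegral do rewrite cReM.
  by rewrite RintegralB ?RintegralZl//; exact: EFin_integrableZ.
under eq_Rintegral do rewrite cImM.
by rewrite RintegralD ?RintegralZl//; exact: EFin_integrableZ.
Qed.

Lemma cintegrableB f g : cintegrable f -> cintegrable g ->
  cintegrable (fun x => f x - g x).
Proof.
move=> hf /(cintegrableZ (-1)) hg; have := cintegrableD hf hg.
by under eq_fun do rewrite mulN1r.
Qed.

Lemma cintB f g : cintegrable f -> cintegrable g ->
  cint (fun x => f x - g x) = cint f - cint g.
Proof.
move=> hf hg; have := cintD hf (cintegrableZ (-1) hg).
by rewrite cintZ// mulN1r; under eq_fun do rewrite mulN1r.
Qed.

(** Multiplying by the unimodular u that rotates the integral onto the positive axis reduces the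
    claim to Re (u f) <= |f|. *)
Lemma cint_le f (h : T -> R) : cintegrable f -> mu.-integrable D (EFin \o h) ->
  (forall x, D x -> cabs (f x) <= h x) -> cabs (cint f) <= Rintegral mu D h.
Proof.
move=> intf inth fh.
have h0 : 0 <= Rintegral mu D h.
  by apply: Rintegral_ge0 => x /fh; exact: le_trans (cabs_ge0 _).
have [->|z0] := eqVneq (cint f) 0; first by rewrite cabs0.
pose u := (cint f)^* / (cabs (cint f))%:C.
have cu : cabs u = 1.
  rewrite cabsM cabsV cabs_conj cabs_real ger0_norm ?cabs_ge0//.
  by rewrite divff// cabs_eq0.
have -> : cabs (cint f) = Re (u * cint f).
  rewrite /u mulrAC (mulrC _ (cint f)) mul_conj.
  have -> : (cabs (cint f) ^+ 2)%:C / (cabs (cint f))%:C = (cabs (cint f))%:C.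
    rewrite rmorphXn/= expr2 mulfK//.
    by rewrite eq_complex/= eqxx andbT cabs_eq0.
  by [].
rewrite -cintZ//=.
have [intuf _] := cintegrableZ u intf.
apply: le_Rintegral => // x Dx.
by rewrite (le_trans (Re_le _))// cabsM cu mul1r fh.
Qed.

Lemma eq_cint f g : (forall x, D x -> f x = g x) -> cint f = cint g.
Proof.
by move=> fg; congr (_ +i* _); apply: eq_Rintegral => x /set_mem /fg ->.
Qed.

Lemma cintegrable_sum (I : Type) (r : seq I) (F : I -> T -> R[i]) :
  (forall i, cintegrable (F i)) -> cintegrable (fun x => \sum_(i <- r) F i x).
Proof.
move=> FH; elim: r => [|i r IH].
  under eq_fun do rewrite big_nil.
  by split; exact: integrable0.
under eq_fun do rewrite big_cons.
exact: cintegrableD.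
Qed.

Lemma cint_sum (I : Type) (r : seq I) (F : I -> T -> R[i]) :
  (forall i, cintegrable (F i)) ->
  cint (fun x => \sum_(i <- r) F i x) = \sum_(i <- r) cint (F i).
Proof.
move=> FH; elim: r => [|i r IH].
  rewrite big_nil; under eq_fun do rewrite big_nil.
  by rewrite /cint /Rintegral !integral0.
rewrite big_cons -IH -cintD//; last exact: cintegrable_sum.
by under eq_fun do rewrite big_cons.
Qed.

End ComplexIntegral.

(** * Continuity and integration of complex functions on a real segment *)

Section Segments.
Variable R : realType.
Implicit Types (g : R -> R[i]) (a b t : R).
Local Notation mu := (@lebesgue_measure R).
Local Notation seg a b := (`[a, b]%classic : set (measurableTypeR R)).

Definition rcont g t := forall e : R, 0 < e -> exists2 d : R, 0 < d &
  forall s, `|s - t| < d -> cabs (g s - g t) < e.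

Lemma rcont_Re g t : rcont g t -> {for t, continuous (fun s => Re (g s))}.
Proof.
move=> gt; apply/cvgrPdist_lt => e /gt[d d0 H]; exists d => //= s.
rewrite /ball_/= distrC => /H; apply: le_lt_trans.
by rewrite distrC -cReB; exact: Re_le_cabs.
Qed.

Lemma rcont_Im g t : rcont g t -> {for t, continuous (fun s => Im (g s))}.
Proof.
move=> gt; apply/cvgrPdist_lt => e /gt[d d0 H]; exists d => //= s.
rewrite /ball_/= distrC => /H; apply: le_lt_trans.
by rewrite distrC -cImB; exact: Im_le_cabs.
Qed.

Lemma continuous_seg_integrable (h : R -> R) a b :
  (forall t, a <= t <= b -> {for t, continuous h}) ->
  mu.-integrable (seg a b) (EFin \o h).
Proof.
move=> ch; apply: continuous_compact_integrable; first exact: segment_compact.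
apply: continuous_in_subspaceT => t; rewrite inE/= in_itv/= => tab.
exact: ch.
Qed.

Lemma rcont_cintegrable g a b : (forall t, a <= t <= b -> rcont g t) ->
  cintegrable mu (seg a b) g.
Proof.
move=> gc; split; apply: continuous_seg_integrable => t /gc; first exact: rcont_Re.
exact: rcont_Im.
Qed.

Lemma rcontB f g t : rcont f t -> rcont g t -> rcont (fun x => f x - g x) t.
Proof.
move=> Hf Hg e e0; have e2 : 0 < e / 2 by rewrite divr_gt0.
have [d1 d10 H1] := Hf _ e2; have [d2 d20 H2] := Hg _ e2.
exists (Num.min d1 d2); first by rewrite lt_min d10.
move=> s; rewrite lt_min => /andP[/H1 {}H1 /H2 {}H2].
have -> : f s - g s - (f t - g t) = (f s - f t) - (g s - g t) by ring.
by rewrite (le_lt_trans (cabsB _ _))// [ltRHS](splitr e) ltrD.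
Qed.

Lemma rcont_comp (F : R[i] -> R[i]) g t : rcont g t -> ccont F (g t) ->
  rcont (fun s => F (g s)) t.
Proof.
move=> Hg HF e /HF[d d0 Hd]; have [d' d'0 Hd'] := Hg _ d0.
by exists d' => // s /Hd' /Hd.
Qed.

Lemma rcont_horizontal (y t : R) : rcont (fun x => x +i* y) t.
Proof.
move=> e e0; exists e => // s; rewrite (_ : _ - _ = (s - t)%:C) ?cabs_real//.
by apply: complex_eq; rewrite /= ?subrr.
Qed.

Lemma rcont_vertical (x t : R) : rcont (fun y => x +i* y) t.
Proof.
move=> e e0; exists e => // s.
rewrite (_ : _ - _ = 'i * (s - t)%:C) ?cabsM ?cabs_real//; last first.
  by apply: complex_eq; rewrite /=; ring.
by rewrite cabsE/= expr0n/= expr1n add0r sqrtr1 mul1r.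
Qed.

Lemma Rint_split (h : R -> R) a m b : a <= m -> m <= b ->
  mu.-integrable (seg a b) (EFin \o h) ->
  Rintegral mu (seg a b) h = Rintegral mu (seg a m) h + Rintegral mu (seg m b) h.
Proof.
move=> am mb hi; have := Rintegral_itvB (x := m) hi.
rewrite !bnd_simp => /(_ am mb); rewrite Rintegral_itv_obnd_cbnd => [<-|].
  by rewrite addrC subrK.
apply: integrableS hi => //; apply: subset_itvr.
by rewrite bnd_simp.
Qed.

Lemma cint_split g a m b : a <= m -> m <= b -> cintegrable mu (seg a b) g ->
  cint mu (seg a b) g = cint mu (seg a m) g + cint mu (seg m b) g.
Proof.
move=> am mb [h1 h2]; apply: complex_eq; rewrite ?cReD ?cImD /=; exact: Rint_split.
Qed.

Lemma mu_seg a b : a <= b -> fine (mu (seg a b)) = b - a.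
Proof.
rewrite le_eqVlt => /predU1P[->|ab]; rewrite lebesgue_measure_itv/= lte_fin.
  by rewrite ltxx subrr.
by rewrite ab.
Qed.

Lemma cint_seg_le g a b (M : R) : a <= b -> cintegrable mu (seg a b) g ->
  (forall t, a <= t <= b -> cabs (g t) <= M) ->
  cabs (cint mu (seg a b) g) <= (b - a) * M.
Proof.
move=> ab gi gM; have := @cint_le _ _ _ mu (seg a b) _ g (fun=> M) gi.
rewrite Rintegral_cst// mu_seg// mulrC; apply => //.
by apply: continuous_seg_integrable => t _; exact: cst_continuous.
Qed.

Lemma cint_cst_seg (c : R[i]) a b : a <= b ->
  cint mu (seg a b) (fun=> c) = (b - a)%:C * c.
Proof.
move=> ab; rewrite /cint !Rintegral_cst// mu_seg//.
by case: c => x y; apply: complex_eq; rewrite /=; ring.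
Qed.

End Segments.

(** * Goursat's theorem *)

Section Goursat.
Variable R : realType.
Local Notation mu := (@lebesgue_measure R).
Local Notation seg a b := (`[a, b]%classic : set (measurableTypeR R)).
Variable F : R[i] -> R[i].
Implicit Types a b c d x y : R.

(** The counterclockwise contour integral of F along the boundary of [a, b] x [c, d], with opposite
    sides paired under one integral sign. *)
Definition rect_int a b c d : R[i] :=
  cint mu (seg a b) (fun x => F (x +i* c) - F (x +i* d)) +
  'i * cint mu (seg c d) (fun y => F (b +i* y) - F (a +i* y)).

Definition diff_on_rect a b c d := forall x y, a <= x <= b -> c <= y <= d ->
  cdiff F (x +i* y).

Lemma diff_on_rectS a b c d a' b' c' d' : a <= a' -> b' <= b -> c <= c' -> d' <= d ->
  diff_on_rect a b c d -> diff_on_rect a' b' c' d'.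
Proof.
move=> aa bb cc dd H x y /andP[x1 x2] /andP[y1 y2]; apply: H; apply/andP; split; lra.
Qed.

Let hor a b c d y1 y2 : diff_on_rect a b c d -> c <= y1 <= d -> c <= y2 <= d ->
  cintegrable mu (seg a b) (fun x => F (x +i* y1) - F (x +i* y2)).
Proof.
move=> H h1 h2; apply: rcont_cintegrable => t tab; apply: rcontB.
  by apply: (rcont_comp (@rcont_horizontal _ y1 t)); apply/cdiff_cont/H.
by apply: (rcont_comp (@rcont_horizontal _ y2 t)); apply/cdiff_cont/H.
Qed.

Let ver a b c d x1 x2 : diff_on_rect a b c d -> a <= x1 <= b -> a <= x2 <= b ->
  cintegrable mu (seg c d) (fun y => F (x1 +i* y) - F (x2 +i* y)).
Proof.
move=> H h1 h2; apply: rcont_cintegrable => t tab; apply: rcontB.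
  by apply: (rcont_comp (@rcont_vertical _ x1 t)); apply/cdiff_cont/H.
by apply: (rcont_comp (@rcont_vertical _ x2 t)); apply/cdiff_cont/H.
Qed.

Lemma rect_int_splitx a m b c d : a <= m -> m <= b -> c <= d ->
  diff_on_rect a b c d -> rect_int a b c d = rect_int a m c d + rect_int m b c d.
Proof.
move=> am mb cd H; rewrite /rect_int.
have ab := le_trans am mb.
rewrite (cint_split am mb); last by apply: (hor H); rewrite ?lexx ?cd.
have -> : cint mu (seg c d) (fun y => F (b +i* y) - F (a +i* y)) =
    cint mu (seg c d) (fun y => F (m +i* y) - F (a +i* y)) +
    cint mu (seg c d) (fun y => F (b +i* y) - F (m +i* y)).
  rewrite -cintD//; first by apply: eq_cint => y _; ring.
    by apply: (ver H); rewrite ?lexx ?am ?mb.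
  by apply: (ver H); rewrite ?lexx ?am ?mb ?ab.
by ring.
Qed.

Lemma rect_int_splity a b c m d : a <= b -> c <= m -> m <= d ->
  diff_on_rect a b c d -> rect_int a b c d = rect_int a b c m + rect_int a b m d.
Proof.
move=> ab cm md H; rewrite /rect_int.
have cd := le_trans cm md.
rewrite (cint_split cm md); last by apply: (ver H); rewrite ?lexx ?ab.
have -> : cint mu (seg a b) (fun x => F (x +i* c) - F (x +i* d)) =
    cint mu (seg a b) (fun x => F (x +i* c) - F (x +i* m)) +
    cint mu (seg a b) (fun x => F (x +i* m) - F (x +i* d)).
  rewrite -cintD//; first by apply: eq_cint => y _; ring.
    by apply: (hor H); rewrite ?lexx ?cm ?md ?cd.
  by apply: (hor H); rewrite ?lexx ?cm ?md ?cd.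
by ring.
Qed.

Lemma rect_int_quarter a m b c n d (e : R) : a <= m -> m <= b -> c <= n -> n <= d ->
  diff_on_rect a b c d ->
  cabs (rect_int a m c n) <= e -> cabs (rect_int a m n d) <= e ->
  cabs (rect_int m b c n) <= e -> cabs (rect_int m b n d) <= e ->
  cabs (rect_int a b c d) <= 4 * e.
Proof.
move=> am mb cn nd H h1 h2 h3 h4.
rewrite (rect_int_splitx am mb (le_trans cn nd) H).
rewrite (rect_int_splity am cn nd); last exact: diff_on_rectS H.
rewrite (rect_int_splity mb cn nd); last exact: diff_on_rectS H.
have := cabsD (rect_int a m c n + rect_int a m n d) (rect_int m b c n + rect_int m b n d).
have := cabsD (rect_int a m c n) (rect_int a m n d).
have := cabsD (rect_int m b c n) (rect_int m b n d).
lra.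
Qed.

(* The integral of the affine part of [F] vanishes. *)
Lemma rect_int_small a b c d z D (e s : R) : a <= b -> c <= d -> 0 <= e ->
  diff_on_rect a b c d ->
  (forall x y, a <= x <= b -> c <= y <= d ->
     cabs (x +i* y - z) <= s /\
     cabs (F (x +i* y) - F z - D * (x +i* y - z)) <= e * cabs (x +i* y - z)) ->
  cabs (rect_int a b c d) <= 2 * e * s * ((b - a) + (d - c)).
Proof.
move=> ab cd e0 H Hs.
have Hs' x y : a <= x <= b -> c <= y <= d ->
    cabs (F (x +i* y) - F z - D * (x +i* y - z)) <= e * s.
  by move=> hx hy; have [h1 h2] := Hs _ _ hx hy; rewrite (le_trans h2)// ler_wpM2l.
have -> : rect_int a b c d =
    cint mu (seg a b) (fun x => F (x +i* c) - F (x +i* d) - D * ('i * (c - d)%:C)) +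
    'i * cint mu (seg c d) (fun y => F (b +i* y) - F (a +i* y) - D * (b - a)%:C).
  rewrite /rect_int [X in _ = X + _]cintB//; last 2 first.
    by apply: (hor H); rewrite ?lexx ?cd.
    by split; apply: continuous_seg_integrable => t _; exact: cst_continuous.
  rewrite [X in _ = _ + 'i * X]cintB//; last 2 first.
    by apply: (ver H); rewrite ?lexx ?ab.
    by split; apply: continuous_seg_integrable => t _; exact: cst_continuous.
  rewrite !cint_cst_seg// !rmorphB/=; ring.
have e1 : cabs (cint mu (seg a b)
    (fun x => F (x +i* c) - F (x +i* d) - D * ('i * (c - d)%:C))) <= (b - a) * (2 * (e * s)).
  apply: cint_seg_le => //.
    apply: cintegrableB => //; first by apply: (hor H); rewrite ?lexx ?cd.
    by split; apply: continuous_seg_integrable => t _; exact: cst_continuous.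
  move=> x xab.
  have -> : F (x +i* c) - F (x +i* d) - D * ('i * (c - d)%:C) =
    (F (x +i* c) - F z - D * (x +i* c - z)) - (F (x +i* d) - F z - D * (x +i* d - z)).
    have -> : 'i * (c - d)%:C = (x +i* c) - (x +i* d) :> R[i].
      by apply: complex_eq; rewrite /=; ring.
    by ring.
  rewrite (le_trans (cabsB _ _))//.
  have := Hs' x c xab; rewrite lexx cd => /(_ isT).
  have := Hs' x d xab; rewrite lexx cd => /(_ isT).
  by lra.
have e2 : cabs (cint mu (seg c d)
    (fun y => F (b +i* y) - F (a +i* y) - D * (b - a)%:C)) <= (d - c) * (2 * (e * s)).
  apply: cint_seg_le => //.
    apply: cintegrableB => //; first by apply: (ver H); rewrite ?lexx ?ab.
    by split; apply: continuous_seg_integrable => t _; exact: cst_continuous.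
  move=> y ycd.
  have -> : F (b +i* y) - F (a +i* y) - D * (b - a)%:C =
    (F (b +i* y) - F z - D * (b +i* y - z)) - (F (a +i* y) - F z - D * (a +i* y - z)).
    have -> : (b - a)%:C = (b +i* y) - (a +i* y) :> R[i].
      by apply: complex_eq; rewrite /=; ring.
    by ring.
  rewrite (le_trans (cabsB _ _))//.
  have := Hs' b y; rewrite lexx ab => /(_ isT ycd).
  have := Hs' a y; rewrite lexx ab => /(_ isT ycd).
  by lra.
rewrite (le_trans (cabsD _ _))// cabsM.
have -> : cabs ('i : R[i]) = 1 by rewrite cabsE/= expr0n/= expr1n add0r sqrtr1.
by rewrite mul1r (le_trans (lerD e1 e2))// le_eqVlt; apply/orP; left; apply/eqP; ring.
Qed.

Section Bisection.
Variables (a b c d : R).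
Hypotheses (ab : a <= b) (cd : c <= d) (Hd : diff_on_rect a b c d).

Let w n := (b - a) / 2 ^+ n.
Let h n := (d - c) / 2 ^+ n.
Let q n (p : R * R) := cabs (rect_int p.1 (p.1 + w n) p.2 (p.2 + h n)).

Variable e : R.
Hypothesis e0 : 0 < e.
Hypothesis big : e < cabs (rect_int a b c d).

(** Lower left corner of a quarter whose integral is still large. The last branch is untested: if
    all four quarters were small, so would be their sum, by [rect_int_quarter]. *)
Let nxt n (p : R * R) : R * R :=
  if q n.+1 p > e / 4 ^+ n.+1 then p else
  if q n.+1 (p.1 + w n.+1, p.2) > e / 4 ^+ n.+1 then (p.1 + w n.+1, p.2) else
  if q n.+1 (p.1, p.2 + h n.+1) > e / 4 ^+ n.+1 then (p.1, p.2 + h n.+1) else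
  (p.1 + w n.+1, p.2 + h n.+1).

Fixpoint quarter n : R * R := if n is m.+1 then nxt m (quarter m) else (a, c).

Let w0 n : 0 <= w n. Proof. by rewrite divr_ge0 ?subr_ge0// exprn_ge0. Qed.
Let h0 n : 0 <= h n. Proof. by rewrite divr_ge0 ?subr_ge0// exprn_ge0. Qed.
Let wS n : w n = w n.+1 + w n.+1.
Proof. by rewrite /w exprS; field; rewrite expf_eq0/= pnatr_eq0 andbF. Qed.
Let hS n : h n = h n.+1 + h n.+1.
Proof. by rewrite /h exprS; field; rewrite expf_eq0/= pnatr_eq0 andbF. Qed.

Let nxt1 n p : p.1 <= (nxt n p).1 <= p.1 + w n.+1.
Proof.
by rewrite /nxt; case: ifP => _; [|case: ifP => _; [|case: ifP => _]] => /=;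
  rewrite lexx ?lerDl ?w0.
Qed.
Let nxt2 n p : p.2 <= (nxt n p).2 <= p.2 + h n.+1.
Proof.
by rewrite /nxt; case: ifP => _; [|case: ifP => _; [|case: ifP => _]] => /=;
  rewrite lexx ?lerDl ?h0.
Qed.

Let in1 n m : (n <= m)%N ->
  (quarter n).1 <= (quarter m).1 /\ (quarter m).1 + w m <= (quarter n).1 + w n.
Proof.
elim: m => [|m IH]; first by rewrite leqn0 => /eqP->.
rewrite leq_eqVlt => /predU1P[->//|/IH[h1 h2]] /=.
have /andP[h3 h4] := nxt1 m (quarter m).
by have := wS m; split; lra.
Qed.
Let in2 n m : (n <= m)%N ->
  (quarter n).2 <= (quarter m).2 /\ (quarter m).2 + h m <= (quarter n).2 + h n.
Proof.
elim: m => [|m IH]; first by rewrite leqn0 => /eqP->.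
rewrite leq_eqVlt => /predU1P[->//|/IH[h1 h2]] /=.
have /andP[h3 h4] := nxt2 m (quarter m).
by have := hS m; split; lra.
Qed.

Let rect_n n : diff_on_rect (quarter n).1 ((quarter n).1 + w n) (quarter n).2 ((quarter n).2 + h n).
Proof.
have [h1 h2] := in1 (leq0n n); have [h3 h4] := in2 (leq0n n).
apply: diff_on_rectS Hd; rewrite //=.
- by rewrite (le_trans h2)//= /w expr0 divr1 addrC subrK.
- by rewrite (le_trans h4)//= /h expr0 divr1 addrC subrK.
Qed.

Let q_big n : e / 4 ^+ n < q n (quarter n).
Proof.
elim: n => [|n IH].
  by rewrite expr0 divr1 /q /w /h !expr0 !divr1/= !(addrC _ (_ - _)) !subrK.
rewrite /= /nxt; case: ifP => // /negbT; rewrite -leNgt => h1.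
case: ifP => // /negbT; rewrite -leNgt => h2.
case: ifP => // /negbT; rewrite -leNgt => h3.
rewrite ltNge; apply/negP => h4.
move: IH; rewrite ltNge => /negP; apply.
have -> : e / 4 ^+ n = 4 * (e / 4 ^+ n.+1).
  by rewrite exprS; field; rewrite expf_eq0/= pnatr_eq0 andbF.
move: h1 h2 h3 h4; rewrite /q/=; set p := quarter n => h1 h2 h3 h4.
have ww := w0 n.+1; have hh := h0 n.+1.
have E1 : p.1 + w n.+1 + w n.+1 = p.1 + w n by rewrite (wS n) addrA.
have E2 : p.2 + h n.+1 + h n.+1 = p.2 + h n by rewrite (hS n) addrA.
rewrite E1 in h2 h4; rewrite E2 in h3 h4.
apply: (@rect_int_quarter _ (p.1 + w n.+1) _ _ (p.2 + h n.+1)) => //;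
  rewrite ?lerDl -?E1 -?E2 ?lerDl//.
by rewrite E1 E2; exact: rect_n.
Qed.

(** The nested rectangles shrink to a point where F is differentiable; there the expansion makes the
    n-th integral of order 4^(-n) with an arbitrarily small factor, against the lower bound e /
    4^n. *)
Lemma bisection_absurd : False.
Proof.
have cvx : cvgn (fun n => (quarter n).1).
  apply: nondecreasing_is_cvgn; first by move=> n m /in1[].
  exists b => _ [n _ <-]; have [_] := in1 (leq0n n).
  by have := w0 n; rewrite /= /w expr0 divr1; lra.
have cvy : cvgn (fun n => (quarter n).2).
  apply: nondecreasing_is_cvgn; first by move=> n m /in2[].
  exists d => _ [n _ <-]; have [_] := in2 (leq0n n).
  by have := h0 n; rewrite /= /h expr0 divr1; lra.
set X := limn (fun n => (quarter n).1) in cvx.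
set Y := limn (fun n => (quarter n).2) in cvy.
have hX n : (quarter n).1 <= X <= (quarter n).1 + w n.
  apply/andP; split; [apply: limr_ge => //|apply: limr_le => //];
    exists n => // m /= nm; have [h1 h2] := in1 nm; have := w0 m => hm.
    by [].
  by apply: le_trans h2; rewrite lerDl.
have hY n : (quarter n).2 <= Y <= (quarter n).2 + h n.
  apply/andP; split; [apply: limr_ge => //|apply: limr_le => //];
    exists n => // m /= nm; have [h1 h2] := in2 nm; have := h0 m => hm.
    by [].
  by apply: le_trans h2; rewrite lerDl.
have [D HD] : cdiff F (X +i* Y) by exact: (rect_n (n := 0) (hX 0) (hY 0)).
pose s := (b - a) + (d - c).
have s0 : 0 <= s by rewrite addr_ge0 ?subr_ge0.
(* [rect_int_small] will give 2 eta s^2 / 4^n for the n-th rectangle, which this choice keeps below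
   e / 4^n. *)
pose eta := e / (2 * s ^+ 2 + 1).
have K0 : 0 < 2 * s ^+ 2 + 1 by rewrite ltr_wpDl// mulr_ge0// sqr_ge0.
have eta0 : 0 < eta by rewrite divr_gt0.
have [dl dl0 Hdl] := HD _ eta0.
have [n Hn] : exists n, s / 2 ^+ n < dl.
  exists (Num.truncn (s / dl)).+1.
  rewrite ltr_pdivrMr ?exprn_gt0// mulrC -ltr_pdivrMr//.
  apply: lt_trans (truncnS_gt _) _.
  by rewrite -natrX ltr_nat ltn_expl.
have := q_big n; rewrite ltNge => /negP; apply.
have sn x y : (quarter n).1 <= x <= (quarter n).1 + w n ->
    (quarter n).2 <= y <= (quarter n).2 + h n ->
    cabs (x +i* y - (X +i* Y)) <= s / 2 ^+ n.
  move=> /andP[x1 x2] /andP[y1 y2].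
  have /andP[X1 X2] := hX n; have /andP[Y1 Y2] := hY n.
  rewrite (le_trans (cabs_le_ReIm _))//= mulrDl lerD//.
    by rewrite -/(w n) ler_norml; apply/andP; split; lra.
  by rewrite -/(h n) ler_norml; apply/andP; split; lra.
apply: le_trans (@rect_int_small _ _ _ _ (X +i* Y) D eta (s / 2 ^+ n) _ _ _ _ _) _ => //.
- by rewrite lerDl.
- by rewrite lerDl.
- exact: ltW.
- move=> x y hx hy; split; first exact: sn.
  have := Hdl (x +i* y - (X +i* Y)); rewrite [(X +i* Y) + _]addrC subrK; apply.
  exact: le_lt_trans (sn _ _ hx hy) Hn.
rewrite !(addrC _ (_ n)) !addrK /w /h -mulrDl -/s.
have -> : 2 * eta * (s / 2 ^+ n) * (s / 2 ^+ n) = (2 * s ^+ 2) * eta / 4 ^+ n.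
  have -> : (4 : R) = 2 ^+ 2 by rewrite expr2; ring.
  by rewrite -exprM mulnC exprM; field; rewrite expf_eq0/= pnatr_eq0 andbF.
rewrite ler_pM2r ?invr_gt0 ?exprn_gt0// /eta mulrA ler_pdivrMr//.
by rewrite mulrC ler_pM2l// lerDl.
Qed.
End Bisection.

Lemma goursat a b c d : a <= b -> c <= d -> diff_on_rect a b c d ->
  rect_int a b c d = 0.
Proof.
move=> ab cd H; apply/eqP; rewrite -cabs_eq0 eq_le cabs_ge0 andbT.
apply/ler_addgt0Pr => e e0; rewrite add0r leNgt; apply/negP => /= big.
exact: (bisection_absurd ab cd H e0 big).
Qed.

End Goursat.

(** * The exponential and means over circles *)

Section ComplexExponential.
Variable R : realType.
Implicit Types (z w : R[i]) (x y t r : R).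

Definition cexp z : R[i] := (expR (Re z))%:C * expi (Im z).

Lemma expiD x y : expi (x + y) = expi x * expi y.
Proof. by apply: complex_eq; rewrite /= ?cosD ?sinD//; ring. Qed.

Lemma expi0 : expi (0 : R) = 1.
Proof. by rewrite /expi cos0 sin0. Qed.

Lemma cabs_expi t : cabs (expi t) = 1.
Proof. by rewrite cabsE/= cos2Dsin2 sqrtr1. Qed.

Lemma expi_2pi : expi (2 * pi : R) = 1.
Proof. by rewrite /expi mulrC mulr_natr cos2pi sin2pi. Qed.

Lemma cexpD z w : cexp (z + w) = cexp z * cexp w.
Proof. by rewrite /cexp cReD cImD expRD expiD rmorphM/=; ring. Qed.

Lemma cexp0 : cexp (0 : R[i]) = 1.
Proof. by rewrite /cexp/= expR0 expi0 mul1r. Qed.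

Lemma cabs_cexp z : cabs (cexp z) = expR (Re z).
Proof. by rewrite cabsM cabs_expi mulr1 cabs_real ger0_norm// expR_ge0. Qed.

Lemma cexp_neq0 z : cexp z != 0.
Proof. by rewrite -cabs_gt0 cabs_cexp expR_gt0. Qed.

Lemma is_derive_bound (f : R -> R) x D : is_derive x 1 f D ->
  forall e : R, 0 < e -> exists2 d : R, 0 < d &
  forall h, `|h| < d -> `|f (x + h) - f x - D * h| <= e * `|h|.
Proof.
move=> [df fD] e e0.
have : (fun h => h^-1 *: (f (h *: 1 + x) - f x)) @ 0^' --> D.
  by rewrite -fD; exact: df.
move/cvgrPdist_lt => /(_ e e0)[d /= d0 Hd]; exists d => // h hd.
have [->|h0] := eqVneq h 0.
  by rewrite addr0 subrr mulr0 subr0 normr0 mulr0.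
have := Hd h; rewrite /ball_/= sub0r normrN => /(_ hd h0) H.
have -> : f (x + h) - f x - D * h = - (D - h^-1 *: (f (h *: 1 + x) - f x)) * h.
  by rewrite /GRing.scale/= mulr1 (addrC h x); field.
by rewrite normrM normrN ler_wpM2r// ltW.
Qed.

(** Only the point 0 calls on the real derivatives of exp, cos and sin; the addition formula carries
    the result elsewhere. *)
Lemma cderiv_cexp0 : cderiv cexp (0 : R[i]) 1.
Proof.
(* The four error terms A1 to A4 contribute 1 + 2 + 3 + 2 = 8 multiples of e' |z|. *)
move=> e e0; pose e' := Num.min 1 (e / 8).
have e'0 : 0 < e' by rewrite lt_min ltr01 divr_gt0.
have e'1 : e' <= 1 by rewrite ge_min lexx.
have e'8 : 8 * e' <= e by rewrite mulrC -ler_pdivlMr// ge_min lexx orbT.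
clearbody e'.
have [d1 d10 H1] := is_derive_bound (is_derive_expR (0 : R)) e'0.
have [d2 d20 H2] := is_derive_bound (is_derive_cos (0 : R)) e'0.
have [d3 d30 H3] := is_derive_bound (is_derive_sin (0 : R)) e'0.
exists (Num.min (Num.min d1 d2) (Num.min d3 e')); first by rewrite !lt_min d10 d20 d30 e'0.
move=> [x y] xyd.
have hx : `|x| <= cabs (x +i* y) := Re_le_cabs (x +i* y).
have hy : `|y| <= cabs (x +i* y) := Im_le_cabs (x +i* y).
move: xyd; rewrite !lt_min -!andbA => /and4P[h1 h2 h3 h4].
have := H1 _ (le_lt_trans hx h1); have := H2 _ (le_lt_trans hy h2).
have := H3 _ (le_lt_trans hy h3).
rewrite !add0r expR0 cos0 sin0 ?subr0 ?mul1r ?oppr0 ?mul0r ?subr0.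
move: hx hy h4; set H := cabs (x +i* y) => hx hy h4 sy cy ex.
rewrite cexp0 /cexp.
rewrite (le_trans (cabs_le_ReIm _))// /expi/=.
have -> : expR x * cos y - 0 * sin y - 1 - x =
  (expR x - 1 - x) * cos y + (1 + x) * (cos y - 1) by ring.
have -> : expR x * sin y + 0 * cos y - 0 - y =
  expR x * (sin y - y) + (expR x - 1) * y by ring.
have c1 : `|cos y| <= 1 by rewrite cos_max.
have x1 : `|1 + x| <= 2.
  rewrite (le_trans (ler_normD _ _))// normr1.
  by have := le_trans (ltW (le_lt_trans hx h4)) e'1; lra.
have ex1 : `|expR x - 1| <= 2 * `|x|.
  rewrite -[expR x - 1](subrK x) (le_trans (ler_normD _ _))//.
  rewrite (le_trans (lerD ex (lexx _)))// -{2}[`|x|]mul1r -mulrDl ler_wpM2r//; lra.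
have ex3 : `|expR x| <= 3.
  rewrite -[expR x](subrK 1) (le_trans (ler_normD _ _))// normr1.
  by have := le_trans (ltW (le_lt_trans hx h4)) e'1; lra.
have A1 : `|(expR x - 1 - x) * cos y| <= e' * H.
  rewrite normrM -[leRHS]mulr1 ler_pM// (le_trans ex)// ler_wpM2l//; exact: ltW.
have A2 : `|(1 + x) * (cos y - 1)| <= 2 * (e' * H).
  rewrite normrM ler_pM// (le_trans cy)// ler_wpM2l//; exact: ltW.
have A3 : `|expR x * (sin y - y)| <= 3 * (e' * H).
  rewrite normrM ler_pM// (le_trans sy)// ler_wpM2l//; exact: ltW.
have A4 : `|(expR x - 1) * y| <= 2 * (e' * H).
  rewrite normrM mulrA ler_pM// (le_trans ex1)// ler_wpM2l// (le_trans hx)//.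
  exact: ltW.
apply: (@le_trans _ _ (8 * e' * H)); last by rewrite ler_wpM2r// cabs_ge0.
rewrite (le_trans (lerD (ler_normD _ _) (ler_normD _ _)))//.
by rewrite -mulrA; lra.
Qed.

Lemma cderiv_cexp z : cderiv cexp z (cexp z).
Proof.
move=> e e0; have c0 : 0 < cabs (cexp z) by rewrite cabs_gt0 cexp_neq0.
have [d d0 Hd] := cderiv_cexp0 (divr_gt0 e0 c0).
exists d => // h /Hd; rewrite add0r cexp0 mul1r => H.
rewrite cexpD.
have -> : cexp z * cexp h - cexp z - cexp z * h = cexp z * (cexp h - 1 - h) by ring.
by rewrite cabsM mulrC -ler_pdivlMr// mulrAC.
Qed.

Definition circle_pt r t : R[i] := r%:C * expi t.

Lemma cabs_circle_pt r t : 0 <= r -> cabs (circle_pt r t) = r.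
Proof. by move=> r0; rewrite cabsM cabs_real cabs_expi mulr1 ger0_norm. Qed.

Lemma circle_pt_neq0 r t : 0 < r -> circle_pt r t != 0.
Proof. by move=> r0; rewrite -cabs_gt0 cabs_circle_pt// ltW. Qed.

Lemma cexp_circle r y : 0 < r -> cexp (ln r +i* y) = circle_pt r y.
Proof. by move=> r0; rewrite /cexp/= lnK// posrE. Qed.

Lemma cont_expi t : rcont (@expi R) t.
Proof.
have := rcont_comp (@rcont_vertical R 0 t) (cdiff_cont (ex_intro _ _ (cderiv_cexp (0 +i* t)))).
rewrite (_ : (fun s : R => _) = @expi R)//; apply/funext => s.
by rewrite /cexp/= expR0 mul1r.
Qed.

Lemma cont_circle_pt r t : rcont (circle_pt r) t.
Proof.
have h : cdiff (fun z : R[i] => r%:C * z) (expi t).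
  by apply: cdiffM; [exact: cdiff_cst|exact: cdiff_id].
exact: (rcont_comp (@cont_expi t) (cdiff_cont h)).
Qed.

End ComplexExponential.

(** * Normalized means over circles *)

Section CircleMean.
Variable R : realType.
Local Notation mu := (@lebesgue_measure R).
Local Notation ang := (@angles R).
Local Notation cm := (circle_measure R).
Local Notation seg a b := (`[a, b]%classic : set (measurableTypeR R)).
Implicit Types (h : R -> R) (g : R -> R[i]).

Definition mean h : R := Rintegral cm ang h.
Definition cmean g : R[i] := cint cm ang g.
Definition mintegrable h := cm.-integrable ang (EFin \o h).

Lemma twopi_gt0 : 0 < 2 * pi :> R.
Proof. by rewrite mulr_gt0// pi_gt0. Qed.

Lemma mang : measurable (ang : set (measurableTypeR R)).
Proof. exact: measurable_itv. Qed.

Lemma cm_ang : cm ang = 1%E.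
Proof.
rewrite /circle_measure/= /mscale/= lebesgue_measure_itv/= lte_fin twopi_gt0.
by rewrite oppr0 adde0 -EFinM mulVf// gt_eqF// twopi_gt0.
Qed.

Lemma ge0_integral_circle (f : measurableTypeR R -> \bar R) :
  measurable_fun (ang : set (measurableTypeR R)) f ->
  (forall x, ang x -> (0 <= f x)%E) ->
  (\int[cm]_(x in ang) f x = ((2 * pi)^-1)%:E * \int[mu]_(x in ang) f x)%E.
Proof. by move=> mf f0; rewrite /circle_measure ge0_integral_mscale//; exact: mang. Qed.

Lemma mintegrableP h : mu.-integrable ang (EFin \o h) <-> mintegrable h.
Proof.
have E : measurable_fun (ang : set (measurableTypeR R))
      (EFin \o h : measurableTypeR R -> \bar R) ->
    (\int[cm]_(x in ang) `|(EFin \o h) x| =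
    ((2 * pi)^-1)%:E * \int[mu]_(x in ang) `|(EFin \o h) x|)%E.
  by move=> mh; apply: ge0_integral_circle => //; exact: measurableT_comp.
have p0 : 0 < (2 * pi)^-1 :> R by rewrite invr_gt0 twopi_gt0.
split=> /integrableP[mh H]; apply/integrableP; split => //.
  by rewrite E// lte_mul_pinfty// ?lee_fin ?(ltW p0).
move: H; rewrite E//; set I := (\int[_]_(_ in _) _)%E; case: I => [r _|/=|//].
  exact: ltry.
by rewrite gt0_muley ?lte_fin.
Qed.

Lemma meanE h : mu.-integrable ang (EFin \o h) ->
  mean h = (2 * pi)^-1 * Rintegral mu ang h.
Proof.
move=> hi; have mh := measurable_int _ hi.
rewrite /mean /Rintegral [in LHS]integralE [in RHS]integralE.
rewrite !ge0_integral_circle//; last 2 first.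
  exact: measurable_funeneg.
  exact: measurable_funepos.
have F1 : (\int[mu]_(x in ang) (EFin \o h)^\+ x)%E \is a fin_num.
  by apply: integrable_pos_fin_num => //; exact: mang.
have F2 : (\int[mu]_(x in ang) (EFin \o h)^\- x)%E \is a fin_num.
  by apply: integrable_neg_fin_num => //; exact: mang.
rewrite -muleBr//; last by rewrite fin_num_adde_defr.
by rewrite fineM// fin_numB F1 F2.
Qed.

Lemma cont_mintegrable h : (forall t, ang t -> {for t, continuous h}) -> mintegrable h.
Proof.
move=> hc; apply/mintegrableP; apply: continuous_seg_integrable => t t2.
by apply: hc; rewrite /angles/= in_itv.
Qed.

Lemma cont_cintegrable g : (forall t, ang t -> rcont g t) -> cintegrable cm ang g.
Proof.
by move=> gc; split; apply: cont_mintegrable => t /gc; [exact: rcont_Re|exact: rcont_Im].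
Qed.

Lemma cmeanE g : cintegrable mu ang g -> cmean g = ((2 * pi)^-1)%:C * cint mu ang g.
Proof.
move=> [g1 g2]; rewrite /cmean /cint; apply: complex_eq.
  by rewrite /= -[LHS]/(mean _) meanE//; ring.
by rewrite /= -[LHS]/(mean _) meanE//; ring.
Qed.

Lemma mean_cst (k : R) : mean (fun=> k) = k.
Proof. by rewrite /mean Rintegral_cst ?cm_ang ?mulr1//; exact: mang. Qed.

Lemma cmean_cst (c : R[i]) : cmean (fun=> c) = c.
Proof. by rewrite /cmean /cint -!/(mean _) !mean_cst; case: c. Qed.

Lemma mean_le h1 h2 : mintegrable h1 -> mintegrable h2 ->
  (forall t, ang t -> h1 t <= h2 t) -> mean h1 <= mean h2.
Proof. by move=> *; apply: le_Rintegral => //; exact: mang. Qed.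

Lemma mintegrable_cst (k : R) : mintegrable (fun=> k).
Proof. by apply: cont_mintegrable => t _; exact: cst_continuous. Qed.

(** The exponential pulls the annulus back to a rectangle of height 2 pi. Its horizontal sides
    cancel by periodicity, and Goursat's theorem equates the two vertical ones. *)
Lemma cmean_circle_const (f : R[i] -> R[i]) r1 r2 : 0 < r1 -> r1 <= r2 ->
  (forall z, r1 <= cabs z <= r2 -> cdiff f z) ->
  cmean (fun t => f (circle_pt r1 t)) = cmean (fun t => f (circle_pt r2 t)).
Proof.
move=> r10 r12 fd; have r20 := lt_le_trans r10 r12.
have ln12 : ln r1 <= ln r2 by rewrite ler_ln// posrE.
have H : diff_on_rect (fun z => f (cexp z)) (ln r1) (ln r2) 0 (2 * pi).
  move=> x y /andP[x1 x2] _; apply: cdiff_comp.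
    by eexists; exact: cderiv_cexp.
  apply: fd; rewrite cabs_cexp/=.
  move: x1 x2; rewrite -ler_expR lnK ?posrE// => ->.
  by rewrite -ler_expR lnK ?posrE.
have := goursat ln12 (ltW twopi_gt0) H; rewrite /rect_int.
have -> : cint mu (seg (ln r1) (ln r2))
    (fun x => f (cexp (x +i* 0)) - f (cexp (x +i* (2 * pi)))) = 0.
  rewrite -[RHS](mulr0 ((ln r2 - ln r1)%:C)) -cint_cst_seg//; apply: eq_cint => x _.
  by rewrite /cexp/= expi_2pi expi0 subrr.
rewrite add0r => /eqP; rewrite mulf_eq0 eq_complex/= oner_eq0 andbF/= => /eqP.
have ci r : r1 <= r <= r2 -> cintegrable mu ang (fun t => f (circle_pt r t)).
  move=> /andP[rr1 rr2]; apply: rcont_cintegrable => t _.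
  apply: (rcont_comp (@cont_circle_pt _ r t)); apply/cdiff_cont/fd.
  by rewrite cabs_circle_pt ?rr1// ltW// (lt_le_trans r10).
have -> : cint mu (seg 0 (2 * pi))
    (fun y => f (cexp (ln r2 +i* y)) - f (cexp (ln r1 +i* y))) =
    cint mu ang (fun y => f (circle_pt r2 y)) - cint mu ang (fun y => f (circle_pt r1 y)).
  rewrite -cintB//; [|exact: mang|by apply: ci; rewrite lexx r12..].
  by apply: eq_cint => y _; rewrite !cexp_circle.
move=> /subr0_eq E.
by rewrite !cmeanE ?E//; apply: ci; rewrite lexx r12.
Qed.

(** Compactness of the interval of angles, in near-covering form, makes the joint continuity at each
    (r0, t) uniform in t. *)
Lemma near_circle_uniform (g : R -> R -> R[i]) r0 :
  (forall t, ang t -> forall e : R, 0 < e -> exists2 d : R, 0 < d &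
    forall r s, `|r - r0| < d -> `|s - t| < d -> cabs (g r s - g r0 t) < e) ->
  forall e : R, 0 < e -> exists2 d : R, 0 < d &
    forall r, `|r - r0| < d -> forall t, ang t -> cabs (g r t - g r0 t) < e.
Proof.
move=> H e e0; have e2 : 0 < e / 2 by rewrite divr_gt0.
have /compact_near_coveringP cv := @segment_compact R 0 (2 * pi).
have := cv R (nbhs r0) (fun r t => cabs (g r t - g r0 t) < e) _.
case=> [t tang|d /= d0 Hd].
  have [d d0 Hd] := H t tang _ e2.
  exists (ball t d, ball r0 d); first by split; exact: nbhsx_ballx.
  move=> [s r] [/= ts rr]; move: ts rr; rewrite /ball/= distrC => ts; rewrite distrC => rr.
  have -> : g r s - g r0 s = (g r s - g r0 t) - (g r0 s - g r0 t) by ring.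
  rewrite (le_lt_trans (cabsB _ _))// [ltRHS](splitr e) ltrD ?Hd//.
  by rewrite subrr normr0.
exists d => // r rd t tang; apply: (Hd r) => //.
by rewrite /ball_/= distrC.
Qed.

End CircleMean.

(** * Cauchy's formula *)

Section Cauchy.
Variable R : realType.
Local Notation ang := (@angles R).
Local Notation cm := (circle_measure R).
Local Notation pt := (@circle_pt R).
Implicit Types (f g : R[i] -> R[i]) (a z : R[i]) (r e : R).

Lemma rcont_circle f r t : ccont f (pt r t) -> rcont (fun s => f (pt r s)) t.
Proof. exact: (rcont_comp (@cont_circle_pt R r t)). Qed.

Lemma rcont_cst (c : R[i]) t : rcont (fun=> c) t.
Proof. by move=> e e0; exists 1 => // s _; rewrite subrr cabs0. Qed.

Lemma rcont_cabs (g : R -> R[i]) t : rcont g t -> {for t, continuous (fun s => cabs (g s))}.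
Proof.
move=> gt; apply/cvgrPdist_lt => e /gt[d d0 H]; exists d => //= s.
rewrite /ball_/= distrC => /H; apply: le_lt_trans.
have := ler_cabsB (g s) (g t); have := ler_cabsB (g t) (g s).
by rewrite (cabsBC (g t)) ler_norml => h1 h2; apply/andP; split; lra.
Qed.

Lemma cabs_cmean_le (g : R -> R[i]) (h : R -> R) : (forall t, ang t -> rcont g t) ->
  mintegrable h -> (forall t, ang t -> cabs (g t) <= h t) -> cabs (cmean g) <= mean h.
Proof.
by move=> gc hi gh; apply: cint_le => //; [exact: mang|exact: cont_cintegrable].
Qed.

Lemma cabs_cmean_bound (g : R -> R[i]) (M : R) : (forall t, ang t -> rcont g t) ->
  (forall t, ang t -> cabs (g t) <= M) -> cabs (cmean g) <= M.
Proof.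
by move=> gc gM; rewrite -[M]mean_cst; apply: cabs_cmean_le => //; exact: mintegrable_cst.
Qed.

Lemma cmeanB (g1 g2 : R -> R[i]) : (forall t, ang t -> rcont g1 t) ->
  (forall t, ang t -> rcont g2 t) ->
  cmean (fun t => g1 t - g2 t) = cmean g1 - cmean g2.
Proof. by move=> h1 h2; apply: cintB; [exact: mang|exact: cont_cintegrable..]. Qed.

Lemma cmeanD (g1 g2 : R -> R[i]) : (forall t, ang t -> rcont g1 t) ->
  (forall t, ang t -> rcont g2 t) ->
  cmean (fun t => g1 t + g2 t) = cmean g1 + cmean g2.
Proof. by move=> h1 h2; apply: cintD; [exact: mang|exact: cont_cintegrable..]. Qed.

Lemma cmeanZ (c : R[i]) (g : R -> R[i]) : (forall t, ang t -> rcont g t) ->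
  cmean (fun t => c * g t) = c * cmean g.
Proof. by move=> h1; apply: cintZ; [exact: mang|exact: cont_cintegrable]. Qed.

Lemma eq_cmean (g1 g2 : R -> R[i]) : (forall t, ang t -> g1 t = g2 t) ->
  cmean g1 = cmean g2.
Proof. by move=> E; rewrite /cmean; apply: eq_cint. Qed.

Lemma near_circle_ccont f r0 : 0 <= r0 -> (forall z, cabs z = r0 -> ccont f z) ->
  forall e, 0 < e -> exists2 d : R, 0 < d & forall r, `|r - r0| < d ->
    forall t, ang t -> cabs (f (pt r t) - f (pt r0 t)) < e.
Proof.
move=> r00 fc e e0; apply: (@near_circle_uniform R (fun r t => f (pt r t)) r0 _ e e0).
move=> t _ e' e'0.
have [d1 d10 H1] := fc (pt r0 t) (cabs_circle_pt t r00) e' e'0.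
have d12 : 0 < d1 / 2 by rewrite divr_gt0.
have [d2 d20 H2] := @cont_circle_pt R r0 t _ d12.
exists (Num.min (d1 / 2) d2); first by rewrite lt_min d12.
move=> r s; rewrite !lt_min => /andP[r1 _] /andP[_ /H2 s2].
apply: H1; rewrite (_ : _ - _ = (r - r0)%:C * expi s + (pt r0 s - pt r0 t)).
  rewrite (le_lt_trans (cabsD _ _))// cabsM cabs_real cabs_expi mulr1.
  by rewrite [ltRHS](splitr d1) ltrD.
by rewrite /circle_pt rmorphB/=; ring.
Qed.

Lemma circle_mean_continuous f r0 : 0 <= r0 -> (forall z, cabs z = r0 -> ccont f z) ->
  forall e, 0 < e -> exists2 d : R, 0 < d & forall r, 0 <= r ->
    (forall t, rcont (fun t => f (pt r t)) t) -> `|r - r0| < d ->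
    cabs (cmean (fun t => f (pt r t)) - cmean (fun t => f (pt r0 t))) <= e.
Proof.
move=> r00 fc e e0; have [d d0 Hd] := near_circle_ccont r00 fc e0.
exists d => // r r0' rc /Hd H.
rewrite -cmeanB; last 2 first.
  by move=> t _; exact: rc.
  by move=> t _; apply: rcont_circle; apply: fc; rewrite cabs_circle_pt.
apply: cabs_cmean_bound => [t tang|t /H/ltW//].
by apply: rcontB => //; apply: rcont_circle; apply: fc; rewrite cabs_circle_pt.
Qed.

Lemma analytic_cdiff f z : analytic f -> cabs z < 1 -> cdiff f z.
Proof. by move=> /analyticP fa z1; apply: fa. Qed.

Lemma analytic_rcont f r t : analytic f -> 0 <= r -> r < 1 -> rcont (fun s => f (pt r s)) t.
Proof.
move=> fa r0 r1; apply: rcont_circle; apply: cdiff_cont; apply: analytic_cdiff => //.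
by rewrite cabs_circle_pt.
Qed.

(** The mean does not depend on the radius beyond |a|, and the kernel tends uniformly to 1 as the
    circle grows. *)
Lemma cmean_cauchy_kernel a r : cabs a < r -> cmean (fun t => pt r t / (pt r t - a)) = 1.
Proof.
move=> ar; have r0 : 0 < r := le_lt_trans (cabs_ge0 _) ar.
have dk z : r <= cabs z -> cdiff (fun z => z / (z - a)) z.
  move=> rz; apply: cdiff_div; last 2 first.
    exact: cdiff_id.
    by apply: cdiffB; [exact: cdiff_id|exact: cdiff_cst].
  by rewrite subr_eq0; apply/eqP => za; move: (lt_le_trans ar rz); rewrite za ltxx.
apply/eqP; rewrite -subr_eq0 -cabs_eq0 eq_le cabs_ge0 andbT.
apply/ler_addgt0Pr => e e0; rewrite add0r.
(* Then s - |a| >= |a| / e, which bounds |a| / (s - |a|) by e. *)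
pose s := r + cabs a + cabs a / e.
have rs : r <= s by rewrite /s -addrA lerDl addr_ge0 ?divr_ge0 ?cabs_ge0// ltW.
have s0 : 0 < s by exact: lt_le_trans rs.
rewrite (@cmean_circle_const _ (fun z => z / (z - a)) r s)//; last first.
  by move=> z /andP[rz _]; exact: dk.
rewrite -[X in _ - X](cmean_cst (1 : R[i])) -cmeanB; last 2 first.
- by move=> t _; apply: (@rcont_circle (fun z => z / (z - a))); apply/cdiff_cont/dk; rewrite cabs_circle_pt// ltW.
- by move=> t _; exact: rcont_cst.
apply: cabs_cmean_bound => [t _|t _].
  apply: rcontB; last by exact: rcont_cst.
  by apply: (@rcont_circle (fun z => z / (z - a))); apply/cdiff_cont/dk; rewrite cabs_circle_pt// ltW.
have za : s - cabs a <= cabs (pt s t - a).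
  by rewrite -{1}(cabs_circle_pt t (ltW s0)) ler_cabsB.
have sa : 0 < s - cabs a by rewrite subr_gt0 (lt_le_trans ar).
have z0 : pt s t - a != 0 by rewrite -cabs_gt0 (lt_le_trans sa).
have -> : pt s t / (pt s t - a) - 1 = a / (pt s t - a) by field.
rewrite cabsM cabsV ler_pdivrMr ?(lt_le_trans sa)//.
apply: (@le_trans _ _ (e * (s - cabs a))); last by rewrite ler_pM2l.
rewrite -ler_pdivrMl// mulrC /s.
have := cabs_ge0 a; lra.
Qed.

(** The quotient g z = z (f z - f a) / (z - a), completed by its limit at a, is continuous, but not
    yet known to be differentiable at a. Its mean M s is constant on 0 < s < |a| and on |a| < s < 1,
    continuous at 0 and at |a|, and zero at s = 0 thanks to the factor z; hence it vanishes at r,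
    and the kernel mean gives f a. *)
Lemma cauchy_formula f a r : analytic f -> cabs a < r -> r < 1 ->
  cmean (fun t => f (pt r t) * (pt r t / (pt r t - a))) = f a.
Proof.
move=> fa ar r1; have r0 : 0 < r := le_lt_trans (cabs_ge0 _) ar.
have [D HD] := analytic_cdiff fa (lt_trans ar r1).
pose g z := if z == a then D * a else (f z - f a) / (z - a) * z.
have gd z : cabs z < 1 -> z != a -> cdiff g z.
  move=> z1 za.
  apply: (@cdiff_local _ (fun z => (f z - f a) / (z - a) * z) _ _ (cabs (z - a))).
  - by rewrite cabs_gt0 subr_eq0.
  - move=> w wz; rewrite /g; case: eqP => // wa.
    by move: wz; rewrite wa cabsBC ltxx.
  - apply: cdiffM; last exact: cdiff_id.
    apply: cdiff_div; first by rewrite subr_eq0.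
      by apply: cdiffB; [exact: analytic_cdiff|exact: cdiff_cst].
    by apply: cdiffB; [exact: cdiff_id|exact: cdiff_cst].
have gc z : cabs z < 1 -> ccont g z.
  move=> z1; have [->|za] := eqVneq z a; last exact/cdiff_cont/gd.
  move=> e e0; have e2 : 0 < e / 2 by rewrite divr_gt0.
  have [d1 d10 H1] := HD _ e2.
  have D0 : 0 < cabs D + 1 by rewrite ltr_wpDl ?cabs_ge0.
  have [d2 d20 H2] : exists2 d2 : R, 0 < d2 & d2 <= 1 - cabs a /\ cabs D * d2 < e / 2.
    exists (Num.min (1 - cabs a) (e / 2 / (cabs D + 1))).
      by rewrite lt_min subr_gt0 (lt_trans ar r1) divr_gt0.
    rewrite ge_min lexx; split => //.
    have [->|Dn] := eqVneq D 0; first by rewrite cabs0 mul0r.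
    have c0 : 0 < cabs D by rewrite cabs_gt0.
    apply: (@le_lt_trans _ _ (cabs D * (e / 2 / (cabs D + 1)))).
      by rewrite ler_pM2l// ge_min lexx orbT.
    by rewrite mulrC mulrAC ltr_pdivrMr// ltr_pM2l// ltrDl.
  exists (Num.min d1 d2); first by rewrite lt_min d10.
  move=> w; rewrite lt_min => /andP[w1 w2].
  rewrite /g eqxx; case: eqP => [_|/eqP wa]; first by rewrite subrr cabs0.
  have wa0 : w - a != 0 by rewrite subr_eq0.
  have -> : (f w - f a) / (w - a) * w - D * a =
    (f w - f a - D * (w - a)) / (w - a) * w + D * (w - a) by field.
  have := H1 _ w1; rewrite [a + _]addrC subrK => {}H1.
  have cwa : 0 < cabs (w - a) by rewrite cabs_gt0.
  have w1' : cabs w <= 1.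
    rewrite -(subrK a w) (le_trans (cabsD _ _))//.
    by have [H _] := H2; have := ltW w2; lra.
  rewrite (le_lt_trans (cabsD _ _))// [ltRHS](splitr e) ler_ltD//.
    rewrite !cabsM cabsV -[e / 2]mulr1 ler_pM ?cabs_ge0 ?divr_ge0 ?cabs_ge0//.
    by rewrite ler_pdivrMr.
  rewrite cabsM (le_lt_trans _ H2.2)// ler_wpM2l ?cabs_ge0//; exact: ltW.
pose M s := cmean (fun t => g (pt s t)).
have rc s t : 0 <= s -> s < 1 -> rcont (fun t => g (pt s t)) t.
  by move=> s0 s1; apply: rcont_circle; apply: gc; rewrite cabs_circle_pt.
have Mc s : 0 <= s -> s < 1 -> forall e, 0 < e -> exists2 d : R, 0 < d &
    forall s', 0 <= s' -> s' < 1 -> `|s' - s| < d -> cabs (M s' - M s) <= e.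
  move=> s0 s1 e e0.
  have [|d d0 Hd] := @circle_mean_continuous g s s0 _ e e0.
    by move=> z zs; apply: gc; rewrite zs.
  by exists d => // s' s'0 s'1 /Hd; apply => // t; exact: rc.
have Mconst s s' : 0 < s -> s <= s' -> s' < 1 -> (cabs a < s) || (s' < cabs a) -> M s = M s'.
  move=> s0 ss s1 H; apply: cmean_circle_const => // z /andP[z1 z2].
  apply: gd; first exact: le_lt_trans s1.
  apply/eqP => za; move: H z1 z2; rewrite za; case/orP => h.
    by rewrite leNgt h.
  by move=> _; rewrite leNgt h.
have M0 : M 0 = 0.
  rewrite /M -[RHS](cmean_cst 0); apply: eq_cmean => t _.
  by rewrite /circle_pt/= mul0r /g; case: eqP => [<-|_]; rewrite mulr0.
(* M takes the same value at s2 near 0 and at s1 just below |a|; continuity at both ends joins M 0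
   to M |a|. *)
have Ma : M (cabs a) = 0.
  have [->|a0] := eqVneq a 0; first by rewrite cabs0.
  have ca : 0 < cabs a by rewrite cabs_gt0.
  apply/eqP; rewrite -cabs_eq0 eq_le cabs_ge0 andbT.
  apply/ler_addgt0Pr => e e0; rewrite add0r (splitr e).
  have e2 : 0 < e / 2 by rewrite divr_gt0.
  have [d1 d10 H1] := Mc _ (cabs_ge0 a) (lt_trans ar r1) _ e2.
  have [d2 d20 H2] := Mc _ (lexx _) ltr01 _ e2.
  pose s1 := cabs a - Num.min (cabs a / 2) (d1 / 2).
  pose s2 := Num.min s1 (d2 / 2).
  have [m0 [m1 m2]] : 0 < Num.min (cabs a / 2) (d1 / 2) /\
    Num.min (cabs a / 2) (d1 / 2) <= cabs a / 2 /\ Num.min (cabs a / 2) (d1 / 2) <= d1 / 2.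
    by rewrite lt_min !divr_gt0// !ge_min !lexx orbT.
  have s10 : 0 < s1 by rewrite /s1; lra.
  have s1a : s1 < cabs a by rewrite /s1; lra.
  have s20 : 0 < s2 by rewrite lt_min s10 divr_gt0.
  have s21 : s2 <= s1 by rewrite ge_min lexx.
  have s2d : s2 <= d2 / 2 by rewrite ge_min lexx orbT.
  have E : M s2 = M s1 by rewrite (@Mconst s2 s1)// ?s1a ?orbT//; lra.
  have -> : M (cabs a) = (M s2 - M 0) - (M s1 - M (cabs a)) by rewrite E M0; ring.
  rewrite (le_trans (cabsB _ _))// lerD//.
    by apply: H2; rewrite ?subr0 ?ger0_norm//; lra.
  apply: H1; [lra|lra|].
  by rewrite distrC ger0_norm /s1; lra.
have Mr : M r = 0.
  apply/eqP; rewrite -cabs_eq0 eq_le cabs_ge0 andbT.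
  apply/ler_addgt0Pr => e e0; rewrite add0r.
  have [d1 d10 H1] := Mc _ (cabs_ge0 a) (lt_trans ar r1) _ e0.
  pose s1 := Num.min r (cabs a + d1 / 2).
  have s1r : s1 <= r by rewrite ge_min lexx.
  have s1a : cabs a < s1 by rewrite lt_min ar ltrDl divr_gt0.
  have s1d : s1 <= cabs a + d1 / 2 by rewrite ge_min lexx orbT.
  have ca := cabs_ge0 a.
  rewrite -(@Mconst s1 r)// ?s1a//; last lra.
  rewrite -[M s1]subr0 -Ma; apply: H1; [lra|lra|].
  by rewrite ger0_norm; lra.
have z0 t : pt r t - a != 0.
  by rewrite subr_eq0; apply/eqP => E; move: ar; rewrite -E cabs_circle_pt ?ltxx// ltW.
have kc t : rcont (fun t => pt r t / (pt r t - a)) t.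
  apply: (@rcont_circle (fun z => z / (z - a))); apply: cdiff_cont.
  apply: cdiff_div => //; first exact: cdiff_id.
  by apply: cdiffB; [exact: cdiff_id|exact: cdiff_cst].
have kfc t : rcont (fun t => f a * (pt r t / (pt r t - a))) t.
  apply: (@rcont_circle (fun z => f a * (z / (z - a)))); apply: cdiff_cont.
  apply: cdiffM; first exact: cdiff_cst.
  apply: cdiff_div => //; first exact: cdiff_id.
  by apply: cdiffB; [exact: cdiff_id|exact: cdiff_cst].
transitivity (cmean (fun t => g (pt r t) + f a * (pt r t / (pt r t - a)))).
  apply: eq_cmean => t _; rewrite /g -subr_eq0 (negbTE (z0 t)).
  by field; exact: z0.
rewrite cmeanD//; last by move=> t _; apply: rc => //; exact: ltW.
by rewrite -/(M r) Mr add0r cmeanZ// cmean_cauchy_kernel// mulr1.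
Qed.

End Cauchy.

(** * Taylor coefficients *)

Section Taylor.
Variable R : realType.
Local Notation ang := (@angles R).
Local Notation cm := (circle_measure R).
Local Notation pt := (@circle_pt R).
Implicit Types (f g : R[i] -> R[i]) (a z : R[i]) (r e : R) (c : nat -> R[i]).

Lemma rcontD (f g : R -> R[i]) t : rcont f t -> rcont g t -> rcont (fun x => f x + g x) t.
Proof.
move=> Hf Hg e e0; have e2 : 0 < e / 2 by rewrite divr_gt0.
have [d1 d10 H1] := Hf _ e2; have [d2 d20 H2] := Hg _ e2.
exists (Num.min d1 d2); first by rewrite lt_min d10.
move=> s; rewrite lt_min => /andP[/H1 {}H1 /H2 {}H2].
have -> : f s + g s - (f t + g t) = (f s - f t) + (g s - g t) by ring.
by rewrite (le_lt_trans (cabsD _ _))// [ltRHS](splitr e) ltrD.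
Qed.

Lemma rcontZ (c : R[i]) (g : R -> R[i]) t : rcont g t -> rcont (fun x => c * g x) t.
Proof.
move=> gt; have h : cdiff (fun z : R[i] => c * z) (g t).
  by apply: cdiffM; [exact: cdiff_cst|exact: cdiff_id].
exact: (rcont_comp gt (cdiff_cont h)).
Qed.

Lemma rcontX (g : R -> R[i]) t n : rcont g t -> rcont (fun x => g x ^+ n) t.
Proof.
move=> gt; have h : cdiff (fun z : R[i] => z ^+ n) (g t) by apply/cdiffX/cdiff_id.
exact: (rcont_comp gt (cdiff_cont h)).
Qed.

Lemma rcontV (g : R -> R[i]) t : g t != 0 -> rcont g t -> rcont (fun x => (g x)^-1) t.
Proof.
by move=> g0 gt; apply: (rcont_comp (F := fun z => z^-1) gt (cderiv_cont (cderivV g0))).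
Qed.

(** Polarization writes the product as a combination of two squares. *)
Lemma rcontM (f g : R -> R[i]) t : rcont f t -> rcont g t -> rcont (fun x => f x * g x) t.
Proof.
move=> ft gt.
have -> : (fun x => f x * g x) =
    fun x => 4^-1 * ((f x + g x) ^+ 2 - (f x - g x) ^+ 2).
  by apply/funext => x; field.
apply/rcontZ/rcontB; apply: rcontX; first exact: rcontD.
exact: rcontB.
Qed.

Lemma rcont_conj (g : R -> R[i]) t : rcont g t -> rcont (fun x => (g x)^*) t.
Proof.
move=> gt e /gt[d d0 H]; exists d => // s /H.
by rewrite -rmorphB/= cabs_conj.
Qed.

Lemma rcont_sum (I : Type) (s : seq I) (F : I -> R -> R[i]) t :
  (forall i, rcont (F i) t) -> rcont (fun x => \sum_(i <- s) F i x) t.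
Proof.
move=> FH; elim: s => [|i s IH].
  by under eq_fun do rewrite big_nil; exact: rcont_cst.
by under eq_fun do rewrite big_cons; exact: rcontD.
Qed.

Lemma meanD (h1 h2 : R -> R) : mintegrable h1 -> mintegrable h2 ->
  mean (fun t => h1 t + h2 t) = mean h1 + mean h2.
Proof. by move=> ? ?; apply: RintegralD => //; exact: mang. Qed.

Lemma meanB (h1 h2 : R -> R) : mintegrable h1 -> mintegrable h2 ->
  mean (fun t => h1 t - h2 t) = mean h1 - mean h2.
Proof. by move=> ? ?; apply: RintegralB => //; exact: mang. Qed.

Lemma meanZ (k : R) (h : R -> R) : mintegrable h ->
  mean (fun t => k * h t) = k * mean h.
Proof. by move=> ?; apply: RintegralZl => //; exact: mang. Qed.

Lemma mean_ge0 (h : R -> R) : (forall t, ang t -> 0 <= h t) -> 0 <= mean h.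
Proof. by move=> h0; apply: Rintegral_ge0. Qed.

Lemma mintegrableD (h1 h2 : R -> R) : mintegrable h1 -> mintegrable h2 ->
  mintegrable (fun t => h1 t + h2 t).
Proof. by move=> ? ?; apply: EFin_integrableD => //; exact: mang. Qed.

Lemma mintegrableB (h1 h2 : R -> R) : mintegrable h1 -> mintegrable h2 ->
  mintegrable (fun t => h1 t - h2 t).
Proof. by move=> ? ?; apply: EFin_integrableB => //; exact: mang. Qed.

Lemma mintegrableZ (k : R) (h : R -> R) : mintegrable h ->
  mintegrable (fun t => k * h t).
Proof. by move=> ?; apply: EFin_integrableZ => //; exact: mang. Qed.

Lemma rcont_mintegrable (g : R -> R[i]) : (forall t, ang t -> rcont g t) ->
  mintegrable (fun t => cabs (g t)).
Proof. by move=> gc; apply: cont_mintegrable => t /gc; exact: rcont_cabs. Qed.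

Lemma rcont_sqr_mintegrable (g : R -> R[i]) : (forall t, ang t -> rcont g t) ->
  mintegrable (fun t => cabs (g t) ^+ 2).
Proof.
move=> gc; under [X in mintegrable X]eq_fun do rewrite -cabsX.
by apply: rcont_mintegrable => t /gc; exact: rcontX.
Qed.

Definition avg f r := mean (fun t => cabs (f (pt r t))).
Definition avg2 f r := mean (fun t => cabs (f (pt r t)) ^+ 2).

(** The n-th Taylor coefficient by Cauchy's integral; the radius 1/2 is arbitrary, as [coefE]
    shows. *)
Definition coef f n : R[i] := cmean (fun t => f (pt 2^-1 t) / pt 2^-1 t ^+ n).

Definition psum c N z : R[i] := \sum_(n < N) c n * z ^+ n.

Lemma geometric_sum (q : R[i]) N : 1 - q != 0 ->
  (1 - q)^-1 = \sum_(n < N) q ^+ n + q ^+ N / (1 - q).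
Proof.
move=> q1; elim: N => [|N IH]; first by rewrite big_ord0 add0r expr0 mul1r.
by rewrite big_ord_recr/= {1}IH -addrA; congr (_ + _); rewrite exprS; field.
Qed.

Lemma coefE f r n : analytic f -> 0 < r -> r < 1 ->
  cmean (fun t => f (pt r t) / pt r t ^+ n) = coef f n.
Proof.
move=> fa r0 r1.
have h z : 0 < cabs z -> cabs z < 1 -> cdiff (fun z => f z / z ^+ n) z.
  move=> z0 z1; apply: cdiff_div; [|exact: analytic_cdiff|exact/cdiffX/cdiff_id].
  by rewrite expf_neq0// -cabs_gt0.
rewrite /coef; have [r2|r2] := leP r 2^-1.
  apply: (cmean_circle_const (f := fun z => f z / z ^+ n)) => // z /andP[z1 z2]; apply: h; lra.
by apply/esym/(cmean_circle_const (f := fun z => f z / z ^+ n)) => //;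
  [lra|move=> z /andP[z1 z2]; apply: h; lra].
Qed.

Lemma rcont_coef f r n t : analytic f -> 0 < r -> r < 1 ->
  rcont (fun t => f (pt r t) / pt r t ^+ n) t.
Proof.
move=> fa r0 r1; apply: rcontM; first by apply: analytic_rcont => //; exact: ltW.
apply: rcontV; first by rewrite expf_neq0// circle_pt_neq0.
by apply: rcontX; exact: cont_circle_pt.
Qed.

Lemma coef_le f r n : analytic f -> 0 < r -> r < 1 -> cabs (coef f n) <= avg f r / r ^+ n.
Proof.
move=> fa r0 r1; rewrite -(coefE n fa r0 r1) /avg mulrC -meanZ; last first.
  by apply: rcont_mintegrable => t _; apply: analytic_rcont => //; exact: ltW.
apply: cabs_cmean_le => [t _||t _]; first exact: rcont_coef.
  apply: mintegrableZ; apply: rcont_mintegrable => t _.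
  by apply: analytic_rcont => //; exact: ltW.
by rewrite cabsM cabsV cabsX cabs_circle_pt ?(ltW r0)// mulrC.
Qed.

Lemma avg_bound f r M : analytic f -> 0 <= r -> r < 1 ->
  (forall t, cabs (f (pt r t)) <= M) -> avg f r <= M.
Proof.
move=> fa r0 r1 fM; rewrite -[M]mean_cst; apply: mean_le => //.
  by apply: rcont_mintegrable => t _; exact: analytic_rcont.
exact: mintegrable_cst.
Qed.

Lemma avg_ge0 f r : 0 <= avg f r.
Proof. by apply: mean_ge0 => t _; exact: cabs_ge0. Qed.

(** Expanding the Cauchy kernel as a geometric sum in a/z leaves the remainder (a/z)^N times the
    kernel, which on |z| = r is at most (|a|/r)^N / (1 - |a|/r). *)
Lemma taylor f a r N : analytic f -> cabs a < r -> r < 1 ->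
  cabs (f a - psum (coef f) N a) <= avg f r * ((cabs a / r) ^+ N / (1 - cabs a / r)).
Proof.
move=> fa ar r1; have r0 : 0 < r := le_lt_trans (cabs_ge0 _) ar.
have z0 t : pt r t != 0 by rewrite circle_pt_neq0.
have za0 t : pt r t - a != 0.
  by rewrite subr_eq0; apply/eqP => E; move: ar; rewrite -E cabs_circle_pt ?ltxx// ltW.
have fc t : rcont (fun t => f (pt r t)) t by apply: analytic_rcont => //; exact: ltW.
have kc t : rcont (fun t => pt r t / (pt r t - a)) t.
  apply: rcontM; first exact: cont_circle_pt.
  by apply: rcontV => //; apply: rcontB; [exact: cont_circle_pt|exact: rcont_cst].
have Nc t : rcont (fun t => f (pt r t) * ((a / pt r t) ^+ N * (pt r t / (pt r t - a)))) t.
  apply: rcontM => //; apply: rcontM => //; apply: rcontX; apply: rcontZ.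
  by apply: rcontV => //; exact: cont_circle_pt.
have -> : f a - psum (coef f) N a =
    cmean (fun t => f (pt r t) * ((a / pt r t) ^+ N * (pt r t / (pt r t - a)))).
  rewrite -(cauchy_formula fa ar r1).
  have -> : psum (coef f) N a =
      cmean (fun t => \sum_(n < N) a ^+ n * (f (pt r t) / pt r t ^+ n)).
    rewrite /cmean cint_sum; first last.
    - by move=> n; apply/cintegrableZ/cont_cintegrable => [|t _]; [exact: mang|exact: rcont_coef].
    - exact: mang.
    apply: eq_bigr => n _; rewrite cintZ; first last.
    - by apply: cont_cintegrable => t _; exact: rcont_coef.
    - exact: mang.
    by rewrite -/(cmean _) coefE// mulrC.
  rewrite -cmeanB; last 2 first.
  - by move=> t _; exact: rcontM.
  - by move=> t _; apply: rcont_sum => n; apply: rcontZ; exact: rcont_coef.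
  apply: eq_cmean => t _.
  have qz : 1 - a / pt r t = (pt r t - a) / pt r t by field.
  have q1 : 1 - a / pt r t != 0 by rewrite qz mulf_neq0// invr_neq0.
  have -> : pt r t / (pt r t - a) = (1 - a / pt r t)^-1 by rewrite qz invf_div.
  rewrite {1}(geometric_sum N q1) mulrDr mulr_sumr addrAC.
  rewrite [X in X + _ = _](_ : _ = 0) ?add0r//.
  apply/eqP; rewrite subr_eq0; apply/eqP/eq_bigr => n _.
  by rewrite expr_div_n; ring.
rewrite /avg mulrC -meanZ; last by apply: rcont_mintegrable => t _; exact: fc.
apply: cabs_cmean_le => [t _//||t _].
  by apply: mintegrableZ; apply: rcont_mintegrable => t _; exact: fc.
rewrite cabsM mulrC ler_wpM2r ?cabs_ge0//.
rewrite cabsM cabsX cabsM cabsV cabs_circle_pt ?(ltW r0)//.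
rewrite ler_wpM2l ?exprn_ge0 ?divr_ge0 ?cabs_ge0 ?(ltW r0)//.
rewrite cabsM cabsV cabs_circle_pt ?(ltW r0)//.
have ra : 0 < r - cabs a by rewrite subr_gt0.
have -> : (1 - cabs a / r)^-1 = r / (r - cabs a) by field; rewrite !gt_eqF.
rewrite ler_pM2l// lef_pV2 ?posrE ?cabs_gt0//.
by rewrite -{1}(cabs_circle_pt t (ltW r0)) ler_cabsB.
Qed.

Lemma analytic_psum c N : analytic (psum c N).
Proof.
apply/analyticP => z _; apply: cdiff_sum => n.
by apply: cdiffM; [exact: cdiff_cst|exact/cdiffX/cdiff_id].
Qed.

(** On |z| = r the conjugate of z is r^2 / z, so each conjugated monomial extracts one Taylor
    coefficient of g. *)
Lemma cmean_conj_psum g c N r : analytic g -> 0 < r -> r < 1 ->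
  cmean (fun t => g (pt r t) * (psum c N (pt r t))^*) =
  \sum_(n < N) (c n)^* * (r ^+ (2 * n))%:C * coef g n.
Proof.
move=> ga r0 r1.
transitivity (cmean (fun t => \sum_(n < N)
    ((c n)^* * (r ^+ (2 * n))%:C) * (g (pt r t) / pt r t ^+ n))).
  apply: eq_cmean => t _; rewrite /psum rmorph_sum mulr_sumr/=; apply: eq_bigr => n _.
  rewrite rmorphM rmorphXn/= .
  have z0 : pt r t != 0 by rewrite circle_pt_neq0.
  have -> : (pt r t)^* = (r ^+ 2)%:C / pt r t.
    apply: (mulfI z0); rewrite mul_conj cabs_circle_pt ?(ltW r0)//; by field.
  rewrite exprM [(r ^+ 2 ^+ n)%:C]rmorphXn/= expr_div_n; ring.
rewrite /cmean cint_sum; first last.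
- by move=> n; apply/cintegrableZ/cont_cintegrable => [|t _]; [exact: mang|exact: rcont_coef].
- exact: mang.
apply: eq_bigr => n _; rewrite cintZ; first last.
- by apply: cont_cintegrable => t _; exact: rcont_coef.
- exact: mang.
by rewrite -/(cmean _) coefE.
Qed.

(** The mean is independent of the radius, and the integrand tends to 0 on large circles. *)
Lemma cmean_negpow k r : (0 < k)%N -> 0 < r -> cmean (fun t => (pt r t ^+ k)^-1) = 0.
Proof.
move=> k0 r0; apply/eqP; rewrite -cabs_eq0 eq_le cabs_ge0 andbT.
apply/ler_addgt0Pr => e e0; rewrite add0r.
pose s := r + 1 + e^-1.
have s1 : 1 <= s by rewrite /s addrAC lerDr addr_ge0 ?ltW// invr_gt0.
have s0 : 0 < s by exact: lt_le_trans s1.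
have rs : r <= s by rewrite /s -addrA lerDl addr_ge0 ?ltW// invr_gt0.
have zd z : r <= cabs z -> cdiff (fun z => (z ^+ k)^-1) z.
  move=> rz; have z0 : z ^+ k != 0.
    by rewrite expf_neq0// -cabs_gt0 (lt_le_trans r0).
  have [D HD] := cdiffX k (cdiff_id z).
  by eexists; exact: (cderiv_comp HD (cderivV z0)).
rewrite (@cmean_circle_const _ (fun z => (z ^+ k)^-1) r s)//; last first.
  by move=> z /andP[h _]; exact: zd.
apply: cabs_cmean_bound => t _.
  apply: (@rcont_circle _ (fun z => (z ^+ k)^-1)); apply/cdiff_cont/zd.
  by rewrite cabs_circle_pt// ltW.
rewrite cabsV cabsX cabs_circle_pt ?(ltW s0)//.
apply: (@le_trans _ _ s^-1).
  by rewrite lef_pV2 ?posrE ?exprn_gt0// ler_eXnr.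
rewrite -[e]invrK lef_pV2 ?posrE ?invr_gt0// /s; have := ltW r0; lra.
Qed.

Lemma coef_monom m n : coef (fun z => z ^+ m) n = (m == n)%:R.
Proof.
have r0 : 0 < 2^-1 :> R by [].
have z0 t : pt 2^-1 t != 0 by rewrite circle_pt_neq0.
rewrite /coef; case: (ltngtP m n) => [mn|nm|->].
- rewrite mulr0n -(@cmean_negpow (n - m) 2^-1) ?subn_gt0//; apply: eq_cmean => t _.
  rewrite (_ : _ ^+ n = pt 2^-1 t ^+ (n - m) * pt 2^-1 t ^+ m); last first.
    by rewrite -exprD subnK// ltnW.
  by rewrite invfM mulrC mulfVK// expf_neq0.
- have an : analytic (fun z : R[i] => z ^+ (m - n)).
    by apply/analyticP => z _; exact/cdiffX/cdiff_id.
  have := @cauchy_formula R _ 0 2^-1 an; rewrite cabs0 => /(_ r0).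
  rewrite expr0n subn_eq0 leqNgt nm/= => <-; last by lra.
  apply: eq_cmean => t _; rewrite subr0 divff// mulr1.
  rewrite (_ : _ ^+ m = pt 2^-1 t ^+ (m - n) * pt 2^-1 t ^+ n); last first.
    by rewrite -exprD subnK// ltnW.
  by rewrite mulfK// expf_neq0.
- rewrite -[RHS]cmean_cst; apply: eq_cmean => t _.
  by rewrite divff// expf_neq0.
Qed.

Lemma tcoefD f g n : analytic f -> analytic g ->
  coef (fun z => f z + g z) n = coef f n + coef g n.
Proof.
move=> fa ga; have h : 2^-1 < 1 :> R by lra.
rewrite /coef -cmeanD; [|by move=> t _; exact: rcont_coef..].
by apply: eq_cmean => t _; ring.
Qed.

Lemma tcoefZ (k : R[i]) f n : analytic f -> coef (fun z => k * f z) n = k * coef f n.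
Proof.
move=> fa; have h : 2^-1 < 1 :> R by lra.
rewrite /coef -cmeanZ; last by move=> t _; exact: rcont_coef.
by apply: eq_cmean => t _; ring.
Qed.

Lemma analyticD f g : analytic f -> analytic g -> analytic (fun z => f z + g z).
Proof. by move=> /analyticP fa /analyticP ga; apply/analyticP => z z1; apply: cdiffD; [apply: fa|apply: ga]. Qed.

Lemma analyticM f g : analytic f -> analytic g -> analytic (fun z => f z * g z).
Proof. by move=> /analyticP fa /analyticP ga; apply/analyticP => z z1; apply: cdiffM; [apply: fa|apply: ga]. Qed.

Lemma analytic_cst (k : R[i]) : analytic (fun=> k).
Proof. by apply/analyticP => z _; exact: cdiff_cst. Qed.

Lemma analyticZ (k : R[i]) f : analytic f -> analytic (fun z => k * f z).
Proof. by move=> fa; exact: (analyticM (@analytic_cst k) fa). Qed.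

Lemma analyticB f g : analytic f -> analytic g -> analytic (fun z => f z - g z).
Proof. by move=> /analyticP fa /analyticP ga; apply/analyticP => z z1; apply: cdiffB; [apply: fa|apply: ga]. Qed.

Lemma tcoefB f g n : analytic f -> analytic g ->
  coef (fun z => f z - g z) n = coef f n - coef g n.
Proof.
move=> fa ga; have := tcoefD n fa (@analyticZ (-1) g ga).
rewrite tcoefZ; last exact: ga.
have -> : (fun z => f z - g z) = (fun z => f z + -1 * g z).
  by apply/funext => z; rewrite mulN1r.
by rewrite mulN1r.
Qed.

Lemma coef_psum c N n : coef (psum c N) n = if (n < N)%N then c n else 0.
Proof.
elim: N => [|N IH].
  rewrite ltn0 /coef -[RHS]cmean_cst; apply: eq_cmean => t _.
  by rewrite /psum big_ord0 mul0r.
have -> : psum c N.+1 = fun z => psum c N z + c N * z ^+ N.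
  by apply/funext => z; rewrite /psum big_ord_recr.
have an : analytic (fun z : R[i] => z ^+ N).
  by apply/analyticP => z _; exact/cdiffX/cdiff_id.
rewrite tcoefD; [|exact: analytic_psum|exact: (@analyticZ (c N) _ an)].
rewrite IH tcoefZ; last exact: an.
rewrite coef_monom ltnS.
by case: (ltngtP n N) => [h|h|->]; rewrite /= ?mulr0n ?mulr1n ?mulr0 ?addr0 ?add0r ?mulr1.
Qed.

Lemma bessel_eq f r N : analytic f -> 0 < r -> r < 1 ->
  avg2 (fun z => f z - psum (coef f) N z) r =
  avg2 f r - \sum_(n < N) cabs (coef f n) ^+ 2 * r ^+ (2 * n).
Proof.
move=> fa r0 r1; set s := psum (coef f) N.
have sa : analytic s by exact: analytic_psum.
have fc t : rcont (fun t => f (pt r t)) t by apply: analytic_rcont => //; exact: ltW.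
have sc t : rcont (fun t => s (pt r t)) t by apply: analytic_rcont => //; exact: ltW.
have Ec g : analytic g -> (forall n, (n < N)%N -> coef g n = coef f n) ->
    mean (fun t => Re (g (pt r t) * (s (pt r t))^*)) =
    \sum_(n < N) cabs (coef f n) ^+ 2 * r ^+ (2 * n).
  move=> ga gf; rewrite -[LHS]/(Re (cmean (fun t => g (pt r t) * (s (pt r t))^*))).
  rewrite cmean_conj_psum// cRe_sum; apply: eq_bigr => n _.
  rewrite gf// mulrAC (mulrC (coef f n)^*) mul_conj cReM/=; ring.
have fsc t : rcont (fun t => f (pt r t) * (s (pt r t))^*) t.
  by apply: rcontM => //; exact: rcont_conj.
have ssc t : rcont (fun t => s (pt r t) * (s (pt r t))^*) t.
  by apply: rcontM => //; exact: rcont_conj.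
transitivity (mean (fun t => (cabs (f (pt r t)) ^+ 2 - 2 * Re (f (pt r t) * (s (pt r t))^*))
    + Re (s (pt r t) * (s (pt r t))^*))).
  apply: eq_Rintegral => t _; rewrite !sqr_cabs mul_conj/= sqr_cabs.
  by case: (f _) => a b; case: (s _) => x y /=; ring.
have i1 : mintegrable (fun t => cabs (f (pt r t)) ^+ 2).
  by apply: rcont_sqr_mintegrable.
have i2 : mintegrable (fun t => Re (f (pt r t) * (s (pt r t))^*)).
  by apply: cont_mintegrable => t _; exact: rcont_Re.
have i3 : mintegrable (fun t => Re (s (pt r t) * (s (pt r t))^*)).
  by apply: cont_mintegrable => t _; exact: rcont_Re.
rewrite meanD//; last by apply: mintegrableB => //; exact: mintegrableZ.
rewrite meanB//; last exact: mintegrableZ.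
rewrite meanZ// !Ec//; last by move=> n nN; rewrite coef_psum nN.
by rewrite /avg2; ring.
Qed.

Lemma bessel f r N : analytic f -> 0 < r -> r < 1 ->
  \sum_(n < N) cabs (coef f n) ^+ 2 * r ^+ (2 * n) <= avg2 f r.
Proof.
move=> fa r0 r1; rewrite -subr_ge0 -bessel_eq//.
by apply: mean_ge0 => t _; rewrite sqr_ge0.
Qed.

Lemma expr_small (q e : R) : 0 <= q -> q < 1 -> 0 < e -> exists N, q ^+ N < e.
Proof.
move=> q0 q1 e0.
have : (fun n => q ^+ n) @ \oo --> (0 : R) by apply: cvg_expr; rewrite ger0_norm.
move/cvgrPdist_lt => /(_ e e0)[N _ /(_ N (leqnn N))].
by rewrite sub0r normrN ger0_norm ?exprn_ge0// => h; exists N.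
Qed.

(** The Taylor remainder is uniformly small on |z| = r, being controlled from the larger circle |z|
    = s, so the left-hand side of [bessel_eq] can be made smaller than e. *)
Lemma parseval_le f r A : analytic f -> 0 < r -> r < 1 ->
  (forall N, \sum_(n < N) cabs (coef f n) ^+ 2 * r ^+ (2 * n) <= A) -> avg2 f r <= A.
Proof.
move=> fa r0 r1 H; apply/ler_addgt0Pr => e e0.
pose s := (r + 1) / 2.
have rs : r < s by rewrite /s; lra.
have s1 : s < 1 by rewrite /s; lra.
have s0 : 0 < s by exact: lt_trans rs.
pose K := avg f s / (1 - r / s).
have q1 : r / s < 1 by rewrite ltr_pdivrMr ?mul1r.
have K0 : 0 <= K by rewrite divr_ge0 ?avg_ge0// subr_ge0 ltW.
pose e' := Num.min 1 (e / (K ^+ 2 + 1)).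
have K1 : 0 < K ^+ 2 + 1 by rewrite ltr_wpDl ?sqr_ge0.
have e'0 : 0 < e' by rewrite lt_min ltr01 divr_gt0.
have [N HN] := @expr_small (r / s) e' (divr_ge0 (ltW r0) (ltW s0)) q1 e'0.
have := bessel_eq N fa r0 r1 => /eqP; rewrite eq_sym subr_eq => /eqP ->.
rewrite addrC lerD//.
have sm t : cabs (f (pt r t) - psum (coef f) N (pt r t)) ^+ 2 <= e.
  have := @taylor f (pt r t) s N fa; rewrite cabs_circle_pt ?(ltW r0)// => /(_ rs s1) h.
  apply: (@le_trans _ _ ((K * e') ^+ 2)).
    rewrite ler_sqr ?nnegrE ?cabs_ge0 ?(mulr_ge0 K0 (ltW e'0))//.
    apply: le_trans h _; rewrite mulrCA -/K mulrC.
    by apply: ler_wpM2l => //; exact: ltW.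
  have e'1 : e' <= 1 by rewrite ge_min lexx.
  have e'2 : e' * (K ^+ 2 + 1) <= e by rewrite -ler_pdivlMr// ge_min lexx orbT.
  apply: le_trans e'2; rewrite exprMn mulrC expr2 -mulrA ler_pM2l//.
  rewrite (le_trans (ler_piMl _ e'1)) ?sqr_ge0//.
  by rewrite lerDl.
rewrite -[e]mean_cst; apply: mean_le; [|exact: mintegrable_cst|by move=> t _; exact: sm].
apply: rcont_sqr_mintegrable => t _; apply: rcontB.
  by apply: analytic_rcont => //; exact: ltW.
by apply: analytic_rcont; [exact: analytic_psum|exact: ltW|exact: r1].
Qed.

(** In Bessel's inequality every weight r^(2n) with n < N is at least r^(2N), which tends to 1 with
    r; Bernoulli's inequality makes this quantitative. *)
Lemma coef_limit_near f N A d : analytic f -> 0 < d ->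
  (forall r, 0 < r -> r < 1 -> 1 - d < r -> avg2 f r <= A) ->
  \sum_(n < N) cabs (coef f n) ^+ 2 <= A.
Proof.
move=> fa d0 H.
have H2 r : 0 < r -> r < 1 -> 1 - d < r -> (\sum_(n < N) cabs (coef f n) ^+ 2) * r ^+ (2 * N) <= A.
  move=> r0 r1 rd; apply: le_trans (H _ r0 r1 rd); apply: le_trans (bessel N fa r0 r1).
  rewrite mulr_suml; apply: ler_sum => n _; rewrite ler_wpM2l ?sqr_ge0//.
  by rewrite ler_wiXn2l ?(ltW r0) ?(ltW r1)// leq_mul2l/= ltnW.
set S := (X in X <= A) in H2 *.
have S0 : 0 <= S by apply: sumr_ge0 => n _; rewrite sqr_ge0.
apply/ler_addgt0Pr => e e0.
have bern k (x : R) : 0 <= x -> x <= 1 -> 1 - x *+ k <= (1 - x) ^+ k.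
  move=> x0 x1; elim: k => [|k IH]; first by rewrite mulr0n subr0 expr0.
  rewrite exprS mulrSr.
  apply: (@le_trans _ _ ((1 - x) * (1 - x *+ k))); last by rewrite ler_wpM2l// subr_ge0.
  have : 0 <= x * (x *+ k) by rewrite mulr_ge0// mulrn_wge0.
  by rewrite mulrBl mul1r mulrBr mulr1; lra.
(* The radius will be 1 - x: the first bounds keep it in the allowed range, the last makes the
   Bernoulli loss 2 N x S at most e. *)
pose x := Num.min (Num.min (1 / 2) (d / 2)) (e / (S * (2 * N)%:R + 1)).
have S1 : 0 < S * (2 * N)%:R + 1 by rewrite ltr_wpDl// mulr_ge0.
have x0 : 0 < x by rewrite !lt_min !divr_gt0.
have x1 : x <= 1 / 2 by rewrite !ge_min lexx.
have xd : x <= d / 2 by rewrite !ge_min lexx orbT.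
have x2 : x * (S * (2 * N)%:R + 1) <= e by rewrite -ler_pdivlMr// ge_min lexx orbT.
have h : S * (1 - x) ^+ (2 * N) <= A by apply: H2; lra.
have := bern (2 * N)%N x (ltW x0) ltac:(lra) => /(ler_wpM2l S0) h2.
rewrite -mulr_natr mulrBr mulr1 in h2.
have : S * (x * (2 * N)%:R) <= e by apply: le_trans x2; rewrite mulrDr mulr1 mulrCA lerDl ltW.
lra.
Qed.

Lemma coef_limit f N A : analytic f ->
  (forall r, 0 < r -> r < 1 -> avg2 f r <= A) ->
  \sum_(n < N) cabs (coef f n) ^+ 2 <= A.
Proof. by move=> fa H; apply: (coef_limit_near N fa ltr01) => r r0 r1 _; exact: H. Qed.

End Taylor.

(** * Montel's theorem *)

Section Montel.
Variable R : realType.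
Local Notation ang := (@angles R).
Local Notation pt := (@circle_pt R).
Implicit Types (f g : R[i] -> R[i]) (a z : R[i]) (r e : R).

Lemma ccauchy_cvg (x : nat -> R[i]) :
  (forall e : R, 0 < e -> exists N, forall m n, (N <= m)%N -> (N <= n)%N ->
     cabs (x m - x n) <= e) ->
  exists l, forall e : R, 0 < e -> exists N, forall n, (N <= n)%N -> cabs (x n - l) <= e.
Proof.
move=> H.
have cv (y : nat -> R) : (forall m n, `|y m - y n| <= cabs (x m - x n)) -> cvgn y.
  move=> yx; apply: cauchy_cvg; apply: cauchy_exP => e e0.
  have e2 : 0 < e / 2 by rewrite divr_gt0.
  have [N HN] := H _ e2.
  exists (y N); exists N => // n /= Nn.
  rewrite /ball/= (le_lt_trans (yx _ _))// (le_lt_trans (HN _ _ _ _))//.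
  by rewrite ltr_pdivrMr// mulr_natr mulr2n ltrDl.
have c1 := cv (fun n => Re (x n)) (fun m n => ltac:(rewrite -cReB; exact: Re_le_cabs)).
have c2 := cv (fun n => Im (x n)) (fun m n => ltac:(rewrite -cImB; exact: Im_le_cabs)).
exists (limn (fun n => Re (x n)) +i* limn (fun n => Im (x n))) => e e0.
have e2 : 0 < e / 2 by rewrite divr_gt0.
move/cvgrPdist_lt : c1 => /(_ _ e2)[N1 _ H1].
move/cvgrPdist_lt : c2 => /(_ _ e2)[N2 _ H2].
exists (maxn N1 N2) => n; rewrite geq_max => /andP[/H1/= h1 /H2/= h2].
rewrite cabsBC (le_trans (cabs_le_ReIm _))// [leRHS](splitr e) cReB cImB/=.
by rewrite lerD// ltW.
Qed.

Lemma analytic_bounded f r : analytic f -> r < 1 ->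
  exists B, forall z, cabs z <= r -> cabs (f z) <= B.
Proof.
move=> fa r1; pose s := Num.max ((r + 1) / 2) 2^-1.
have s1 : s < 1 by rewrite gt_max; apply/andP; split; lra.
have rs : r < s by rewrite lt_max; apply/orP; left; lra.
have s0 : 0 < s by rewrite lt_max; apply/orP; right; lra.
exists (avg f s * (1 - Num.max r 0 / s)^-1) => z zr.
have z0 := cabs_ge0 z.
have r0 : 0 <= r by exact: le_trans zr.
have := taylor 0 fa (le_lt_trans zr rs) s1.
rewrite /psum big_ord0 subr0 expr0 mul1r => h; apply: le_trans h _.
rewrite ler_wpM2l ?avg_ge0// max_l//.
have rs1 : r / s < 1 by rewrite ltr_pdivrMr// mul1r.
have zs : cabs z / s <= r / s by rewrite ler_pM2r ?invr_gt0.
by rewrite lef_pV2 ?posrE ?subr_gt0// ?lerB// (le_lt_trans zs).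
Qed.

(** D is Cauchy's integral for the derivative at a. The remainder is quadratic in h with a constant
    depending only on B and d, hence uniform along a bounded sequence of functions. *)
Lemma cauchy_quotient f a (d B : R) : analytic f -> 0 < d -> cabs a + d < 1 ->
  (forall z, cabs z <= cabs a + d -> cabs (f z) <= B) ->
  let D := cmean (fun t => f (pt (cabs a + d) t) *
    (pt (cabs a + d) t / (pt (cabs a + d) t - a) ^+ 2)) in
  cabs D <= B / d ^+ 2 /\
  forall h, cabs h <= d / 2 -> cabs (f (a + h) - f a - h * D) <= 2 * B / d ^+ 3 * cabs h ^+ 2.
Proof.
move=> fa d0 r1 fB D; set r := cabs a + d in r1 fB D *.
have ar : cabs a < r by rewrite /r ltrDl.
have r0 : 0 < r := le_lt_trans (cabs_ge0 _) ar.
have B0 : 0 <= B by apply: le_trans (fB 0 _); rewrite ?cabs_ge0// cabs0 ltW.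
have zr t : cabs (pt r t) = r by rewrite cabs_circle_pt// ltW.
have zad t : d <= cabs (pt r t - a).
  by have := ler_cabsB (pt r t) a; rewrite zr /r; lra.
have zah t h : cabs h <= d / 2 -> d / 2 <= cabs (pt r t - (a + h)).
  move=> hd; have -> : pt r t - (a + h) = pt r t - a - h by ring.
  by have := ler_cabsB (pt r t - a) h; have := zad t; lra.
have nz x : d / 2 <= cabs x -> x != 0.
  by move=> h; rewrite -cabs_gt0; apply: lt_le_trans h; rewrite divr_gt0.
have dd : d / 2 <= d by lra.
have fc t : rcont (fun t => f (pt r t)) t by apply: analytic_rcont => //; exact: ltW.
have kc b n t : d / 2 <= cabs (pt r t - b) ->
    rcont (fun t => f (pt r t) * (pt r t / (pt r t - b) ^+ n)) t.
  move=> h; apply: rcontM => //; apply: rcontM; first exact: cont_circle_pt.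
  apply: rcontV; first by rewrite expf_neq0// nz.
  by apply: rcontX; apply: rcontB; [exact: cont_circle_pt|exact: rcont_cst].
split.
  apply: cabs_cmean_bound => t _; first by apply: kc; exact: le_trans (zad t).
  rewrite cabsM ler_pM ?cabs_ge0//; first by apply: fB; rewrite zr.
  rewrite cabsM cabsV cabsX zr -[leRHS]mul1r ler_pM ?invr_ge0 ?exprn_ge0 ?cabs_ge0 ?(ltW r0)//.
    exact: ltW.
  rewrite lef_pV2 ?posrE ?exprn_gt0//; last exact: lt_le_trans (zad t).
  by rewrite lerXn2r// ?nnegrE ?cabs_ge0 ?(ltW d0).
move=> h hd.
have ahr : cabs (a + h) < r by rewrite (le_lt_trans (cabsD _ _))// /r ltrD2l; lra.
have kc1 b t : d / 2 <= cabs (pt r t - b) ->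
    rcont (fun t => f (pt r t) * (pt r t / (pt r t - b))) t.
  by move=> /(kc b 1%N); under eq_fun do rewrite expr1.
have hD : h * D = cmean (fun t => h * (f (pt r t) * (pt r t / (pt r t - a) ^+ 2))).
  by rewrite cmeanZ// => t _; apply: kc; exact: le_trans (zad t).
rewrite -(cauchy_formula fa ahr r1) -(cauchy_formula fa ar r1) hD.
rewrite -cmeanB; last 2 first.
  by move=> t _; apply: kc1; exact: zah.
  by move=> t _; apply: kc1; exact: le_trans (zad t).
rewrite -cmeanB; last 2 first.
  move=> t _; apply: rcontB; apply: kc1; first exact: zah.
  exact: le_trans (zad t).
  by move=> t _; apply: rcontZ; apply: kc; exact: le_trans (zad t).
apply: cabs_cmean_bound => t _.
  apply: rcontB; first apply: rcontB; first by apply: kc1; exact: zah.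
    by apply: kc1; exact: le_trans (zad t).
  by apply: rcontZ; apply: kc; exact: le_trans (zad t).
set z := pt r t.
have n1 : z - a != 0 by apply: nz; exact: le_trans (zad t).
have n2 : z - (a + h) != 0 by apply: nz; exact: zah.
have -> : f z * (z / (z - (a + h))) - f z * (z / (z - a)) - h * (f z * (z / (z - a) ^+ 2)) =
   f z * (h ^+ 2 * (z * ((z - a) ^+ 2 * (z - (a + h)))^-1)) by field; rewrite n1 n2.
rewrite cabsM cabsM cabsX cabsM cabsV cabsM cabsX zr.
have -> : 2 * B / d ^+ 3 * cabs h ^+ 2 = B * (cabs h ^+ 2 * (1 * (d ^+ 2 * (d / 2))^-1)).
  by field; rewrite gt_eqF.
rewrite ler_pM ?cabs_ge0//; last 2 first.
  by apply: fB; rewrite zr.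
  rewrite ler_wpM2l ?sqr_ge0// ler_pM ?(ltW r0) ?(ltW r1)//.
    by rewrite invr_ge0 mulr_ge0 ?cabs_ge0// sqr_ge0.
  rewrite lef_pV2 ?posrE.
  - rewrite ler_pM ?sqr_ge0 ?(ltW d0)// ?divr_ge0 ?(ltW d0)//; last exact: zah.
    by rewrite lerXn2r// ?nnegrE ?cabs_ge0 ?(ltW d0)// zad.
  - by rewrite mulr_gt0 ?cabs_gt0// exprn_gt0// cabs_gt0.
  - by rewrite mulr_gt0 ?exprn_gt0// divr_gt0.
rewrite mulr_ge0 ?sqr_ge0// mulr_ge0 ?(ltW r0)// invr_ge0 mulr_ge0 ?cabs_ge0//.
by rewrite sqr_ge0.
Qed.

Definition lucvg (u : nat -> R[i] -> R[i]) g := forall r e, r < 1 -> 0 < e ->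
  exists N, forall n, (N <= n)%N -> forall z, cabs z <= r -> cabs (u n z - g z) <= e.

(** The Cauchy integrals for the derivatives form a Cauchy sequence, and the quadratic remainders of
    [cauchy_quotient] are uniform in n, so the expansion at a passes to the limit. *)
Lemma lucvg_analytic u g : (forall n, analytic (u n)) -> lucvg u g -> analytic g.
Proof.
move=> ua ug; apply/analyticP => a a1.
pose d := (1 - cabs a) / 2.
have d0 : 0 < d by rewrite /d divr_gt0// subr_gt0.
have r1 : cabs a + d < 1 by rewrite /d; have : cabs a < 1 := a1; lra.
pose D f := cmean (fun t => f (pt (cabs a + d) t) *
    (pt (cabs a + d) t / (pt (cabs a + d) t - a) ^+ 2)).
have fc f t : analytic f -> rcont (fun t => f (pt (cabs a + d) t) *
    (pt (cabs a + d) t / (pt (cabs a + d) t - a) ^+ 2)) t.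
  move=> fa; apply: rcontM.
    by apply: analytic_rcont; [exact: fa|rewrite addr_ge0 ?cabs_ge0 ?ltW|exact: r1].
  apply: rcontM; first exact: cont_circle_pt.
  apply: rcontV.
    rewrite expf_neq0// -cabs_gt0 (lt_le_trans d0)//.
    have := ler_cabsB (pt (cabs a + d) t) a.
    by rewrite cabs_circle_pt ?addr_ge0 ?cabs_ge0 ?(ltW d0)//; lra.
  by apply: rcontX; apply: rcontB; [exact: cont_circle_pt|exact: rcont_cst].
have DB f1 f2 : analytic f1 -> analytic f2 -> D (fun z => f1 z - f2 z) = D f1 - D f2.
  move=> h1 h2; rewrite /D -cmeanB; last 2 first.
    by move=> t _; exact: (fc f1 t h1).
    by move=> t _; exact: (fc f2 t h2).
  by apply: eq_cmean => t _; rewrite mulrBl.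
have [l Hl] : exists l, forall e : R, 0 < e ->
    exists N, forall n, (N <= n)%N -> cabs (D (u n) - l) <= e.
  apply: ccauchy_cvg => e e0.
  have e2 : 0 < e * d ^+ 2 / 2 by rewrite divr_gt0// mulr_gt0// exprn_gt0.
  have [N HN] := ug _ _ r1 e2; exists N => m n Nm Nn.
  rewrite -DB; [|exact: ua|exact: ua].
  have fB z : cabs z <= cabs a + d -> cabs (u m z - u n z) <= e * d ^+ 2.
    move=> zr; have -> : u m z - u n z = (u m z - g z) - (u n z - g z) by ring.
    rewrite (le_trans (cabsB _ _))// (splitr (e * d ^+ 2)) lerD//; exact: HN.
  have [+ _] := cauchy_quotient (analyticB (ua m) (ua n)) d0 r1 fB.
  by rewrite mulfK// expf_neq0// gt_eqF.
have [N0 HN0] := ug _ _ r1 ltr01.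
have [B0 HB0] := analytic_bounded (ua N0) r1.
have uB n : (N0 <= n)%N -> forall z, cabs z <= cabs a + d -> cabs (u n z) <= B0 + 2.
  move=> Nn z zr; have -> : u n z = u N0 z + ((u n z - g z) - (u N0 z - g z)) by ring.
  rewrite (le_trans (cabsD _ _))// lerD ?HB0// (le_trans (cabsB _ _))//.
  by have := HN0 n Nn z zr; have := HN0 N0 (leqnn _) z zr; lra.
have key h : cabs h <= d / 2 ->
    cabs (g (a + h) - g a - l * h) <= 2 * (B0 + 2) / d ^+ 3 * cabs h ^+ 2.
  move=> hd; apply/ler_addgt0Pr => e e0; have e3 : 0 < e / 3 by rewrite divr_gt0.
  have [N1 H1] := ug _ _ r1 e3.
  have [N2 H2] := Hl _ e3.
  pose n := maxn N0 (maxn N1 N2).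
  have [n0 [n1 n2]] : (N0 <= n /\ N1 <= n /\ N2 <= n)%N.
    by rewrite /n !leq_max !leqnn !orbT.
  have [_ /(_ h hd)] := cauchy_quotient (ua n) d0 r1 (uB n n0).
  rewrite -/(D (u n)) => h3.
  have ahr : cabs (a + h) <= cabs a + d.
    by rewrite (le_trans (cabsD _ _))// lerD2l (le_trans hd)//; lra.
  have ara : cabs a <= cabs a + d by rewrite lerDl ltW.
  have -> : g (a + h) - g a - l * h = (u n (a + h) - u n a - h * D (u n)) +
    ((u n a - g a) - (u n (a + h) - g (a + h)) + h * (D (u n) - l)) by ring.
  rewrite (le_trans (cabsD _ _))// lerD// (le_trans (cabsD _ _))//.
  have := H1 n n1 _ ahr; have := H1 n n1 _ ara; have := H2 n n2.
  have hle1 : cabs h <= 1 by rewrite (le_trans hd)// /d; have := cabs_ge0 a; lra.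
  have := cabsB (u n a - g a) (u n (a + h) - g (a + h)).
  rewrite cabsM => q1 q2 q3 q4.
  have : cabs h * cabs (D (u n) - l) <= e / 3.
    by rewrite -[e / 3]mul1r ler_pM ?cabs_ge0.
  lra.
exists l => e e0.
have B2 : 0 < 2 * (B0 + 2) / d ^+ 3 + 1.
  rewrite ltr_wpDl// divr_ge0 ?exprn_ge0 ?(ltW d0)// mulr_ge0//.
  by apply: le_trans (uB _ (leqnn _) 0 _); rewrite ?cabs_ge0// cabs0 addr_ge0 ?cabs_ge0 ?(ltW d0).
exists (Num.min (d / 2) (e / (2 * (B0 + 2) / d ^+ 3 + 1))).
  by rewrite lt_min; apply/andP; split; exact: divr_gt0.
move=> h; rewrite lt_min => /andP[/ltW h1 h2].
apply: le_trans (key h h1) _; rewrite expr2 mulrA ler_wpM2r ?cabs_ge0//.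
move: h2; rewrite ltr_pdivlMr// mulrDr mulr1 mulrC => h2.
by have := cabs_ge0 h; lra.
Qed.

(** An ultrafilter finer than [\oo] replaces the diagonal argument: along it every bounded sequence
    converges, and its members are nonempty sets of arbitrarily large indices from which k is picked
    recursively, k m being within 1/(m+1) of the limit in the coordinates up to m. *)
Lemma diag_extraction (x : nat -> nat -> R) (B : nat -> R) :
  (forall j n, `|x j n| <= B j) ->
  exists (k : nat -> nat) (p : nat -> R), {homo k : m n / (m < n)%N} /\
    forall j e, 0 < e -> exists N, forall n, (N <= n)%N -> `|x j (k n) - p j| < e.
Proof.
move=> xB.
have [G [GU oG]] := @ultraFilterLemma nat \oo _.
have cvx j : exists q : R, x j @ G --> q.
  have [|q [_ Hq]] := @segment_compact R (- B j) (B j) (x j @ G) _.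
    have /filterS : [set: nat] `<=` [set n | `[- B j, B j]%classic (x j n)].
      by move=> n _ /=; rewrite in_itv/= -ler_norml.
    by apply; exact: filterT.
  exists q; apply/cvgrPdist_lt => e e0.
  have [//|Gn] := @in_ultra_setVsetC _ G [set n | `|q - x j n| < e] GU.
  have [] := Hq [set y | ~ (`|q - y| < e)] (ball q e) _ (nbhsx_ballx _ _ e0) => //.
  by move=> y [] + qy.
have [p Hp] := choice cvx.
have S m : G [set n | forall j, (j <= m)%N -> `|x j n - p j| < m.+1%:R^-1].
  have S' l e : 0 < e -> G [set n | forall j, (j <= l)%N -> `|x j n - p j| < e].
    move=> e0; elim: l => [|l IH].
      move/cvgrPdist_lt : (Hp 0) => /(_ e e0).
      by apply: filterS => n /= h j; rewrite leqn0 => /eqP->; rewrite distrC.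
    move/cvgrPdist_lt : (Hp l.+1) => /(_ e e0).
    apply: filterS2 IH => n /= h1 h2 j; rewrite leq_eqVlt ltnS => /predU1P[->|/h1//].
    by rewrite distrC.
  exact: S'.
have nx m n0 : exists n, (n0 < n)%N /\ forall j, (j <= m)%N -> `|x j n - p j| < m.+1%:R^-1.
  have G2 : G [set n | (n0 < n)%N] by apply: oG; exists n0.+1.
  have [n [h1 h2]] := filter_ex (filterI G2 (S m)).
  by exists n.
have [F HF] := choice (fun q : nat * nat => nx q.1 q.2).
pose k := fix k m := if m is m'.+1 then F (m, k m') else F (0%N, 0%N).
have kS m : (k m < k m.+1)%N by have [] := HF (m.+1, k m).
exists k, p; split.
  by apply: homo_ltn => //; exact: ltn_trans.
move=> j e e0; exists (maxn j (Num.truncn e^-1)) => n; rewrite geq_max => /andP[jn en].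
have : `|x j (k n) - p j| < n.+1%:R^-1.
  by case: n jn {en} => [|n] jn; [have [_ ->] := HF (0%N, 0%N)|have [_ ->] := HF (n.+1, k n)].
move/lt_le_trans; apply.
rewrite -[leRHS]invrK lef_pV2 ?posrE ?invr_gt0//.
by apply: le_trans (ltW (truncnS_gt _)) _; rewrite ler_nat.
Qed.

Lemma cdiag_extraction (x : nat -> nat -> R[i]) (B : nat -> R) :
  (forall j n, cabs (x j n) <= B j) ->
  exists (k : nat -> nat) (p : nat -> R[i]), {homo k : m n / (m < n)%N} /\
    forall j e, 0 < e -> exists N, forall n, (N <= n)%N -> cabs (x j (k n) - p j) < e.
Proof.
move=> xB.
(* Real parts sit at even indices, imaginary parts at odd ones. *)
pose y i n := if odd i then Im (x i./2 n) else Re (x i./2 n).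
have [k [p [kh Hp]]] := @diag_extraction y (fun i => B i./2) (fun j n => ltac:(
  rewrite /y; case: ifP => _; apply: le_trans (xB j./2 n);
  [exact: Im_le_cabs|exact: Re_le_cabs])).
exists k, (fun j => p j.*2 +i* p j.*2.+1); split=> // j e e0.
have e2 : 0 < e / 2 by rewrite divr_gt0.
have [N1 H1] := Hp j.*2 _ e2; have [N2 H2] := Hp j.*2.+1 _ e2.
exists (maxn N1 N2) => n; rewrite geq_max => /andP[/H1 h1 /H2 h2].
rewrite (le_lt_trans (cabs_le_ReIm _))// cReB cImB/= [ltRHS](splitr e).
move: h1 h2; rewrite /y/= odd_double doubleK uphalf_double => h1 h2.
exact: ltrD.
Qed.

(** Extraction makes every Taylor coefficient converge. The common bound makes Taylor remainders
    uniformly small on smaller disks, so finitely many coefficients decide, and the subsequence is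
    uniformly Cauchy there. *)
Lemma montel (u : nat -> R[i] -> R[i]) : (forall n, analytic (u n)) ->
  (forall r, 0 < r -> r < 1 ->
     exists B, forall n z, cabs z <= r -> cabs (u n z) <= B) ->
  exists (k : nat -> nat) g, [/\ {homo k : m n / (m < n)%N}, analytic g & lucvg (u \o k) g].
Proof.
move=> ua uB.
have cB j : exists B, forall n, cabs (coef (u n) j) <= B.
  have [B HB] := uB 2^-1 ltac:(lra) ltac:(lra).
  exists (B / 2^-1 ^+ j) => n.
  apply: le_trans (@coef_le R (u n) 2^-1 j (ua n) _ _) _; [lra|lra|].
  rewrite ler_pM2r ?invr_gt0 ?exprn_gt0//.
  by apply: avg_bound; [exact: ua|lra|lra|move=> t; apply: HB; rewrite cabs_circle_pt//; lra].
have [Bc HBc] := choice cB.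
have [k [p [kh Hp]]] := @cdiag_extraction (fun j n => coef (u n) j) Bc HBc.
have uc r e : 0 < r -> r < 1 -> 0 < e -> exists N, forall m n, (N <= m)%N -> (N <= n)%N ->
    forall z, cabs z <= r -> cabs (u (k m) z - u (k n) z) <= e.
  move=> r0 r1 e0; pose s := (r + 1) / 2.
  have rs : r < s by rewrite /s; lra.
  have s1 : s < 1 by rewrite /s; lra.
  have s0 : 0 < s by exact: lt_trans rs.
  have [B HB] := uB s s0 s1.
  have B0 : 0 <= B by apply: le_trans (HB 0 0 _); rewrite ?cabs_ge0// cabs0 ltW.
  have q1 : r / s < 1 by rewrite ltr_pdivrMr// mul1r.
  have K1 : 0 < B / (1 - r / s) + 1.
    by rewrite ltr_wpDl// divr_ge0// subr_ge0 ltW.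
  have e3 : 0 < e / 3 / (B / (1 - r / s) + 1) by rewrite !divr_gt0.
  have [N HN] := @expr_small R (r / s) _ (divr_ge0 (ltW r0) (ltW s0)) q1 e3.
  have tail n z : cabs z <= r -> cabs (u n z - psum (coef (u n)) N z) <= e / 3.
    move=> zr; apply: le_trans (taylor N (ua n) (le_lt_trans zr rs) s1) _.
    have zs : cabs z / s <= r / s by rewrite ler_pM2r ?invr_gt0.
    apply: (@le_trans _ _ (B * ((r / s) ^+ N / (1 - r / s)))).
      apply: ler_pM; rewrite ?avg_ge0//.
      - apply: divr_ge0; first by rewrite exprn_ge0// divr_ge0 ?cabs_ge0 ?(ltW s0).
        by rewrite subr_ge0 (le_trans zs)// ltW.
      - by apply: avg_bound; [exact: ua|exact: ltW|exact: s1|move=> t; apply: HB; rewrite cabs_circle_pt// ltW].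
      apply: ler_pM.
      - by rewrite exprn_ge0// divr_ge0 ?cabs_ge0// ltW.
      - by rewrite invr_ge0 subr_ge0 (le_trans zs)// ltW.
      - by rewrite lerXn2r// nnegrE divr_ge0 ?cabs_ge0// ltW.
      - by rewrite lef_pV2 ?posrE ?subr_gt0 ?lerB// (le_lt_trans zs).
    have q0 : 0 <= (r / s) ^+ N by rewrite exprn_ge0// divr_ge0// ltW.
    rewrite mulrA mulrAC; apply: le_trans (_ : (B / (1 - r / s) + 1) * (r / s) ^+ N <= _).
      by rewrite ler_wpM2r// lerDl.
    by rewrite mulrC -ler_pdivlMr// ltW.
  have [M HM] : exists M, forall m n, (M <= m)%N -> (M <= n)%N -> forall z, cabs z <= r ->
      cabs (psum (coef (u (k m))) N z - psum (coef (u (k n))) N z) <= e / 3.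
    have fin L d : 0 < d -> exists M, forall n, (M <= n)%N -> forall j, (j < L)%N ->
        cabs (coef (u (k n)) j - p j) < d.
      move=> d0; elim: L => [|L [M1 H1]]; first by exists 0%N.
      have [M2 H2] := Hp L d d0; exists (maxn M1 M2) => n; rewrite geq_max => /andP[n1 n2] j.
      by rewrite ltnS leq_eqVlt => /predU1P[->|]; [exact: H2|exact: H1].
    have e6 : 0 < e / 6 / (N%:R + 1) by rewrite !divr_gt0// ltr_wpDl.
    have [M HM] := fin N _ e6; exists M => m n Mm Mn z zr.
    rewrite /psum -sumrB.
    apply: le_trans (cabs_sum _ _ _) _.
    apply: (@le_trans _ _ (\sum_(j < N) (2 * (e / 6 / (N%:R + 1))))).
      apply: ler_sum => j _; rewrite -mulrBl cabsM cabsX.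
      rewrite -[leRHS]mulr1; apply: ler_pM; rewrite ?cabs_ge0 ?exprn_ge0 ?cabs_ge0//; last first.
        by apply: exprn_ile1; rewrite ?cabs_ge0// (le_trans zr)// ltW.
      have -> : coef (u (k m)) j - coef (u (k n)) j =
        (coef (u (k m)) j - p j) - (coef (u (k n)) j - p j) by ring.
      rewrite (le_trans (cabsB _ _))//.
      have := HM m Mm j (ltn_ord j); have := HM n Mn j (ltn_ord j); lra.
    rewrite sumr_const card_ord -[leLHS]mulr_natr.
    have -> : 2 * (e / 6 / (N%:R + 1)) * N%:R = e / 3 * (N%:R / (N%:R + 1)).
      have N1 : N%:R + 1 != 0 :> R by rewrite gt_eqF// ltr_wpDl.
      by field.
    have N1 : N%:R / (N%:R + 1) <= 1 :> R.
      by rewrite ler_pdivrMr ?ltr_wpDl// mul1r lerDl.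
    by apply: ler_piMr => //; rewrite divr_ge0// ltW.
  exists M => m n Mm Mn z zr.
  have -> : u (k m) z - u (k n) z = (u (k m) z - psum (coef (u (k m))) N z) +
    ((psum (coef (u (k m))) N z - psum (coef (u (k n))) N z) -
     (u (k n) z - psum (coef (u (k n))) N z)) by ring.
  rewrite (le_trans (cabsD _ _))//.
  have := cabsB (psum (coef (u (k m))) N z - psum (coef (u (k n))) N z)
     (u (k n) z - psum (coef (u (k n))) N z).
  have := tail (k m) z zr; have := tail (k n) z zr; have := HM m n Mm Mn z zr; lra.
have ptw z : exists l, cabs z < 1 -> forall e, 0 < e ->
    exists N, forall n, (N <= n)%N -> cabs (u (k n) z - l) <= e.
  have [z1|z1] := ltP (cabs z) 1; last by exists 0 => h; exfalso; lra.
  have [|l Hl] := @ccauchy_cvg (fun n => u (k n) z); last by exists l.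
  move=> e e0; pose r := Num.max (cabs z) 2^-1.
  have r0 : 0 < r by rewrite lt_max; apply/orP; right; lra.
  have r1 : r < 1 by rewrite gt_max z1; lra.
  have [N HN] := uc r e r0 r1 e0; exists N => m n Nm Nn; apply: HN => //.
  by rewrite le_max lexx.
have [g Hg] := choice ptw.
have lu : lucvg (u \o k) g.
  move=> r e r1 e0; pose r' := Num.max r 2^-1.
  have r'0 : 0 < r' by rewrite lt_max; apply/orP; right; lra.
  have r'1 : r' < 1 by rewrite gt_max r1; lra.
  have e2 : 0 < e / 2 by rewrite divr_gt0.
  have [N HN] := uc r' _ r'0 r'1 e2; exists N => n Nn z zr /=.
  have zr' : cabs z <= r' by rewrite le_max zr.
  have [M HM] := Hg z (le_lt_trans zr' r'1) _ e2.
  have -> : u (k n) z - g z = (u (k n) z - u (k (maxn N M)) z) +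
    (u (k (maxn N M)) z - g z) by ring.
  rewrite (le_trans (cabsD _ _))// [leRHS](splitr e) lerD//.
    by apply: HN => //; exact: leq_maxl.
  by apply: HM; exact: leq_maxr.
exists k, g; split; [exact: kh| |exact: lu].
by apply: (lucvg_analytic _ lu) => n; exact: ua.
Qed.

End Montel.

(** * The Poisson kernel *)

Section Poisson.
Variable R : realType.
Local Notation ang := (@angles R).
Local Notation mu := (@lebesgue_measure R).
Local Notation pt := (@circle_pt R).
Implicit Types (f g : R[i] -> R[i]) (a z : R[i]) (r e s t : R).

Definition poisson a s t : R := (s ^+ 2 - cabs a ^+ 2) / cabs (pt s t - a) ^+ 2.

Lemma pt_sub_neq0 a s t : 0 < s -> cabs a < s -> pt s t - a != 0.
Proof.
move=> s0 as1; rewrite subr_eq0; apply/eqP => E.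
by move: as1; rewrite -E cabs_circle_pt ?ltxx// ltW.
Qed.

(** Cauchy kernel plus a term whose product with an analytic function has mean zero: this is how the
    Poisson formula follows from Cauchy's. *)
Lemma poisson_kernelE a s t : 0 < s -> cabs a < s ->
  (poisson a s t)%:C = pt s t / (pt s t - a) + a^* / (pt s t - a)^*.
Proof.
move=> s0 as1; have z0 := pt_sub_neq0 t s0 as1.
have zc0 : (pt s t - a)^* != 0 by rewrite conjc_eq0.
rewrite /poisson rmorphM/= fmorphV/= -mul_conj rmorphB/= -mul_conj.
have -> : (s ^+ 2)%:C = pt s t * (pt s t)^*.
  by rewrite mul_conj cabs_circle_pt// ltW.
rewrite (_ : (pt s t)^* = (pt s t - a)^* + a^*); last by rewrite -rmorphD/= subrK.
move: zc0; set w := (pt s t - a)^*; set b := a^*; clearbody w b => w0.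
by field; rewrite w0 z0.
Qed.

Lemma rcont_kernel a s t : 0 < s -> cabs a < s -> rcont (fun t => pt s t / (pt s t - a)) t.
Proof.
move=> s0 as1; apply: rcontM; first exact: cont_circle_pt.
apply: rcontV; first exact: pt_sub_neq0.
by apply: rcontB; [exact: cont_circle_pt|exact: rcont_cst].
Qed.

Lemma rcont_kernel_conj a s t : 0 < s -> cabs a < s ->
  rcont (fun t => a^* / (pt s t - a)^*) t.
Proof.
move=> s0 as1; apply: rcontZ; apply: rcontV; first by rewrite conjc_eq0 pt_sub_neq0.
by apply: rcont_conj; apply: rcontB; [exact: cont_circle_pt|exact: rcont_cst].
Qed.

Lemma rcont_poisson a s t : 0 < s -> cabs a < s -> rcont (fun t => (poisson a s t)%:C) t.
Proof.
move=> s0 as1; under eq_fun do rewrite poisson_kernelE//.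
by apply: rcontD; [exact: rcont_kernel|exact: rcont_kernel_conj].
Qed.

Lemma poisson_ge0 a s t : cabs a < s -> 0 <= poisson a s t.
Proof.
move=> as1; rewrite divr_ge0 ?sqr_ge0// subr_ge0 lerXn2r// ?nnegrE ?cabs_ge0 ?(ltW as1)//.
by rewrite (le_trans (cabs_ge0 a))// ltW.
Qed.

(** On |z| = s the factor equals conj(a) z / (s^2 - conj(a) z), which is analytic on the closed disk
    of radius s and vanishes at 0; shrinking the circle sends the mean to 0. *)
Lemma cmean_antikernel f a s : analytic f -> cabs a < s -> s < 1 ->
  cmean (fun t => a^* / (pt s t - a)^* * f (pt s t)) = 0.
Proof.
move=> fa as1 s1; have s0 : 0 < s := le_lt_trans (cabs_ge0 _) as1.
pose k z := f z * (a^* * z / ((s ^+ 2)%:C - a^* * z)).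
have az z : cabs z <= s -> s * (s - cabs a) <= cabs ((s ^+ 2)%:C - a^* * z).
  move=> zs; have := ler_cabsB (s ^+ 2)%:C (a^* * z).
  rewrite cabs_real ger0_norm ?sqr_ge0// cabsM cabs_conj; apply: le_trans.
  by have := ler_wpM2l (cabs_ge0 a) zs; lra.
have ss : 0 < s * (s - cabs a) by rewrite mulr_gt0// subr_gt0.
have kd z : cabs z <= s -> cdiff k z.
  move=> zs; apply: cdiffM; first by apply: analytic_cdiff => //; exact: le_lt_trans s1.
  apply: cdiff_div.
  - by rewrite -cabs_gt0 (lt_le_trans ss)// az.
  - by apply: cdiffM; [exact: cdiff_cst|exact: cdiff_id].
  - by apply: cdiffB; [exact: cdiff_cst|apply: cdiffM; [exact: cdiff_cst|exact: cdiff_id]].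
have -> : cmean (fun t => a^* / (pt s t - a)^* * f (pt s t)) = cmean (fun t => k (pt s t)).
  apply: eq_cmean => t _; rewrite /k mulrC; congr (_ * _).
  have z0 : pt s t != 0 by exact: circle_pt_neq0.
  have -> : (s ^+ 2)%:C = pt s t * (pt s t)^* by rewrite mul_conj cabs_circle_pt// ltW.
  have zc0 : (pt s t - a)^* != 0 by rewrite conjc_eq0 pt_sub_neq0.
  rewrite (mulrC a^* (pt s t)) -mulrBr -rmorphB/=.
  move: zc0; set w := (pt s t - a)^*; set b := a^*; clearbody w b => w0.
by field; rewrite w0 z0.
have [B HB] := analytic_bounded fa s1.
have B0 : 0 <= B by apply: le_trans (HB 0 _); rewrite ?cabs_ge0// cabs0 ltW.
apply/eqP; rewrite -cabs_eq0 eq_le cabs_ge0 andbT.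
apply/ler_addgt0Pr => e e0; rewrite add0r.
pose r := Num.min s (e / (B * (cabs a / (s * (s - cabs a))) + 1)).
have K0 : 0 <= B * (cabs a / (s * (s - cabs a))).
  by rewrite mulr_ge0// divr_ge0 ?cabs_ge0// ltW.
have K1 : 0 < B * (cabs a / (s * (s - cabs a))) + 1 by rewrite ltr_wpDl.
have r0 : 0 < r by rewrite lt_min s0; exact: divr_gt0.
have rs : r <= s by rewrite ge_min lexx.
rewrite -(cmean_circle_const (f := k) r0 rs); last by move=> z /andP[_]; exact: kd.
apply: cabs_cmean_bound => t _.
  by apply: rcont_circle; apply/cdiff_cont/kd; rewrite cabs_circle_pt// ltW.
have re : r * (B * (cabs a / (s * (s - cabs a))) + 1) <= e.
  by rewrite -ler_pdivlMr// ge_min lexx orbT.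
apply: le_trans re; rewrite /k cabsM.
apply: (@le_trans _ _ (B * (cabs a * r / (s * (s - cabs a))))).
  apply: ler_pM; rewrite ?cabs_ge0//; first by apply: HB; rewrite cabs_circle_pt// ltW.
  rewrite cabsM cabsM cabs_conj cabsV cabs_circle_pt ?(ltW r0)//.
  rewrite ler_wpM2l ?mulr_ge0 ?cabs_ge0 ?(ltW r0)//.
  rewrite lef_pV2 ?posrE//; first by apply: az; rewrite cabs_circle_pt// ltW.
  by rewrite (lt_le_trans ss)// az// cabs_circle_pt// ltW.
rewrite [leRHS]mulrDr mulr1.
have -> : B * (cabs a * r / (s * (s - cabs a))) = r * (B * (cabs a / (s * (s - cabs a)))) by ring.
by rewrite lerDl ltW.
Qed.

Lemma poisson_formula f a s : analytic f -> cabs a < s -> s < 1 ->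
  f a = cmean (fun t => (poisson a s t)%:C * f (pt s t)).
Proof.
move=> fa as1 s1; have s0 : 0 < s := le_lt_trans (cabs_ge0 _) as1.
have fc t : rcont (fun t => f (pt s t)) t by apply: analytic_rcont => //; exact: ltW.
transitivity (cmean (fun t => f (pt s t) * (pt s t / (pt s t - a)) +
    a^* / (pt s t - a)^* * f (pt s t))).
  rewrite cmeanD; first last.
  - by move=> t _; apply: rcontM; [exact: rcont_kernel_conj|exact: fc].
  - by move=> t _; apply: rcontM; [exact: fc|exact: rcont_kernel].
  by rewrite cauchy_formula// cmean_antikernel// addr0.
by apply: eq_cmean => t _; rewrite poisson_kernelE//; ring.
Qed.

Lemma poisson_le f a s : analytic f -> cabs a < s -> s < 1 ->
  cabs (f a) <= mean (fun t => poisson a s t * cabs (f (pt s t))).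
Proof.
move=> fa as1 s1; have s0 : 0 < s := le_lt_trans (cabs_ge0 _) as1.
have fc t : rcont (fun t => f (pt s t)) t by apply: analytic_rcont => //; exact: ltW.
have E t : cabs ((poisson a s t)%:C * f (pt s t)) = poisson a s t * cabs (f (pt s t)).
  by rewrite cabsM cabs_real ger0_norm// poisson_ge0.
rewrite {1}(poisson_formula fa as1 s1); apply: cabs_cmean_le.
- by move=> t _; apply: rcontM; [exact: rcont_poisson|exact: fc].
- under [X in mintegrable X]eq_fun do rewrite -E.
  by apply: rcont_mintegrable => t _; apply: rcontM; [exact: rcont_poisson|exact: fc].
- by move=> t _; rewrite E.
Qed.

Lemma cRe_conj (z : R[i]) : Re z^* = Re z. Proof. by case: z. Qed.
Lemma cIm_conj (z : R[i]) : Im z^* = - Im z. Proof. by case: z. Qed.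

Lemma cmean_conj (g : R -> R[i]) : cintegrable (circle_measure R) ang g ->
  cmean (fun t => (g t)^*) = (cmean g)^*.
Proof.
move=> [i1 i2]; apply: complex_eq; rewrite ?cRe_conj ?cIm_conj /cmean /cint /=.
  by apply: eq_Rintegral => t _; rewrite cRe_conj.
rewrite -mulN1r -RintegralZl//; last exact: mang.
by apply: eq_Rintegral => t _; rewrite cIm_conj mulN1r.
Qed.

Lemma mean_poisson a s : cabs a < s -> mean (poisson a s) = 1.
Proof.
move=> as1; have s0 : 0 < s := le_lt_trans (cabs_ge0 _) as1.
have E : cmean (fun t => (poisson a s t)%:C) = 1.
  transitivity (cmean (fun t => pt s t / (pt s t - a) + a^* / (pt s t - a)^*)).
    by apply: eq_cmean => t _; rewrite poisson_kernelE.
  transitivity (cmean (fun t => pt s t / (pt s t - a)) +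
      (cmean (fun t => pt s t / (pt s t - a)) - 1)^*).
    rewrite cmeanD; [|by move=> t _; exact: rcont_kernel|by move=> t _; exact: rcont_kernel_conj].
    congr (_ + _).
    rewrite -[X in (_ - X)^*](cmean_cst (1 : R[i])) -cmeanB;
      [|by move=> t _; exact: rcont_kernel|by move=> t _; exact: rcont_cst].
    transitivity (cmean (fun t => (pt s t / (pt s t - a) - 1)^*)).
      apply: eq_cmean => t _; have z0 := pt_sub_neq0 t s0 as1.
      have -> : pt s t / (pt s t - a) - 1 = a / (pt s t - a) by field.
      by rewrite rmorphM/= fmorphV.
    have i : cintegrable (circle_measure R) ang (fun t => pt s t / (pt s t - a) - 1).
      by apply: cont_cintegrable => t _; apply: rcontB; [exact: rcont_kernel|exact: rcont_cst].
    exact: cmean_conj i.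
  by rewrite cmean_cauchy_kernel// subrr rmorph0 addr0.
by have := congr1 (@complex.Re R) E; rewrite /cmean/= => <-.
Qed.

Lemma poisson_bound a s t : cabs a < s -> poisson a s t <= (s + cabs a) / (s - cabs a).
Proof.
move=> as1; have s0 : 0 < s := le_lt_trans (cabs_ge0 _) as1.
have sa : 0 < s - cabs a by rewrite subr_gt0.
have h : s - cabs a <= cabs (pt s t - a).
  by rewrite -{1}(cabs_circle_pt t (ltW s0)) ler_cabsB.
rewrite /poisson ler_pdivrMr; last by rewrite exprn_gt0// (lt_le_trans sa).
have -> : s ^+ 2 - cabs a ^+ 2 = (s + cabs a) / (s - cabs a) * (s - cabs a) ^+ 2.
  by field; rewrite gt_eqF.
apply: ler_wpM2l.
  by apply: divr_ge0; [rewrite addr_ge0 ?cabs_ge0// ltW|exact: ltW].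
by rewrite lerXn2r// ?nnegrE ?cabs_ge0 ?(ltW sa).
Qed.

Lemma cont_poisson a s t : 0 < s -> cabs a < s -> {for t, continuous (poisson a s)}.
Proof. by move=> s0 as1; exact: rcont_Re (rcont_poisson t s0 as1). Qed.

(** On this range sin vanishes only at 0. Near 0 its derivative 1 gives |sin v| >= |v| / 2; on the
    rest, a compact interval up to sign, its minimum is positive. *)
Lemma sin_lower (eta : R) : 0 < eta -> eta < pi -> exists2 c : R, 0 < c <= 2^-1 &
  forall v, `|v| <= pi - eta -> c * `|v| <= `|sin v|.
Proof.
move=> e0 epi.
have h2 : 0 < 2^-1 :> R by lra.
have [d d0 Hd] := is_derive_bound (is_derive_sin (0 : R)) h2.
have small v : `|v| < d -> 2^-1 * `|v| <= `|sin v|.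
  move=> /Hd; rewrite add0r sin0 cos0 subr0 mul1r => h.
  have : `|v| <= `|sin v| + `|sin v - v|.
    by rewrite -{1}(subKr (sin v) v) (le_trans (ler_normB _ _)).
  lra.
pose d' := Num.min d (pi - eta) .
have d'0 : 0 < d' by rewrite lt_min d0 subr_gt0.
have [//|c|v0 v0i Hv] := @EVT_min R (fun v => sin v) d' (pi - eta).
  by rewrite ge_min lexx orbT.
  by apply: continuous_subspaceT => x; exact: continuous_sin.
move: v0i; rewrite in_itv/= => /andP[v1 v2].
have s0 : 0 < sin v0 by apply: sin_gt0_pi; apply/andP; split; lra.
exists (Num.min 2^-1 (sin v0 / pi)).
  by rewrite lt_min h2 divr_gt0 ?pi_gt0// ge_min lexx.
have pos v : 0 <= v -> v <= pi - eta -> Num.min 2^-1 (sin v0 / pi) * v <= `|sin v|.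
  move=> v0' vp; have [vd|vd] := ltP v d.
    apply: le_trans (small v _); rewrite ?ger0_norm//.
    by rewrite ler_wpM2r// ge_min lexx.
  apply: (@le_trans _ _ (sin v0)).
    apply: (@le_trans _ _ (sin v0 / pi * v)).
      by rewrite ler_wpM2r// ge_min lexx orbT.
    by rewrite mulrAC ler_pdivrMr ?pi_gt0// ler_pM2l//; lra.
  apply: le_trans (ler_norm _); apply: Hv.
  by rewrite in_itv/= vp andbT ge_min vd.
move=> v vp; have := pos _ (normr_ge0 v) vp.
suff -> : `|sin `|v| | = `|sin v| by [].
have [h|h] := boolP (0 <= v); first by rewrite (ger0_norm h).
by rewrite (@ltr0_norm _ v) ?ltNge// sinN normrN.
Qed.

(** On the shell 2^(j-1) dl <= |u| < 2^j dl the left side is at most dl / (2^(j-1) dl)^2 = 4 / (4^j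
    dl), which is the term of index j. *)
Lemma dyadic_kernel (dl u : R) J : 0 < dl -> `|u| < 2 ^+ J * dl ->
  dl / (dl ^+ 2 + u ^+ 2) <=
  \sum_(j < J.+1) (if `|u| < 2 ^+ j * dl then 4 / (4 ^+ j * dl) else 0).
Proof.
move=> d0; have t0 j : 0 <= (if `|u| < 2 ^+ j * dl then 4 / (4 ^+ j * dl) else 0).
  by case: ifP => // _; rewrite divr_ge0// mulr_ge0 ?exprn_ge0// ltW.
have uu : 0 <= u ^+ 2 by rewrite sqr_ge0.
have d2 : 0 < dl ^+ 2 by rewrite exprn_gt0.
elim: J => [|J IH] uJ.
  rewrite big_ord1 uJ expr0 mul1r.
  apply: (@le_trans _ _ (dl / dl ^+ 2)).
    by rewrite ler_wpM2l ?(ltW d0)// lef_pV2 ?posrE ?lerDl// ltr_wpDr.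
  by rewrite expr2 invfM mulrA divff ?gt_eqF// ler_wpM2r ?invr_ge0 ?(ltW d0)//; lra.
have [/IH h|h] := ltP `|u| (2 ^+ J * dl).
  by rewrite big_ord_recr/= (le_trans h)// lerDl.
rewrite big_ord_recr/= uJ; apply: (@le_trans _ _ (4 / (4 ^+ J.+1 * dl))); last first.
  by rewrite lerDr sumr_ge0.
have h2 : (2 ^+ J * dl) ^+ 2 <= u ^+ 2.
  rewrite -(real_normK (num_real u)) lerXn2r// ?nnegrE//.
  by apply: mulr_ge0; [exact: exprn_ge0|exact: ltW].
have J0 : 0 < (4 : R) ^+ J by rewrite exprn_gt0.
apply: (@le_trans _ _ (dl / (2 ^+ J * dl) ^+ 2)).
  rewrite ler_wpM2l ?(ltW d0)// lef_pV2 ?posrE.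
  - by rewrite (le_trans h2)// lerDr ltW.
  - by rewrite ltr_wpDr.
  - by rewrite exprn_gt0// mulr_gt0// exprn_gt0.
have -> : (2 ^+ J * dl) ^+ 2 = 4 ^+ J * dl ^+ 2.
  by rewrite exprMn -exprM mulnC exprM; congr (_ ^+ _ * _); rewrite expr2; ring.
rewrite (exprS 4 J) le_eqVlt; apply/orP; left; apply/eqP.
move: J0; set q := 4 ^+ J; clearbody q => q0.
by field; rewrite !gt_eqF.
Qed.

End Poisson.

(** * The radial maximal function *)

Section RadialMaximal.
Variable R : realType.
Local Notation ang := (@angles R).
Local Notation mu := (@lebesgue_measure R).
Local Notation pt := (@circle_pt R).
Implicit Types (f g : R[i] -> R[i]) (a z : R[i]) (r e s t : R).

Lemma kernel_integrable (G : R -> R) (th dl : R) :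
  (forall t, ang t -> {for t, continuous G}) -> 0 < dl ->
  mu.-integrable ang (EFin \o (fun t => G t * (dl / (dl ^+ 2 + (t - th) ^+ 2)))).
Proof.
move=> Gc d0; apply: continuous_seg_integrable => t tt.
apply: cvgM; first by apply: Gc; rewrite /angles/= in_itv.
apply: cvgM; first exact: cvg_cst.
apply: cvgV; first by rewrite gt_eqF// ltr_wpDr ?sqr_ge0// exprn_gt0.
apply: cvgD; first exact: cvg_cst.
under eq_fun do rewrite expr2; rewrite expr2.
by apply: cvgM; apply: cvgB; first [exact: cvg_id|exact: cvg_cst].
Qed.

(** Each dyadic ball of [dyadic_kernel] is averaged by the Hardy-Littlewood maximal function of G
    extended by zero; the ball of index j contributes at most 8 v / 2^j, and the sum is at most 16
    v. *)
Lemma kernel_HL (G : R -> R) (th dl v : R) :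
  (forall t, ang t -> {for t, continuous G}) -> (forall t, 0 <= G t) -> ang th ->
  0 < dl -> (HL_maximal (G \_ ang) th <= v%:E)%E ->
  (\int[mu]_(t in ang) (G t * (dl / (dl ^+ 2 + (t - th) ^+ 2)))%:E <= (16 * v)%:E)%E.
Proof.
move=> Gc G0 angth d0 HLv.
have mG : measurable_fun (ang : set (measurableTypeR R)) (EFin \o G).
  have /integrableP[+ _] : mu.-integrable ang (EFin \o G); last by [].
  by apply: continuous_seg_integrable => t tt; apply: Gc; rewrite /angles/= in_itv.
have [J HJ] : exists J, 2 * pi < 2 ^+ J * dl.
  exists (Num.truncn (2 * pi / dl)).+1.
  rewrite -ltr_pdivrMr//; apply: lt_trans (truncnS_gt _) _.
  by rewrite -natrX ltr_nat ltn_expl.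
pose c j : R := 4 / (4 ^+ j * dl).
have c0 j : 0 <= c j by rewrite divr_ge0// mulr_ge0 ?exprn_ge0// ltW.
pose B j : set (measurableTypeR R) := ball th (2 ^+ j * dl).
have mB j : measurable (B j) by exact: measurable_ball.
pose T j t := ((c j)%:E * ((EFin \o G) \_ (B j)) t)%E.
have mT j : measurable_fun (ang : set (measurableTypeR R)) (T j).
  apply: measurable_funeM; apply/(measurable_restrict _ (mB j) (@mang R)).
  by apply: measurable_funS mG; [exact: mang|exact: subIsetl].
have T0 j t : (0 <= T j t)%E.
  by rewrite mule_ge0 ?lee_fin// patchE; case: ifP => // _; rewrite lee_fin.
have v0 : 0 <= v.
  rewrite -lee_fin (le_trans _ HLv)//; apply: HL_maximalT_ge0.
  apply: integrable_locally_restrict; first exact: mang.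
  by apply: continuous_seg_integrable => t tt; apply: Gc; rewrite /angles/= in_itv.
have Bint j : (\int[mu]_(t in ang) ((EFin \o G) \_ (B j)) t <= (2 * (2 ^+ j * dl) * v)%:E)%E.
  have rj : 0 < 2 ^+ j * dl by rewrite mulr_gt0// exprn_gt0.
  rewrite -integral_mkcondr integral_mkcondl.
  have : (iavg (G \_ ang) (B j) <= v%:E)%E.
    apply: le_trans HLv; apply: ereal_sup_ubound; exists (2 ^+ j * dl) => //=.
    by rewrite in_itv/= rj.
  rewrite /iavg lebesgue_measure_ball ?(ltW rj)// inver mulrn_eq0/= gt_eqF//.
  rewrite lee_pdivrMl ?mulrn_wgt0// => H; apply: le_trans (le_trans H _); last first.
    by rewrite -EFinM lee_fin mulr2n; lra.
  rewrite le_eqVlt; apply/orP; left; apply/eqP; apply: eq_integral => t _.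
  by rewrite !patchE; case: ifP => _ /=; rewrite ger0_norm.
apply: (@le_trans _ _ (\int[mu]_(t in ang) (\sum_(j <- index_iota 0 J.+1) T j t))%E).
  apply: ge0_le_integral; first exact: mang.
  - move=> t _; rewrite lee_fin mulr_ge0// divr_ge0 ?(ltW d0)// addr_ge0 ?sqr_ge0//.
  - by have /integrableP[+ _] := kernel_integrable th Gc d0.
  - by apply: emeasurable_sum => j; exact: mT.
  - move=> t tang.
    have tu : `|t - th| < 2 ^+ J * dl.
      apply: le_lt_trans HJ; move: tang angth; rewrite /angles/= !in_itv/=.
      by move=> /andP[t0 t1] /andP[h0 h1]; rewrite ler_norml; apply/andP; split; lra.
    rewrite big_mkord; apply: le_trans (_ : (G t * \sum_(j < J.+1) (if `|t - th| < 2 ^+ j * dl then 4 / (4 ^+ j * dl) else 0))%:E <= _)%E.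
      by rewrite lee_fin ler_wpM2l// dyadic_kernel.
    rewrite mulr_sumr -sumEFin; apply: lee_sum => j _.
    rewrite /T patchE; case: (boolP (t \in B j)) => [/set_mem|/negP tB].
      by rewrite /B /ball/= distrC => ->; rewrite -EFinM lee_fin mulrC.
    have -> : (`|t - th| < 2 ^+ j * dl) = false.
      by apply/negbTE/negP => h; apply: tB; rewrite inE /B /ball/= distrC.
    by rewrite mulr0 mule0.
rewrite ge0_integral_sum; [|exact: mang|exact: mT|by move=> j t _; exact: T0].
rewrite big_mkord; apply: (@le_trans _ _ (\sum_(j < J.+1) (8 * v * 2^-1 ^+ j)%:E)%E).
  apply: lee_sum => j _; rewrite /T ge0_integralZl_EFin//; first last.
  - apply/(measurable_restrict _ (mB j) (@mang R)).
    by apply: measurable_funS mG; [exact: mang|exact: subIsetl].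
  - by move=> t _; rewrite patchE; case: ifP => // _; rewrite lee_fin.
  - exact: mang.
  apply: le_trans (lee_wpmul2l _ (Bint j)) _; first by rewrite lee_fin.
  rewrite -EFinM lee_fin le_eqVlt; apply/orP; left; apply/eqP; rewrite /c.
  have -> : (4 : R) ^+ j = 2 ^+ j * 2 ^+ j by rewrite -exprMn; congr (_ ^+ _); ring.
  have p0 : 2 ^+ j != 0 :> R by rewrite expf_neq0.
  rewrite exprVn; move: p0; set q := 2 ^+ j; clearbody q => p0.
  by field; rewrite p0 gt_eqF.
rewrite sumEFin lee_fin -mulr_sumr.
have geo n : \sum_(j < n) (2^-1 : R) ^+ j <= 2.
  suff -> : \sum_(j < n) (2^-1 : R) ^+ j = 2 - 2 * 2^-1 ^+ n.
    by rewrite gerBl mulr_ge0// exprn_ge0.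
  elim: n => [|n IH]; first by rewrite big_ord0 expr0; ring.
  by rewrite big_ord_recr/= IH exprS; field.
by have := ler_wpM2l (mulr_ge0 (ler0n R 8) v0) (geo J.+1); lra.
Qed.

Lemma dist_circle r t th : cabs (expi t - pt r th) ^+ 2 =
  (1 - r) ^+ 2 + 4 * r * sin ((t - th) / 2) ^+ 2.
Proof.
rewrite sqr_cabs /expi /circle_pt/=.
have -> : (cos t - (r * cos th - 0 * sin th)) ^+ 2 + (sin t - (r * sin th + 0 * cos th)) ^+ 2 =
  (cos t ^+ 2 + sin t ^+ 2) + r ^+ 2 * (cos th ^+ 2 + sin th ^+ 2) -
  2 * r * (cos t * cos th + sin t * sin th) by ring.
rewrite !cos2Dsin2 -cosB.
have -> : cos (t - th) = 1 - 2 * sin ((t - th) / 2) ^+ 2.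
  have {1}-> : t - th = ((t - th) / 2) *+ 2 by rewrite -mulr_natr; field.
  rewrite cos_mulr2n.
  have := cos2Dsin2 ((t - th) / 2) => h.
  have -> : cos ((t - th) / 2) ^+ 2 = 1 - sin ((t - th) / 2) ^+ 2 by lra.
  by ring.
by ring.
Qed.

Lemma poisson_kernel_alg (rho r c u2 S2 : R) : 0 < rho -> 2^-1 <= r -> r < 1 ->
  0 < c -> c <= 2^-1 -> 0 <= u2 -> 0 <= S2 -> c ^+ 2 * u2 <= 4 * S2 ->
  (rho ^+ 2 - (r * rho) ^+ 2) / (rho ^+ 2 * ((1 - r) ^+ 2 + 4 * r * S2)) <=
  4 / c ^+ 2 * ((1 - r) / ((1 - r) ^+ 2 + u2)).
Proof.
move=> rho0 r2 r1 c0 c2 u20 S20 q2.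
have d0 : 0 < (1 - r) ^+ 2 by rewrite exprn_gt0// subr_gt0.
have cc : 0 < c ^+ 2 by rewrite exprn_gt0.
have rS : S2 <= 2 * r * S2 by rewrite ler_peMl//; lra.
have D0 : 0 < (1 - r) ^+ 2 + 4 * r * S2 by lra.
have D1 : 0 < (1 - r) ^+ 2 + u2 by lra.
have c1 : c ^+ 2 <= 1 by rewrite exprn_ile1// ?(ltW c0)//; lra.
have -> : (rho ^+ 2 - (r * rho) ^+ 2) / (rho ^+ 2 * ((1 - r) ^+ 2 + 4 * r * S2)) =
    (1 - r) * ((1 + r) / ((1 - r) ^+ 2 + 4 * r * S2)).
  by field; rewrite !gt_eqF.
have -> : 4 / c ^+ 2 * ((1 - r) / ((1 - r) ^+ 2 + u2)) =
    (1 - r) * (4 / (c ^+ 2 * ((1 - r) ^+ 2 + u2))) by field; rewrite !gt_eqF.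
rewrite ler_wpM2l ?subr_ge0 ?(ltW r1)//.
rewrite ler_pdivrMr// mulrAC ler_pdivlMr ?mulr_gt0//.
have q1 : c ^+ 2 * ((1 - r) ^+ 2) <= (1 - r) ^+ 2 by rewrite ler_piMl// ltW.
have q4 : c ^+ 2 * ((1 - r) ^+ 2 + u2) <= 2 * ((1 - r) ^+ 2 + 4 * r * S2).
  by rewrite mulrDr; lra.
apply: (@le_trans _ _ (2 * (c ^+ 2 * ((1 - r) ^+ 2 + u2)))); last by lra.
by apply: ler_wpM2r; [exact/ltW/mulr_gt0|lra].
Qed.

Lemma maximal_radial (eta : R) : 0 < eta -> eta < pi -> exists2 C : R, 0 < C &
  forall f M (lam : R), analytic f -> (forall r, 0 < r -> r < 1 -> avg f r <= M) ->
  0 < lam -> exists S : set (measurableTypeR R),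
  [/\ measurable S, (mu S <= (C * M / lam)%:E)%E &
  forall th r, 2 * eta <= th -> th <= 2 * pi - 2 * eta -> 2^-1 <= r -> r < 1 ->
    lam < cabs (f (pt r th)) -> S th].
Proof.
move=> e0 epi; have [c /andP[c0 c2] Hc] := sin_lower e0 epi.
pose K := 4 / c ^+ 2.
have cc : 0 < c ^+ 2 by rewrite exprn_gt0.
have K0 : 0 < K by rewrite divr_gt0.
have p0 := pi_gt0 R; have p2 := pi_ge2 R.
(* The product of 3 from the maximal inequality, 2 pi from the normalization of the mean, and 4 K
   from the threshold v. *)
exists (24 * pi * K); first by apply: mulr_gt0 K0; rewrite mulr_gt0.
move=> f M lam fa fM lam0.
pose v := lam / (4 * K).
have v0 : 0 < v by rewrite divr_gt0// mulr_gt0.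
pose rho (k : nat) : R := 1 - k.+2%:R^-1.
have rho0 k : 0 < rho k by rewrite subr_gt0 invf_lt1// ltr1n.
have rho1 k : rho k < 1 by rewrite gtrBl invr_gt0.
pose G k t := cabs (f (pt (rho k) t)).
have Gc k t : {for t, continuous (G k)}.
  by apply: rcont_cabs; apply: analytic_rcont; [exact: fa|exact: ltW|exact: rho1].
have Gi k : mu.-integrable ang (EFin \o G k) by apply: continuous_seg_integrable => t _.
have Gl k : locally_integrable setT (G k \_ ang).
  by apply: integrable_locally_restrict; [exact: mang|exact: Gi].
pose A k : set (measurableTypeR R) := [set th | (v%:E < HL_maximal (G k \_ ang) th)%E].
have mA k : measurable (A k).
  rewrite -[X in measurable X]setTI; apply: emeasurable_fun_o_infty => //.
  exact: measurable_HL_maximal.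
have muA k : (mu (A k) <= (24 * pi * K * M / lam)%:E)%E.
  apply: le_trans (maximal_inequality (Gl k) v0) _.
  have -> : (\int[mu]_(y in setT) `|((G k \_ ang) y)%:E|)%E = (Rintegral mu ang (G k))%:E.
    rewrite /Rintegral fineK; last first.
      by apply: integrable_fin_num; [exact: mang|exact: Gi].
    rewrite [RHS]integral_mkcond; apply: eq_integral => y _.
    by rewrite !patchE; case: ifP => _ /=; rewrite ?normr0// ger0_norm// cabs_ge0.
  have := fM _ (rho0 k) (rho1 k); rewrite /avg meanE; last exact: Gi.
  rewrite ler_pdivrMl ?mulr_gt0// => h; rewrite -EFinM lee_fin.
  apply: le_trans (ler_wpM2l (ltW (divr_gt0 _ v0)) h) _; first by [].
  rewrite le_eqVlt; apply/orP; left; apply/eqP; rewrite /v.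
  by field; rewrite !gt_eqF.
(* The sets A k need not be monotone. The intersections over k >= m increase with m and are each
   contained in A m, so their union inherits the measure bound; and a large value at r propagates,
   by continuity, to r * rho k for all large k. *)
pose B m := \bigcap_(k in [set k | (m <= k)%N]) A k.
have mB m : measurable (B m) by apply: bigcap_measurableType => k _; exact: mA.
have mUB : measurable (\bigcup_m B m) by exact: bigcupT_measurable.
exists (\bigcup_m B m); split; first exact: mUB.
- have ndB : nondecreasing_seq B.
    by move=> m n mn; apply/subsetPset => x Bx k /= nk; apply: Bx; exact: leq_trans nk.
  have cB := nondecreasing_cvg_mu (mu := mu) mB mUB ndB.
  rewrite -(cvg_lim _ cB)//; apply: lime_le; first by apply/cvg_ex; eexists; exact: cB.
  apply: nearW => m /=; apply: le_trans (muA m); apply: le_measure; rewrite ?inE//.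
  by move=> x; apply => /=.
- move=> th r h1 h2 r2 r1 lf.
  have r0 : 0 < r by apply: lt_le_trans r2.
  have angth : ang th by rewrite /angles/= in_itv/=; apply/andP; split; lra.
  have [d d0 Hd] : exists2 d : R, 0 < d & forall z, cabs (z - pt r th) < d -> lam < cabs (f z).
    have dd : 0 < cabs (f (pt r th)) - lam by rewrite subr_gt0.
    have fcd : cdiff f (pt r th) by apply: analytic_cdiff; [exact: fa|rewrite cabs_circle_pt// ltW].
    have [d d0 Hd] := cdiff_cont fcd dd.
    exists d => // z /Hd h; have := ler_cabsB (f (pt r th)) (f z).
    by rewrite cabsBC; lra.
  exists (Num.truncn d^-1) => // k /= dk.
  have rk : cabs (pt (r * rho k) th - pt r th) < d.
    have -> : pt (r * rho k) th - pt r th = - (r * k.+2%:R^-1)%:C * expi th.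
      by rewrite /circle_pt /rho !rmorphM rmorphB/=; ring.
    rewrite cabsM cabs_expi mulr1 cabsN cabs_real ger0_norm ?mulr_ge0 ?(ltW r0)//.
    apply: (@le_lt_trans _ _ k.+2%:R^-1).
      by rewrite ler_piMl// ltW.
    rewrite -[d]invrK ltf_pV2 ?posrE ?invr_gt0//.
    by apply: lt_le_trans (truncnS_gt _) _; rewrite ler_nat ltnS leqW.
  (* If the maximal function were at most v, the Poisson bound at r * rho k on the circle of radius
     rho k would give at most lam there. *)
  rewrite /A/= ltNge; apply/negP => HLv.
  have rr : cabs (pt (r * rho k) th) < rho k.
    rewrite cabs_circle_pt; last by rewrite mulr_ge0// ltW.
    by rewrite gtr_pMl.
  have := Hd _ rk; rewrite ltNge => /negP; apply.
  apply: le_trans (poisson_le fa rr (rho1 k)) _.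
  have Pb t : ang t -> poisson (pt (r * rho k) th) (rho k) t <=
      K * ((1 - r) / ((1 - r) ^+ 2 + (t - th) ^+ 2)).
    move=> tang; rewrite /poisson cabs_circle_pt; last by rewrite mulr_ge0// ltW.
    have -> : pt (rho k) t - pt (r * rho k) th = (rho k)%:C * (expi t - pt r th).
      by rewrite /circle_pt rmorphM/=; ring.
    rewrite cabsM cabs_real ger0_norm ?(ltW (rho0 k))// [(_ * cabs _) ^+ 2]exprMn dist_circle.
    have u1 : `|(t - th) / 2| <= pi - eta.
      move: tang; rewrite /angles/= in_itv/= => /andP[t0 t1].
      by rewrite ler_norml; apply/andP; split; lra.
    have s2 : c ^+ 2 * ((t - th) / 2) ^+ 2 <= sin ((t - th) / 2) ^+ 2.
      have := Hc _ u1 => h.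
      rewrite -(real_normK (num_real ((t - th) / 2))) -(real_normK (num_real (sin _))).
      by rewrite -exprMn lerXn2r// nnegrE// mulr_ge0// ltW.
    move: s2; set S2 := sin _ ^+ 2 => s2.
    set u2 := (t - th) ^+ 2; have u20 : 0 <= u2 by exact: sqr_ge0.
    have s2' : c ^+ 2 * (u2 / 4) <= S2.
      by apply: le_trans s2; rewrite le_eqVlt; apply/orP; left; apply/eqP; rewrite /u2; field.
    apply: poisson_kernel_alg; rewrite ?c0 ?c2 ?r2 ?r1 ?rho0 ?u20 ?sqr_ge0//.
    by move: s2'; clear; lra.
  have ki : mu.-integrable ang (EFin \o (fun t => G k t * ((1 - r) / ((1 - r) ^+ 2 + (t - th) ^+ 2)))).
    by apply: kernel_integrable => [t _|]; [exact: Gc|rewrite subr_gt0].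
  apply: (@le_trans _ _ (mean (fun t => K * (G k t * ((1 - r) / ((1 - r) ^+ 2 + (t - th) ^+ 2)))))).
    apply: mean_le.
    - apply: cont_mintegrable => t _; apply: cvgM; last exact: Gc.
      by apply: cont_poisson; [exact: rho0|exact: rr].
    - by apply: mintegrableZ; apply/mintegrableP.
    - move=> t tang; rewrite -/(G k t) mulrCA [leLHS]mulrC ler_wpM2l ?cabs_ge0//.
      exact: Pb.
  rewrite meanZ; last by apply/mintegrableP.
  rewrite meanE//.
  have d1 : 0 < 1 - r by rewrite subr_gt0.
  have := kernel_HL (fun t _ => Gc k t) (fun t => cabs_ge0 _) angth d1 HLv.
  rewrite -[X in (X <= _)%E]fineK; last by apply: integrable_fin_num; [exact: mang|exact: ki].
  rewrite lee_fin => h.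
  have h' : (2 * pi)^-1 * Rintegral mu ang
      (fun t => G k t * ((1 - r) / ((1 - r) ^+ 2 + (t - th) ^+ 2))) <= 4 * v.
    rewrite ler_pdivrMl ?mulr_gt0//; apply: le_trans h _.
    have : 2 * v <= pi * v by rewrite ler_wpM2r// ltW.
    lra.
  apply: le_trans (ler_wpM2l (ltW K0) h') _.
  by rewrite /v le_eqVlt; apply/orP; left; apply/eqP; field; rewrite gt_eqF.
Qed.

End RadialMaximal.

(** * Radial limits of functions with square-summable coefficients *)

Section RadialLimits.
Variable R : realType.
Local Notation ang := (@angles R).
Local Notation mu := (@lebesgue_measure R).
Local Notation pt := (@circle_pt R).
Implicit Types (f g : R[i] -> R[i]) (a z l : R[i]) (r e s t : R).

Definition has_rlim f t l := forall e, 0 < e -> exists2 d : R, 0 < d &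
  forall r, 0 <= r -> r < 1 -> 1 - d < r -> cabs (f (pt r t) - l) < e.

Definition rconv f t := exists l, has_rlim f t l.

Lemma rlim_cvg f t l : has_rlim f t l <->
  (f (r%:C * expi t) : R[i]^o) @[r --> (1 : R)^'-] --> (l : R[i]^o).
Proof.
split=> [H|/cvgrPdist_lt H e e0].
- apply/cvgrPdist_lt => e; rewrite ltcE/= => /andP[/eqP ime ree].
  have [d d0 Hd] := H _ ree; near=> r.
  rewrite normc_cabs ltcE/= ime eqxx/= cabsBC; apply: Hd.
  + near: r; apply: nbhs_left_ge; lra.
  + by near: r; exact: nbhs_left_lt.
  + by near: r; apply: nbhs_left_gt; rewrite ltrBlDr ltrDl.
- have := H e%:C; rewrite ltcR => /(_ e0)[d /= d0 Hd].
  exists d => // r r0 r1 rd.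
  have := Hd r; rewrite /ball_/= ger0_norm ?subr_ge0 ?ltW// => /(_ _ r1).
  by rewrite normc_cabs ltcR cabsBC; apply; lra.
Unshelve. all: by end_near. Qed.

Lemma boundaryE f t l : has_rlim f t l -> boundary f t = l.
Proof. by move=> /rlim_cvg h; apply: (cvg_lim _ h); exact: norm_hausdorff. Qed.

(** Fixes the default value of the limit, so that [boundary f] is constant, hence measurable, off
    the set of convergence. *)
Lemma boundary_dvg f t : ~ rconv f t -> boundary f t = (point : R[i]^o).
Proof.
move=> H; apply: (@dvgP (R[i]^o)) => /cvg_ex[l hl]; apply: H; exists l.
exact/rlim_cvg.
Qed.

Lemma boundary_rlim f t : rconv f t -> has_rlim f t (boundary f t).
Proof. by move=> [l hl]; rewrite (boundaryE hl). Qed.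

Lemma has_rlimD f g t l m : has_rlim f t l -> has_rlim g t m ->
  has_rlim (fun z => f z + g z) t (l + m).
Proof.
move=> /rlim_cvg h1 /rlim_cvg h2; apply/rlim_cvg; exact: (cvgD h1 h2).
Qed.

Lemma has_rlimM f g t l m : has_rlim f t l -> has_rlim g t m ->
  has_rlim (fun z => f z * g z) t (l * m).
Proof.
move=> /rlim_cvg h1 /rlim_cvg h2; apply/rlim_cvg.
exact: (cvgM h1 h2).
Qed.

Lemma has_rlim_cst (c : R[i]) t : has_rlim (fun=> c) t c.
Proof. by move=> e e0; exists 1 => // r _ _ _; rewrite subrr cabs0. Qed.

Lemma has_rlimZ (c : R[i]) f t l : has_rlim f t l ->
  has_rlim (fun z => c * f z) t (c * l).
Proof. exact/has_rlimM/has_rlim_cst. Qed.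

Lemma has_rlim_cont f t : ccont f (expi t) -> has_rlim f t (f (expi t)).
Proof.
move=> fc e /fc[d d0 Hd]; exists d => // r r0 r1 rd; apply: Hd.
have -> : pt r t - expi t = (r - 1)%:C * expi t by rewrite /circle_pt rmorphB/=; ring.
rewrite cabsM cabs_expi mulr1 cabs_real ltr_norml; apply/andP; split; lra.
Qed.

Lemma has_rlim_ext f g t l : (forall z, cabs z < 1 -> f z = g z) ->
  has_rlim f t l -> has_rlim g t l.
Proof.
move=> fg H e /H[d d0 Hd]; exists d => // r r0 r1 rd.
by rewrite -fg ?cabs_circle_pt// Hd.
Qed.

(** Radii increasing to 1; the shift by 2 keeps them positive from index 0. *)
Definition rho (n : nat) : R := 1 - n.+2%:R^-1.

Lemma rho_gt0 n : 0 < rho n.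
Proof. by rewrite subr_gt0 invf_lt1// ltr1n. Qed.

Lemma rho_lt1 n : rho n < 1.
Proof. by rewrite gtrBl invr_gt0. Qed.

Lemma rho_near d : 0 < d -> exists N, forall n, (N <= n)%N -> 1 - d < rho n.
Proof.
move=> d0; exists (Num.truncn d^-1) => n dn; rewrite ltrD2l ltrN2.
rewrite -[d]invrK ltf_pV2 ?posrE ?invr_gt0//.
by apply: lt_le_trans (truncnS_gt _) _; rewrite ler_nat ltnS leqW.
Qed.

Lemma has_rlim_seq f t l : has_rlim f t l -> forall e, 0 < e ->
  exists N, forall n, (N <= n)%N -> cabs (f (pt (rho n) t) - l) < e.
Proof.
move=> H e /H[d d0 Hd]; have [N HN] := rho_near d0; exists N => n /HN h.
by apply: Hd => //; [exact/ltW/rho_gt0|exact: rho_lt1].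
Qed.

Lemma rconv_cauchy f t :
  (forall e, 0 < e -> exists2 d : R, 0 < d & forall r s,
    0 <= r -> r < 1 -> 1 - d < r -> 0 <= s -> s < 1 -> 1 - d < s ->
    cabs (f (pt r t) - f (pt s t)) <= e) -> rconv f t.
Proof.
move=> H; have [|l Hl] := @ccauchy_cvg R (fun n => f (pt (rho n) t)).
  move=> e /H[d d0 Hd]; have [N HN] := rho_near d0; exists N => m n /HN hm /HN hn.
  by apply: Hd => //; rewrite ?rho_lt1 ?(ltW (rho_gt0 _)).
exists l => e e0; have e3 : 0 < e / 3 by rewrite divr_gt0.
have [d d0 Hd] := H _ e3; exists d => // r r0 r1 rd.
have [N HN] := rho_near d0; have [M HM] := Hl _ e3.
pose n := maxn N M.
have h1 := HM n (leq_maxr _ _).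
have h2 := Hd r (rho n) r0 r1 rd (ltW (rho_gt0 n)) (rho_lt1 n) (HN n (leq_maxl _ _)).
have -> : f (pt r t) - l = (f (pt r t) - f (pt (rho n) t)) + (f (pt (rho n) t) - l) by ring.
by rewrite (le_lt_trans (cabsD _ _))//; lra.
Qed.

(** The variance of |f| on the circle, the mean of (|f| - m)^2, is nonnegative. *)
Lemma avg_sq f r : analytic f -> 0 <= r -> r < 1 -> avg f r ^+ 2 <= avg2 f r.
Proof.
move=> fa r0 r1; have fc t : rcont (fun t => f (pt r t)) t by exact: analytic_rcont.
set m := avg f r.
have i1 : mintegrable (fun t => cabs (f (pt r t))) by apply: rcont_mintegrable => t _.
have i2 : mintegrable (fun t => cabs (f (pt r t)) ^+ 2) by apply: rcont_sqr_mintegrable => t _.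
have : 0 <= mean (fun t => (cabs (f (pt r t)) ^+ 2 - (2 * m) * cabs (f (pt r t))) + m ^+ 2).
  apply: mean_ge0 => t _.
  have := sqr_ge0 (cabs (f (pt r t)) - m); rewrite sqrrB; lra.
rewrite meanD; [|by apply: mintegrableB => //; exact: mintegrableZ|exact: mintegrable_cst].
rewrite meanB//; last exact: mintegrableZ.
rewrite meanZ// mean_cst -/(avg f r) -/(avg2 f r) -/m expr2; lra.
Qed.

(** A bounds the squared H^2 norm. Phrased through partial sums, it passes to limits one coefficient
    at a time. *)
Definition h2le f A := forall N, \sum_(n < N) cabs (coef f n) ^+ 2 <= A.

Lemma h2le_avg2 f A r : analytic f -> h2le f A -> 0 < r -> r < 1 -> avg2 f r <= A.
Proof.
move=> fa fA r0 r1; apply: parseval_le => // N; apply: le_trans (fA N).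
apply: ler_sum => n _; rewrite ler_piMr ?sqr_ge0//.
by apply: exprn_ile1; exact: ltW.
Qed.

Definition tail f N z := f z - psum (coef f) N z.

Lemma analytic_tail f N : analytic f -> analytic (tail f N).
Proof. by move=> fa; apply: analyticB fa _; exact: analytic_psum. Qed.

Lemma coef_tail f N n : analytic f -> coef (tail f N) n = if (n < N)%N then 0 else coef f n.
Proof.
move=> fa; rewrite /tail tcoefB; [|exact: fa|exact: analytic_psum].
by rewrite coef_psum; case: ifP => _; rewrite ?subrr ?subr0.
Qed.

Lemma h2le_tail f A e : analytic f -> h2le f A -> 0 < e ->
  exists N, h2le (tail f N) e.
Proof.
move=> fa fA e0; pose S n := \sum_(i < n) cabs (coef f i) ^+ 2.
have S_nd : nondecreasing_seq S.
  apply/nondecreasing_seqP => n; rewrite /S big_ord_recr/= lerDl; exact: sqr_ge0.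
have cS : cvgn S.
  by apply: nondecreasing_is_cvgn => //; exists A => _ [n _ <-]; exact: fA.
have Sl n : S n <= limn S by exact: nondecreasing_cvgn_le.
move/cvgrPdist_lt : (cS) => /(_ e e0)[N _ /(_ N (leqnn N)) /=].
rewrite ger0_norm ?subr_ge0// => HN.
exists N => K; under eq_bigr do rewrite coef_tail//.
have [KN|NK] := leqP K N.
  rewrite big1 ?ltW// => i _.
  by rewrite (leq_trans (ltn_ord i) KN) cabs0 expr0n.
suff <- : S K - S N = \sum_(i < K) cabs (if (i < N)%N then 0 else coef f i) ^+ 2.
  by have := Sl K; lra.
rewrite /S -(subnKC (ltnW NK)) !big_split_ord/= addrAC subrr add0r.
rewrite [X in _ = X + _]big1 ?add0r => [|i _]; last by rewrite ltn_ord cabs0 expr0n.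
by apply: eq_bigr => i _; rewrite ltnNge leq_addr.
Qed.

Lemma psum_ccont c N z : ccont (@psum R c N) z.
Proof.
apply: cdiff_cont; apply: cdiff_sum => n.
by apply: cdiffM; [exact: cdiff_cst|exact/cdiffX/cdiff_id].
Qed.

Lemma negligible_small (A : set (measurableTypeR R)) :
  (forall e, 0 < e -> exists S : set (measurableTypeR R),
     [/\ measurable S, (mu S <= e%:E)%E & A `<=` S]) -> mu.-negligible A.
Proof.
move=> H.
have H' n : exists S : set (measurableTypeR R),
    [/\ measurable S, (mu S <= (n.+1%:R^-1)%:E)%E & A `<=` S].
  by apply: H; rewrite invr_gt0.
have [S HS] := choice H'.
exists (\bigcap_n S n); split.
- by apply: bigcap_measurableType => n _; have [] := HS n.
- apply/eqP; rewrite eq_le measure_ge0 andbT.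
  apply/lee_addgt0Pr => e e0; rewrite add0e.
  have [N HN] : exists N, (N.+1%:R^-1 : R) <= e.
    exists (Num.truncn e^-1); rewrite -[leRHS]invrK lef_pV2 ?posrE ?invr_gt0//.
    exact/ltW/truncnS_gt.
  have [mS HS1 _] := HS N.
  apply: (@le_trans _ _ (mu (S N))).
    apply: le_measure; rewrite ?inE//; first by apply: bigcap_measurableType => n _; have [] := HS n.
    by move=> x; apply.
  by apply: le_trans HS1 _; rewrite lee_fin.
- by move=> x Ax n _; have [_ _] := HS n; apply.
Qed.

Lemma cabs_osc (P1 P2 g1 g2 L : R[i]) e : cabs g1 <= e / 4 -> cabs g2 <= e / 4 ->
  cabs (P1 - L) < e / 4 -> cabs (P2 - L) < e / 4 ->
  cabs ((P1 + g1) - (P2 + g2)) <= e.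
Proof.
move=> h1 h2 h3 h4.
have -> : (P1 + g1) - (P2 + g2) = (g1 - g2) + ((P1 - L) - (P2 - L)) by ring.
rewrite (le_trans (cabsD _ _))//.
have := cabsB g1 g2; have := cabsB (P1 - L) (P2 - L); lra.
Qed.

(** Fatou's theorem: f is a polynomial, continuous up to the circle, plus a tail of small norm. The
    maximal inequality confines the angles where the tail exceeds e / 4 to a set of arbitrarily
    small measure; outside it the oscillation of f near the circle is at most e. *)
Lemma h2_rconv_inner f A eta : analytic f -> h2le f A -> 0 < eta -> eta < pi ->
  mu.-negligible [set th : measurableTypeR R | [/\ 2 * eta <= th, th <= 2 * pi - 2 * eta & ~ rconv f th]].
Proof.
move=> fa fA eta0 etapi.
have [C C0 HC] := maximal_radial eta0 etapi.
pose Bad e := [set th : measurableTypeR R | [/\ 2 * eta <= th, th <= 2 * pi - 2 * eta &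
  ~ exists2 d : R, 0 < d & forall r s,
    0 <= r -> r < 1 -> 1 - d < r -> 0 <= s -> s < 1 -> 1 - d < s ->
    cabs (f (pt r th) - f (pt s th)) <= e]].
have badN e : 0 < e -> mu.-negligible (Bad e).
  move=> e0; apply: negligible_small => e' e'0.
  have l0 : 0 < e / 4 by rewrite divr_gt0.
  (* Chosen so that the weak-type bound C M / (e / 4) equals e'. *)
  pose M := e' * (e / 4) / C.
  have M0 : 0 < M by rewrite divr_gt0// mulr_gt0.
  have [N HN] := h2le_tail fa fA (exprn_gt0 2 M0).
  have ga := @analytic_tail f N fa.
  have gM r : 0 < r -> r < 1 -> avg (tail f N) r <= M.
    move=> r0 r1; have := le_trans (avg_sq ga (ltW r0) r1) (h2le_avg2 ga HN r0 r1).
    by rewrite ler_sqr ?nnegrE ?avg_ge0// ltW.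
  have [S [mS muS HS]] := HC _ _ _ ga gM l0.
  exists S; split => //.
    apply: le_trans muS _; rewrite lee_fin /M le_eqVlt; apply/orP; left; apply/eqP.
    by field; rewrite !gt_eqF.
  move=> th [h1 h2 h3]; apply: contrapT => nS; apply: h3.
  have gl r : 2^-1 <= r -> r < 1 -> cabs (tail f N (pt r th)) <= e / 4.
    by move=> r2 r1; rewrite leNgt; apply/negP => /(HS th r h1 h2 r2 r1).
  have [d d0 Hd] := has_rlim_cont (@psum_ccont (coef f) N (expi th)) l0.
  exists (Num.min d 2^-1); first by rewrite lt_min d0; lra.
  have dh : Num.min d 2^-1 <= 2^-1 by rewrite ge_min lexx orbT.
  have dd : Num.min d 2^-1 <= d by rewrite ge_min lexx.
  move=> r s r0 r1 rd s0 s1 sd.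
  have half u : 1 - Num.min d 2^-1 < u -> 2^-1 <= u by move: dh; clear; lra.
  have near1 u : 1 - Num.min d 2^-1 < u -> 1 - d < u.
    by apply: le_lt_trans; rewrite lerD2l lerN2.
  have E z : f z = psum (coef f) N z + tail f N z by rewrite /tail addrC subrK.
  rewrite !E; apply: (cabs_osc (L := psum (coef f) N (expi th))).
  - exact: gl (half _ rd) r1.
  - exact: gl (half _ sd) s1.
  - exact: Hd r0 r1 (near1 _ rd).
  - exact: Hd s0 s1 (near1 _ sd).
have BN : mu.-negligible (\bigcup_n Bad n.+1%:R^-1).
  by apply: negligible_bigcup => n; apply: badN; rewrite invr_gt0.
apply: negligibleS BN.
move=> th [h1 h2 h3]; apply: contrapT => h4; apply: h3; apply: rconv_cauchy => e e0.
have [n Hn] : exists n, (n.+1%:R^-1 : R) <= e.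
  exists (Num.truncn e^-1); rewrite -[leRHS]invrK lef_pV2 ?posrE ?invr_gt0//.
  exact/ltW/truncnS_gt.
apply: contrapT => h5; apply: h4; exists n => //; split => // -[d d0 Hd].
apply: h5; exists d => // r s r0 r1 rd s0 s1 sd.
by apply: le_trans Hn; exact: Hd.
Qed.

Lemma h2_rconv_ae f A : analytic f -> h2le f A ->
  mu.-negligible [set t : measurableTypeR R | ang t /\ ~ rconv f t].
Proof.
move=> fa fA; have p2 := pi_ge2 R.
pose eta n : R := n.+1%:R^-1.
pose B n := [set th : measurableTypeR R | [/\ 2 * eta n <= th, th <= 2 * pi - 2 * eta n & ~ rconv f th]].
have BN : mu.-negligible (\bigcup_n B n).
  apply: negligible_bigcup => n; apply: h2_rconv_inner fa fA _ _; first by rewrite invr_gt0.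
  by apply: (@le_lt_trans _ _ 1); [rewrite invf_le1// ler1n|lra].
have e0 : mu.-negligible [set (0 : measurableTypeR R)].
  by apply/negligibleP; [exact: measurable_set1|exact: lebesgue_measure_set1].
have e2 : mu.-negligible [set (2 * pi : measurableTypeR R)].
  by apply/negligibleP; [exact: measurable_set1|exact: lebesgue_measure_set1].
apply: negligibleS (negligibleU (negligibleU e0 e2) BN) => t [].
rewrite /angles/= in_itv/= => /andP[t0 t1] h.
have [->|tn0] := eqVneq t 0; first by left; left.
have [->|tn2] := eqVneq t (2 * pi); first by left; right.
right; pose m := Num.min t (2 * pi - t) / 2.
have m0 : 0 < m by rewrite divr_gt0// lt_min subr_gt0 !lt_neqAle tn2 eq_sym tn0 t0 t1.
have m1 : 2 * m <= t by rewrite /m mulrC divfK// ge_min lexx.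
have m2 : 2 * m <= 2 * pi - t by rewrite /m mulrC divfK// ge_min lexx orbT.
have [n Hn] : exists n, (n.+1%:R^-1 : R) <= m.
  exists (Num.truncn m^-1); rewrite -[leRHS]invrK lef_pV2 ?posrE ?invr_gt0//.
  exact/ltW/truncnS_gt.
have n2 : 2 * eta n <= 2 * m by rewrite ler_pM2l.
exists n => //; split; [exact: le_trans n2 m1| |exact: h].
by rewrite lerBrDl -lerBrDr (le_trans n2).
Qed.

(** * Measurability of boundary functions *)

Lemma cont_measurable_ang (h : R -> R) : (forall t, ang t -> {for t, continuous h}) ->
  measurable_fun (ang : set (measurableTypeR R)) (h : measurableTypeR R -> R).
Proof. by move=> /cont_mintegrable /integrableP[/measurable_EFinP]. Qed.

(** An enumeration of the rationals, with 0 at the indices that encode none; it makes the Cauchy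
    criterion for radial limits countable. *)
Definition dense_seq (j : nat) : R := if unpickle j is Some q then ratr (q : rat) else 0.

Lemma dense_seqP x y : x < y -> exists j, x < dense_seq j < y.
Proof.
move=> xy; have [q] := rat_in_itvoo xy; rewrite in_itv/= => h.
by exists (pickle q); rewrite /dense_seq pickleK.
Qed.

(** The Cauchy criterion restricted to rational radii is a countable combination of closed
    conditions on continuous functions of t; continuity of f along each radius extends it to all
    radii. *)
Lemma measurable_rconv f : analytic f ->
  measurable ([set t | ang t /\ rconv f t] : set (measurableTypeR R)).
Proof.
move=> fa.
pose C m n j k : set (measurableTypeR R) := [set t | ang t /\
  (1 - n.+1%:R^-1 < dense_seq j < 1 -> 1 - n.+1%:R^-1 < dense_seq k < 1 ->
   cabs (f (pt (dense_seq j) t) - f (pt (dense_seq k) t)) <= m.+1%:R^-1)].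
have n0 n : 0 <= 1 - n.+1%:R^-1 :> R by rewrite subr_ge0 invf_le1// ler1n.
have mC m n j k : measurable (C m n j k).
  have [/andP[h1 h2]|h] := boolP (1 - n.+1%:R^-1 < dense_seq j < 1); last first.
    rewrite (_ : C _ _ _ _ = ang); first exact: mang.
    apply/seteqP; split=> t /=; first by case.
    by move=> tt; split=> // h1; rewrite h1 in h.
  have [/andP[h3 h4]|h] := boolP (1 - n.+1%:R^-1 < dense_seq k < 1); last first.
    rewrite (_ : C _ _ _ _ = ang); first exact: mang.
    apply/seteqP; split=> t /=; first by case.
    by move=> tt; split=> // _ h3; rewrite h3 in h.
  have jj : 0 <= dense_seq j by rewrite (le_trans (n0 n))// ltW.
  have kk : 0 <= dense_seq k by rewrite (le_trans (n0 n))// ltW.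
  pose F t := cabs (f (pt (dense_seq j) t) - f (pt (dense_seq k) t)).
  rewrite (_ : C _ _ _ _ = ang `&` [set t | F t <= m.+1%:R^-1]).
    apply: measurable_fun_le; [exact: mang| |exact: measurable_cst].
    apply: cont_measurable_ang => t _; apply: rcont_cabs; apply: rcontB.
      exact: (analytic_rcont _ fa jj h2).
    exact: (analytic_rcont _ fa kk h4).
  apply/seteqP; split=> t /=; rewrite /C/= h1 h2 h3 h4.
    by move=> [tt H]; split => //; exact: H.
  by move=> [tt H]; split.
rewrite (_ : [set t | _ /\ _] = \bigcap_m \bigcup_n \bigcap_j \bigcap_k C m n j k).
  apply: bigcap_measurableType => m _; apply: bigcup_measurable => n _.
  by apply: bigcap_measurableType => j _; apply: bigcap_measurableType => k _.
apply/seteqP; split=> t /=.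
  move=> [tt [l Hl]] m _; have m2 : 0 < (m.+1%:R^-1 : R) / 2 by rewrite divr_gt0// invr_gt0.
  have [d d0 Hd] := Hl _ m2.
  have [n Hn] : exists n, (n.+1%:R^-1 : R) <= d.
    exists (Num.truncn d^-1); rewrite -[leRHS]invrK lef_pV2 ?posrE ?invr_gt0//.
    exact/ltW/truncnS_gt.
  exists n => // j _ k _; split => // /andP[h1 h2] /andP[h3 h4].
  have -> : f (pt (dense_seq j) t) - f (pt (dense_seq k) t) =
    (f (pt (dense_seq j) t) - l) - (f (pt (dense_seq k) t) - l) by ring.
  rewrite (le_trans (cabsB _ _))// (splitr (m.+1%:R^-1)) lerD//.
    by apply: ltW; apply: Hd => //; [rewrite (le_trans (n0 n))// ltW|rewrite (le_lt_trans _ h1)// lerB].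
  by apply: ltW; apply: Hd => //; [rewrite (le_trans (n0 n))// ltW|rewrite (le_lt_trans _ h3)// lerB].
move=> H; split; first by have [n _ /(_ 0 I 0 I)[]] := H 0 I.
apply: rconv_cauchy => e e0; have e3 : 0 < e / 3 by rewrite divr_gt0.
have [m Hm] : exists m, (m.+1%:R^-1 : R) <= e / 3.
  exists (Num.truncn (e / 3)^-1); rewrite -[leRHS]invrK lef_pV2 ?posrE ?invr_gt0//.
  exact/ltW/truncnS_gt.
have [n _ Hn] := H m I.
have approx r : 0 <= r -> r < 1 -> 1 - n.+1%:R^-1 < r ->
    exists j, 1 - n.+1%:R^-1 < dense_seq j < 1 /\
      cabs (f (pt r t) - f (pt (dense_seq j) t)) <= e / 3.
  move=> r0 r1 rn.
  have fcd : cdiff f (pt r t) by apply: analytic_cdiff; [exact: fa|rewrite cabs_circle_pt].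
  have [d d0 Hd] := cdiff_cont fcd e3.
  have : r < Num.min (r + d) 1 by rewrite lt_min r1 andbT ltrDl.
  move=> /dense_seqP[j /andP[j1]]; rewrite lt_min => /andP[j2 j3].
  exists j; split; first by rewrite j3 (lt_trans rn).
  rewrite cabsBC ltW//; apply: Hd.
  have -> : pt (dense_seq j) t - pt r t = (dense_seq j - r)%:C * expi t.
    by rewrite /circle_pt rmorphB/=; ring.
  rewrite cabsM cabs_expi mulr1 cabs_real ger0_norm; lra.
exists n.+1%:R^-1; first by rewrite invr_gt0.
move=> r s r0 r1 rn s0 s1 sn.
have [j [hj fj]] := approx r r0 r1 rn; have [k [hk fk]] := approx s s0 s1 sn.
have [_ /(_ hj hk) fjk] := Hn j I k I.
have -> : f (pt r t) - f (pt s t) = (f (pt r t) - f (pt (dense_seq j) t)) +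
  ((f (pt (dense_seq j) t) - f (pt (dense_seq k) t)) - (f (pt s t) - f (pt (dense_seq k) t))).
  by ring.
rewrite (le_trans (cabsD _ _))//.
have := cabsB (f (pt (dense_seq j) t) - f (pt (dense_seq k) t)) (f (pt s t) - f (pt (dense_seq k) t)).
move=> h5; apply: le_trans (lerD fj (le_trans h5 (lerD (le_trans fjk Hm) fk))) _.
lra.
Qed.

(** On the set of convergence, a limit of continuous functions along the radii rho n; off it, a
    constant. P will be the real or the imaginary part. *)
Lemma measurable_boundary_part f (P : R[i] -> R) : analytic f ->
  (forall z w, `|P z - P w| <= cabs (z - w)) ->
  (forall r, 0 <= r -> r < 1 -> forall t, {for t, continuous (fun t => P (f (pt r t)))}) ->
  measurable_fun (ang : set (measurableTypeR R))
    ((fun t => P (boundary f t)) : measurableTypeR R -> R).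
Proof.
move=> fa P1 Pc.
pose E : set (measurableTypeR R) := [set t | ang t /\ rconv f t].
have mE : measurable E by exact: measurable_rconv.
have EU : (ang : set (measurableTypeR R)) = E `|` (ang `\` E).
  by rewrite setDUK// => t [].
rewrite EU; apply/measurable_funU; [exact: mE|exact: measurableD (@mang R) mE|split].
  apply: (@measurable_fun_cvg _ _ _ _ (fun n t => P (f (pt (rho n) t)))) => [n|t [tt tc]].
    apply: (@measurable_funS _ _ _ _ ang); [exact: mang|by move=> t []|].
    by apply: cont_measurable_ang => t _; apply: Pc; [exact/ltW/rho_gt0|exact: rho_lt1].
  apply/cvgrPdist_lt => e e0; have [N HN] := has_rlim_seq (boundary_rlim tc) e0.
  exists N => // n /= /HN h; rewrite distrC; exact: le_lt_trans (P1 _ _) h.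
apply: (@eq_measurable_fun _ _ _ _ _ (fun=> P (point : R[i]^o))); last exact: measurable_cst.
move=> t /set_mem[tt tn]; rewrite boundary_dvg// => tc; exact: tn.
Qed.

Lemma measurable_boundary_Re f : analytic f ->
  measurable_fun (ang : set (measurableTypeR R))
    ((fun t => Re (boundary f t)) : measurableTypeR R -> R).
Proof.
move=> fa; apply: (measurable_boundary_part fa (P := fun z => Re z)) => [z w|r r0 r1 t].
  by rewrite -cReB; exact: Re_le_cabs.
by apply: rcont_Re; exact: analytic_rcont fa r0 r1.
Qed.

Lemma measurable_boundary_Im f : analytic f ->
  measurable_fun (ang : set (measurableTypeR R))
    ((fun t => Im (boundary f t)) : measurableTypeR R -> R).
Proof.
move=> fa; apply: (measurable_boundary_part fa (P := fun z => Im z)) => [z w|r r0 r1 t].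
  by rewrite -cImB; exact: Im_le_cabs.
by apply: rcont_Im; exact: analytic_rcont fa r0 r1.
Qed.

End RadialLimits.

(** * Boundary values in the mean of order two *)

Section SquareIntegrable.
Variable R : realType.
Local Notation ang := (@angles R).
Local Notation mu := (@lebesgue_measure R).
Local Notation cm := (circle_measure R).
Local Notation pt := (@circle_pt R).
Local Notation mR := (measurableTypeR R).
Implicit Types (f g : R[i] -> R[i]) (a z l : R[i]) (r e s t : R).

Definition mmeas (h : R -> R) := measurable_fun (ang : set mR) (h : mR -> R).
Definition aeang (P : R -> Prop) := mu.-negligible [set t : mR | ang t /\ ~ P t].
(** The extended-valued counterpart of [mean], meaningful before integrability is known. *)
Definition Iang (h : R -> R) : \bar R := (\int[cm]_(t in ang) (h t)%:E)%E.

Lemma cm_negligible (A : set mR) : mu.-negligible A -> cm.-negligible A.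
Proof.
move=> [N [mN N0 AN]]; exists N; split => //.
by rewrite /circle_measure/= /mscale/= N0 mule0.
Qed.

Lemma aeang_ae (P : R -> Prop) : aeang P -> {ae cm, forall t, ang t -> P t}.
Proof.
by move=> /cm_negligible; apply: negligibleS => t /= /not_implyP.
Qed.

Lemma aeangW (P Q : R -> Prop) : (forall t, ang t -> P t -> Q t) -> aeang P -> aeang Q.
Proof.
by move=> PQ; apply: negligibleS => t [tt nQ]; split => // Pt; exact/nQ/PQ.
Qed.

Lemma aeangI (P Q : R -> Prop) : aeang P -> aeang Q -> aeang (fun t => P t /\ Q t).
Proof.
move=> hP hQ; apply: negligibleS (negligibleU hP hQ) => t [tt /not_andP[h|h]].
  by left.
by right.
Qed.

Lemma aeangT (P : R -> Prop) : (forall t, ang t -> P t) -> aeang P.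
Proof.
move=> H; apply: negligibleS (negligible_set0 _) => t [tt].
by apply; exact: H.
Qed.

Lemma le_Iang_ae (h1 h2 : R -> R) : mmeas h1 -> mmeas h2 -> (forall t, 0 <= h1 t) ->
  (forall t, 0 <= h2 t) -> aeang (fun t => h1 t <= h2 t) -> (Iang h1 <= Iang h2)%E.
Proof.
move=> m1 m2 p1 p2 H; apply: ae_ge0_le_integral => //.
- exact: mang.
- by move=> t _; rewrite lee_fin.
- exact/measurable_EFinP.
- by move=> t _; rewrite lee_fin.
- exact/measurable_EFinP.
- by apply/aeang_ae; apply: aeangW H => t _; rewrite lee_fin.
Qed.

Lemma IangD (h1 h2 : R -> R) : mmeas h1 -> mmeas h2 -> (forall t, 0 <= h1 t) ->
  (forall t, 0 <= h2 t) -> Iang (fun t => (h1 t + h2 t)%R) = (Iang h1 + Iang h2)%E.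
Proof.
move=> m1 m2 p1 p2; rewrite /Iang -ge0_integralD//.
- exact: mang.
- by move=> t _; rewrite lee_fin.
- exact/measurable_EFinP.
- by move=> t _; rewrite lee_fin.
- exact/measurable_EFinP.
Qed.

Lemma IangZ (k : R) (h : R -> R) : 0 <= k -> mmeas h -> (forall t, 0 <= h t) ->
  Iang (fun t => (k * h t)%R) = (k%:E * Iang h)%E.
Proof.
move=> k0 m1 p1; rewrite /Iang -ge0_integralZl_EFin//.
- exact: mang.
- by move=> t _; rewrite lee_fin.
- exact/measurable_EFinP.
Qed.

Lemma Iang_cst (k : R) : Iang (fun=> k) = k%:E.
Proof.
rewrite /Iang integral_cst; last exact: mang.
by have := cm_ang R; rewrite /= => ->; rewrite mule1.
Qed.

Lemma Iang_mean (h : R -> R) : mintegrable h -> Iang h = (mean h)%:E.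
Proof.
move=> hi; rewrite /mean /Rintegral fineK//.
by apply: integrable_fin_num; [exact: mang|exact: hi].
Qed.

Lemma mintegrable_meas (h : R -> R) : mintegrable h -> mmeas h.
Proof. by move=> /integrableP[/measurable_EFinP]. Qed.

Lemma mintegrable_Iang (h : R -> R) : mmeas h -> (forall t, 0 <= h t) ->
  (Iang h < +oo)%E -> mintegrable h.
Proof.
move=> mh h0 hoo; apply/integrableP; split; first exact/measurable_EFinP.
apply: le_lt_trans hoo; rewrite le_eqVlt; apply/orP; left; apply/eqP.
by apply: eq_integral => t _; rewrite /= ger0_norm.
Qed.

Lemma mmeas_cst (k : R) : mmeas (fun=> k). Proof. exact: measurable_cst. Qed.
Lemma mmeasD (h1 h2 : R -> R) : mmeas h1 -> mmeas h2 -> mmeas (fun t => h1 t + h2 t).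
Proof. by move=> ? ?; exact: measurable_funD. Qed.
Lemma mmeasB (h1 h2 : R -> R) : mmeas h1 -> mmeas h2 -> mmeas (fun t => h1 t - h2 t).
Proof. by move=> ? ?; exact: measurable_funB. Qed.
Lemma mmeasM (h1 h2 : R -> R) : mmeas h1 -> mmeas h2 -> mmeas (fun t => h1 t * h2 t).
Proof. by move=> ? ?; exact: measurable_funM. Qed.
Lemma mmeas_comp (F h : R -> R) : continuous F -> mmeas h -> mmeas (fun t => F (h t)).
Proof. by move=> Fc mh; apply: measurableT_comp => //; exact: continuous_measurable_fun. Qed.
Lemma mmeas_cont (h : R -> R) : (forall t, ang t -> {for t, continuous h}) -> mmeas h.
Proof. exact: cont_measurable_ang. Qed.

Definition cmmeas (g : R -> R[i]) := mmeas (fun t => Re (g t)) /\ mmeas (fun t => Im (g t)).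

Lemma mmeas_sqr_cabs (g : R -> R[i]) : cmmeas g -> mmeas (fun t => cabs (g t) ^+ 2).
Proof.
move=> [m1 m2]; under eq_fun do rewrite sqr_cabs !expr2.
by apply: mmeasD; exact: mmeasM.
Qed.

Lemma mmeas_cabs (g : R -> R[i]) : cmmeas g -> mmeas (fun t => cabs (g t)).
Proof.
move=> [m1 m2]; under eq_fun do rewrite cabsE !expr2.
by apply: mmeas_comp; [exact: sqrt_continuous|apply: mmeasD; exact: mmeasM].
Qed.

Lemma cmmeasD (g1 g2 : R -> R[i]) : cmmeas g1 -> cmmeas g2 -> cmmeas (fun t => g1 t + g2 t).
Proof.
move=> [m1 m2] [n1 n2]; split.
  by under eq_fun do rewrite cReD; exact: mmeasD.
by under eq_fun do rewrite cImD; exact: mmeasD.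
Qed.

Lemma cmmeasM (g1 g2 : R -> R[i]) : cmmeas g1 -> cmmeas g2 -> cmmeas (fun t => g1 t * g2 t).
Proof.
move=> [m1 m2] [n1 n2]; split.
  by under eq_fun do rewrite cReM; apply: mmeasB; exact: mmeasM.
by under eq_fun do rewrite cImM; apply: mmeasD; exact: mmeasM.
Qed.

Lemma cmmeas_cst (c : R[i]) : cmmeas (fun=> c).
Proof. by split; exact: mmeas_cst. Qed.

Lemma cmmeasB (g1 g2 : R -> R[i]) : cmmeas g1 -> cmmeas g2 -> cmmeas (fun t => g1 t - g2 t).
Proof.
move=> [m1 m2] [n1 n2]; split.
  by under eq_fun do rewrite cReB; exact: mmeasB.
by under eq_fun do rewrite cImB; exact: mmeasB.
Qed.

Lemma cmmeas_conj (g : R -> R[i]) : cmmeas g -> cmmeas (fun t => (g t)^*).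
Proof.
move=> [m1 m2]; split; first by under eq_fun do rewrite cRe_conj.
under eq_fun do rewrite cIm_conj -mulN1r.
by apply: mmeasM => //; exact: mmeas_cst.
Qed.

Lemma cmmeas_rcont (g : R -> R[i]) : (forall t, ang t -> rcont g t) -> cmmeas g.
Proof.
by move=> gc; split; apply: mmeas_cont => t /gc; [exact: rcont_Re|exact: rcont_Im].
Qed.

Lemma cmmeas_boundary f : analytic f -> cmmeas (boundary f).
Proof.
by move=> fa; split; [exact: measurable_boundary_Re fa|exact: measurable_boundary_Im fa].
Qed.

Lemma cmmeas_circle f r : analytic f -> 0 <= r -> r < 1 -> cmmeas (fun t => f (pt r t)).
Proof. by move=> fa r0 r1; apply: cmmeas_rcont => t _; exact: analytic_rcont fa r0 r1. Qed.

(** Fatou's lemma after removal of a null set containing the points of non-convergence; the bound is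
    required only for large k, which does not affect a lower limit. *)
Lemma fatou_bound (Fk : nat -> R -> R) (F : R -> R) (M : R) :
  (forall k, mmeas (Fk k)) -> mmeas F -> (forall k t, 0 <= Fk k t) -> (forall t, 0 <= F t) ->
  aeang (fun t => Fk ^~ t @ \oo --> F t) ->
  (exists N, forall k, (N <= k)%N -> (Iang (Fk k) <= M%:E)%E) -> (Iang F <= M%:E)%E.
Proof.
move=> mFk mF Fk0 F0 /cm_negligible[N [mN N0 HN]] [n0 Hn0].
have mD : measurable ((ang : set mR) `\` N) by apply: measurableD mN; exact: mang.
have E (h : R -> R) : mmeas h -> (forall t, 0 <= h t) ->
    (Iang h = \int[cm]_(t in ang `\` N) (h t)%:E)%E.
  move=> mh h0; apply: ge0_negligible_integral => //; first exact: mang.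
    exact/measurable_EFinP.
  by move=> t _; rewrite lee_fin.
rewrite E//.
have mS (h : R -> R) : mmeas h -> measurable_fun ((ang : set mR) `\` N) (EFin \o h : mR -> \bar R).
  move=> /measurable_EFinP mh; apply: measurable_funS mh; first exact: mang.
  by move=> t [].
have -> : (\int[cm]_(t in ang `\` N) (F t)%:E =
    \int[cm]_(t in ang `\` N) limn_einf (fun k => (Fk k t)%:E))%E.
  apply: eq_integral => t /set_mem[tt tN].
  have Ft : Fk ^~ t @ \oo --> F t by apply: contrapT => h; exact/tN/HN.
  have /cvg_limn_einf_sup[-> //] : (fun k => (Fk k t)%:E) @ \oo --> (F t)%:E.
  by apply: cvg_EFin => //; exact: nearW.
apply: le_trans (fatou _ mD (fun k => mS _ (mFk k)) _) _.
  by move=> k t _; rewrite lee_fin.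
rewrite limn_einf_lim; apply: lime_le; first exact: is_cvg_einfs.
apply: nearW => n; apply: le_trans (ereal_inf_lbound _) (Hn0 (maxn n0 n) (leq_maxl _ _)).
by exists (maxn n0 n); [exact: leq_maxr|rewrite E].
Qed.

(** H^2 in terms of coefficients, the form in which estimates are made; [hardy2P] identifies it with
    [hardy 2]. *)
Definition H2 f := analytic f /\ exists A, h2le f A.

Lemma H2_rconv f : H2 f -> aeang (rconv f).
Proof. by move=> [fa [A fA]]; exact: h2_rconv_ae fa fA. Qed.

Lemma Iang_avg2 f r : analytic f -> 0 <= r -> r < 1 ->
  Iang (fun t => (cabs (f (pt r t)) ^+ 2)%R) = (avg2 f r)%:E.
Proof.
move=> fa r0 r1; apply: Iang_mean; apply: rcont_sqr_mintegrable => t _.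
exact: analytic_rcont fa r0 r1.
Qed.

Lemma cvg_cabs_sqr (x : nat -> R[i]) l :
  (forall e, 0 < e -> exists N, forall n, (N <= n)%N -> cabs (x n - l) < e) ->
  (fun n => cabs (x n) ^+ 2) @ \oo --> cabs l ^+ 2.
Proof.
move=> H; have h : (fun n => cabs (x n)) @ \oo --> cabs l.
  apply/cvgrPdist_lt => e /H[N HN]; exists N => // n /= /HN h.
  apply: le_lt_trans h; have := ler_cabsB (x n) l; have := ler_cabsB l (x n).
  by rewrite (cabsBC l) => h1 h2; rewrite ler_norml; apply/andP; split; lra.
by under eq_fun do rewrite expr2; rewrite expr2; exact: cvgM.
Qed.

Lemma Iang_boundary_le f A : analytic f -> h2le f A ->
  (Iang (fun t => (cabs (boundary f t) ^+ 2)%R) <= A%:E)%E.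
Proof.
move=> fa fA; apply: (@fatou_bound (fun k t => cabs (f (pt (rho R k) t)) ^+ 2)).
- move=> k; apply: mmeas_sqr_cabs; apply: cmmeas_circle fa _ _; [exact/ltW/rho_gt0|exact: rho_lt1].
- by apply: mmeas_sqr_cabs; exact: cmmeas_boundary fa.
- by move=> k t; exact: sqr_ge0.
- by move=> t; exact: sqr_ge0.
- apply: aeangW (h2_rconv_ae fa fA) => t _ tc; apply: cvg_cabs_sqr.
  exact: has_rlim_seq (boundary_rlim tc).
- exists 0%N => k _; rewrite Iang_avg2; [|exact: fa|exact/ltW/rho_gt0|exact: rho_lt1].
  by rewrite lee_fin; apply: h2le_avg2 fa fA _ _; [exact: rho_gt0|exact: rho_lt1].
Qed.

Lemma cabs_sqr3 (P Q g k : R[i]) :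
  cabs ((P + g) - (Q + k)) ^+ 2 <= 2 * cabs (P - Q) ^+ 2 + (4 * cabs g ^+ 2 + 4 * cabs k ^+ 2).
Proof.
have -> : (P + g) - (Q + k) = (P - Q) + (g - k) by ring.
have h1 := cabsD (P - Q) (g - k); have h2 := cabsB g k.
have := cabs_ge0 ((P - Q) + (g - k)); have := cabs_ge0 (g - k).
move: h1 h2; set x := cabs (_ + _); set y := cabs (P - Q); set w := cabs (g - k).
set u := cabs g; set v := cabs k => h1 h2 w0 x0.
have e1 : x ^+ 2 <= (y + w) ^+ 2 by rewrite lerXn2r// ?nnegrE// (le_trans x0).
have e2 : w ^+ 2 <= (u + v) ^+ 2 by rewrite lerXn2r// ?nnegrE// (le_trans w0).
have := sqr_ge0 (y - w); have := sqr_ge0 (u - v).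
move: e1 e2; clear; rewrite !expr2; nra.
Qed.

(** The polynomial part converges uniformly on the circle and contributes at most 2 (e/4); the tail
    has squared norm at most e/16, on the circle of radius r as on the boundary, and contributes 4
    (e/16) twice. *)
Lemma h2_boundary_cvg f A e : analytic f -> h2le f A -> 0 < e ->
  exists2 d : R, 0 < d & forall r, 0 <= r -> r < 1 -> 1 - d < r ->
    (Iang (fun t => (cabs (f (pt r t) - boundary f t) ^+ 2)%R) <= e%:E)%E.
Proof.
move=> fa fA e0; have e16 : 0 < e / 16 by rewrite divr_gt0.
have [N HN] := h2le_tail fa fA e16.
have ga := @analytic_tail R f N fa.
pose P := psum (coef f) N.
have e4 : 0 < Num.min 1 (e / 4) by rewrite lt_min ltr01 divr_gt0.
have [d d0 Hd] := @near_circle_ccont R P 1 ler01 (fun z _ => @psum_ccont _ _ _ z) _ e4.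
exists (Num.min d 1) => [|r r0 r1 rd]; first by rewrite lt_min d0 ltr01.
have r0' : 0 < r by apply: le_lt_trans rd; rewrite subr_ge0 ge_min lexx orbT.
have rd' : `|r - 1| < d.
  rewrite ltr0_norm ?subr_lt0// opprB ltrBlDr -ltrBlDl.
  by apply: le_lt_trans rd; rewrite lerD2l lerN2 ge_min lexx.
apply: (@le_trans _ _ (Iang (fun t => ((e / 2 + (4 * cabs (tail f N (pt r t)) ^+ 2 +
    4 * cabs (boundary (tail f N) t) ^+ 2)))%R)))%E.
  have m1 : mmeas (fun t => cabs (tail f N (pt r t)) ^+ 2).
    by apply: mmeas_sqr_cabs; exact: cmmeas_circle ga r0 r1.
  have m2 : mmeas (fun t => cabs (boundary (tail f N) t) ^+ 2).
    by apply: mmeas_sqr_cabs; exact: cmmeas_boundary ga.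
  apply: le_Iang_ae.
  - apply: mmeas_sqr_cabs; apply: cmmeasB; last exact: cmmeas_boundary fa.
    exact: cmmeas_circle fa r0 r1.
  - apply: mmeasD; first exact: mmeas_cst.
    by apply: mmeasD; apply: mmeasM => //; exact: mmeas_cst.
  - by move=> t; exact: sqr_ge0.
  - by move=> t; apply: addr_ge0; [apply/ltW; rewrite divr_gt0|apply: addr_ge0; apply: mulr_ge0 => //; exact: sqr_ge0].
  - apply: aeangW (h2_rconv_ae fa fA) => t tt tc.
    have fl := boundary_rlim tc.
    have Pl : has_rlim P t (P (expi t)) by apply: has_rlim_cont; exact: psum_ccont.
    have gl : has_rlim (tail f N) t (boundary f t - P (expi t)).
      have := has_rlimD fl (has_rlimZ (-1) Pl); rewrite mulN1r.
      by apply: has_rlim_ext => z _; rewrite mulN1r.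
    have -> : boundary f t = P (expi t) + boundary (tail f N) t.
      by rewrite (boundaryE gl) addrC subrK.
    have -> : f (pt r t) = P (pt r t) + tail f N (pt r t) by rewrite /tail addrC subrK.
    apply: le_trans (cabs_sqr3 _ _ _ _) _; rewrite lerD2r.
    have := Hd r rd' t tt; rewrite /circle_pt mul1r => h.
    have h1 : cabs (P (pt r t) - P (expi t)) <= 1.
      by apply: ltW; apply: lt_le_trans h _; rewrite ge_min lexx.
    have h2 : cabs (P (pt r t) - P (expi t)) <= e / 4.
      by apply: ltW; apply: lt_le_trans h _; rewrite ge_min lexx orbT.
    have : cabs (P (pt r t) - P (expi t)) ^+ 2 <= 1 * (e / 4).
      by rewrite expr2; apply: ler_pM; rewrite ?cabs_ge0.
    lra.
have m1 : mmeas (fun t => cabs (tail f N (pt r t)) ^+ 2).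
  by apply: mmeas_sqr_cabs; exact: cmmeas_circle ga r0 r1.
have m2 : mmeas (fun t => cabs (boundary (tail f N) t) ^+ 2).
  by apply: mmeas_sqr_cabs; exact: cmmeas_boundary ga.
have m1' : mmeas (fun t => 4 * cabs (tail f N (pt r t)) ^+ 2).
  by apply: mmeasM => //; exact: mmeas_cst.
have m2' : mmeas (fun t => 4 * cabs (boundary (tail f N) t) ^+ 2).
  by apply: mmeasM => //; exact: mmeas_cst.
have p1 t : 0 <= 4 * cabs (tail f N (pt r t)) ^+ 2 by rewrite mulr_ge0// sqr_ge0.
have p2 t : 0 <= 4 * cabs (boundary (tail f N) t) ^+ 2 by rewrite mulr_ge0// sqr_ge0.
rewrite IangD; [|exact: mmeas_cst|exact: mmeasD|by move=> t; rewrite ltW// divr_gt0|by move=> t; exact: addr_ge0].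
rewrite IangD//.
have k4 : 0 <= 4 :> R by [].
rewrite (IangZ k4 m1); last by move=> t; exact: sqr_ge0.
rewrite (IangZ k4 m2); last by move=> t; exact: sqr_ge0.
rewrite Iang_cst Iang_avg2; [|exact: ga|exact: r0|exact: r1].
have b1 := h2le_avg2 ga HN r0' r1.
have b2 := Iang_boundary_le ga HN.
have b3 : (4%:E * Iang (fun t => (cabs (boundary (tail f N) t) ^+ 2)%R) <= (4 * (e / 16))%:E)%E.
  by rewrite EFinM; apply: lee_wpmul2l => //; rewrite lee_fin.
apply: (@le_trans _ _ ((e / 2)%:E + ((4 * avg2 (tail f N) r)%:E + (4 * (e / 16))%:E))%E).
  by rewrite leeD2l// leeD2l.
rewrite -!EFinD lee_fin; move: b1; clear; lra.
Qed.

(** Young's inequality with a weight: the factor of b^2 can be taken arbitrarily close to 1, so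
    limits of means lose no constant. *)
Lemma sqr_split (b c eta : R) : 0 < eta ->
  (b + c) ^+ 2 <= (1 + eta) * b ^+ 2 + (1 + eta^-1) * c ^+ 2.
Proof.
move=> eta0; rewrite -subr_ge0.
have -> : (1 + eta) * b ^+ 2 + (1 + eta^-1) * c ^+ 2 - (b + c) ^+ 2 =
  eta * (b - c / eta) ^+ 2 by field; rewrite gt_eqF.
by rewrite mulr_ge0 ?sqr_ge0// ltW.
Qed.

Lemma mint_boundary_sqr f : H2 f -> mintegrable (fun t => cabs (boundary f t) ^+ 2).
Proof.
move=> [fa [A fA]]; apply: mintegrable_Iang.
- by apply: mmeas_sqr_cabs; exact: cmmeas_boundary fa.
- by move=> t; exact: sqr_ge0.
- by apply: le_lt_trans (Iang_boundary_le fa fA) _; exact: ltry.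
Qed.

Lemma avg2_le_boundary f A eta e : analytic f -> h2le f A -> 0 < eta -> 0 < e ->
  exists2 d : R, 0 < d & forall r, 0 <= r -> r < 1 -> 1 - d < r ->
  avg2 f r <= (1 + eta) * mean (fun t => cabs (boundary f t) ^+ 2) + e.
Proof.
move=> fa fA eta0 e0; have K0 : 0 < 1 + eta^-1 by rewrite addr_gt0// invr_gt0.
have [d d0 Hd] := h2_boundary_cvg fa fA (divr_gt0 e0 K0).
exists d => // r r0 r1 rd; rewrite -lee_fin -(Iang_avg2 fa r0 r1).
have i1 := mint_boundary_sqr (conj fa (ex_intro _ A fA)).
have m1 := mintegrable_meas i1.
have m2 : mmeas (fun t => cabs (f (pt r t) - boundary f t) ^+ 2).
  apply: mmeas_sqr_cabs; apply: cmmeasB; last exact: cmmeas_boundary fa.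
  exact: cmmeas_circle fa r0 r1.
apply: (@le_trans _ _ (Iang (fun t => ((1 + eta) * cabs (boundary f t) ^+ 2 +
    (1 + eta^-1) * cabs (f (pt r t) - boundary f t) ^+ 2)%R))).
  apply: le_Iang_ae.
  - by apply: mmeas_sqr_cabs; exact: cmmeas_circle fa r0 r1.
  - by apply: mmeasD; apply: mmeasM => //; exact: mmeas_cst.
  - by move=> t; exact: sqr_ge0.
  - by move=> t; rewrite addr_ge0// mulr_ge0 ?sqr_ge0// ltW// addr_gt0.
  - apply: aeangT => t _; apply: le_trans (sqr_split _ _ eta0).
    rewrite lerXn2r// ?nnegrE ?addr_ge0 ?cabs_ge0//.
    by rewrite -{1}(subrK (boundary f t) (f (pt r t))) addrC cabsD.
rewrite IangD; first last.
- by move=> t; rewrite mulr_ge0 ?sqr_ge0// ltW.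
- by move=> t; rewrite mulr_ge0 ?sqr_ge0// ltW// addr_gt0.
- by apply: mmeasM => //; exact: mmeas_cst.
- by apply: mmeasM => //; exact: mmeas_cst.
rewrite (@IangZ (1 + eta)); [|by rewrite ltW// addr_gt0|exact: m1|by move=> t; exact: sqr_ge0].
rewrite (@IangZ (1 + eta^-1)); [|by rewrite ltW|exact: m2|by move=> t; exact: sqr_ge0].
rewrite (Iang_mean i1) [leRHS]EFinD -EFinM leeD2l//.
have -> : e%:E = ((1 + eta^-1)%:E * (e / (1 + eta^-1))%:E)%E.
  by rewrite -EFinM mulrC divfK// gt_eqF.
by apply: lee_wpmul2l; [rewrite lee_fin ltW|exact: Hd].
Qed.

(** Near radius 1, [avg2] is at most (1 + eta) times the boundary mean plus e; Bessel's inequality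
    passes this to the coefficients, and eta and e then tend to 0. *)
Lemma coef_le_boundary f N : H2 f ->
  \sum_(n < N) cabs (coef f n) ^+ 2 <= mean (fun t => cabs (boundary f t) ^+ 2).
Proof.
move=> [fa [A fA]]; set m := mean _; set S := \sum_(n < N) _.
have m0 : 0 <= m by apply: mean_ge0 => t _; exact: sqr_ge0.
have S0 : 0 <= S by apply: sumr_ge0 => n _; exact: sqr_ge0.
have key eta e : 0 < eta -> 0 < e -> S <= (1 + eta) * m + e.
  move=> eta0 e0; have [d d0 Hd] := avg2_le_boundary fa fA eta0 e0.
  apply: (coef_limit_near N fa d0) => r r0 r1 rd; exact: Hd (ltW r0) r1 rd.
apply/ler_addgt0Pr => e e0.
have K0 : 0 < m + 1 by rewrite ltr_wpDl.
have := key (e / (m + 1) / 2) (e / 2) ltac:(by rewrite !divr_gt0) ltac:(by rewrite divr_gt0).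
move=> h; apply: le_trans h _.
have : e / (m + 1) / 2 * m <= e / 2.
  have -> : e / (m + 1) / 2 * m = e / 2 * (m / (m + 1)) by field; rewrite gt_eqF.
  by rewrite ler_piMr ?divr_ge0 ?(ltW e0)// ler_pdivrMr// mul1r lerDl.
rewrite mulrDl mul1r; move: e0; clear; lra.
Qed.

End SquareIntegrable.

(** * The Hardy space of order two *)

Section HardyTwo.
Variable R : realType.
Local Notation ang := (@angles R).
Local Notation mu := (@lebesgue_measure R).
Local Notation cm := (circle_measure R).
Local Notation pt := (@circle_pt R).
Local Notation mR := (measurableTypeR R).
Implicit Types (f g : R[i] -> R[i]) (a z l : R[i]) (r e s t : R).

Lemma geometric_from (q : R) N K : q < 1 ->
  \sum_(n < K) (if (n < N)%N then 0 else q ^+ n) + q ^+ (maxn K N) / (1 - q) = q ^+ N / (1 - q).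
Proof.
move=> q1; have q1' : 1 - q != 0 by rewrite gt_eqF// subr_gt0.
elim: K => [|K IH]; first by rewrite big_ord0 add0r max0n.
rewrite big_ord_recr /= -IH -addrA; congr (_ + _).
case: (boolP (K < N)%N) => [|]KN; first by rewrite (maxn_idPr KN) (maxn_idPr (ltnW KN)) add0r.
rewrite -leqNgt in KN.
by rewrite (maxn_idPl KN) (maxn_idPl (leqW KN)) exprS; field.
Qed.

(** Cauchy-Schwarz in the linearized form 2 x y <= lam x^2 + y^2 / lam, applied term by term; it is
    stable under the limit in K, after which lam is optimized. *)
Lemma psum_h2_le f A N K z (lam : R) : 0 < lam -> h2le f A ->
  (forall n, (n < N)%N -> coef f n = 0) -> cabs z < 1 ->
  2 * cabs (psum (coef f) K z) <= lam * A + (cabs z ^+ (2 * N) / (1 - cabs z ^+ 2)) / lam.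
Proof.
move=> l0 fA f0 z1; set q := cabs z ^+ 2.
have q1 : q < 1 by rewrite /q expr2 mulr_ilt1// cabs_ge0.
have q0 : 0 <= q by exact: sqr_ge0.
apply: (@le_trans _ _ (\sum_(n < K) (lam * cabs (coef f n) ^+ 2 +
    (if (n < N)%N then 0 else q ^+ n) / lam))).
  apply: (@le_trans _ _ (2 * \sum_(n < K) cabs (coef f n * z ^+ n))).
    by rewrite ler_wpM2l// cabs_sum.
  rewrite mulr_sumr; apply: ler_sum => n _; rewrite cabsM cabsX.
  case: ltnP => nN.
    by rewrite (f0 _ nN) cabs0 !mul0r expr0n /= !mulr0 addr0.
  rewrite /q -exprM mulnC exprM; set x := cabs (coef f n); set y := cabs z ^+ n.
  rewrite -subr_ge0.
  have -> : lam * x ^+ 2 + y ^+ 2 / lam - 2 * (x * y) = lam * (x - y / lam) ^+ 2.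
    by field; rewrite gt_eqF.
  by rewrite mulr_ge0 ?sqr_ge0// ltW.
rewrite big_split /= -mulr_sumr -mulr_suml lerD//.
  by apply: ler_wpM2l; [exact: ltW|exact: fA].
rewrite ler_wpM2r ?invr_ge0 ?(ltW l0)// exprM -/q -(geometric_from N K q1) lerDl.
by apply: divr_ge0; [exact: exprn_ge0|rewrite subr_ge0 ltW].
Qed.

Lemma psum_cvg f z e : analytic f -> cabs z < 1 -> 0 < e ->
  exists K, cabs (f z - psum (coef f) K z) <= e.
Proof.
move=> fa z1 e0; set r := (1 + cabs z) / 2.
have zr : cabs z < r by rewrite /r ltr_pdivlMr//; lra.
have r1 : r < 1 by rewrite /r ltr_pdivrMr//; lra.
have r0 : 0 < r by apply: le_lt_trans zr; exact: cabs_ge0.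
clearbody r.
have q0 : 0 <= cabs z / r by rewrite divr_ge0 ?cabs_ge0// ltW.
have q1 : cabs z / r < 1 by rewrite ltr_pdivrMr// mul1r.
have b0 := avg_ge0 f r; set b := avg f r in b0 *.
have c0 : 0 < 1 - cabs z / r by rewrite subr_gt0.
have [K hK] := expr_small q0 q1 (divr_gt0 (mulr_gt0 e0 c0) (ltr_wpDl b0 ltr01)).
exists K; apply: le_trans (taylor K fa zr r1) _; rewrite -/b mulrA ler_pdivrMr//.
apply: le_trans (_ : b * (e * (1 - cabs z / r) / (b + 1)) <= _).
  by apply: ler_wpM2l; [exact: b0|exact: ltW].
rewrite mulrA ler_pdivrMr ?ltr_wpDl// mulrC ler_wpM2l ?lerDl//.
by rewrite mulr_ge0 ?ltW.
Qed.

Lemma h2_point f A N z : analytic f -> 0 < A -> h2le f A ->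
  (forall n, (n < N)%N -> coef f n = 0) -> cabs z < 1 ->
  cabs (f z) ^+ 2 <= A * (cabs z ^+ (2 * N) / (1 - cabs z ^+ 2)).
Proof.
move=> fa A0 fA f0 z1; set x := cabs (f z); set B := _ / _.
have q1 : cabs z ^+ 2 < 1 by rewrite expr2 mulr_ilt1// cabs_ge0.
have B0 : 0 <= B by rewrite /B divr_ge0 ?exprn_ge0 ?cabs_ge0// subr_ge0 ltW.
have : 0 <= x by exact: cabs_ge0.
rewrite le_eqVlt => /predU1P[<-|x0]; first by rewrite expr0n /= mulr_ge0// ltW.
have key lam : 0 < lam -> 2 * x <= lam * A + B / lam.
  move=> l0; apply/ler_addgt0Pr => e e0.
  have [K HK] := psum_cvg fa z1 (divr_gt0 e0 (ltr0n R 2)).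
  have := psum_h2_le K l0 fA f0 z1; rewrite -/B.
  have := cabsD (f z - psum (coef f) K z) (psum (coef f) K z); rewrite subrK -/x.
  move: HK; clear; lra.
(* The optimal weight: it turns the bound into x <= B A / x. *)
have := key (x / A) (divr_gt0 x0 A0); rewrite divfK ?gt_eqF//.
rewrite mulr_natl mulr2n lerD2l invf_div mulrA ler_pdivlMr//.
by rewrite expr2 (mulrC B).
Qed.

Lemma h2_vanish f : analytic f -> (forall n, coef f n = 0) ->
  forall z, cabs z < 1 -> f z = 0.
Proof.
move=> fa f0 z z1; apply/eqP; rewrite -cabs_eq0 eq_le cabs_ge0 andbT.
apply/ler_addgt0Pr => e e0; rewrite add0r; have [K] := psum_cvg fa z1 e0.
rewrite /psum big1 ?subr0// => n _; by rewrite f0 mul0r.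
Qed.

Lemma avg2_0 f : avg2 f 0 = cabs (f 0) ^+ 2.
Proof.
rewrite /avg2; under [X in mean X]eq_fun do rewrite /circle_pt mul0r.
exact: mean_cst.
Qed.

Lemma h2le_ge0 f A : h2le f A -> 0 <= A.
Proof. by move=> /(_ 0%N); rewrite big_ord0. Qed.

Lemma h2le_avg2_ge0 f A r : analytic f -> h2le f A -> 0 <= r -> r < 1 -> avg2 f r <= A.
Proof.
move=> fa fA; rewrite le_eqVlt => /predU1P[<- _|r0 r1]; last exact: h2le_avg2 fa fA r0 r1.
rewrite avg2_0; apply/ler_addgt0Pr => e e0.
have A0 := h2le_ge0 fA; have Ae : 0 < A + e by rewrite ltr_wpDl.
have fAe : h2le f (A + e) by move=> N; apply: le_trans (fA N) _; rewrite lerDl ltW.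
have c0 : cabs (0 : R[i]) < 1 by rewrite cabs0.
have := @h2_point f (A + e) 0 0 fa Ae fAe ltac:(by []) c0.
by rewrite cabs0 muln0 expr0 expr0n /= subr0 divr1 mulr1.
Qed.

Lemma hardy_norm2E f r : analytic f -> 0 <= r -> r < 1 ->
  ((\int[cm]_(t in ang) (cabs (f (r%:C * expi t)) `^ 2)%:E) `^ 2^-1)%E =
  (Num.sqrt (avg2 f r))%:E.
Proof.
move=> fa r0 r1; under eq_integral do rewrite powR_mulrn ?cabs_ge0//.
have := Iang_avg2 fa r0 r1; rewrite /Iang /circle_pt => ->.
rewrite poweR_EFin powR12_sqrt//; apply: mean_ge0 => t _; exact: sqr_ge0.
Qed.

Lemma h2le_hardy_norm2 f A : analytic f -> h2le f A ->
  (hardy_norm 2 f <= (Num.sqrt A)%:E)%E.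
Proof.
move=> fa fA; apply: ge_ereal_sup => _ [r /= /andP[r0 r1] <-].
rewrite (hardy_norm2E fa r0 r1) lee_fin ler_wsqrtr//.
exact: h2le_avg2_ge0 fa fA r0 r1.
Qed.

Lemma hardy_norm2_h2le f C : analytic f -> 0 <= C -> (hardy_norm 2 f <= C%:E)%E ->
  h2le f (C ^+ 2).
Proof.
move=> fa C0 fC N; apply: (@coef_limit R f N _ fa) => r r0 r1.
have : ((Num.sqrt (avg2 f r))%:E <= C%:E)%E.
  apply: le_trans fC; apply: ereal_sup_ubound; exists r => /=; first by rewrite (ltW r0).
  exact: hardy_norm2E fa (ltW r0) r1.
have a0 : 0 <= avg2 f r by apply: mean_ge0 => t _; exact: sqr_ge0.
rewrite lee_fin => h; rewrite -(sqr_sqrtr a0) lerXn2r// ?nnegrE ?sqrtr_ge0//.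
Qed.

Lemma hardy2P f : hardy 2 f <-> H2 f.
Proof.
split=> [[fa fn]|[fa [A fA]]]; split=> //; try exact: fa.
  have n0 : (0 <= hardy_norm 2 f)%E.
    apply: le_trans (ereal_sup_ubound _); last first.
      by exists 0; [rewrite /= lexx ltr01|exact: hardy_norm2E fa (lexx 0) ltr01].
    by rewrite lee_fin sqrtr_ge0.
  exists (fine (hardy_norm 2 f) ^+ 2); apply: hardy_norm2_h2le fa _ _.
    exact: fine_ge0.
  by rewrite fineK// ge0_fin_numE.
by apply: le_lt_trans (h2le_hardy_norm2 fa fA) _; exact: ltry.
Qed.

Lemma hardy_norm1E f r : analytic f -> 0 <= r -> r < 1 ->
  ((\int[cm]_(t in ang) (cabs (f (r%:C * expi t)) `^ 1)%:E) `^ 1^-1)%E = (avg f r)%:E.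
Proof.
move=> fa r0 r1; under eq_integral do rewrite powRr1 ?cabs_ge0//.
have /Iang_mean := @rcont_mintegrable R _ (fun t _ => @analytic_rcont R f r t fa r0 r1).
rewrite /Iang /circle_pt => ->; rewrite invr1 poweRe1// lee_fin.
by apply: mean_ge0 => t _; exact: cabs_ge0.
Qed.

Lemma hardy1P f : hardy 1 f <->
  analytic f /\ exists A, forall r, 0 <= r -> r < 1 -> avg f r <= A.
Proof.
split=> [[fa fn]|[fa [A fA]]]; split=> //; try exact: fa.
  exists (fine (hardy_norm 1 f)) => r r0 r1.
  have h : ((avg f r)%:E <= hardy_norm 1 f)%E.
    by apply: ereal_sup_ubound; exists r => /=; [rewrite r0|exact: hardy_norm1E fa r0 r1].
  have n0 : (0 <= hardy_norm 1 f)%E by apply: le_trans h; rewrite lee_fin avg_ge0.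
  by rewrite -lee_fin (@fineK _ (hardy_norm 1 f)); [exact: h|rewrite ge0_fin_numE].
apply: (@le_lt_trans _ _ A%:E); last exact: ltry.
apply: ge_ereal_sup => _ [r /= /andP[r0 r1] <-].
by rewrite (hardy_norm1E fa r0 r1) lee_fin; exact: fA.
Qed.

Lemma mintegrable_dom (h G : R -> R) : mmeas h -> mintegrable G ->
  (forall t, ang t -> `|h t| <= G t) -> mintegrable h.
Proof.
move=> mh Gi H; apply: le_integrable Gi; first exact: mang.
  exact/measurable_EFinP.
by move=> t /H h1; rewrite /= lee_fin; apply: le_trans h1 _; exact: ler_norm.
Qed.

Lemma ae_eq_mean (h1 h2 : R -> R) : mmeas h1 -> mmeas h2 ->
  aeang (fun t => h1 t = h2 t) -> mean h1 = mean h2.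
Proof.
move=> m1 m2 H; rewrite /mean /Rintegral; congr fine; apply: ae_eq_integral.
- exact: mang.
- exact/measurable_EFinP.
- exact/measurable_EFinP.
- by apply: (@filterS _ _ (ae_filter_ringOfSetsType cm)) (aeang_ae H) => t h tt; rewrite h.
Qed.

Lemma ae_eq_cmean (g1 g2 : R -> R[i]) : cmmeas g1 -> cmmeas g2 ->
  aeang (fun t => g1 t = g2 t) -> cmean g1 = cmean g2.
Proof.
move=> [m1 m2] [n1 n2] H; rewrite /cmean /cint; congr (_ +i* _).
  by apply: ae_eq_mean => //; apply: aeangW H => t _ ->.
by apply: ae_eq_mean => //; apply: aeangW H => t _ ->.
Qed.

Lemma H2D f g : H2 f -> H2 g -> H2 (fun z => f z + g z).
Proof.
move=> [fa [A fA]] [ga [B gB]]; split; first exact: analyticD fa ga.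
exists (2 * A + 2 * B) => N.
apply: (@le_trans _ _ (\sum_(n < N) (2 * cabs (coef f n) ^+ 2 + 2 * cabs (coef g n) ^+ 2))).
  apply: ler_sum => n _; rewrite (tcoefD n fa ga).
  set x := coef f n; set y := coef g n.
  apply: (@le_trans _ _ ((cabs x + cabs y) ^+ 2)).
    by rewrite lerXn2r ?nnegrE ?addr_ge0 ?cabs_ge0// cabsD.
  rewrite -subr_ge0; have := sqr_ge0 (cabs x - cabs y).
  set u := cabs x; set v := cabs y; rewrite !expr2; nra.
by rewrite big_split /= -!mulr_sumr; apply: lerD; apply: ler_wpM2l => //; [exact: fA|exact: gB].
Qed.

Lemma H2Z (k : R[i]) f : H2 f -> H2 (fun z => k * f z).
Proof.
move=> [fa [A fA]]; split; first exact: analyticZ fa.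
exists (cabs k ^+ 2 * A) => N.
under eq_bigr do rewrite (tcoefZ _ _ fa) cabsM exprMn.
by rewrite -mulr_sumr ler_wpM2l ?sqr_ge0.
Qed.

Lemma H2_0 : H2 (fun=> 0 : R[i]).
Proof.
split; first exact: analytic_cst; exists 0 => N; rewrite big1// => n _.
by rewrite /coef; under eq_cmean do rewrite mul0r; rewrite cmean_cst cabs0 expr0n.
Qed.

Lemma H2_sum (I : Type) (s : seq I) (c : I -> R[i]) (F : I -> R[i] -> R[i]) :
  (forall i, H2 (F i)) -> H2 (fun z => \sum_(i <- s) c i * F i z).
Proof.
move=> HF; elim: s => [|i s IH].
  by under eq_fun do rewrite big_nil; exact: H2_0.
by under eq_fun do rewrite big_cons; apply: H2D => //; exact/H2Z/HF.
Qed.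

(** * The inner product of H^2 through boundary values *)

Local Notation dot := (@hardy2_dot R).

Lemma dot_cmmeas f g : H2 f -> H2 g -> cmmeas (fun t => boundary f t * (boundary g t)^*).
Proof.
by move=> [fa _] [ga _]; apply: cmmeasM; [|apply: cmmeas_conj]; exact: cmmeas_boundary.
Qed.

Lemma dot_cintegrable f g : H2 f -> H2 g ->
  cintegrable cm ang (fun t => boundary f t * (boundary g t)^*).
Proof.
move=> hf hg; have [m1 m2] := dot_cmmeas hf hg.
have di := mintegrableD (mint_boundary_sqr hf) (mint_boundary_sqr hg).
have le t : cabs (boundary f t * (boundary g t)^*) <=
    cabs (boundary f t) ^+ 2 + cabs (boundary g t) ^+ 2.
  rewrite cabsM cabs_conj; have := sqr_ge0 (cabs (boundary f t) - cabs (boundary g t)).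
  have := cabs_ge0 (boundary f t); have := cabs_ge0 (boundary g t).
  set u := cabs _; set v := cabs _; rewrite !expr2; nra.
by split; apply: mintegrable_dom di _ => // t _;
  apply: le_trans (le t); [exact: Re_le_cabs|exact: Im_le_cabs].
Qed.

Lemma dotE f g : dot f g = cmean (fun t => boundary f t * (boundary g t)^*).
Proof. by []. Qed.

(** [boundary] is additive only where both radial limits exist, that is almost everywhere; the
    integrals agree nevertheless. *)
Lemma dotDl f1 f2 g : H2 f1 -> H2 f2 -> H2 g ->
  dot (fun z => f1 z + f2 z) g = dot f1 g + dot f2 g.
Proof.
move=> h1 h2 hg; rewrite !dotE /cmean.
rewrite -(cintD (@mang R) (dot_cintegrable h1 hg) (dot_cintegrable h2 hg)).
apply: ae_eq_cmean.
- exact: dot_cmmeas (H2D h1 h2) hg.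
- by apply: cmmeasD; exact: dot_cmmeas.
- apply: aeangW (aeangI (H2_rconv h1) (H2_rconv h2)) => t _ [c1 c2].
  by rewrite (boundaryE (has_rlimD (boundary_rlim c1) (boundary_rlim c2))) mulrDl.
Qed.

Lemma dotZl (k : R[i]) f g : H2 f -> H2 g -> dot (fun z => k * f z) g = k * dot f g.
Proof.
move=> hf hg; rewrite !dotE /cmean -(cintZ (@mang R) _ (dot_cintegrable hf hg)).
apply: ae_eq_cmean.
- exact: dot_cmmeas (H2Z k hf) hg.
- by apply: cmmeasM; [exact: cmmeas_cst|exact: dot_cmmeas].
- apply: aeangW (H2_rconv hf) => t _ c1.
  by rewrite (boundaryE (has_rlimZ k (boundary_rlim c1))) mulrA.
Qed.

Lemma dotC f g : H2 f -> H2 g -> dot g f = (dot f g)^*.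
Proof.
move=> hf hg; rewrite !dotE -cmean_conj; last exact: dot_cintegrable.
by apply: eq_cmean => t _; rewrite rmorphM /= conjCK mulrC.
Qed.

Lemma dotZr (k : R[i]) f g : H2 f -> H2 g -> dot f (fun z => k * g z) = k^* * dot f g.
Proof.
move=> hf hg; rewrite (dotC (H2Z k hg) hf) (dotZl k hg hf) rmorphM /=.
by rewrite -(dotC hg hf).
Qed.

(** Radial limits are taken from inside, so whatever values f has outside the disk, its boundary
    function is identically 0. *)
Lemma dot_0disk f g : (forall z, cabs z < 1 -> f z = 0) -> dot f g = 0.
Proof.
move=> f0; rewrite dotE -[RHS](@cmean_cst R 0); apply: eq_cmean => t _.
have h : has_rlim f t 0 by apply: has_rlim_ext (has_rlim_cst 0 t) => z /f0.
by rewrite (boundaryE h) mul0r.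
Qed.

Lemma dot_suml (I : finType) (c : I -> R[i]) (F : I -> R[i] -> R[i]) g :
  (forall i, H2 (F i)) -> H2 g ->
  dot (fun z => \sum_i c i * F i z) g = \sum_i c i * dot (F i) g.
Proof.
move=> HF hg; elim: (index_enum I) => [|i s IH].
  rewrite big_nil; under [X in dot X]eq_fun do rewrite big_nil.
  exact: dot_0disk.
under [X in dot X]eq_fun do rewrite big_cons.
by rewrite big_cons dotDl// ?dotZl ?IH//; [exact: H2Z|exact: H2_sum].
Qed.

Lemma dot_sum (I : finType) (c d : I -> R[i]) (F : I -> R[i] -> R[i]) :
  (forall i, H2 (F i)) ->
  dot (fun z => \sum_i c i * F i z) (fun z => \sum_j d j * F j z) =
  \sum_i \sum_j c i * (d j)^* * dot (F i) (F j).
Proof.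
move=> HF; rewrite dot_suml//; last exact: H2_sum.
apply: eq_bigr => i _; rewrite (dotC (H2_sum _ d HF) (HF i)) dot_suml//.
rewrite rmorph_sum mulr_sumr; apply: eq_bigr => j _ /=.
by rewrite rmorphM /= -(dotC (HF j) (HF i)) mulrA.
Qed.

Definition nrm2 f := mean (fun t => cabs (boundary f t) ^+ 2).

Lemma dot_self f : H2 f -> dot f f = (nrm2 f)%:C.
Proof.
move=> hf; rewrite dotE /cmean /cint; under eq_fun do rewrite mul_conj /=.
rewrite /nrm2 /mean; congr (_ +i* _); under eq_fun do rewrite mul_conj /=.
exact: (@mean_cst R 0).
Qed.

Lemma nrm2_ge0 f : 0 <= nrm2 f.
Proof. by apply: mean_ge0 => t _; exact: sqr_ge0. Qed.

Lemma nrm2_h2le f : H2 f -> h2le f (nrm2 f).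
Proof. by move=> hf N; exact: coef_le_boundary. Qed.

Lemma nrm2_le f A : analytic f -> h2le f A -> nrm2 f <= A.
Proof.
move=> fa fA; rewrite -lee_fin -Iang_mean; first exact: Iang_boundary_le fa fA.
exact: mint_boundary_sqr (conj fa (ex_intro _ A fA)).
Qed.

Lemma nrm2_eq0 f : H2 f -> nrm2 f = 0 -> forall z, cabs z < 1 -> f z = 0.
Proof.
move=> hf f0; have fa := proj1 hf; apply: h2_vanish fa _ => n.
have := nrm2_h2le hf n.+1; rewrite f0 big_ord_recr /= => h.
apply/eqP; rewrite -cabs_eq0 -sqrf_eq0 eq_le sqr_ge0 andbT.
apply: le_trans h; rewrite lerDr; apply: sumr_ge0 => k _; exact: sqr_ge0.
Qed.

End HardyTwo.

(** * Logarithm, square root, and factorization of polynomials *)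

Section Logarithm.
Variable R : realType.
Implicit Types (z w h : R[i]) (e : R).

(** The principal branch on the right half-plane, where the argument is the arctangent of Im w / Re
    w. *)
Definition Log w : R[i] := ln (cabs w) +i* atan (Im w / Re w).

Lemma Re_pos_neq0 w : 0 < Re w -> w != 0.
Proof. by apply: contraTneq => ->; rewrite ltxx. Qed.

Lemma cexp_Log w : 0 < Re w -> cexp (Log w) = w.
Proof.
move=> w0; have c0 : 0 < cabs w by rewrite cabs_gt0 Re_pos_neq0.
rewrite /cexp /Log /= lnK ?posrE//.
set u := Im w / Re w.
have su : Num.sqrt (1 + u ^+ 2) = cabs w / Re w.
  have -> : 1 + u ^+ 2 = (cabs w / Re w) ^+ 2.
    by rewrite /u !expr_div_n sqr_cabs mulrDl divff// sqrf_eq0 gt_eqF.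
  by rewrite sqrtr_sqr ger0_norm// divr_ge0 ?ltW.
have cu : cos (atan u) = Re w / cabs w by rewrite cos_atan su invf_div.
have scu : sin (atan u) = u * cos (atan u).
  rewrite -{2}(atanK u) /tan mulfVK// cu mulf_neq0 ?invr_neq0 ?gt_eqF//.
apply: complex_eq; rewrite rC_mul /= ?scu cu /u.
  by rewrite mulrC divfK// gt_eqF.
by field; rewrite !gt_eqF.
Qed.

Lemma ccont_Log w : 0 < Re w -> ccont Log w.
Proof.
move=> w0 e e0; have c0 : 0 < cabs w by rewrite cabs_gt0 Re_pos_neq0.
have e2 : 0 < e / 2 by rewrite divr_gt0.
have /cvgrPdist_lt/(_ _ e2)/nbhs_ballP[d1 /= d10 H1] := @continuous_ln R _ c0.
have /cvgrPdist_lt/(_ _ e2)/nbhs_ballP[d2 /= d20 H2] := @continuous_atan R (Im w / Re w).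
(* The two quotients Im / Re differ by at most |v - w| (Re w + |Im w|) / (Re v Re w), and Re v > Re
   w / 2. *)
set D := (Re w ^+ 2 / 2) / (Re w + `|Im w|).
have s0 : 0 < Re w + `|Im w| by rewrite ltr_pwDl.
have D0 : 0 < D by rewrite /D divr_gt0// divr_gt0// exprn_gt0.
have D20 : 0 < D * d2 by rewrite mulr_gt0.
have w20 : 0 < Re w / 2 by rewrite divr_gt0.
exists (Num.min d1 (Num.min (Re w / 2) (D * d2))) => [|v].
  by rewrite lt_min d10 lt_min w20 D20.
rewrite !lt_min => /andP[v1 /andP[v2 v3]].
have := Re_le_cabs (v - w); have := Im_le_cabs (v - w); rewrite cReB cImB => i1 r1.
have rv : Re w / 2 < Re v.
  by have := le_lt_trans r1 v2; rewrite ltr_norml => /andP[]; lra.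
have rv0 : 0 < Re v by apply: lt_trans rv.
apply: le_lt_trans (cabs_le_ReIm _) _; rewrite cReB cImB /Log /=.
have -> : e = e / 2 + e / 2 by field.
apply: ltrD.
  rewrite distrC; apply: H1; rewrite /ball /= distrC.
  apply: le_lt_trans v1; have := ler_cabsB v w; have := ler_cabsB w v.
  by rewrite (cabsBC w) ler_norml => ? ?; apply/andP; split; lra.
rewrite distrC; apply: H2; rewrite /ball /= distrC.
have -> : Im v / Re v - Im w / Re w =
    ((Im v - Im w) * Re w - Im w * (Re v - Re w)) / (Re v * Re w).
  by field; rewrite !gt_eqF.
rewrite normrM normfV (gtr0_norm (mulr_gt0 rv0 w0)) ltr_pdivrMr ?mulr_gt0//.
apply: le_lt_trans (ler_normB _ _) _; rewrite !normrM (gtr0_norm w0).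
apply: (@le_lt_trans _ _ (cabs (v - w) * (Re w + `|Im w|))).
  rewrite mulrDr lerD//; first by rewrite ler_wpM2r// ltW.
  by rewrite mulrC ler_wpM2r.
apply: (@lt_trans _ _ (D * d2 * (Re w + `|Im w|))); first by rewrite ltr_pM2r.
rewrite /D mulrAC divfK ?gt_eqF// mulrC -mulrA; rewrite ltr_pM2l//.
by rewrite mulrC ltr_pM2r.
Qed.

(** Inverse function argument: with k = Log (w + h) - Log w, the exponential gives h / w = cexp k -
    1, which is k up to a small multiple of |k|; continuity of [Log] makes k small. *)
Lemma cderiv_Log w : 0 < Re w -> cderiv Log w w^-1.
Proof.
move=> w0 e e0; have wn := Re_pos_neq0 w0.
have c0 : 0 < cabs w by rewrite cabs_gt0.
pose e' := Num.min 2^-1 (e * cabs w / 2).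
have e'0 : 0 < e' by rewrite /e' lt_min invr_gt0 ltr0n /= divr_gt0// mulr_gt0.
have e'1 : e' <= 2^-1 by rewrite /e' ge_min lexx.
have e'2 : e' <= e * cabs w / 2 by rewrite /e' ge_min lexx orbT.
clearbody e'.
have [d1 d10 H1] := @cderiv_cexp0 R _ e'0.
have [d2 d20 H2] := ccont_Log w0 d10.
exists (Num.min (Re w) d2) => [|h]; first by rewrite lt_min w0.
rewrite lt_min => /andP[h1 h2].
have wh0 : 0 < Re (w + h).
  by have := Re_le_cabs h; rewrite cReD ler_norml => /andP[]; lra.
set k := Log (w + h) - Log w.
have ek : h / w = cexp k - 1.
  have : cexp (Log w) * cexp k = w + h by rewrite -cexpD /k addrC subrK cexp_Log.
  by rewrite cexp_Log// => E; have -> : h = w * cexp k - w; [rewrite E addrC addKr|field].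
have kd : cabs k < d1 by apply: H2; rewrite addrC addKr.
have := H1 _ kd; rewrite cexp0 add0r mul1r -ek => H3.
have hw : cabs (h / w) = cabs h / cabs w by rewrite cabsM cabsV.
have k2 : cabs k <= 2 * cabs (h / w).
  have := ler_cabsB k (h / w); rewrite cabsBC => H4.
  have : e' * cabs k <= 2^-1 * cabs k by rewrite ler_wpM2r// cabs_ge0.
  lra.
rewrite mulrC cabsBC; apply: le_trans H3 _.
apply: (@le_trans _ _ (e * cabs w / 2 * (2 * (cabs h / cabs w)))).
  by apply: ler_pM; rewrite ?cabs_ge0 ?(ltW e'0)// -hw.
by rewrite le_eqVlt; apply/orP; left; apply/eqP; field; rewrite gt_eqF.
Qed.

Lemma cdiff_Log w : 0 < Re w -> cdiff Log w.
Proof. by move=> w0; exists w^-1; exact: cderiv_Log. Qed.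

Definition csqrt w := cexp (2^-1 * Log w).

Lemma sqr_csqrt w : 0 < Re w -> csqrt w ^+ 2 = w.
Proof.
move=> w0; rewrite expr2 -cexpD -mulrDl.
have -> : (2^-1 + 2^-1 : R[i]) = 1 by rewrite -mulr2n -[_ *+ 2]mulr_natl mulfV// pnatr_eq0.
by rewrite mul1r cexp_Log.
Qed.

Lemma cdiff_cexp z : cdiff (@cexp R) z.
Proof. by exists (cexp z); exact: cderiv_cexp. Qed.

Lemma cdiff_csqrt w : 0 < Re w -> cdiff csqrt w.
Proof.
move=> w0; apply: (@cdiff_comp R (fun z => 2^-1 * Log z) (@cexp R)); last exact: cdiff_cexp.
by apply: cdiffM; [exact: cdiff_cst|exact: cdiff_Log].
Qed.

End Logarithm.

(** * Blaschke factors and square roots for polynomials *)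

Section PolynomialFactorization.
Variable R : realType.
Local Notation ang := (@angles R).
Local Notation pt := (@circle_pt R).
Implicit Types (f g b h : R[i] -> R[i]) (a z w c : R[i]).

Lemma analytic_cdiffP f : (forall z, cabs z < 1 -> cdiff f z) -> analytic f.
Proof. by move=> H; apply/analyticP => z; exact: H. Qed.

Lemma Re_oneB w z : cabs w <= 1 -> cabs z < 1 -> 0 < Re (1 - w * z).
Proof.
move=> w1 z1; rewrite cReB /= subr_gt0; apply: le_lt_trans (Re_le _) _.
rewrite cabsM; apply: le_lt_trans z1.
by rewrite -[leRHS]mul1r ler_wpM2r// cabs_ge0.
Qed.

Lemma root_sqrt w : cabs w <= 1 -> analytic (fun z => csqrt (1 - w * z)) /\
  forall z, cabs z < 1 -> csqrt (1 - w * z) ^+ 2 = 1 - w * z.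
Proof.
move=> w1; split=> [|z z1]; last exact/sqr_csqrt/Re_oneB.
apply: analytic_cdiffP => z z1; apply: (@cdiff_comp R (fun z => 1 - w * z) (@csqrt R)).
  by apply: cdiffB; [|apply: cdiffM]; [exact: cdiff_cst..|exact: cdiff_id].
exact/cdiff_csqrt/Re_oneB.
Qed.

Lemma blaschke_sqr a z :
  cabs (1 - a^* * z) ^+ 2 - cabs (z - a) ^+ 2 = (1 - cabs a ^+ 2) * (1 - cabs z ^+ 2).
Proof.
case: a => a1 a2; case: z => z1 z2.
by rewrite !sqr_cabs !cReB !cImB !cReM !cImM /=; ring.
Qed.

Lemma blaschke_le a z : cabs a <= 1 -> cabs z <= 1 -> cabs (z - a) <= cabs (1 - a^* * z).
Proof.
move=> a1 z1; rewrite -ler_sqr ?nnegrE ?cabs_ge0// -subr_ge0 blaschke_sqr.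
by rewrite mulr_ge0// subr_ge0 exprn_ile1// cabs_ge0.
Qed.

Lemma blaschke_eq a z : cabs z = 1 -> cabs (1 - a^* * z) = cabs (z - a).
Proof.
move=> z1; apply/eqP; rewrite -(@eqrXn2 _ 2)// ?cabs_ge0// -subr_eq0 blaschke_sqr.
by rewrite z1 expr1n subrr mulr0.
Qed.

(** Zeros inside the disk are carried by b, so that g keeps linear factors without zeros there and
    has an analytic square root h; g has the modulus of p on the circle, which transfers an L^1
    bound on p to an L^2 bound on h. *)
Record factored (p b h g : R[i] -> R[i]) : Prop := Factored {
  fact_b : analytic b;
  fact_h : analytic h;
  fact_g : forall z, ccont g z;
  fact_b1 : forall z, cabs z < 1 -> cabs (b z) <= 1;
  fact_hh : forall z, cabs z < 1 -> h z ^+ 2 = g z;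
  fact_bg : forall z, cabs z < 1 -> b z * g z = p z;
  fact_circle : forall z, cabs z = 1 -> cabs (g z) = cabs (p z) }.

Lemma ccontM f g z : (forall z, cdiff g z) -> ccont f z -> ccont (fun z => f z * g z) z.
Proof.
move=> gd fc e e0.
have gc := cdiff_cont (gd z).
have f0 := cabs_ge0 (f z); have g0 := cabs_ge0 (g z).
have e1 : 0 < Num.min 1 (e / (2 * (cabs (g z) + 1))).
  by rewrite lt_min ltr01 divr_gt0// mulr_gt0// ltr_wpDl.
have e2 : 0 < Num.min 1 (e / (2 * (cabs (f z) + 1))).
  by rewrite lt_min ltr01 divr_gt0// mulr_gt0// ltr_wpDl.
have [d1 d10 H1] := fc _ e1; have [d2 d20 H2] := gc _ e2.
exists (Num.min d1 d2) => [|w]; first by rewrite lt_min d10.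
rewrite lt_min => /andP[/H1 + /H2]; rewrite !lt_min => /andP[a1 a2] /andP[b1 b2].
have -> : f w * g w - f z * g z = (f w - f z) * g w + f z * (g w - g z) by ring.
have gw : cabs (g w) <= cabs (g z) + 1.
  have := cabsD (g w - g z) (g z); rewrite subrK; move: b1; clear; lra.
apply: le_lt_trans (cabsD _ _) _; rewrite !cabsM.
have -> : e = e / (2 * (cabs (g z) + 1)) * (cabs (g z) + 1) +
    (cabs (f z) + 1) * (e / (2 * (cabs (f z) + 1))).
  by field; rewrite !gt_eqF// ltr_wpDl.
apply: ltr_leD.
  apply: (@le_lt_trans _ _ (cabs (f w - f z) * (cabs (g z) + 1))).
    by rewrite ler_wpM2l// cabs_ge0.
  by rewrite ltr_pM2r// ltr_wpDl.
by apply: ler_pM; rewrite ?cabs_ge0 ?lerDl ?ltW.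
Qed.

(** A root with |a| < 1 gives b the Blaschke factor and g the factor 1 - conj(a) z, of the same
    modulus as z - a on the circle. A root with |a| >= 1 gives g the factor z - a = - a (1 - z / a).
    In both cases the bracket has positive real part in the disk, where [csqrt] is analytic. *)
Lemma factored_prod (s : seq R[i]) c :
  exists b h g, factored (fun z => c * \prod_(a <- s) (z - a)) b h g.
Proof.
elim: s => [|a s [b [h [g [fb fh fg b1 hh bg gc]]]]].
  exists (fun=> 1), (fun=> sqrtc c), (fun=> c); split.
  - exact: analytic_cst.
  - exact: analytic_cst.
  - by move=> z; exact/cdiff_cont/cdiff_cst.
  - by move=> z _; rewrite cabs1.
  - by move=> z _; exact: sqr_sqrtc.
  - by move=> z _; rewrite big_nil mul1r mulr1.
  - by move=> z _; rewrite big_nil mulr1.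
have [a1|a1] := ltP (cabs a) 1.
  have ac1 : cabs a^* <= 1 by rewrite cabs_conj ltW.
  have [sa sq] := root_sqrt ac1.
  have lin z : cdiff (fun z => 1 - a^* * z) z.
    by apply: cdiffB; [|apply: cdiffM]; [exact: cdiff_cst..|exact: cdiff_id].
  have n0 z : cabs z < 1 -> 1 - a^* * z != 0.
    by move=> z1; exact/Re_pos_neq0/Re_oneB.
  exists (fun z => b z * ((z - a) / (1 - a^* * z))), (fun z => h z * csqrt (1 - a^* * z)),
    (fun z => g z * (1 - a^* * z)); split.
  - apply: analyticM fb _; apply: analytic_cdiffP => z z1.
    apply: cdiff_div; [exact: n0| |exact: lin].
    by apply: cdiffB; [exact: cdiff_id|exact: cdiff_cst].
  - exact: analyticM fh sa.
  - by move=> z; exact: ccontM.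
  - move=> z z1; rewrite cabsM -[leRHS]mulr1; apply: ler_pM; rewrite ?cabs_ge0//; first exact: b1.
    rewrite cabsM cabsV ler_pdivrMr ?mul1r ?cabs_gt0 ?n0//.
    by apply: blaschke_le; exact: ltW.
  - by move=> z z1; rewrite exprMn hh// sq.
  - move=> z z1; transitivity ((z - a) * (b z * g z)); last by rewrite bg// big_cons mulrCA.
    have := n0 z z1; set k := 1 - _; clearbody k => kn.
    by field.
  - move=> z z1; rewrite big_cons mulrCA !cabsM gc// cabsM blaschke_eq//.
    by rewrite mulrC.
have an : a != 0 by rewrite -cabs_gt0 (lt_le_trans ltr01).
have w1 : cabs a^-1 <= 1 by rewrite cabsV invf_le1// (lt_le_trans ltr01).
have [sa sq] := root_sqrt w1.
exists b, (fun z => h z * (sqrtc (- a) * csqrt (1 - a^-1 * z))), (fun z => g z * (z - a)); split.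
- exact: fb.
- by apply: analyticM fh _; apply: analyticZ sa.
- move=> z; apply: ccontM => // {}z.
  by apply: cdiffB; [exact: cdiff_id|exact: cdiff_cst].
- exact: b1.
- move=> z z1; rewrite 2!exprMn hh// sq// sqr_sqrtc; congr (_ * _).
  by rewrite mulrBr mulr1 mulNr mulrA mulfV// mul1r opprK addrC.
- by move=> z z1; rewrite big_cons mulrA bg// mulrAC -mulrA.
- by move=> z z1; rewrite big_cons mulrCA !cabsM gc// cabsM mulrC.
Qed.

(** Inside the disk |h|^2 = |g|; as g is continuous up to the circle, the means of |h|^2 near radius
    1 exceed that of |p| by at most e. *)
Lemma factored_h2le p b h g : factored p b h g ->
  h2le h (mean (fun t => cabs (p (expi t)))).
Proof.
move=> [fb fh fg b1 hh bg gc] N; apply/ler_addgt0Pr => e e0.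
have [d d0 Hd] := @near_circle_ccont R g 1 ler01 (fun z _ => fg z) _ e0.
apply: (coef_limit_near N fh d0) => r r0 r1 rd.
have rd' : `|r - 1| < d by rewrite ltr0_norm ?subr_lt0// opprB ltrBlDr -ltrBlDl.
have gi : mintegrable (fun t => cabs (g (pt 1 t))).
  by apply: rcont_mintegrable => t _; apply: rcont_circle; exact: fg.
have cp t : cabs (p (expi t)) = cabs (g (pt 1 t)).
  by rewrite gc ?cabs_circle_pt//; rewrite /circle_pt mul1r.
have -> : mean (fun t => cabs (p (expi t))) = mean (fun t => cabs (g (pt 1 t))).
  by congr mean; apply: funext.
rewrite -[e]mean_cst -meanD//; last exact: mintegrable_cst.
apply: mean_le; first by apply: rcont_sqr_mintegrable => t _; exact: analytic_rcont fh (ltW r0) r1.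
  by apply: mintegrableD => //; exact: mintegrable_cst.
move=> t tt; rewrite -cabsX hh ?cabs_circle_pt ?(ltW r0)//.
have := Hd r rd' t tt => /ltW; have := ler_cabsB (g (pt r t)) (g (pt 1 t)); lra.
Qed.

Lemma factored_psum (c : nat -> R[i]) N : exists b h g, factored (psum c N) b h g.
Proof.
pose p := \poly_(n < N) c n.
have [s Ep] := closed_field_poly_normal p.
have [b [h [g H]]] := factored_prod s (lead_coef p).
exists b, h, g; suff -> : psum c N = (fun z => lead_coef p * \prod_(a <- s) (z - a)) by [].
apply: funext => z; rewrite /psum -horner_poly -/p Ep hornerZ horner_prod.
congr (_ * _); first by rewrite -Ep.
by apply: eq_bigr => a _; rewrite hornerXsubC.
Qed.

End PolynomialFactorization.

(** * Factorization in the Hardy space of order one *)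

Section HardyOne.
Variable R : realType.
Local Notation ang := (@angles R).
Local Notation mu := (@lebesgue_measure R).
Local Notation cm := (circle_measure R).
Local Notation pt := (@circle_pt R).
Local Notation mR := (measurableTypeR R).
Implicit Types (f g b h : R[i] -> R[i]) (a z l : R[i]) (r e s t : R).

Lemma lucvg_pt (u : nat -> R[i] -> R[i]) g z e : lucvg u g -> cabs z < 1 -> 0 < e ->
  exists N, forall n, (N <= n)%N -> cabs (u n z - g z) <= e.
Proof. by move=> ug z1 e0; have [N HN] := ug _ _ z1 e0; exists N => n /HN; exact. Qed.

Lemma lucvg_coef (u : nat -> R[i] -> R[i]) g k e : (forall n, analytic (u n)) ->
  analytic g -> lucvg u g -> 0 < e ->
  exists N, forall n, (N <= n)%N -> cabs (coef (u n) k - coef g k) < e.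
Proof.
move=> ua ga ug e0; have h0 : 0 < 2^-1 :> R by rewrite invr_gt0.
have h1 : 2^-1 < 1 :> R by rewrite invf_lt1// ltr1n.
have e1 : 0 < e / 2 * 2^-1 ^+ k by rewrite mulr_gt0 ?divr_gt0// exprn_gt0.
have [N HN] := ug _ _ h1 e1; exists N => n /HN H.
rewrite -(tcoefB k (ua n) ga).
have da := analyticB (ua n) ga.
apply: le_lt_trans (coef_le k da h0 h1) _; rewrite ltr_pdivrMr ?exprn_gt0//.
apply: (@le_lt_trans _ _ (e / 2 * 2^-1 ^+ k)).
  apply: (avg_bound da (ltW h0) h1) => t; apply: H.
  by rewrite cabs_circle_pt// ltW.
by rewrite ltr_pM2r ?exprn_gt0// ltr_pdivrMr// mulr_natr mulr2n ltrDl.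
Qed.

Lemma h2le_lucvg (u : nat -> R[i] -> R[i]) g A : (forall n, analytic (u n)) ->
  analytic g -> lucvg u g -> (forall n, h2le (u n) A) -> h2le g A.
Proof.
move=> ua ga ug uA N.
have h k : (fun n => cabs (coef (u n) k) ^+ 2) @ \oo --> cabs (coef g k) ^+ 2.
  by apply: cvg_cabs_sqr => e e0; exact: lucvg_coef ua ga ug e0.
have H : (fun n => \sum_(k < N) cabs (coef (u n) k) ^+ 2) @ \oo -->
    \sum_(k < N) cabs (coef g k) ^+ 2.
  elim: N => [|N IH].
    by under eq_fun do rewrite big_ord0; rewrite big_ord0; exact: cvg_cst.
  by under eq_fun do rewrite big_ord_recr /=; rewrite big_ord_recr /=; apply: cvgD.
apply: (closed_cvg (fun x => x <= A)) H; first exact: closed_le.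
by apply: nearW => n; exact: uA.
Qed.

Lemma lucvg_sub (u : nat -> R[i] -> R[i]) g (k : nat -> nat) :
  {homo k : m n / (m < n)%N} -> lucvg u g -> lucvg (u \o k) g.
Proof.
move=> kh ug r e r1 e0; have [N HN] := ug r e r1 e0; exists N => n Nn.
apply: HN; apply: leq_trans Nn _; elim: n => // n IH.
by apply: leq_ltn_trans IH _; exact: kh.
Qed.

Lemma bounded_h2le b : analytic b -> (forall z, cabs z < 1 -> cabs (b z) <= 1) -> h2le b 1.
Proof.
move=> ba b1 N; apply: (@coef_limit R b N _ ba) => r r0 r1.
rewrite -[1](@mean_cst R); apply: mean_le.
- by apply: rcont_sqr_mintegrable => t _; exact: analytic_rcont ba (ltW r0) r1.
- exact: mintegrable_cst.
- by move=> t _; rewrite exprn_ile1 ?cabs_ge0// b1// cabs_circle_pt ?(ltW r0).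
Qed.

(** The dilation z -> f (rho n * z) is approximated on the closed disk by its Taylor polynomials,
    uniformly, since the circle of radius rho n lies inside the disk where f is analytic. *)
Lemma psum_approx f A (n : nat) : analytic f ->
  (forall r, 0 <= r -> r < 1 -> avg f r <= A) ->
  exists N, forall z, cabs z <= 1 ->
  cabs (psum (fun k => coef f k * (rho R n)%:C ^+ k) N z - f ((rho R n)%:C * z)) <= n.+1%:R^-1.
Proof.
move=> fa fA; have r0 := rho_gt0 R n; have r1 := rho_lt1 R n.
set s := rho R n in r0 r1 *; set r := (1 + s) / 2.
have sr : s < r by rewrite /r ltr_pdivlMr//; lra.
have rr1 : r < 1 by rewrite /r ltr_pdivrMr//; lra.
have rr0 : 0 < r by apply: lt_trans sr.
clearbody r.
have q0 : 0 <= s / r by rewrite divr_ge0 ?ltW.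
have q1 : s / r < 1 by rewrite ltr_pdivrMr// mul1r.
have c0 : 0 < 1 - s / r by rewrite subr_gt0.
have A0 : 0 <= A by apply: le_trans (fA _ (ltW rr0) rr1); exact: avg_ge0.
have i0 : 0 < n.+1%:R^-1 :> R by rewrite invr_gt0 ltr0n.
have [N HN] := expr_small q0 q1 (divr_gt0 (mulr_gt0 i0 c0) (ltr_wpDl A0 ltr01)).
exists N => z z1.
have zs : cabs (s%:C * z) <= s by rewrite cabsM cabs_real (gtr0_norm r0) ler_piMr// ltW.
have zr : cabs (s%:C * z) < r by apply: le_lt_trans sr.
have -> : psum (fun k => coef f k * s%:C ^+ k) N z = psum (coef f) N (s%:C * z).
  by apply: eq_bigr => k _; rewrite exprMn mulrA.
rewrite cabsBC; apply: le_trans (taylor N fa zr rr1) _.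
set x := cabs (s%:C * z) in zs zr *; have x0 : 0 <= x by exact: cabs_ge0.
clearbody x.
have xs : x / r <= s / r by rewrite ler_pM2r ?invr_gt0.
have e1 : (x / r) ^+ N <= (s / r) ^+ N.
  by rewrite lerXn2r ?nnegrE// divr_ge0// ltW.
have e2 : (1 - x / r)^-1 <= (1 - s / r)^-1.
  by rewrite lef_pV2 ?posrE// ?lerD2l ?lerN2// subr_gt0 (le_lt_trans xs).
apply: (@le_trans _ _ (A * ((s / r) ^+ N / (1 - s / r)))).
  apply: ler_pM; [exact: avg_ge0| |exact: fA (ltW rr0) rr1|].
    by rewrite divr_ge0 ?exprn_ge0 ?divr_ge0 ?(ltW rr0)// subr_ge0 (le_trans xs)// ltW.
  apply: ler_pM => //; first by rewrite exprn_ge0// divr_ge0// ltW.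
  by rewrite invr_ge0 subr_ge0 (le_trans xs)// ltW.
rewrite mulrA ler_pdivrMr//.
apply: (@le_trans _ _ (A * (n.+1%:R^-1 * (1 - s / r) / (A + 1)))).
  by apply: ler_wpM2l; [exact: A0|exact: ltW].
rewrite mulrA ler_pdivrMr ?ltr_wpDl// mulrC ler_wpM2l ?lerDl//.
by apply: mulr_ge0; exact: ltW.
Qed.

Lemma cvg_unique_cabs (x : nat -> R[i]) l m :
  (forall e, 0 < e -> exists N, forall n, (N <= n)%N -> cabs (x n - l) <= e) ->
  (forall e, 0 < e -> exists N, forall n, (N <= n)%N -> cabs (x n - m) <= e) -> l = m.
Proof.
move=> Hl Hm; apply/eqP; rewrite -subr_eq0 -cabs_eq0 eq_le cabs_ge0 andbT.
apply/ler_addgt0Pr => e e0; rewrite add0r.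
have e2 : 0 < e / 2 by rewrite divr_gt0.
have [N1 H1] := Hl _ e2; have [N2 H2] := Hm _ e2.
have := H1 _ (leq_maxl N1 N2); have := H2 _ (leq_maxr N1 N2).
set y := x _ => h2 h1; have -> : l - m = (y - m) - (y - l) by ring.
apply: le_trans (cabsB _ _) _; move: h1 h2; clear; lra.
Qed.

(** A weak form of F. Riesz's factorization. Polynomials close to the dilations of f factor as b_n
    h_n^2; the b_n are bounded by 1 and the h_n have squared norms at most A + 1, the + 1 absorbing
    the approximation error. Two successive extractions give limits, and b_n h_n^2 converges at each
    point both to f and to the product of the limits. *)
Lemma H1_factor f A : analytic f -> (forall r, 0 <= r -> r < 1 -> avg f r <= A) ->
  exists b h, [/\ analytic b, forall z, cabs z < 1 -> cabs (b z) <= 1, H2 h &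
    forall z, cabs z < 1 -> f z = b z * h z ^+ 2].
Proof.
move=> fa fA.
have A0 : 0 <= A by apply: le_trans (fA _ (lexx 0) ltr01); exact: avg_ge0.
have step n : exists bh : (R[i] -> R[i]) * (R[i] -> R[i]),
  [/\ analytic bh.1, analytic bh.2, (forall z, cabs z < 1 -> cabs (bh.1 z) <= 1),
   h2le bh.2 (A + 1) & forall z, cabs z < 1 ->
   cabs (bh.1 z * bh.2 z ^+ 2 - f ((rho R n)%:C * z)) <= n.+1%:R^-1].
  have [N HN] := psum_approx n fa fA.
  have [b [h [g H]]] := factored_psum (fun k => coef f k * (rho R n)%:C ^+ k) N.
  exists (b, h); split => /=; [exact: fact_b H|exact: fact_h H|exact: fact_b1 H| |].
    move=> K; apply: le_trans (factored_h2le H K) _.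
    apply: (@le_trans _ _ (avg f (rho R n) + 1)); last first.
      by rewrite lerD2r; apply: fA; [exact/ltW/rho_gt0|exact: rho_lt1].
    have fi : mintegrable (fun t => cabs (f (pt (rho R n) t))).
      by apply: rcont_mintegrable => t _; apply: analytic_rcont fa _ _;
        [exact/ltW/rho_gt0|exact: rho_lt1].
    rewrite -[1 in leRHS](@mean_cst R) /avg -meanD//; last exact: mintegrable_cst.
    apply: mean_le.
    - apply: (@rcont_mintegrable R (fun t => psum _ N (expi t))) => t _.
      by apply: rcont_comp; [exact: cont_expi|exact: psum_ccont].
    - by apply: mintegrableD => //; exact: mintegrable_cst.
    - move=> t _; have := HN (expi t); rewrite cabs_expi => /(_ (lexx _)).
      set x := psum _ _ _; rewrite -/(circle_pt _ t); set y := f _ => h1.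
      have : n.+1%:R^-1 <= 1 :> R by rewrite invf_le1 ?ltr0n// ler1n.
      move: h1 (ler_cabsB x y); set q := _^-1; move: (cabs _) (cabs x) (cabs y) q; clear; move=> *; lra.
  by move=> z z1; rewrite (fact_hh H z1) (fact_bg H z1); exact/HN/ltW.
have {step}[bh Hbh] := choice step.
pose b n := (bh n).1; pose h n := (bh n).2.
have ba n : analytic (b n) by have [x1 x2 x3 x4 x5] := Hbh n; exact: x1.
have ha n : analytic (h n) by have [x1 x2 x3 x4 x5] := Hbh n; exact: x2.
have b1 n z : cabs z < 1 -> cabs (b n z) <= 1 by have [_ _ H _ _] := Hbh n; exact: H.
have hA n : h2le (h n) (A + 1) by have [x1 x2 x3 x4 x5] := Hbh n; exact: x4.
have bhf n z : cabs z < 1 ->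
    cabs (b n z * h n z ^+ 2 - f ((rho R n)%:C * z)) <= n.+1%:R^-1.
  by have [_ _ _ _ H] := Hbh n; exact: H.
clearbody b h; clear bh Hbh.
have [k1 [B [k1h Ba Bu]]] : exists (k : nat -> nat) g,
    [/\ {homo k : m n / (m < n)%N}, analytic g & lucvg (b \o k) g].
  apply: montel => [n|r r0 r1]; first exact: ba.
  exists 1 => n z zr.
  by apply: b1; apply: le_lt_trans r1.
have [k2 [H [k2h Ha Hu]]] : exists (k : nat -> nat) g,
    [/\ {homo k : m n / (m < n)%N}, analytic g & lucvg ((h \o k1) \o k) g].
  apply: montel => [n|r r0 r1]; first exact: ha.
  exists (Num.sqrt ((A + 1) * (1 / (1 - r ^+ 2)))) => n z zr.
  have z1 : cabs z < 1 by apply: le_lt_trans r1.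
  have A1 : 0 < A + 1 by rewrite ltr_wpDl.
  have := @h2_point R (h (k1 n)) (A + 1) 0 z (ha _) A1 (hA _) ltac:(by []) z1.
  rewrite muln0 expr0 => h2.
  rewrite -(ger0_norm (cabs_ge0 (h (k1 n) z))) -sqrtr_sqr ler_wsqrtr//.
  apply: le_trans h2 _; apply: ler_wpM2l; first exact: ltW.
  have r21 : r ^+ 2 < 1 by rewrite expr2 mulr_ilt1// ltW.
  have zr2 : cabs z ^+ 2 <= r ^+ 2 by rewrite lerXn2r ?nnegrE ?cabs_ge0// ltW.
  rewrite !div1r lef_pV2 ?posrE ?subr_gt0//; first by rewrite lerD2l lerN2.
  exact: le_lt_trans r21.
have HA : h2le H (A + 1).
  apply: h2le_lucvg Ha Hu _ => n; first exact: ha.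
  exact: hA.
exists B, H; split.
- exact: Ba.
- move=> z z1; apply/ler_addgt0Pr => e e0.
  have [N HN] := lucvg_pt Bu z1 e0; have := HN N (leqnn _) => /= h1.
  have := b1 (k1 N) z z1; have := ler_cabsB (B z) (b (k1 N) z).
  by rewrite cabsBC; move: h1; clear; lra.
- by split; [exact: Ha|exists (A + 1)].
move=> z z1.
pose k := k1 \o k2; have kh : {homo k : m n / (m < n)%N} by move=> m n mn; apply/k1h/k2h.
have kn n : (n <= k n)%N.
  by elim: n => // n IH; apply: leq_ltn_trans IH _; exact: kh.
apply: (@cvg_unique_cabs (fun n => b (k n) z * h (k n) z ^+ 2)) => e e0.
  have e2 : 0 < e / 2 by rewrite divr_gt0.
  have [d d0 Hd] := cdiff_cont (analytic_cdiff fa z1) e2.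
  have [N1 HN1] := rho_near d0.
  have [N2 HN2] : exists N, forall n, (N <= n)%N -> n.+1%:R^-1 <= e / 2 :> R.
    have i0 : 0 <= (e / 2)^-1 by rewrite invr_ge0 ltW.
    exists (Num.bound (e / 2)^-1) => n Nn.
    rewrite -[leRHS]invrK lef_pV2 ?posrE ?invr_gt0 ?ltr0n//.
    by apply: le_trans (ltW (archi_boundP i0)) _; rewrite ler_nat leqW.
  exists (maxn N1 N2) => n; rewrite geq_max => /andP[n1 n2].
  have kn1 := leq_trans n1 (kn n); have kn2 := leq_trans n2 (kn n).
  have a1 := bhf (k n) z z1; have a2 := HN2 _ kn2.
  have a3 : cabs (f ((rho R (k n))%:C * z) - f z) < e / 2.
    apply: Hd; rewrite -{2}[z]mul1r -mulrBl cabsM.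
    have := HN1 _ kn1; have := rho_lt1 R (k n); set rr := rho R _ => q1 q2.
    have -> : rr%:C - 1 = (rr - 1)%:C :> R[i].
      by apply: complex_eq; rewrite ?cReB ?cImB /= ?subr0.
    rewrite cabs_real ltr0_norm ?subr_lt0// opprB.
    apply: (@le_lt_trans _ _ (1 - rr)); last lra.
    by rewrite ler_piMr ?(ltW z1)// subr_ge0 ltW.
  set x := _ * _; rewrite -(subrK (f ((rho R (k n))%:C * z)) x) -addrA.
  have a4 := le_trans a1 a2; rewrite -/x in a4.
  by apply: le_trans (cabsD _ _) _; apply: le_trans (lerD a4 (ltW a3)) _; rewrite -splitr.
have Bc := lucvg_sub k2h Bu.
have Kc := Hu; have z0 := cabs_ge0 (H z).
have Hz0 := cabs_ge0 (H z).
pose e' := Num.min 1 (e / ((cabs (H z) + 1) ^+ 2 + 2 * cabs (H z) + 1)).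
have D0 : 0 < (cabs (H z) + 1) ^+ 2 + 2 * cabs (H z) + 1.
  by rewrite ltr_wpDl// addr_ge0 ?sqr_ge0// mulr_ge0.
have e'0 : 0 < e' by rewrite /e' lt_min ltr01 divr_gt0.
have e'1 : e' <= 1 by rewrite /e' ge_min lexx.
have e'2 : e' * ((cabs (H z) + 1) ^+ 2 + 2 * cabs (H z) + 1) <= e.
  by rewrite -ler_pdivlMr// /e' ge_min lexx orbT.
clearbody e'.
have [N1 HN1] := lucvg_pt Bc z1 e'0; have [N2 HN2] := lucvg_pt Kc z1 e'0.
exists (maxn N1 N2) => n; rewrite geq_max => /andP[/HN1 n1 /HN2 n2].
have Bz1 : cabs (B z) <= 1.
  apply/ler_addgt0Pr => d d0.
  have [N HN] := lucvg_pt Bu z1 d0; have := HN N (leqnn _) => /= h1.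
  have := b1 (k1 N) z z1; have := ler_cabsB (B z) (b (k1 N) z).
  by rewrite cabsBC; move: h1; clear; lra.
move: n1 n2; rewrite /= -/(k n) => n1 n2.
have e1 : k1 (k2 n) = k n by []. rewrite !e1 in n1 n2.
set x := b (k n) z in n1 *; set y := h (k n) z in n2 *.
have -> : x * y ^+ 2 - B z * H z ^+ 2 =
    (x - B z) * y ^+ 2 + B z * ((y - H z) * (y - H z + 2 * H z)) by ring.
apply: le_trans (cabsD _ _) _; rewrite (cabsM (x - B z)) (cabsM (B z)) (cabsM (y - H z)) cabsX.
have yb : cabs y <= cabs (H z) + 1.
  by have := cabsD (y - H z) (H z); rewrite subrK; move: n2 e'1; clear; lra.
have yb2 : cabs (y - H z + 2 * H z) <= 1 + 2 * cabs (H z).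
  apply: le_trans (cabsD _ _) _; rewrite cabsM.
  have -> : cabs (2 : R[i]) = 2 by rewrite -[2 : R[i]](rmorph_nat (@real_complex R)) cabs_real normr_nat.
  by rewrite lerD2r; apply: le_trans e'1.
apply: le_trans e'2.
have p1 : cabs (x - B z) * cabs y ^+ 2 <= e' * (cabs (H z) + 1) ^+ 2.
  apply: ler_pM; rewrite ?cabs_ge0 ?exprn_ge0 ?cabs_ge0//.
  by rewrite lerXn2r ?nnegrE ?cabs_ge0// addr_ge0.
have p2 : cabs (B z) * (cabs (y - H z) * cabs (y - H z + 2 * H z)) <= e' * (1 + 2 * cabs (H z)).
  rewrite -[leRHS]mul1r; apply: ler_pM; rewrite ?cabs_ge0 ?mulr_ge0 ?cabs_ge0//.
  by apply: ler_pM; rewrite ?cabs_ge0.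
move: p1 p2; clear; nra.
Qed.

End HardyOne.

(** * Boundary values and Orlicz estimates in the Hardy space of order one *)

Section BoundaryPoisson.
Variable R : realType.
Local Notation ang := (@angles R).
Local Notation mu := (@lebesgue_measure R).
Local Notation cm := (circle_measure R).
Local Notation pt := (@circle_pt R).
Local Notation mR := (measurableTypeR R).
Implicit Types (f g b h : R[i] -> R[i]) (a z l : R[i]) (r e s t : R).

(** Dilation invariance: the kernels on the circles of radius rho n, at the points rho n * a, are
    one fixed kernel on the unit circle. *)
Lemma poisson_scale a s t : 0 < s -> poisson (s%:C * a) s t = poisson a 1 t.
Proof.
move=> s0; rewrite /poisson.
have -> : pt s t - s%:C * a = s%:C * (pt 1 t - a) by rewrite /circle_pt mul1r mulrBr.
rewrite !cabsM cabs_real (gtr0_norm s0) !exprMn.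
have [->|n0] := eqVneq (cabs (pt 1 t - a)) 0; first by rewrite expr0n /= mulr0 invr0 !mulr0.
by field; rewrite n0 gt_eqF.
Qed.

Lemma mmeas_poisson a : cabs a < 1 -> mmeas (poisson a 1).
Proof. by move=> a1; apply: mmeas_cont => t _; exact: cont_poisson. Qed.

Lemma mint_poissonM a (h : R -> R) : cabs a < 1 -> mintegrable h -> (forall t, 0 <= h t) ->
  mintegrable (fun t => poisson a 1 t * h t).
Proof.
move=> a1 hi h0; apply: mintegrable_dom (mintegrableZ ((1 + cabs a) / (1 - cabs a)) hi) _.
  by apply: mmeasM; [exact: mmeas_poisson|exact: mintegrable_meas].
move=> t _; rewrite ger0_norm; last by apply: mulr_ge0; [exact: poisson_ge0|exact: h0].
by apply: ler_wpM2r; [exact: h0|exact: poisson_bound].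
Qed.

(** The kernel is bounded for fixed a, so mean-square convergence to the boundary function survives
    the weight. [sqr_split] is used with eta small against the limiting mean X. *)
Lemma poisson_h2 h a e : H2 h -> cabs a < 1 -> 0 < e ->
  exists N, forall n, (N <= n)%N ->
  mean (fun t => poisson a 1 t * cabs (h (pt (rho R n) t)) ^+ 2) <=
  mean (fun t => poisson a 1 t * cabs (boundary h t) ^+ 2) + e.
Proof.
move=> hh a1 e0; have [ha [A hA]] := hh.
have bi := mint_boundary_sqr hh.
have Pbi := mint_poissonM a1 bi (fun t => sqr_ge0 _).
have P0 t : 0 <= poisson a 1 t by exact: poisson_ge0.
set X := mean (fun t => poisson a 1 t * cabs (boundary h t) ^+ 2).
have X0 : 0 <= X by apply: mean_ge0 => t _; rewrite mulr_ge0// sqr_ge0.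
pose K := (1 + cabs a) / (1 - cabs a).
have K0 : 0 < K by rewrite /K divr_gt0 ?subr_gt0// ltr_pwDl// cabs_ge0.
have [eta eta0 etaX] : exists2 eta, 0 < eta & eta * X <= e / 2.
  exists (e / 2 / (X + 1)); first by rewrite divr_gt0 ?divr_gt0// ltr_wpDl.
  rewrite mulrAC ler_pdivrMr ?ltr_wpDl//.
  by apply: ler_wpM2l; [rewrite ltW// divr_gt0|rewrite lerDl].
have Q0 : 0 < (1 + eta^-1) * K by rewrite mulr_gt0// addr_gt0// invr_gt0.
have e1 : 0 < e / 2 / ((1 + eta^-1) * K) by rewrite divr_gt0// divr_gt0.
have [d d0 Hd] := h2_boundary_cvg ha hA e1.
have [N HN] := rho_near d0; exists N => n /HN rn.
have r0 := rho_gt0 R n; have r1 := rho_lt1 R n; set r := rho R n in rn r0 r1 *.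
have m2 : mmeas (fun t => cabs (h (pt r t) - boundary h t) ^+ 2).
  apply: mmeas_sqr_cabs; apply: cmmeasB; last exact: cmmeas_boundary ha.
  exact: cmmeas_circle ha (ltW r0) r1.
have Hle := Hd r (ltW r0) r1 rn.
have di : mintegrable (fun t => cabs (h (pt r t) - boundary h t) ^+ 2).
  apply: mintegrable_Iang => //; first by move=> t; exact: sqr_ge0.
  by apply: le_lt_trans Hle _; exact: ltry.
move: Hle; rewrite (Iang_mean di) lee_fin => Hle.
have hi : mintegrable (fun t => cabs (h (pt r t)) ^+ 2).
  by apply: rcont_sqr_mintegrable => t _; exact: analytic_rcont ha (ltW r0) r1.
apply: (@le_trans _ _ (mean (fun t => (1 + eta) * (poisson a 1 t * cabs (boundary h t) ^+ 2) +
    ((1 + eta^-1) * K) * cabs (h (pt r t) - boundary h t) ^+ 2))).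
  apply: mean_le.
  - by apply: mint_poissonM => // t; exact: sqr_ge0.
  - by apply: mintegrableD; exact: mintegrableZ.
  move=> t _; set u := cabs (h _); set v := cabs (boundary _ _); set w := cabs (_ - _).
  have uvw : u ^+ 2 <= (1 + eta) * v ^+ 2 + (1 + eta^-1) * w ^+ 2.
    apply: le_trans (sqr_split _ _ eta0).
    rewrite lerXn2r ?nnegrE ?addr_ge0 ?cabs_ge0// /u.
    by rewrite -(subrK (boundary h t) (h (pt r t))) addrC cabsD.
  apply: le_trans (ler_wpM2l (P0 t) uvw) _.
  rewrite mulrDr mulrCA lerD2l mulrCA -mulrA; apply: ler_wpM2l.
    by rewrite addr_ge0// invr_ge0 ltW.
  by apply: ler_wpM2r; [exact: sqr_ge0|exact: poisson_bound].
rewrite meanD ?meanZ//; [|exact: mintegrableZ..].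
rewrite -/X mulrDl mul1r -addrA lerD2l.
have -> : e = e / 2 + e / 2 by field.
apply: lerD; first exact: etaX.
by rewrite mulrC -ler_pdivlMr.
Qed.

Section OneFunction.
Variables (f : R[i] -> R[i]) (A : R).
Hypotheses (fa : analytic f) (fA : forall r, 0 <= r -> r < 1 -> avg f r <= A).

(** Both factors of f = b h^2 are in H^2. *)
Lemma H1_rconv : aeang (rconv f).
Proof.
have [b [h [ba b1 hh fbh]]] := H1_factor fa fA.
have hb : H2 b by split; [exact: ba|exists 1; exact: bounded_h2le].
apply: aeangW (aeangI (H2_rconv hb) (H2_rconv hh)) => t _ [c1 c2].
have h2 := has_rlimM (boundary_rlim c1) (has_rlimM (boundary_rlim c2) (boundary_rlim c2)).
exists (boundary b t * (boundary h t * boundary h t)); apply: has_rlim_ext h2 => z z1.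
by rewrite fbh// expr2.
Qed.

Lemma H1_boundary_int : mintegrable (fun t => cabs (boundary f t)).
Proof.
have mb := cmmeas_boundary fa.
apply: mintegrable_Iang; [exact: mmeas_cabs|by move=> t; exact: cabs_ge0|].
apply: (@le_lt_trans _ _ A%:E); last exact: ltry.
apply: (@fatou_bound R (fun k t => cabs (f (pt (rho R k) t)))).
- move=> k; apply: mmeas_cabs; apply: cmmeas_circle fa _ _; [exact/ltW/rho_gt0|exact: rho_lt1].
- exact: mmeas_cabs.
- by move=> k t; exact: cabs_ge0.
- by move=> t; exact: cabs_ge0.
- apply: aeangW H1_rconv => t _ /boundary_rlim tc.
  apply/cvgrPdist_lt => e e0; have [N HN] := has_rlim_seq tc e0.
  exists N => // n /= /HN; apply: le_lt_trans.
  set x := boundary f t; set y := f _.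
  have := ler_cabsB x y; have := ler_cabsB y x; rewrite (cabsBC x) => h1 h2.
  by rewrite ler_norml; apply/andP; split; move: h1 h2; clear; lra.
- exists 0%N => k _.
  have r0 := rho_gt0 R k; have r1 := rho_lt1 R k.
  rewrite Iang_mean; first by rewrite lee_fin; exact: fA (ltW r0) r1.
  by apply: rcont_mintegrable => t _; exact: analytic_rcont fa (ltW r0) r1.
Qed.

(** The means of |f| on circles have no evident majorant, so Fatou's lemma is applied to the kernel
    times |h|^2 - |f|, nonnegative inside the disk because |b| <= 1. The means of the first part are
    controlled by [poisson_h2], those of the second are at least |f (r a)|, close to |f a|;
    cancelling the part in |h|^2 leaves the claim. *)
Lemma H1_poisson a : cabs a < 1 ->
  cabs (f a) <= mean (fun t => poisson a 1 t * cabs (boundary f t)).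
Proof.
move=> a1; have [b [h [ba b1 hh fbh]]] := H1_factor fa fA.
have [ha [B hB]] := hh.
have P0 t : 0 <= poisson a 1 t by exact: poisson_ge0.
have fi := mint_poissonM a1 H1_boundary_int (fun t => cabs_ge0 _).
have hi := mint_poissonM a1 (mint_boundary_sqr hh) (fun t => sqr_ge0 _).
apply/ler_addgt0Pr => e e0.
(* The absolute value makes F nonnegative at every t, including those where the radial limits fail
   to exist. *)
pose F t := poisson a 1 t * `|cabs (boundary h t) ^+ 2 - cabs (boundary f t)|.
pose X := mean (fun t => poisson a 1 t * cabs (boundary h t) ^+ 2).
have F0 t : 0 <= F t by rewrite /F mulr_ge0.
have mF : mmeas F.
  apply: mmeasM; first exact: mmeas_poisson.
  apply: (@mmeas_comp R (fun x => `|x|)); first exact: norm_continuous.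
  apply: mmeasB; [apply: mmeas_sqr_cabs|apply: mmeas_cabs]; exact: cmmeas_boundary.
have le_fh z : cabs z < 1 -> cabs (f z) <= cabs (h z) ^+ 2.
  move=> z1; rewrite fbh// cabsM cabsX ler_piMl ?sqr_ge0//; exact: b1.
have IF : (Iang F <= (X - cabs (f a) + e)%:E)%E.
  apply: (@fatou_bound R (fun n t => poisson a 1 t *
     `|cabs (h (pt (rho R n) t)) ^+ 2 - cabs (f (pt (rho R n) t))|)).
  - move=> n; have r0 := rho_gt0 R n; have r1 := rho_lt1 R n.
    apply: mmeasM; first exact: mmeas_poisson.
    apply: (@mmeas_comp R (fun x => `|x|)); first exact: norm_continuous.
    apply: mmeasB; [apply: mmeas_sqr_cabs|apply: mmeas_cabs];
      [exact: cmmeas_circle ha (ltW r0) r1|exact: cmmeas_circle fa (ltW r0) r1].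
  - exact: mF.
  - by move=> n t; rewrite mulr_ge0.
  - exact: F0.
  - apply: aeangW (aeangI (H2_rconv hh) H1_rconv) => t _ [c1 c2].
    apply: cvgM; first exact: cvg_cst.
    apply: cvg_norm; apply: cvgB.
      by apply: cvg_cabs_sqr; exact: has_rlim_seq (boundary_rlim c1).
    apply/cvgrPdist_lt => d d0; have [N HN] := has_rlim_seq (boundary_rlim c2) d0.
    exists N => // n /= /HN; apply: le_lt_trans.
    set x := boundary f t; set y := f _.
    have := ler_cabsB x y; have := ler_cabsB y x; rewrite (cabsBC x) => h1 h2.
    by rewrite ler_norml; apply/andP; split; move: h1 h2; clear; lra.
  have e2 : 0 < e / 2 by rewrite divr_gt0.
  have [N1 HN1] := poisson_h2 hh a1 e2.
  have [d d0 Hd] := cdiff_cont (analytic_cdiff fa a1) e2.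
  have [N2 HN2] := rho_near d0.
  exists (maxn N1 N2) => n; rewrite geq_max => /andP[/HN1 n1 /HN2 n2].
  have r0 := rho_gt0 R n; have r1 := rho_lt1 R n; set r := rho R n in n1 n2 r0 r1 *.
  have i1 : mintegrable (fun t => poisson a 1 t * cabs (h (pt r t)) ^+ 2).
    apply: mint_poissonM => //; last by move=> t; exact: sqr_ge0.
    by apply: rcont_sqr_mintegrable => t _; exact: analytic_rcont ha (ltW r0) r1.
  have i2 : mintegrable (fun t => poisson a 1 t * cabs (f (pt r t))).
    apply: mint_poissonM => //; last by move=> t; exact: cabs_ge0.
    by apply: rcont_mintegrable => t _; exact: analytic_rcont fa (ltW r0) r1.
  have -> : (fun t => poisson a 1 t * `|cabs (h (pt r t)) ^+ 2 - cabs (f (pt r t))|) =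
      (fun t => poisson a 1 t * cabs (h (pt r t)) ^+ 2 - poisson a 1 t * cabs (f (pt r t))).
    apply: funext => t; rewrite -mulrBr ger0_norm// subr_ge0; apply: le_fh.
    by rewrite cabs_circle_pt// ltW.
  rewrite Iang_mean; last exact: mintegrableB.
  rewrite meanB// lee_fin.
  have ras : cabs (r%:C * a) < r.
    by rewrite cabsM cabs_real gtr0_norm// gtr_pMr.
  have := poisson_le fa ras r1.
  have -> : (fun t => poisson (r%:C * a) r t * cabs (f (pt r t))) =
      (fun t => poisson a 1 t * cabs (f (pt r t))).
    by apply: funext => t; rewrite poisson_scale.
  have := Hd (r%:C * a).
  have -> : cabs (r%:C * a - a) = (1 - r) * cabs a.
    have -> : r%:C * a - a = (r - 1)%:C * a.
      by apply: complex_eq; rewrite ?cReB ?cImB !rC_mul /=; ring.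
    by rewrite cabsM cabs_real ltr0_norm ?subr_lt0// opprB.
  have ra : (1 - r) * cabs a < d.
    apply: (@le_lt_trans _ _ (1 - r)); last by move: n2; clear; lra.
    by rewrite ler_piMr ?(ltW a1)// subr_ge0 ltW.
  move=> /(_ ra); have := ler_cabsB (f a) (f (r%:C * a)); rewrite cabsBC.
  move: n1; rewrite -/X; set m1 := mean _; set m2 := mean _.
  set x := cabs (f a); set y := cabs (f _); set w := cabs (_ - _).
  move: m1 m2 x y w; clear=> m1 m2 x y w ? ? ? ?.
  lra.
have Fi : mintegrable F.
  by apply: mintegrable_Iang => //; apply: le_lt_trans IF _; exact: ltry.
move: IF; rewrite (Iang_mean Fi) lee_fin => IF.
have : mean (fun t => poisson a 1 t * cabs (boundary h t) ^+ 2 -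
    poisson a 1 t * cabs (boundary f t)) <= mean F.
  apply: mean_le; [exact: mintegrableB|exact: Fi|move=> t _].
  by rewrite -mulrBr; apply: ler_wpM2l; [exact: P0|exact: ler_norm].
rewrite meanB// -/X; move: IF; set m1 := mean _; set m2 := mean _.
by move: X m1 m2 (cabs (f a)); clear=> *; lra.
Qed.

End OneFunction.

(** The slope is the supremum of the difference quotients to the left of y0; by convexity these lie
    below all quotients to the right. *)
Lemma orlicz_subgradient (Psi : R -> R) (y0 : R) : orlicz_function Psi -> 0 < y0 ->
  exists2 sg : R, 0 <= sg & forall y : R, 0 <= y -> Psi y0 + sg * (y - y0) <= Psi y.
Proof.
move=> [Ph Pc P0 Pg _] y00.
pose S := [set s | exists x : R, [/\ 0 <= x, x < y0 & s = (Psi y0 - Psi x) / (y0 - x)]].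
have slopes (x z : R) : 0 <= x -> x < y0 -> y0 < z ->
    (Psi y0 - Psi x) / (y0 - x) <= (Psi z - Psi y0) / (z - y0).
  move=> x0 xy yz; rewrite ler_pdivrMr ?subr_gt0// mulrAC ler_pdivlMr ?subr_gt0//.
  have zx : 0 < z - x by rewrite subr_gt0 (lt_trans xy).
  have t0 : 0 <= (z - y0) / (z - x) by rewrite divr_ge0// ltW// subr_gt0.
  have t1 : (z - y0) / (z - x) <= 1 by rewrite ler_pdivrMr// mul1r; move: xy; clear; lra.
  have := Pc x z _ x0 (ltW (lt_trans y00 yz)) t0 t1.
  have -> : (z - y0) / (z - x) * x + (1 - (z - y0) / (z - x)) * z = y0.
    by field; rewrite gt_eqF.
  have -> : (z - y0) / (z - x) * Psi x + (1 - (z - y0) / (z - x)) * Psi z =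
      ((z - y0) * Psi x + (y0 - x) * Psi z) / (z - x) by field; rewrite gt_eqF.
  by rewrite ler_pdivlMr//; move: (Psi y0) (Psi x) (Psi z); clear=> *; nra.
have S0 : S (Psi y0 / y0) by exists 0; rewrite lexx P0 !subr0.
have Sub : has_ubound S.
  exists ((Psi (y0 + 1) - Psi y0) / (y0 + 1 - y0)) => _ [x [x0 xy ->]].
  by apply: slopes; rewrite ?ltrDl.
have sS : has_sup S by split; [exists (Psi y0 / y0)|].
exists (sup S).
  apply: le_trans (ub_le_sup Sub S0); rewrite divr_ge0 ?(ltW y00)// ltW//; exact: Pg.
move=> y yge; have [yy|yy|->] := ltgtP y y0.
- have Sy : S ((Psi y0 - Psi y) / (y0 - y)) by exists y.
  have := ub_le_sup Sub Sy; rewrite ler_pdivrMr ?subr_gt0//.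
  by move: (Psi y0) (Psi y) (sup S); clear=> *; nra.
- have : sup S <= (Psi y - Psi y0) / (y - y0).
    by apply: ge_sup; [exists (Psi y0 / y0)|move=> _ [x [x0 xy ->]]; exact: slopes].
  by rewrite ler_pdivlMr ?subr_gt0//; move: (Psi y0) (Psi y) (sup S); clear=> *; nra.
- by rewrite subrr mulr0 addr0.
Qed.

Lemma mmeas_orlicz (Psi : R -> R) (h : R -> R) C : orlicz_function Psi -> 0 < C ->
  (forall t, 0 <= h t) -> mmeas h -> mmeas (fun t => Psi (h t / C)).
Proof.
move=> [Ph _ _ _ _] C0 h0 mh.
(* [Psi] is monotone only on the half-line; truncating its argument at 0 makes it monotone, hence
   measurable, on the whole line. *)
have -> : (fun t => Psi (h t / C)) = (fun t => Psi (Num.max 0 (C^-1 * h t))).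
  apply: funext => t; rewrite (mulrC (h t)); congr Psi; apply/esym/max_idPr.
  by rewrite mulr_ge0// invr_ge0 ltW.
have m1 : mmeas (fun t => C^-1 * h t) by apply: mmeasM => //; exact: mmeas_cst.
have mP : measurable_fun setT (fun x : R => Psi (Num.max 0 x)).
  apply: nondecreasing_measurable => // x y xy /=.
  by apply: Ph; [rewrite le_max lexx|rewrite ge_max !le_max lexx xy orbT].
exact: measurableT_comp mP m1.
Qed.

(** Jensen's inequality for the Poisson measure, by integrating the supporting line of [Psi] at |f
    a| / C; the kernel is then bounded by 2 / (1 - |a|). *)
Lemma orlicz_point (Psi : R -> R) f a C M : orlicz_function Psi -> hardy 1 f -> 0 < C ->
  (orlicz_modular cm ang Psi (boundary f) C <= M%:E)%E -> cabs a < 1 ->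
  Psi (cabs (f a) / C) <= 2 / (1 - cabs a) * M.
Proof.
move=> PO /hardy1P[fa [A fA]] C0 fM a1.
have [Ph Pc P0 Pg _] := PO.
pose G t := Psi (cabs (boundary f t) / C).
have n0 t : 0 <= cabs (boundary f t) / C by rewrite divr_ge0 ?cabs_ge0// ltW.
have Pge0 x : 0 <= x -> 0 <= Psi x.
  by rewrite le_eqVlt => /predU1P[<-|/Pg/ltW]//; rewrite P0.
have G0 t : 0 <= G t by exact: Pge0.
have mG : mmeas G.
  by apply: mmeas_orlicz => // [t|]; [exact: cabs_ge0|apply: mmeas_cabs; exact: cmmeas_boundary fa].
have Gi : mintegrable G.
  by apply: mintegrable_Iang => //; apply: le_lt_trans fM _; exact: ltry.
have GM : mean G <= M by move: fM; rewrite -lee_fin -Iang_mean.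
have K0 : 0 < 1 - cabs a by rewrite subr_gt0.
have M0 : 0 <= M by apply: le_trans GM; apply: mean_ge0.
have c0 : 0 <= cabs (f a) / C by rewrite divr_ge0 ?cabs_ge0// ltW.
move: c0; rewrite le_eqVlt => /predU1P[<-|y0].
  by rewrite P0 mulr_ge0// divr_ge0// ltW.
have [sg sg0 Hs] := orlicz_subgradient PO y0.
have pi1 : mintegrable (poisson a 1).
  have := mint_poissonM a1 (@mintegrable_cst R 1) (fun=> ler01).
  by under eq_fun do rewrite mulr1.
have bi := H1_boundary_int fa fA.
have Pbi := mint_poissonM a1 bi (fun t => cabs_ge0 _).
have PGi := mint_poissonM a1 Gi G0.
have key : Psi (cabs (f a) / C) <= mean (fun t => poisson a 1 t * G t).
  apply: (@le_trans _ _ (mean (fun t => (Psi (cabs (f a) / C) - sg * (cabs (f a) / C)) * poisson a 1 t +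
     (sg / C) * (poisson a 1 t * cabs (boundary f t))))).
    rewrite meanD; [|exact: mintegrableZ..]; rewrite (meanZ _ pi1) (meanZ _ Pbi) mean_poisson// mulr1.
    have := H1_poisson fa fA a1; set m := mean _; set x := cabs (f a) => xm.
    rewrite -addrA lerDl.
    have -> : - (sg * (x / C)) + sg / C * m = sg / C * (m - x) by ring.
    by apply: mulr_ge0; [apply: divr_ge0 => //; exact: ltW|rewrite subr_ge0].
  apply: mean_le; [by apply: mintegrableD; exact: mintegrableZ|exact: PGi|move=> t _].
  have := Hs _ (n0 t) => h; have := ler_wpM2l (poisson_ge0 t a1) h.
  by apply: le_trans; rewrite le_eqVlt; apply/orP; left; apply/eqP; field; rewrite gt_eqF.
apply: le_trans key _.
apply: (@le_trans _ _ (mean (fun t => 2 / (1 - cabs a) * G t))).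
  apply: mean_le; [exact: PGi|exact: mintegrableZ|move=> t _].
  apply: ler_wpM2r; first exact: G0.
  apply: le_trans (poisson_bound t a1) _; rewrite ler_pM2r ?invr_gt0//.
  by move: a1; clear; lra.
rewrite meanZ//; apply: ler_wpM2l GM; by rewrite divr_ge0// ltW.
Qed.

End BoundaryPoisson.

(** * The symbol *)

Section Symbol.
Variable R : realType.
Local Notation ang := (@angles R).
Local Notation mu := (@lebesgue_measure R).
Local Notation cm := (circle_measure R).
Local Notation pt := (@circle_pt R).
Local Notation mR := (measurableTypeR R).
Implicit Types (a z l : R[i]) (r e s t L : R).

(** With the constant 2, the real part is at least 2 - ln 2 >= 1 on the closed disk, so that [phi]
    is well defined there. *)
Definition logw z : R[i] := 2 - Log (1 - z).
Definition phi z : R[i] := 1 - (logw z)^-1.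

Lemma cRe2 : Re (2 : R[i]) = 2.
Proof. by rewrite -[2 : R[i]](rmorph_nat (@real_complex R)). Qed.

Lemma cIm2 : Im (2 : R[i]) = 0.
Proof. by rewrite -[2 : R[i]](rmorph_nat (@real_complex R)). Qed.

Lemma oneB_gt0 z : Re z < 1 -> 0 < cabs (1 - z).
Proof.
by move=> z1; rewrite cabs_gt0; apply: Re_pos_neq0; rewrite cReB /= subr_gt0.
Qed.

Lemma ln2_le1 : ln 2 <= 1 :> R.
Proof.
have h : -1 < 1 :> R by lra.
by have := le_ln1Dx h; have -> : 1 + 1 = 2 :> R by ring.
Qed.

Lemma ln_oneB z : cabs z <= 1 -> ln (cabs (1 - z)) <= 1.
Proof.
(* At z = 1 the logarithm takes its default value 0, and the bound persists. *)
move=> z1; have [h|h] := leP (cabs (1 - z)) 0; first by rewrite ln0 // ler01.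
apply: le_trans ln2_le1; rewrite ler_ln ?posrE//.
by have := cabsB 1 z; rewrite cabs1; move: z1; clear; lra.
Qed.

Lemma Re_logw z : Re (logw z) = 2 - ln (cabs (1 - z)).
Proof. by rewrite /logw cReB cRe2. Qed.

Lemma Im_logw z : `|Im (logw z)| <= 2.
Proof.
rewrite /logw cImB cIm2 sub0r normrN /=; set u := _ / _.
have := atan_gtNpi2 u; have := atan_ltpi2 u; have /andP[_] := pihalf_02 R.
by move=> h1 h2 h3; rewrite ler_norml; apply/andP; split; move: h1 h2 h3; clear; lra.
Qed.

Lemma Re_logw_ge1 z : cabs z <= 1 -> 1 <= Re (logw z).
Proof. by move=> /ln_oneB; rewrite Re_logw; lra. Qed.

Lemma logw_neq0 z : cabs z <= 1 -> logw z != 0.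
Proof. by move=> /Re_logw_ge1 h; apply: Re_pos_neq0; apply: lt_le_trans h. Qed.

Lemma cdiff_phi z : cabs z <= 1 -> Re z < 1 -> cdiff phi z.
Proof.
move=> z1 rz; apply: cdiffB; first exact: cdiff_cst.
apply: (@cdiff_local R (fun w => 1 / logw w) _ _ 1) => [//|w _|]; first by rewrite mul1r.
apply: cdiff_div; [exact: logw_neq0|exact: cdiff_cst|].
apply: cdiffB; first exact: cdiff_cst.
apply: (@cdiff_comp R (fun w => 1 - w) (@Log R)); last by apply: cdiff_Log; rewrite cReB subr_gt0.
by apply: cdiffB; [exact: cdiff_cst|exact: cdiff_id].
Qed.

(** With w = [logw z] and x = Re w, |phi z|^2 = 1 - (2 x - 1) / |w|^2 and |w|^2 <= x^2 + 4. The
    constant 6 is 2 + 4, with 4 taken from (2 x - 1) (x + 4) - (x^2 + 4) = (x - 1) (x + 8) >= 0; the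
    factor 2 comes from removing the square. *)
Lemma phi_gap z : cabs z <= 1 ->
  (2 * (6 - ln (cabs (1 - z))))^-1 <= 1 - cabs (phi z).
Proof.
move=> z1; have w0 := logw_neq0 z1; have X1 := Re_logw_ge1 z1; have Y2 := Im_logw z.
have e6 : 6 - ln (cabs (1 - z)) = Re (logw z) + 4 by rewrite Re_logw; ring.
rewrite e6 /phi; move: (logw z) w0 X1 Y2 => w w0 X1 Y2 {e6}.
have c0 : 0 < cabs w by rewrite cabs_gt0.
have E : cabs (1 - w^-1) ^+ 2 = 1 - (2 * Re w - 1) / cabs w ^+ 2.
  have -> : 1 - w^-1 = (w - 1) / w by field.
  rewrite cabsM cabsV exprMn exprVn.
  have -> : cabs (w - 1) ^+ 2 = cabs w ^+ 2 - (2 * Re w - 1).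
    by rewrite !sqr_cabs cReB cImB /=; ring.
  by field; rewrite gt_eqF.
have wb : cabs w ^+ 2 <= Re w ^+ 2 + 4.
  rewrite sqr_cabs lerD2l -[Im w ^+ 2]real_normK ?num_real//.
  have -> : 4 = 2 ^+ 2 :> R by ring.
  by apply: lerXn2r; rewrite ?nnegrE.
have k : (Re w + 4)^-1 <= (2 * Re w - 1) / cabs w ^+ 2.
  rewrite ler_pdivlMr ?exprn_gt0// mulrC ler_pdivrMr; last by move: X1; clear; lra.
  by apply: le_trans wb _; move: X1; clear; move: (Re w) => x; nra.
have p1 : cabs (1 - w^-1) <= 1.
  rewrite -(@expr_le1 _ 2)// ?cabs_ge0// E lerBlDr lerDl; apply: le_trans k.
  by rewrite invr_ge0; move: X1; clear; lra.
rewrite invfM; set q := (Re w + 4)^-1 in k *.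
have := cabs_ge0 (1 - w^-1); move: E k p1.
by move: (cabs (1 - _)) (_ / cabs w ^+ 2) q; clear=> x y q E k p1 x0; nra.
Qed.

Lemma phi_gap_gt0 z : cabs z <= 1 -> 0 < 1 - cabs (phi z).
Proof.
move=> z1; apply: lt_le_trans (phi_gap z1); rewrite invr_gt0.
by have := ln_oneB z1; lra.
Qed.

Lemma phi_near z L : 0 < L -> cabs z < 1 -> cabs (1 - z) <= expR (- L) ->
  cabs (1 - phi z) <= L^-1.
Proof.
move=> L0 z1 zL; rewrite /phi opprB addrC subrK cabsV.
have z0 : 0 < cabs (1 - z) by apply: oneB_gt0; apply: le_lt_trans (Re_le z) z1.
have h : L <= Re (logw z).
  rewrite Re_logw; have : ln (cabs (1 - z)) <= - L.
    by rewrite -[- L]expRK ler_ln ?posrE ?expR_gt0.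
  lra.
rewrite lef_pV2 ?posrE// ?cabs_gt0 ?logw_neq0 ?(ltW z1)//.
exact: le_trans h (Re_le _).
Qed.

Lemma phi_self : analytic_self_map phi.
Proof.
split; last by move=> z /ltW /phi_gap_gt0; rewrite subr_gt0.
apply: analytic_cdiffP => z z1; apply: cdiff_phi; first exact: ltW.
exact: le_lt_trans (Re_le z) z1.
Qed.

(** The constant is 7 instead of the 6 of [phi_gap]: |1 - e^(it)| <= 2 |1 - r e^(it)|, and the extra
    1 absorbs ln 2, giving a bound uniform in r. *)
Definition gap t : R := 7 - ln (cabs (1 - expi t)).

Lemma gap_ge6 t : 6 <= gap t.
Proof. by have := @ln_oneB (expi t); rewrite /gap cabs_expi => /(_ (lexx _)); lra. Qed.

Lemma gap_gt0 t : 0 < gap t.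
Proof. by apply: lt_le_trans (gap_ge6 t). Qed.

Lemma phi_circle r t : 0 <= r -> r < 1 -> Re (expi t) < 1 ->
  (2 * gap t)^-1 <= 1 - cabs (phi (pt r t)).
Proof.
move=> r0 r1 t1; have zr : cabs (pt r t) = r by rewrite cabs_circle_pt.
have z1 : cabs (pt r t) <= 1 by rewrite zr ltW.
apply: le_trans (phi_gap z1); rewrite lef_pV2 ?posrE ?mulr_gt0 ?gap_gt0//; last first.
  by have := ln_oneB z1; lra.
rewrite ler_pM2l// /gap.
have e0 : 0 < cabs (1 - expi t) by exact: oneB_gt0.
have d0 : 0 < cabs (1 - pt r t).
  by apply: oneB_gt0; apply: le_lt_trans (Re_le _) _; rewrite zr.
have h : cabs (1 - expi t) <= 2 * cabs (1 - pt r t).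
  have -> : 1 - expi t = (1 - pt r t) - (expi t - pt r t) by ring.
  apply: le_trans (cabsB _ _) _; rewrite mulr_natl mulr2n lerD2l.
  have -> : expi t - pt r t = (1 - r)%:C * expi t.
    by rewrite /circle_pt; apply: complex_eq; rewrite ?cReB ?cImB !rC_mul /=; ring.
  rewrite cabsM cabs_expi mulr1 cabs_real ger0_norm ?subr_ge0 ?(ltW r1)//.
  by have := ler_cabsB 1 (pt r t); rewrite cabs1 zr.
have : ln (cabs (1 - expi t)) <= ln (2 * cabs (1 - pt r t)).
  by rewrite ler_ln ?posrE// mulr_gt0.
by rewrite lnM ?posrE//; have := ln2_le1; lra.
Qed.

Lemma phi_bdry_gap t : (2 * gap t)^-1 <= 1 - cabs (phi (expi t)).
Proof.
have z1 : cabs (expi t) <= 1 by rewrite cabs_expi.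
apply: le_trans (phi_gap z1); rewrite lef_pV2 ?posrE ?mulr_gt0 ?gap_gt0//.
  by rewrite ler_pM2l// /gap lerD2r ler_nat.
by have := ln_oneB z1; lra.
Qed.

Lemma phi_bdry_lt1 t : cabs (phi (expi t)) < 1.
Proof. by rewrite -subr_gt0 phi_gap_gt0// cabs_expi. Qed.

Lemma aeang_oneB : aeang (fun t => Re (@expi R t) < 1).
Proof.
have n1 (x : R) : mu.-negligible [set x].
  by apply/negligibleP; [exact: measurable_set1|exact: lebesgue_measure_set1].
apply: negligibleS (negligibleU (n1 0) (n1 (2 * pi))) => t /= [].
rewrite /angles /= in_itv /= => /andP[t0 t2] H.
have [->|tn0] := eqVneq t 0; first by left.
have [->|tn2] := eqVneq t (2 * pi); first by right.
exfalso; apply: H => /=.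
have s0 : 0 < sin (t / 2).
  apply: sin_gt0_pi; apply/andP; split; first by rewrite divr_gt0// lt_neqAle eq_sym tn0.
  by rewrite ltr_pdivrMr// mulrC lt_neqAle tn2.
have -> : t = t / 2 *+ 2 by rewrite -mulr_natr divfK.
rewrite cos_mulr2n cos2sin2 mulrnBl.
by move: (exprn_gt0 2 s0); move: (sin _ ^+ 2); clear=> q q0; lra.
Qed.

(** (1 - z)^(-1/2), whose modulus on the circle is e^(-7/2) times the weight [wgt]. *)
Definition rootF z : R[i] := cexp ((- 2^-1)%:C * Log (1 - z)).

Lemma cabs_rootF z : cabs (rootF z) = expR (- ln (cabs (1 - z)) / 2).
Proof. by rewrite /rootF cabs_cexp rC_mul /=; congr expR; ring. Qed.

Lemma cdiff_rootF z : Re z < 1 -> cdiff rootF z.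
Proof.
move=> rz; apply: (@cdiff_comp R (fun w => (- 2^-1)%:C * Log (1 - w)) (@cexp R)); last exact: cdiff_cexp.
apply: cdiffM; first exact: cdiff_cst.
apply: (@cdiff_comp R (fun w => 1 - w) (@Log R)); last by apply: cdiff_Log; rewrite cReB subr_gt0.
by apply: cdiffB; [exact: cdiff_cst|exact: cdiff_id].
Qed.

(* [rootF] is a square root of [1 / (1 - z)], which has positive real part, so
   its argument is at most [pi / 4]. *)
Lemma rootF_Re z : Re z < 1 -> cabs (rootF z) <= 2 * Re (rootF z).
Proof.
move=> rz; have z0 : 0 < Re (1 - z) by rewrite cReB subr_gt0.
have zn := Re_pos_neq0 z0.
have F2 : rootF z ^+ 2 * (1 - z) = 1.
  rewrite -[X in _ * X](cexp_Log z0) /rootF expr2 -!cexpD -[RHS]cexp0; congr cexp.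
  by apply: complex_eq; rewrite !(cReD, cImD) !rC_mul /=; field.
have Fz : rootF z ^+ 2 = (cabs (1 - z) ^- 2)%:C * (1 - z)^*.
  have k : (1 - z) * (1 - z)^* = (cabs (1 - z) ^+ 2)%:C by exact: mul_conj.
  apply: (mulIf zn); rewrite F2 -mulrA (mulrC _^*) k -rmorphM /= mulVf ?rmorph1//.
  by rewrite expf_neq0// cabs_eq0.
have pos : 0 < Re (rootF z) ^+ 2 - Im (rootF z) ^+ 2.
  have : Re (rootF z ^+ 2) = Re (rootF z) ^+ 2 - Im (rootF z) ^+ 2 by rewrite expr2 cReM.
  move=> <-; rewrite Fz rC_mul /= cRe_conj.
  by apply: mulr_gt0 => //; rewrite invr_gt0 exprn_gt0// cabs_gt0.
have r0 : 0 < Re (rootF z).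
  rewrite /rootF /cexp rC_mul /=; apply: mulr_gt0; first exact: expR_gt0.
  rewrite mul0r addr0; set u := atan _; apply: cos_gt0_pihalf.
  have h1 : - (pi / 2) < u := atan_gtNpi2 _; have h2 : u < pi / 2 := atan_ltpi2 _.
  by have := pi_gt0 R; move: h1 h2; clear=> h1 h2 h3; apply/andP; split; lra.
rewrite -(@ler_sqr R) ?nnegrE ?cabs_ge0 ?mulr_ge0 ?(ltW r0)// sqr_cabs.
move: pos r0; move: (Re _) (Im _); clear=> x y; nra.
Qed.

(** The modulus is at most twice the real part, whose mean over any circle is the value 1 at the
    center. *)
Lemma avg_rootF r : 0 < r -> r < 1 -> avg rootF r <= 2.
Proof.
move=> r0 r1.
have fa : analytic rootF.
  by apply: analytic_cdiffP => z z1; apply: cdiff_rootF; exact: le_lt_trans (Re_le z) z1.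
have rc t : ang t -> rcont (fun t => rootF (pt r t)) t.
  by move=> _; exact: analytic_rcont fa (ltW r0) r1.
have [i1 i2] := cont_cintegrable rc.
have E : mean (fun t => Re (rootF (pt r t))) = 1.
  have c0 : cabs (0 : R[i]) < r by rewrite cabs0.
  have := cauchy_formula fa c0 r1.
  have -> : cmean (fun t => rootF (pt r t) * (pt r t / (pt r t - 0))) =
      cmean (fun t => rootF (pt r t)).
    by apply: eq_cmean => t _; rewrite subr0 divff ?mulr1// circle_pt_neq0.
  move=> /(congr1 (@complex.Re R)) h.
  have -> : mean (fun t => Re (rootF (pt r t))) = Re (rootF 0) by exact: h.
  have L0 : Log (1 - 0) = 0 :> R[i].
    rewrite subr0; apply: complex_eq; first by rewrite /= cabs1 ln1.
    by rewrite /= mul0r atan0.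
  by rewrite /rootF L0 mulr0 cexp0.
apply: (@le_trans _ _ (mean (fun t => 2 * Re (rootF (pt r t))))).
  apply: mean_le; [exact: rcont_mintegrable|exact: mintegrableZ i1|move=> t _].
  apply: rootF_Re; apply: le_lt_trans (Re_le _) _.
  by rewrite cabs_circle_pt// ltW.
by rewrite meanZ// E mulr1.
Qed.

Lemma mmeas_gap : mmeas gap.
Proof.
apply: mmeasB; first exact: mmeas_cst.
have m1 : mmeas (fun t => cabs (1 - expi t)).
  apply: mmeas_cabs; apply: cmmeasB; first exact: cmmeas_cst.
  by apply: cmmeas_rcont => t _; exact: cont_expi.
exact: (measurableT_comp (@measurable_ln R) m1).
Qed.

Definition wgt t : R := expR (gap t / 2).

(** Fatou's lemma along the radii rho k, on which the means of |rootF| are at most 2, replaces the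
    direct integration of |1 - e^(it)|^(-1/2). *)
Lemma mint_wgt : mintegrable wgt.
Proof.
have mw : mmeas wgt.
  apply: (@mmeas_comp R (@expR R) (fun t => gap t / 2)); first exact: continuous_expR.
  by apply: mmeasM; [exact: mmeas_gap|exact: mmeas_cst].
have w0 t : 0 <= wgt t by exact: expR_ge0.
apply: mintegrable_Iang => //; apply: (@le_lt_trans _ _ (expR (7 / 2) * 2)%:E); last exact: ltry.
apply: (@fatou_bound R (fun k t => expR (7 / 2) * cabs (rootF (pt (rho R k) t)))) => //.
- move=> k; have r0 := rho_gt0 R k; have r1 := rho_lt1 R k.
  apply: mmeasM; first exact: mmeas_cst.
  apply: mmeas_cabs; apply: cmmeas_circle (ltW r0) r1.
  by apply: analytic_cdiffP => z z1; apply: cdiff_rootF; exact: le_lt_trans (Re_le z) z1.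
- by move=> k t; rewrite mulr_ge0 ?expR_ge0 ?cabs_ge0.
- apply: aeangW aeang_oneB => t _ t1.
  have -> : wgt t = expR (7 / 2) * cabs (rootF (expi t)).
    by rewrite cabs_rootF -expRD /wgt /gap; congr expR; ring.
  apply: cvgM; first exact: cvg_cst.
  have := has_rlim_cont (cdiff_cont (cdiff_rootF t1)) => /has_rlim_seq H.
  apply/cvgrPdist_lt => d d0; have [N HN] := H _ d0.
  exists N => // n /= /HN; apply: le_lt_trans.
  set x := rootF (expi t); set y := rootF _.
  have := ler_cabsB x y; have := ler_cabsB y x; rewrite (cabsBC x) => h1 h2.
  by rewrite ler_norml; apply/andP; split; move: h1 h2; clear; lra.
- exists 0%N => k _; have r0 := rho_gt0 R k; have r1 := rho_lt1 R k.
  have fa : analytic rootF.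
    by apply: analytic_cdiffP => z z1; apply: cdiff_rootF; exact: le_lt_trans (Re_le z) z1.
  have i1 : mintegrable (fun t => cabs (rootF (pt (rho R k) t))).
    by apply: rcont_mintegrable => t _; exact: analytic_rcont fa (ltW r0) r1.
  rewrite Iang_mean; last exact: mintegrableZ.
  by rewrite meanZ// lee_fin ler_wpM2l ?expR_ge0//; exact: avg_rootF.
Qed.

(** With m = 2 (k + 1), gap <= m e^(gap / m); its k-th power has exponent k gap / m <= gap / 2. *)
Lemma gapX_le t k : gap t ^+ k <= (2 * k.+1)%:R ^+ k * wgt t.
Proof.
have g0 := gap_gt0 t; have k0 : 0 < (2 * k.+1)%:R :> R by rewrite ltr0n.
case: k => [|k] in k0 *.
  rewrite !expr0 mul1r /wgt; apply: le_trans (expR_ge1Dx _).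
  by rewrite lerDl divr_ge0// ltW.
have h1 : gap t <= (2 * k.+2)%:R * expR (gap t / (2 * k.+2)%:R).
  rewrite -ler_pdivrMl// mulrC; apply: le_trans (expR_ge1Dx _).
  by rewrite lerDr ler01.
apply: le_trans (_ : ((2 * k.+2)%:R * expR (gap t / (2 * k.+2)%:R)) ^+ k.+1 <= _).
  by rewrite lerXn2r ?nnegrE ?mulr_ge0 ?expR_ge0 ?(ltW g0) ?(ltW k0).
rewrite exprMn; apply: ler_wpM2l; first by rewrite exprn_ge0// ltW.
rewrite -expRM_natr /wgt ler_expR -mulrA ler_wpM2l ?(ltW g0)//.
rewrite natrM invfM -mulrA ler_piMr ?invr_ge0// mulrC ler_pdivrMr ?ltr0n//.
by rewrite mul1r ler_nat.
Qed.

Lemma mint_gapX k : mintegrable (fun t => gap t ^+ k).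
Proof.
apply: mintegrable_dom (mintegrableZ ((2 * k.+1)%:R ^+ k) mint_wgt) _.
  apply: (@mmeas_comp R (fun x => x ^+ k)); last exact: mmeas_gap.
  exact: exprn_continuous.
move=> t _; rewrite ger0_norm ?exprn_ge0 ?(ltW (gap_gt0 t))//; exact: gapX_le.
Qed.

End Symbol.

(** * The Orlicz function *)

Section OrliczExample.
Variable R : realType.
Implicit Types (x y C : R) (n m k N : nat).

(** The parameter L attached to n!: its square bounds [Psi] at n! when s is the slope just before
    this break. *)
Definition level n (s : R) : R := Num.sqrt (n`!%:R * s).
(** The exponential is, up to a constant, the reciprocal of the area within e^(-level) of 1. The
    final estimate of [not_compact_bergman] succeeds with any factor above 32. *)
Definition slope_incr n (s : R) : R := 40 * expR (2 * level n s).
Fixpoint slope n : R := if n is m.+1 then slope m + slope_incr m (slope m) else 1.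
Definition lev n : R := level n (slope n).
Definition incr n : R := slope_incr n (slope n).
Definition ramp n x : R := Num.max 0 (x - n`!%:R).
Definition psiN N x : R := x + \sum_(n < N) incr n * ramp n x.
(** An infinite sum of ramps, truncated where it stops contributing: for N >= x, the ramps of index
    n >= N vanish at x because x <= N <= n!. *)
Definition Psi x : R := psiN (Num.bound x) x.

Lemma fact_ge1 n : 1 <= n`!%:R :> R.
Proof. by rewrite ler1n fact_gt0. Qed.

Lemma incr_gt0 n : 0 < incr n.
Proof. by rewrite mulr_gt0// expR_gt0. Qed.

Lemma slopeS n : slope n.+1 = slope n + incr n. Proof. by []. Qed.

Lemma slope_ge1 n : 1 <= slope n.
Proof. by elim: n => // n IH; rewrite slopeS; have := incr_gt0 n; lra. Qed.

Lemma slope_sum n : slope n = 1 + \sum_(k < n) incr k.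
Proof.
elim: n => [|n IH]; first by rewrite big_ord0 addr0.
by rewrite slopeS IH big_ord_recr /= addrA.
Qed.

Lemma sqr_lev n : lev n ^+ 2 = n`!%:R * slope n.
Proof.
rewrite /lev /level sqr_sqrtr// mulr_ge0// (le_trans ler01)//; exact: slope_ge1.
Qed.

Lemma lev_ge1 n : 1 <= lev n.
Proof.
rewrite /lev /level -{1}(sqrtr1 R) ler_wsqrtr//.
by apply: mulr_ege1; [exact: fact_ge1|exact: slope_ge1].
Qed.

Lemma lev_gt0 n : 0 < lev n.
Proof. by apply: lt_le_trans (lev_ge1 n). Qed.

(** slope n <= (lev n)^2 <= e^(2 lev n), already below the increment. Hence each new slope is at
    most twice its last increment, which alone has to be estimated. *)
Lemma incr_ge_slope n : slope n <= incr n.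
Proof.
have l0 := lev_gt0 n; have f1 := fact_ge1 n; have s1 := slope_ge1 n.
have h : slope n <= lev n ^+ 2.
  by rewrite sqr_lev ler_peMl// (le_trans ler01).
apply: le_trans h _; rewrite /incr /slope_incr -/(lev n).
have -> : expR (2 * lev n) = expR (lev n) ^+ 2 by rewrite -expRM_natl.
have e1 := expR_ge1Dx (lev n).
have : lev n ^+ 2 <= expR (lev n) ^+ 2.
  by rewrite lerXn2r ?nnegrE ?expR_ge0 ?(ltW l0)//; move: e1; lra.
by have := sqr_ge0 (expR (lev n)); lra.
Qed.

Lemma ramp_ge0 n x : 0 <= ramp n x.
Proof. by rewrite le_max lexx. Qed.

Lemma ramp_homo n x y : x <= y -> ramp n x <= ramp n y.
Proof. by move=> xy; rewrite /ramp ge_max !le_max lexx lerD2r xy orbT. Qed.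

Lemma ramp_convex n x y t : 0 <= t -> t <= 1 ->
  ramp n (t * x + (1 - t) * y) <= t * ramp n x + (1 - t) * ramp n y.
Proof.
move=> t0 t1; have u0 : 0 <= 1 - t by rewrite subr_ge0.
rewrite {1}/ramp ge_max addr_ge0 ?mulr_ge0 ?ramp_ge0//=.
have -> : t * x + (1 - t) * y - n`!%:R = t * (x - n`!%:R) + (1 - t) * (y - n`!%:R) by ring.
by apply: lerD; apply: ler_wpM2l => //; rewrite le_max lexx orbT.
Qed.

Lemma ramp0 n x : x <= n`!%:R -> ramp n x = 0.
Proof. by move=> h; apply/max_idPl; rewrite subr_le0. Qed.

Lemma psiN_stable N M x : (N <= M)%N -> x <= N%:R -> psiN M x = psiN N x.
Proof.
move=> NM xN; rewrite /psiN -!(big_mkord xpredT (fun n => incr n * ramp n x)).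
rewrite (big_cat_nat (leq0n N) NM)//= [X in _ + (_ + X)]big_nat_cond [X in _ + (_ + X)]big1 ?addr0// => n.
rewrite andbT => /andP[Nn _]; rewrite ramp0 ?mulr0//.
by apply: le_trans xN _; rewrite ler_nat (leq_trans Nn)// fact_geq.
Qed.

Lemma PsiE N x : 0 <= x -> x <= N%:R -> Psi x = psiN N x.
Proof.
move=> x0 xN; have h := ltW (archi_boundP x0); rewrite /Psi.
have [NM|/ltnW MN] := leqP N (Num.bound x); first exact: psiN_stable.
by rewrite (psiN_stable MN).
Qed.

Lemma Psi_bound x y : 0 <= x -> 0 <= y -> exists N,
  [/\ x <= N%:R, y <= N%:R, Psi x = psiN N x & Psi y = psiN N y].
Proof.
move=> x0 y0; have h1 := ltW (archi_boundP x0); have h2 := ltW (archi_boundP y0).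
exists (maxn (Num.bound x) (Num.bound y)).
have k1 : x <= (maxn (Num.bound x) (Num.bound y))%:R.
  by apply: le_trans h1 _; rewrite ler_nat leq_maxl.
have k2 : y <= (maxn (Num.bound x) (Num.bound y))%:R.
  by apply: le_trans h2 _; rewrite ler_nat leq_maxr.
by split => //; exact: PsiE.
Qed.

Lemma psiN_homo N x y : x <= y -> psiN N x <= psiN N y.
Proof.
move=> xy; rewrite lerD//; apply: ler_sum => n _.
by apply: ler_wpM2l; [exact/ltW/incr_gt0|exact: ramp_homo].
Qed.

Lemma psiN_convex N x y t : 0 <= t -> t <= 1 ->
  psiN N (t * x + (1 - t) * y) <= t * psiN N x + (1 - t) * psiN N y.
Proof.
move=> t0 t1; rewrite /psiN !mulrDr !mulr_sumr.
set a := t * x; set b := (1 - t) * y.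
rewrite [leRHS]addrACA lerD2l -big_split /=; apply: ler_sum => n _.
have -> : t * (incr n * ramp n x) + (1 - t) * (incr n * ramp n y) =
  incr n * (t * ramp n x + (1 - t) * ramp n y) by ring.
apply: ler_wpM2l; first exact/ltW/incr_gt0.
exact: ramp_convex.
Qed.

Lemma psiN_ge N x : x <= psiN N x.
Proof.
rewrite lerDl; apply: sumr_ge0 => n _.
by apply: mulr_ge0; [exact/ltW/incr_gt0|exact: ramp_ge0].
Qed.

Lemma Psi_ge x : x <= Psi x. Proof. exact: psiN_ge. Qed.

Lemma Psi_homo x y : 0 <= x -> x <= y -> Psi x <= Psi y.
Proof.
move=> x0 xy; have [N [_ _ -> ->]] := Psi_bound x0 (le_trans x0 xy).
exact: psiN_homo.
Qed.

Lemma Psi0 : Psi 0 = 0.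
Proof. by rewrite (@PsiE 0)// /psiN big_ord0 addr0. Qed.

Lemma Psi_orlicz : orlicz_function Psi.
Proof.
split.
- exact: Psi_homo.
- move=> x y t x0 y0 t0 t1; have [N [xN yN -> ->]] := Psi_bound x0 y0.
  have u0 : 0 <= 1 - t by rewrite subr_ge0.
  rewrite (@PsiE N); first exact: psiN_convex.
    by rewrite addr_ge0// mulr_ge0.
  have -> : N%:R = t * N%:R + (1 - t) * N%:R :> R by ring.
  by apply: lerD; exact: ler_wpM2l.
- exact: Psi0.
- by move=> x x0; apply: lt_le_trans (Psi_ge x).
- apply/cvgryPge => A; exists A; split; first exact: num_real.
  by move=> x /= Ax; apply: le_trans (Psi_ge x); exact: ltW.
Qed.

(** Up to n! only ramps of index less than n are active, each at most x. *)
Lemma Psi_le_slope x n : 0 <= x -> x <= n`!%:R -> Psi x <= x * slope n.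
Proof.
move=> x0 xn; have h := ltW (archi_boundP x0).
pose M := maxn (Num.bound x) n.
have xM : x <= M%:R by apply: le_trans h _; rewrite ler_nat leq_maxl.
rewrite (PsiE x0 xM) /psiN slope_sum mulrDr mulr1 lerD2l.
have nM : (n <= M)%N by rewrite leq_maxr.
rewrite -!(big_mkord xpredT (fun k => incr k * ramp k x)) (big_cat_nat (leq0n n) nM)//=.
rewrite [X in _ + X]big_nat_cond [X in _ + X]big1 ?addr0; last first.
  move=> k; rewrite andbT => /andP[nk _]; rewrite ramp0 ?mulr0//.
  by apply: le_trans xn _; rewrite ler_nat; apply: leq_fact.
rewrite big_mkord mulr_sumr; apply: ler_sum => k _; rewrite mulrC.
apply: ler_wpM2r; first exact/ltW/incr_gt0.
by rewrite /ramp ge_max x0 /= gerBl.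
Qed.

Lemma Psi_fact n : Psi n`!%:R <= lev n ^+ 2.
Proof. by rewrite sqr_lev; exact: Psi_le_slope. Qed.

Lemma Psi_ge_incr x n : 0 <= x -> x + incr n * (x - n`!%:R) <= Psi x.
Proof.
move=> x0; have h := ltW (archi_boundP x0).
pose M := maxn (Num.bound x) n.+1.
have xM : x <= M%:R by apply: le_trans h _; rewrite ler_nat leq_maxl.
have nM : (n < M)%N by rewrite leq_maxr.
rewrite (PsiE x0 xM) /psiN lerD2l (bigD1 (Ordinal nM))//=.
rewrite -[leLHS]addr0; apply: lerD.
  by apply: ler_wpM2l; [exact/ltW/incr_gt0|rewrite le_max lexx orbT].
by apply: sumr_ge0 => k _; apply: mulr_ge0; [exact/ltW/incr_gt0|exact: ramp_ge0].
Qed.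

Lemma Psi_2fact n : 40 * expR (2 * lev n) <= Psi (2 * n`!%:R).
Proof.
have f1 := fact_ge1 n; have c0 := incr_gt0 n.
apply: le_trans (@Psi_ge_incr (2 * n`!%:R) n _); last first.
  by apply: mulr_ge0 => //; apply: le_trans f1.
have -> : 2 * n`!%:R - n`!%:R = n`!%:R :> R by ring.
rewrite -/(slope_incr n (slope n)) -/(incr n).
have : incr n * 1 <= incr n * n`!%:R by rewrite ler_pM2l.
lra.
Qed.

Lemma fact_bracket y n0 : n0`!%:R < y -> exists m, [/\ (n0 <= m)%N, m`!%:R < y & y <= m.+1`!%:R].
Proof.
move=> hy; have y0 : 0 <= y by apply: le_trans (ltW hy).
have ex : exists k, y <= k`!%:R.
  exists (Num.bound y); apply: le_trans (ltW (archi_boundP y0)) _.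
  by rewrite ler_nat fact_geq.
have := ex_minnP ex; case: ex_minnP => k yk kmin _.
case: k => [|m] in yk kmin *.
  have : n0`!%:R < 1 :> R by apply: lt_le_trans yk.
  by rewrite ltNge fact_ge1.
have my : m`!%:R < y.
  by rewrite ltNge; apply/negP => /kmin; rewrite ltnn.
exists m; split=> //; rewrite leqNgt; apply/negP => mn0.
have : m.+1`!%:R <= n0`!%:R :> R by rewrite ler_nat leq_fact.
by have := lt_le_trans hy yk => /lt_le_trans h /h; rewrite ltxx.
Qed.

(** As m + 1 >= 2 C and C x > (m+1)!, x lies beyond 2 m!, so [Psi x] already sees the increment at
    m!: it controls [slope m.+1], hence (lev m.+1)^2 <= 4 C Psi(x). As C x <= (m+2)!, [Psi] at C x
    involves no increment beyond that at (m+1)!, which is exponential in [lev m.+1], hence in the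
    square root of Psi(x). *)
Lemma Psi_growth_large C x m : 0 < C -> 0 <= x -> 2 * C <= m.+1%:R ->
  m.+1`!%:R < C * x -> C * x <= m.+2`!%:R ->
  Psi (C * x) <= 80 * (16 * C) * expR (64 * C) * expR (Psi x / 8).
Proof.
move=> C0 x0 Cm my ym; set P := Psi x; have xP : x <= P := Psi_ge x.
have y0 : 0 <= C * x by rewrite mulr_ge0// ltW.
have s1 := slope_ge1 m.+1.
have u1 : Psi (C * x) <= C * x * (80 * expR (2 * lev m.+1)).
  apply: le_trans (Psi_le_slope y0 ym) _; apply: ler_wpM2l => //.
  by rewrite slopeS; have := incr_ge_slope m.+1; rewrite /incr /slope_incr -/(lev _); lra.
have u2 : slope m.+1 * m.+1`!%:R <= 4 * C * P.
  have h1 := @Psi_ge_incr x m x0; rewrite -/P in h1.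
  have h2 : slope m.+1 <= 2 * incr m by rewrite slopeS; have := incr_ge_slope m; lra.
  have h3 : 2 * m`!%:R <= x.
    rewrite factS natrM in my.
    have : 2 * C * m`!%:R <= C * x.
      by apply: le_trans (ltW my); apply: ler_wpM2r.
    by rewrite mulrAC mulrC ler_pM2l.
  have i0 := incr_gt0 m.
  have h4 : incr m * x <= 2 * P.
    have : incr m * (2 * m`!%:R) <= incr m * x by rewrite ler_pM2l.
    by move: h1 x0; rewrite !mulrBr; clear; lra.
  apply: (@le_trans _ _ (2 * incr m * (C * x))).
    by apply: ler_pM => //; [exact: le_trans s1|exact: ltW].
  have -> : 2 * incr m * (C * x) = 2 * C * (incr m * x) by ring.
  have -> : 4 * C * P = 2 * C * (2 * P) by ring.
  by apply: ler_wpM2l h4; rewrite mulr_ge0// ltW.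
have P0 : 0 <= P by apply: le_trans xP.
(* The inequality between the two means: (64 C + P/16)^2 >= 16 C P >= (2 lev)^2. The other half of
   the exponent P/8 pays for the factor x <= P. *)
have u3 : 2 * lev m.+1 <= 64 * C + P / 16.
  have l0 := lev_gt0 m.+1; have := sqr_lev m.+1; rewrite mulrC => lE.
  rewrite -(@ler_sqr R) ?nnegrE ?addr_ge0 ?mulr_ge0 ?(ltW l0) ?(ltW C0) ?divr_ge0//.
  rewrite exprMn lE; apply: (@le_trans _ _ (2 ^+ 2 * (4 * C * P))).
    by apply: ler_wpM2l u2; exact: sqr_ge0.
  by have := sqr_ge0 (64 * C - P / 16); rewrite !expr2; nra.
have u4 : P <= 16 * expR (P / 16).
  by have := expR_ge1Dx (P / 16); lra.
apply: le_trans u1 _.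
apply: (@le_trans _ _ (C * (16 * expR (P / 16)) * (80 * expR (64 * C + P / 16)))).
  apply: ler_pM; [exact: y0|by apply: mulr_ge0 => //; exact: expR_ge0| |].
    by rewrite ler_pM2l// (le_trans xP).
  by apply: ler_wpM2l => //; rewrite ler_expR.
have -> : P / 8 = P / 16 + P / 16 by field.
by rewrite !expRD le_eqVlt; apply/orP; left; apply/eqP; ring.
Qed.

(** Small C x are covered by a constant; the threshold m0 is where consecutive factorials differ by
    a factor above 2 C. *)
Lemma Psi_growth C : 0 < C -> exists2 K : R, 0 < K &
  forall x, 0 <= x -> Psi (C * x) <= K * expR (Psi x / 8).
Proof.
move=> C0; have C20 : 0 <= 2 * C by rewrite mulr_ge0// ltW.
set m0 := Num.bound (2 * C); have Cm := ltW (archi_boundP C20); rewrite -/m0 in Cm.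
have Q0 : 0 < Psi m0.+1`!%:R.
  by apply: lt_le_trans (Psi_ge _); apply: lt_le_trans (fact_ge1 _).
have K0 : 0 < 80 * (16 * C) * expR (64 * C) by apply: mulr_gt0 (expR_gt0 _); apply: mulr_gt0; rewrite ?ltr0n//; apply: mulr_gt0; rewrite ?ltr0n.
exists (Psi m0.+1`!%:R + 80 * (16 * C) * expR (64 * C)); first exact: addr_gt0.
move=> x x0; have e1 : 1 <= expR (Psi x / 8).
  apply: le_trans (expR_ge1Dx _); rewrite lerDl divr_ge0//.
  exact: le_trans (Psi_ge x).
rewrite mulrDl; have [h|h] := leP (C * x) m0.+1`!%:R.
  apply: (@le_trans _ _ (Psi m0.+1`!%:R)); first by apply: Psi_homo h; rewrite mulr_ge0// ltW.
  rewrite -[leLHS]addr0; apply: lerD; first by rewrite ler_peMr// ltW.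
  by apply: mulr_ge0 (expR_ge0 _); exact: ltW.
have [m [m0m my ym]] := fact_bracket h.
case: m => [//|m] in m0m my ym *.
apply: (@le_trans _ _ (80 * (16 * C) * expR (64 * C) * expR (Psi x / 8))).
  apply: Psi_growth_large my ym => //; apply: le_trans Cm _.
  by rewrite ler_nat ltnW.
by rewrite lerDr; apply: mulr_ge0 (expR_ge0 _); exact: ltW.
Qed.

Lemma Psi_small x : 0 <= x -> x <= 1 -> Psi x <= x * Psi 1.
Proof.
move=> x0 x1; have [_ Pc _ _ _] := Psi_orlicz.
have := Pc 1 0 x ler01 (lexx 0) x0 x1.
by rewrite mulr1 !mulr0 addr0 Psi0 mulr0 addr0.
Qed.

End OrliczExample.

(** * Compactness on Hardy-Orlicz spaces *)

Section Composition.
Variable R : realType.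
Local Notation ang := (@angles R).
Local Notation mu := (@lebesgue_measure R).
Local Notation cm := (circle_measure R).
Local Notation pt := (@circle_pt R).
Local Notation mR := (measurableTypeR R).
Local Notation phi := (@phi R).
Local Notation Psi := (@Psi R).
Implicit Types (f g : R[i] -> R[i]) (a z l : R[i]) (r e s t C : R).

Lemma phi_disk z : cabs z < 1 -> cabs (phi z) < 1.
Proof. by move=> z1; have [_] := phi_self R; apply. Qed.

Lemma cdiff_comp_phi f z : analytic f -> cabs z <= 1 -> Re z < 1 -> cdiff (f \o phi) z.
Proof.
move=> fa z1 rz; apply: cdiff_comp; first exact: cdiff_phi.
by apply: analytic_cdiff fa _; rewrite -subr_gt0 phi_gap_gt0.
Qed.

Lemma analytic_comp f : analytic f -> analytic (f \o phi).
Proof.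
move=> fa; apply: analytic_cdiffP => z z1; apply: cdiff_comp_phi fa (ltW z1) _.
exact: le_lt_trans (Re_le z) z1.
Qed.

(** [phi] is differentiable at every point of the circle other than 1 and sends it into the open
    disk, so f o phi has ordinary values there. *)
Lemma boundary_comp f t : analytic f -> Re (expi t) < 1 ->
  boundary (f \o phi) t = f (phi (expi t)).
Proof.
move=> fa t1; apply: boundaryE; apply: has_rlim_cont; apply: cdiff_cont.
by apply: cdiff_comp_phi fa _ t1; rewrite cabs_expi.
Qed.

Lemma mean_le_ae (h1 h2 : R -> R) : mintegrable h1 -> mintegrable h2 ->
  (forall t, 0 <= h1 t) -> (forall t, 0 <= h2 t) -> aeang (fun t => h1 t <= h2 t) ->
  mean h1 <= mean h2.
Proof.
move=> i1 i2 p1 p2 H; rewrite -lee_fin -!Iang_mean//.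
by apply: le_Iang_ae => //; exact: mintegrable_meas.
Qed.

Lemma dominated_mean (F : nat -> R -> R) (G : R -> R) e : (forall n, mmeas (F n)) ->
  mintegrable G -> (forall n t, 0 <= F n t) -> aeang (fun t => forall n, F n t <= G t) ->
  aeang (fun t => F ^~ t @ \oo --> 0) -> 0 < e ->
  exists N, forall n, (N <= n)%N -> (Iang (F n) <= e%:E)%E.
Proof.
move=> mF Gi F0 FG Fc e0.
have mF' n : measurable_fun (ang : set mR) (fun t => (F n t)%:E).
  by apply/measurable_EFinP; exact: mF.
have c1 : {ae cm, forall t, ang t -> (fun n => (F n t)%:E) @ \oo --> 0%E}.
  have := aeang_ae Fc; apply: (@filterS _ _ (ae_filter_ringOfSetsType cm)) => t h tt.
  by apply: cvg_EFin; [exact: nearW|exact: h].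
have c2 : {ae cm, forall t n, ang t -> (`|(F n t)%:E| <= (G t)%:E)%E}.
  have := aeang_ae FG; apply: (@filterS _ _ (ae_filter_ringOfSetsType cm)) => t h n tt.
  by rewrite /= lee_fin ger0_norm//; exact: h.
have [_ _] := dominated_convergence (@mang R) mF' (measurable_cst _) c1 Gi c2.
rewrite integral0 => H.
have {}H : (fun n => Iang (F n)) @ \oo --> 0%E by exact: H.
have /fine_cvgP[Hf /cvgrPdist_lt/(_ _ e0) Hd] := H.
have [N1 _ H1] := Hf; have [N2 _ H2] := Hd.
exists (maxn N1 N2) => n; rewrite geq_max => /andP[n1 n2].
have := H2 n n2; rewrite /= sub0r normrN => h.
rewrite -(fineK (H1 n n1)) lee_fin; apply: le_trans (ltW h); exact: ler_norm.
Qed.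

Lemma cvge0 (x : nat -> \bar R) : (forall n, (0 <= x n)%E) ->
  (forall e, 0 < e -> exists N, forall n, (N <= n)%N -> (x n <= e%:E)%E) ->
  x @ \oo --> 0%E.
Proof.
move=> x0 H; have fin e n : (x n <= e%:E)%E -> x n \is a fin_num.
  by move=> h; rewrite ge0_fin_numE//; apply: le_lt_trans h _; exact: ltry.
apply/fine_cvgP; split.
  by have [N HN] := H 1 ltr01; exists N => // n /= /HN; exact: fin.
apply/cvgrPdist_le => e e0; have [N HN] := H e e0; exists N => // n /= /HN h.
rewrite sub0r normrN ger0_norm ?fine_ge0// -lee_fin fineK//; exact: fin h.
Qed.

Lemma gap_disk t : Re (expi t) < 1 -> forall r, 0 <= r -> r < 1 ->
  (1 - cabs (phi (pt r t)))^-1 <= 2 * gap t.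
Proof.
move=> t1 r r0 r1; have g0 := gap_gt0 t; have h := phi_circle r0 r1 t1.
rewrite -[leRHS]invrK lef_pV2 ?posrE ?invr_gt0 ?mulr_gt0//.
by apply: lt_le_trans h; rewrite invr_gt0 mulr_gt0.
Qed.

Lemma gap_bdry t : (1 - cabs (phi (expi t)))^-1 <= 2 * gap t.
Proof.
have g0 := gap_gt0 t; have h := phi_bdry_gap t.
rewrite -[leRHS]invrK lef_pV2 ?posrE ?invr_gt0 ?mulr_gt0//.
by apply: lt_le_trans h; rewrite invr_gt0 mulr_gt0.
Qed.

(** (1 - x)^N <= e^(1 - (N+1) x) and u^k <= (k+1)^k e^u for u = (N+1) x: decay in N of any order is
    bought with powers of 1/x. Using N + 1 covers N = 0. *)
Lemma exp_decay (x : R) N k : 0 < x -> x <= 1 ->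
  (1 - x) ^+ N / x <= expR 1 * k.+1%:R ^+ k / N.+1%:R ^+ k * x^-1 ^+ k.+1.
Proof.
move=> x0 x1; have u0 : 0 <= N.+1%:R * x by rewrite mulr_ge0// ltW.
have pk : (N.+1%:R * x) ^+ k <= k.+1%:R ^+ k * expR (N.+1%:R * x).
  case: k => [|k]; first by rewrite !expr0 mul1r; apply: le_trans (expR_ge1Dx _); rewrite lerDl.
  have h1 : N.+1%:R * x <= k.+2%:R * expR (N.+1%:R * x / k.+2%:R).
    rewrite -ler_pdivrMl ?ltr0n// mulrC; apply: le_trans (expR_ge1Dx _).
    by rewrite lerDr ler01.
  apply: le_trans (_ : (k.+2%:R * expR (N.+1%:R * x / k.+2%:R)) ^+ k.+1 <= _).
    by apply: lerXn2r; rewrite ?nnegrE ?mulr_ge0 ?expR_ge0 ?(ltW x0).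
  rewrite exprMn; apply: ler_wpM2l; first by rewrite exprn_ge0.
  rewrite -expRM_natr ler_expR -mulrA ler_piMr// mulrC ler_pdivrMr ?ltr0n//.
  by rewrite mul1r ler_nat.
have e1 : (1 - x) ^+ N <= expR 1 * expR (- (N.+1%:R * x)).
  apply: (@le_trans _ _ (expR (- x) ^+ N)).
    by rewrite lerXn2r ?nnegrE ?expR_ge0 ?subr_ge0//; exact: (expR_ge1Dx (- x)).
  rewrite -expRM_natr -expRD ler_expR -natr1 mulrDl mul1r.
  by rewrite mulNr (mulrC x); move: x1; clear; set q := _ * x; lra.
rewrite exprS mulrCA mulrC; apply: ler_wpM2l; first by rewrite invr_ge0 ltW.
apply: le_trans e1 _; rewrite expRN.
rewrite -mulrA -[X in _ <= X]mulrA; apply: ler_wpM2l; first exact: expR_ge0.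
rewrite -exprVn -mulrA -exprMn -invfM exprVn ler_pdivlMr ?exprn_gt0 ?mulr_gt0//.
by rewrite mulrC ler_pdivrMr ?expR_gt0.
Qed.

(** Bounds (N+1)^k times the squared norm of the composition operator on functions whose first N
    coefficients vanish; the power of 2 comes from 1 / (1 - |phi|) <= 2 gap. *)
Definition decay k : R := expR 1 * k.+1%:R ^+ k * 2 ^+ k.+1 * mean (fun t => gap t ^+ k.+1).

Lemma decay_ge0 k : 0 <= decay k.
Proof.
apply: mulr_ge0; last by apply: mean_ge0 => t _; rewrite exprn_ge0// ltW// gap_gt0.
by rewrite !mulr_ge0 ?expR_ge0 ?exprn_ge0.
Qed.

(** At w = phi z, |f w|^2 is at most A |w|^(2N) / (1 - |w|^2), hence A (1 - x)^N / x with x = 1 -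
    |w|; [exp_decay] and 1/x <= 2 gap give a majorant integrable over the circle and independent of
    the radius. *)
Lemma comp_h2le f A N k : analytic f -> 0 < A -> h2le f A ->
  (forall n, (n < N)%N -> coef f n = 0) ->
  h2le (f \o phi) (A * (decay k / N.+1%:R ^+ k)).
Proof.
move=> fa A0 fA f0 M; have ca := analytic_comp fa.
apply: (@coef_limit R (f \o phi) M _ ca) => r r0 r1.
pose K : R := expR 1 * k.+1%:R ^+ k / N.+1%:R ^+ k * 2 ^+ k.+1.
have K0 : 0 <= K by rewrite !mulr_ge0 ?invr_ge0 ?expR_ge0 ?exprn_ge0.
have -> : A * (decay k / N.+1%:R ^+ k) = mean (fun t => (A * K) * gap t ^+ k.+1).
  by rewrite meanZ; [rewrite /decay /K; ring|exact: mint_gapX].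
apply: mean_le_ae.
- by apply: rcont_sqr_mintegrable => t _; exact: analytic_rcont ca (ltW r0) r1.
- by apply: mintegrableZ; exact: mint_gapX.
- by move=> t; exact: sqr_ge0.
- by move=> t; rewrite !mulr_ge0 ?(ltW A0)// exprn_ge0// ltW// gap_gt0.
apply: aeangW (aeang_oneB R) => t _ t1 /=.
have z1 : cabs (pt r t) < 1 by rewrite cabs_circle_pt// ltW.
have w1 := phi_disk z1; set w := phi _ in w1 *.
apply: le_trans (h2_point fa A0 fA f0 w1) _; rewrite -mulrA; apply: ler_wpM2l; first exact: ltW.
have c0 := cabs_ge0 w.
have x0 : 0 < 1 - cabs w by rewrite subr_gt0.
have x1 : 1 - cabs w <= 1 by rewrite gerBl.
apply: (@le_trans _ _ ((1 - (1 - cabs w)) ^+ N / (1 - cabs w))).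
  apply: ler_pM; rewrite ?exprn_ge0 ?invr_ge0 ?subr_ge0 ?exprn_ile1 ?(ltW w1)//.
    rewrite opprB addrC subrK mul2n -addnn exprD ler_piMr ?exprn_ge0//.
    by rewrite exprn_ile1// ltW.
  rewrite lef_pV2 ?posrE//; first by rewrite lerD2l lerN2 expr2 ler_piMr// ltW.
  by rewrite subr_gt0 expr2 mulr_ilt1.
apply: le_trans (exp_decay N k x0 x1) _; rewrite /K -[leRHS]mulrA.
apply: ler_wpM2l; first by rewrite !mulr_ge0 ?invr_ge0 ?expR_ge0 ?exprn_ge0.
rewrite -exprMn lerXn2r ?nnegrE ?invr_ge0 ?mulr_ge0 ?(ltW x0) ?(ltW (gap_gt0 t))//.
exact: gap_disk t1 _ (ltW r0) r1.
Qed.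

Lemma h2leW f A B : A <= B -> h2le f A -> h2le f B.
Proof. by move=> AB fA N; exact: le_trans AB. Qed.

Lemma H2_comp f : H2 f -> H2 (f \o phi).
Proof.
move=> [fa [A fA]]; split; first exact: analytic_comp fa.
have A0 := h2le_ge0 fA; have A1 : 0 < A + 1 by rewrite ltr_wpDl.
have fA1 : h2le f (A + 1) by apply: h2leW fA; rewrite lerDl.
by eexists; apply: (@comp_h2le f (A + 1) 0 0 fa A1 fA1).
Qed.

Lemma lucvg_disk_cvg (u : nat -> R[i] -> R[i]) g z : lucvg u g -> cabs z < 1 ->
  (fun n => cabs (u n z - g z)) @ \oo --> 0.
Proof.
move=> ug z1; apply/cvgrPdist_le => e e0; have [N HN] := lucvg_pt ug z1 e0.
by exists N => // n /= /HN; rewrite sub0r normrN ger0_norm// cabs_ge0.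
Qed.

(** A bounded sequence has a locally uniform limit g. Almost every boundary point is sent into the
    open disk, where the differences converge; their squares, of coefficient sum at most 4, are
    dominated by 8 gap. *)
Lemma compact_hardy2 : compact_operator (hardy 2) (hardy_norm 2) (composition_operator phi).
Proof.
split=> [f /hardy2P hf|u uA]; first by apply/hardy2P; exact: H2_comp.
have HF n : exists f, (hardy 2 f /\ (hardy_norm 2 f <= 1)%E) /\ f \o phi = u n.
  by have [f h1 h2] := uA n; exact: (ex_intro _ f (conj h1 h2)).
have {HF}[F HF] := choice HF.
have Fa n : analytic (F n) by have [[[h _] _] _] := HF n; exact: h.
have F1 n : h2le (F n) 1.
  have [[_ h] _] := HF n.
  by have := hardy_norm2_h2le (Fa n) ler01 h; rewrite expr1n.
have uF n : u n = F n \o phi by have [_ <-] := HF n.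
have [k [g [kh ga kg]]] : exists (k : nat -> nat) g,
    [/\ {homo k : m n / (m < n)%N}, analytic g & lucvg (F \o k) g].
  apply: montel => [n|r r0 r1]; first exact: Fa.
  exists (1 + 1 / (1 - r ^+ 2)) => n z zr.
  have z1 : cabs z < 1 by apply: le_lt_trans r1.
  have := @h2_point R (F n) 1 0 z (Fa n) ltr01 (F1 n) ltac:(by []) z1.
  rewrite mul1r muln0 expr0.
  have r21 : r ^+ 2 < 1 by rewrite expr2 mulr_ilt1// ltW.
  have zr2 : cabs z ^+ 2 <= r ^+ 2 by rewrite lerXn2r ?nnegrE ?cabs_ge0// ltW.
  have : 1 / (1 - cabs z ^+ 2) <= 1 / (1 - r ^+ 2).
    by rewrite !div1r lef_pV2 ?posrE ?subr_gt0// ?lerD2l ?lerN2// (le_lt_trans zr2).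
  have := sqr_ge0 (cabs (F n z) - 1); have := cabs_ge0 (F n z).
  move: (_ / _) (_ / _) (cabs (F n z)); clear=> x y q; rewrite !expr2; nra.
have g1 : h2le g 1 by apply: h2le_lucvg ga kg _ => n; [exact: Fa|exact: F1].
have da n : analytic (fun z => F (k n) z - g z) by exact: analyticB (Fa _) ga.
have d4 n : h2le (fun z => F (k n) z - g z) 4.
  move=> N; apply: (@le_trans _ _ (\sum_(i < N) (2 * cabs (coef (F (k n)) i) ^+ 2 + 2 * cabs (coef g i) ^+ 2))).
    apply: ler_sum => i _; rewrite (tcoefB i (Fa (k n)) ga).
    have := cabsB (coef (F (k n)) i) (coef g i); have := cabs_ge0 (coef (F (k n)) i - coef g i).
    move: (cabs _) (cabs _) (cabs _); clear=> x y w w0 h.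
    have : w ^+ 2 <= (y + x) ^+ 2 by rewrite lerXn2r ?nnegrE// (le_trans w0).
    by have := sqr_ge0 (y - x); rewrite !expr2; nra.
  rewrite big_split /= -!mulr_sumr.
  by have := F1 (k n) N; have := g1 N; lra.
have dH n : H2 ((fun z => F (k n) z - g z) \o phi).
  by apply: H2_comp; split; [exact: da|exists 4; exact: d4].
exists k, (g \o phi); split; [exact: kh| |].
  by apply/hardy2P; apply: H2_comp; split; [exact: ga|exists 1].
have E n : (u \o k) n \- (g \o phi) = (fun z => F (k n) z - g z) \o phi.
  by apply: funext => z; rewrite /= uF.
rewrite /norm_cvg; under eq_fun do rewrite E.
apply: cvge0 => [n|e e0].
  apply: le_trans (ereal_sup_ubound _); last first.
    exists 0; [by rewrite /= lexx ltr01|exact: hardy_norm2E (proj1 (dH n)) (lexx 0) ltr01].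
  by rewrite lee_fin sqrtr_ge0.
have [N HN] : exists N, forall n, (N <= n)%N ->
    (Iang (fun t => (cabs (boundary ((fun z => F (k n) z - g z) \o phi) t) ^+ 2)%R) <= (e ^+ 2)%:E)%E.
  apply: (@dominated_mean _ (fun t => 8 * gap t ^+ 1)).
  - by move=> n; apply: mmeas_sqr_cabs; exact: cmmeas_boundary (proj1 (dH n)).
  - by apply: mintegrableZ; exact: mint_gapX.
  - by move=> n t; exact: sqr_ge0.
  - apply: aeangW (aeang_oneB R) => t _ t1 n.
    rewrite (boundary_comp (da n) t1).
    have w1 := phi_bdry_lt1 t; set w := phi (expi t) in w1 *.
    apply: le_trans (@h2_point R _ 4 0 w (da n) _ (d4 n) _ w1) _ => //.
    rewrite muln0 expr0 div1r.
    have := gap_bdry t; rewrite -/w => gb.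
    have h : (1 - cabs w ^+ 2)^-1 <= (1 - cabs w)^-1.
      rewrite lef_pV2 ?posrE ?subr_gt0//.
        by rewrite lerD2l lerN2 expr2 ler_piMr ?cabs_ge0// ltW.
      by rewrite expr2 mulr_ilt1 ?cabs_ge0.
    by rewrite expr1; move: gb h; clear; lra.
  - apply: aeangW (aeang_oneB R) => t _ t1.
    under eq_fun do rewrite (boundary_comp (da _) t1).
    have h := lucvg_disk_cvg kg (phi_bdry_lt1 t).
    have h2 := cvgM h h; rewrite mulr0 in h2.
    by under eq_fun do rewrite expr2; exact: h2.
  - by rewrite exprn_gt0.
exists N => n /HN h; have := h2le_hardy_norm2 (proj1 (dH n)) (nrm2_h2le (dH n)).
move=> /le_trans; apply; rewrite lee_fin -(ger0_norm (ltW e0)) -sqrtr_sqr ler_wsqrtr//.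
by rewrite -lee_fin -Iang_mean//; exact: mint_boundary_sqr.
Qed.

(** The pointwise growth that the Hardy-Orlicz norm imposes. It passes to locally uniform limits,
    for which membership in the space is not known, and is all that the composition with [phi]
    requires. *)
Definition orlicz_ctrl (C m : R) f := forall z, cabs z < 1 ->
  Psi (cabs (f z) / C) <= m / (1 - cabs z).

Lemma comp_hardy_orlicz C m f : 0 < C -> 0 <= m -> analytic f -> orlicz_ctrl C m f ->
  hardy_orlicz Psi (f \o phi).
Proof.
move=> C0 m0 fa fC; have ca := analytic_comp fa.
split.
  apply/hardy1P; split; first exact: ca.
  exists (mean (fun t => (C * m * 2) * gap t ^+ 1)) => r r0 r1.
  apply: mean_le_ae.
  - by apply: rcont_mintegrable => t _; exact: analytic_rcont ca r0 r1.
  - by apply: mintegrableZ; exact: mint_gapX.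
  - by move=> t; exact: cabs_ge0.
  - by move=> t; rewrite expr1 !mulr_ge0// ?ltW// gap_gt0.
  apply: aeangW (aeang_oneB R) => t _ t1 /=.
  have z1 : cabs (pt r t) < 1 by rewrite cabs_circle_pt.
  have := fC _ (phi_disk z1); have := gap_disk t1 r0 r1; set w := phi _ => gb.
  move=> /(le_trans (Psi_ge _)); rewrite ler_pdivrMr// => h; apply: le_trans h _.
  rewrite expr1 mulrC -!mulrA; apply: ler_wpM2l; first exact: ltW.
  by apply: ler_wpM2l.
have mb : cmmeas (boundary (f \o phi)) by exact: cmmeas_boundary ca.
split; [exact: mb.1|exact: mb.2|exists C => //].
apply: (@le_lt_trans _ _ (Iang (fun t => (m * 2) * gap t ^+ 1)%R)); last first.
  by rewrite Iang_mean ?ltry//; apply: mintegrableZ; exact: mint_gapX.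
apply: le_Iang_ae.
- apply: mmeas_orlicz => //; [exact: Psi_orlicz|by move=> t; exact: cabs_ge0|exact: mmeas_cabs].
- by apply: mintegrable_meas; apply: mintegrableZ; exact: mint_gapX.
- move=> t; apply: le_trans (Psi_ge _); by rewrite divr_ge0 ?cabs_ge0// ltW.
- by move=> t; rewrite expr1 !mulr_ge0// ltW// gap_gt0.
apply: aeangW (aeang_oneB R) => t _ t1; rewrite (boundary_comp fa t1).
apply: le_trans (fC _ (phi_bdry_lt1 t)) _; rewrite expr1 -mulrA.
by apply: ler_wpM2l => //; exact: gap_bdry.
Qed.

Lemma orlicz_modular_homo (f : R[i] -> R[i]) C C' : hardy 1 f -> 0 < C -> C <= C' ->
  (orlicz_modular cm ang Psi (boundary f) C' <= orlicz_modular cm ang Psi (boundary f) C)%E.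
Proof.
move=> /hardy1P[fa _] C0 CC; have C'0 : 0 < C' by apply: lt_le_trans CC.
have mb := mmeas_cabs (cmmeas_boundary fa).
have pos c t : 0 < c -> 0 <= Psi (cabs (boundary f t) / c).
  by move=> c0; apply: le_trans (Psi_ge _); rewrite divr_ge0 ?cabs_ge0// ltW.
apply: le_Iang_ae.
- by apply: mmeas_orlicz => //; [exact: Psi_orlicz|move=> t; exact: cabs_ge0].
- by apply: mmeas_orlicz => //; [exact: Psi_orlicz|move=> t; exact: cabs_ge0].
- by move=> t; exact: pos.
- by move=> t; exact: pos.
apply: aeangT => t _; apply: Psi_homo; first by rewrite divr_ge0 ?cabs_ge0// ltW.
by apply: ler_wpM2l; [exact: cabs_ge0|rewrite lef_pV2 ?posrE].
Qed.

Lemma hardy_orlicz_ctrl f : hardy_orlicz Psi f ->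
  exists C m, [/\ 0 < C, 0 <= m & orlicz_ctrl C m f].
Proof.
move=> [f1 [_ _ [C C0 Cf]]].
have m0 : (0 <= orlicz_modular cm ang Psi (boundary f) C)%E.
  apply: integral_ge0 => t _; rewrite lee_fin; apply: le_trans (Psi_ge _).
  by rewrite divr_ge0 ?cabs_ge0// ltW.
exists C, (2 * fine (orlicz_modular cm ang Psi (boundary f) C)); split=> //.
  by rewrite mulr_ge0// fine_ge0.
move=> z z1; rewrite mulrAC; apply: (orlicz_point (Psi_orlicz R) f1 C0 _ z1).
by rewrite fineK// ge0_fin_numE.
Qed.

(** The infimum defining the norm need not be attained, so an admissible constant below 2 is taken;
    the second 2 comes from the Poisson kernel. *)
Lemma hardy_orlicz_unit_ctrl f : hardy_orlicz Psi f -> (hardy_orlicz_norm Psi f <= 1)%E ->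
  orlicz_ctrl 2 2 f.
Proof.
move=> [f1 _] fn z z1.
have [_ [C [C0 Cm] <-]] : exists2 y, [set C%:E | C in [set C | 0 < C /\
    (orlicz_modular cm ang Psi (boundary f) C <= 1)%E]] y & (y < 2%:E)%E.
  by apply: ereal_inf_lt; apply: le_lt_trans fn _; rewrite lte_fin ltr1n.
rewrite lte_fin => C2.
rewrite -[2 / (1 - _)]mulr1; apply: (orlicz_point (Psi_orlicz R) f1 _ _ z1) => //.
by apply: le_trans (orlicz_modular_homo f1 C0 (ltW C2)) Cm.
Qed.

(** The larger of u and v carries the sum: 4 (u + v) / e is at most 8/e times it, a dilation covered
    by [Psi_growth]. *)
Lemma Psi_half_sum (e : R) : 0 < e -> exists2 K : R, 0 <= K & forall u v P : R,
  0 <= u -> 0 <= v -> Psi u <= P -> Psi v <= P -> Psi (4 * (u + v) / e) <= K * expR (P / 8).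
Proof.
move=> e0; have C0 : 0 < 8 / e by rewrite divr_gt0.
have [K K0 HK] := Psi_growth C0; exists K; first exact: ltW.
have main u v P : 0 <= v -> v <= u -> Psi u <= P -> Psi (4 * (u + v) / e) <= K * expR (P / 8).
  move=> v0 vu uP; have u0 := le_trans v0 vu.
  apply: (@le_trans _ _ (Psi (8 / e * u))).
    apply: Psi_homo; first by apply: divr_ge0; rewrite ?(ltW e0)// mulr_ge0// addr_ge0.
    by rewrite [leRHS]mulrAC ler_pM2r ?invr_gt0//; move: vu; clear; lra.
  apply: le_trans (HK _ u0) _; apply: ler_wpM2l; first exact: ltW.
  by rewrite ler_expR ler_pM2r.
move=> u v P u0 v0 uP vP; have [uv|vu] := leP u v; last exact: main v0 (ltW vu) uP.
by rewrite addrC; exact: main u0 uv vP.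
Qed.

(** Uniform pointwise control gives a normal family. For fixed e the functions Psi(|F n - g| / e) on
    the circle have the integrable majorant K wgt; their means tend to 0, and once at most 1 they
    bound the norm by e. *)
Lemma compact_hardy_orlicz :
  compact_operator (hardy_orlicz Psi) (hardy_orlicz_norm Psi) (composition_operator phi).
Proof.
split=> [f hf|u uA].
  have [C [m [C0 m0 fC]]] := hardy_orlicz_ctrl hf.
  have [[fa _] _] := hf; exact: comp_hardy_orlicz C0 m0 fa fC.
have HF n : exists f, (hardy_orlicz Psi f /\ (hardy_orlicz_norm Psi f <= 1)%E) /\ f \o phi = u n.
  by have [f h1 h2] := uA n; exact: (ex_intro _ f (conj h1 h2)).
have {HF}[F HF] := choice HF.
have Fa n : analytic (F n) by have [[[[h _] _] _] _] := HF n; exact: h.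
have F2 n : orlicz_ctrl 2 2 (F n).
  by have [[h1 h2] _] := HF n; exact: hardy_orlicz_unit_ctrl h1 h2.
have uF n : u n = F n \o phi by have [_ <-] := HF n.
have [k [g [kh ga kg]]] : exists (k : nat -> nat) g,
    [/\ {homo k : m n / (m < n)%N}, analytic g & lucvg (F \o k) g].
  apply: montel => [n|r r0 r1]; first exact: Fa.
  exists (4 / (1 - r)) => n z zr.
  have z1 : cabs z < 1 by apply: le_lt_trans r1.
  have := F2 n z z1 => /(le_trans (Psi_ge _)); rewrite ler_pdivrMr// => h.
  apply: le_trans h _; rewrite mulrAC -natrM; apply: ler_wpM2l => //.
  by rewrite lef_pV2 ?posrE ?subr_gt0// lerD2l lerN2.
(* Enlarging 2 to 4 leaves room for the limit: at each point with g z != 0, |g z| <= 2 |F (k N) z|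
   for some N, so g obeys the same control without any continuity of [Psi]. *)
have F4 n : orlicz_ctrl 4 2 (F n).
  move=> z z1; apply: le_trans (F2 n z z1); apply: Psi_homo.
    by rewrite divr_ge0 ?cabs_ge0.
  by apply: ler_wpM2l; [exact: cabs_ge0|rewrite lef_pV2 ?posrE// ler_nat].
have g4 : orlicz_ctrl 4 2 g.
  move=> z z1; have [g0|gn] := eqVneq (cabs (g z)) 0.
    by rewrite g0 mul0r Psi0 divr_ge0// subr_ge0 ltW.
  have gp : 0 < cabs (g z) / 2 by rewrite divr_gt0// lt_neqAle eq_sym gn cabs_ge0.
  have [N HN] := lucvg_pt kg z1 gp; have := HN N (leqnn _); rewrite /= cabsBC => h.
  apply: le_trans (F2 (k N) z z1); apply: Psi_homo; first by rewrite divr_ge0 ?cabs_ge0.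
  by have := ler_cabsB (g z) (F (k N) z); move: h; clear; lra.
have da n : analytic (fun z => F (k n) z - g z) by exact: analyticB (Fa _) ga.
have ca n := analytic_comp (da n).
exists k, (g \o phi); split; [exact: kh| |].
  by apply: comp_hardy_orlicz ga g4.
have E n : (u \o k) n \- (g \o phi) = (fun z => F (k n) z - g z) \o phi.
  by apply: funext => z; rewrite /= uF.
rewrite /norm_cvg; under eq_fun do rewrite E.
apply: cvge0 => [n|e e0].
  by apply: le_ereal_inf_tmp => _ [C [C0 _] <-]; rewrite lee_fin ltW.
have [K K0 HK] := Psi_half_sum e0.
have [N HN] : exists N, forall n, (N <= n)%N ->
    (Iang (fun t => (Psi (cabs (boundary ((fun z => (F (k n) z - g z)%R) \o phi) t) / e))%R) <= 1%:E)%E.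
  apply: (@dominated_mean _ (fun t => K * wgt t)) => //.
  - move=> n; apply: mmeas_orlicz => //; [exact: Psi_orlicz|by move=> t; exact: cabs_ge0|].
    exact: mmeas_cabs (cmmeas_boundary (ca n)).
  - by apply: mintegrableZ; exact: mint_wgt.
  - by move=> n t; apply: le_trans (Psi_ge _); rewrite divr_ge0 ?cabs_ge0// ltW.
  - apply: aeangW (aeang_oneB R) => t _ t1 n.
    rewrite (boundary_comp (da n) t1); have w1 := phi_bdry_lt1 t.
    have gb := gap_bdry t; set w := phi (expi t) in w1 gb *.
    (* Divided by the 8 of [Psi_growth], this is the exponent gap / 2 of the weight. *)
    have P2 : 2 / (1 - cabs w) <= 4 * gap t.
      by move: gb; set q := _^-1; clear; lra.
    have q0 (x : R[i]) : 0 <= cabs x / 4 by rewrite divr_ge0 ?cabs_ge0.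
    have := HK _ _ _ (q0 (F (k n) w)) (q0 (g w)) (le_trans (F4 (k n) w w1) P2) (le_trans (g4 w w1) P2).
    have -> : 4 * gap t / 8 = gap t / 2 by field.
    apply: le_trans; apply: Psi_homo; first by rewrite divr_ge0 ?cabs_ge0// ltW.
    rewrite ler_pM2r ?invr_gt0// mulrDr ![4 * _]mulrC !divfK//; exact: cabsB.
  - apply: aeangW (aeang_oneB R) => t _ t1.
    under eq_fun do rewrite (boundary_comp (da _) t1).
    have w1 := phi_bdry_lt1 t; set w := phi (expi t) in w1 *.
    apply/cvgrPdist_le => d d0.
    have Q0 : 0 < Psi 1 by apply: lt_le_trans (Psi_ge 1).
    have d1 : 0 < Num.min 1 (d / Psi 1) by rewrite lt_min ltr01 divr_gt0.
    have [N HN] := lucvg_pt kg w1 (mulr_gt0 e0 d1).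
    exists N => // n /= /HN /= h.
    have x0 : 0 <= cabs (F (k n) w - g w) / e by rewrite divr_ge0 ?cabs_ge0// ltW.
    have xm : cabs (F (k n) w - g w) / e <= Num.min 1 (d / Psi 1) by rewrite ler_pdivrMr// mulrC.
    rewrite sub0r normrN ger0_norm; last exact: le_trans (Psi_ge _).
    apply: le_trans (Psi_small x0 _) _; first by apply: le_trans xm _; rewrite ge_min lexx.
    by rewrite -ler_pdivlMr//; apply: le_trans xm _; rewrite ge_min lexx orbT.
exists N => n /HN h; apply: ereal_inf_lbound; exists e => //; split=> //.
Qed.

End Composition.

(** * Singular values *)

Section Schatten.
Variable R : realType.
Local Notation phi := (@phi R).
Local Notation fct := (R[i] -> R[i]).
Local Notation dot := (@hardy2_dot R).
Implicit Types (f g : fct) (s p x : R).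

Lemma coef_sum (I : Type) (r : seq I) (c : I -> R[i]) (e : I -> fct) n :
  (forall i, H2 (e i)) ->
  coef (fun z => \sum_(i <- r) c i * e i z) n = \sum_(i <- r) c i * coef (e i) n.
Proof.
move=> He; elim: r => [|i r IH].
  rewrite big_nil; under [X in coef X]eq_fun do rewrite big_nil.
  by rewrite /coef; under eq_cmean do rewrite mul0r; rewrite cmean_cst.
under [X in coef X]eq_fun do rewrite big_cons.
have [h1 _] := H2Z (c i) (He i); have [h2 _] := H2_sum r c He; have [h3 _] := He i.
by rewrite big_cons (tcoefD n h1 h2) (tcoefZ _ n h3) IH.
Qed.

(** More than N vectors of an N-dimensional space are dependent; the coefficients are read off a
    nonzero row of the kernel. *)
Lemma kernel_family (I : finType) N (a : I -> 'I_N -> R[i]) : (N < #|I|)%N ->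
  exists2 c : I -> R[i], (exists i, c i != 0) & forall n, \sum_i c i * a i n = 0.
Proof.
move=> NI; pose A := \matrix_(j < #|I|, n < N) a (enum_val j) n.
have : kermx A != 0.
  rewrite -mxrank_eq0 mxrank_ker subn_eq0 -ltnNge.
  by apply: leq_ltn_trans NI; exact: rank_leq_col.
case/rowV0Pn => v /sub_kermxP vA v0.
exists (fun i => v 0 (enum_rank i)).
  have /rV0Pn[j vj] := v0; exists (enum_val j); by rewrite enum_valK.
move=> n; have := congr1 (fun M => fun_of_matrix M 0 n) vA; rewrite !mxE => vAn.
rewrite -[RHS]vAn (reindex (@enum_rank I)) /=; last first.
  by apply: onW_bij; exact: enum_rank_bij.
by apply: eq_bigr => i _; rewrite mxE enum_rankK.
Qed.

Lemma rC_inj (x y : R) : x%:C = y%:C -> x = y.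
Proof. by move/(congr1 (@complex.Re R)). Qed.

Lemma conj_rC x : (x%:C : R[i])^* = x%:C.
Proof. by apply: complex_eq; rewrite ?cRe_conj ?cIm_conj /= ?oppr0. Qed.

Section Family.
Variables (I : finType) (s : I -> R) (e : I -> fct).
Hypothesis es : forall i, singular_space (composition_operator phi) (s i) (e i).

Lemma singular_H2 i : H2 (e i).
Proof. by have [h _] := es i; exact/hardy2P. Qed.

Lemma singular_gram i j :
  dot (e i \o phi) (e j \o phi) = (s j ^+ 2)%:C * dot (e i) (e j).
Proof.
have [_ [_ /(_ _ (es i).1) h]] := es j; rewrite [LHS]h.
have -> : (s j ^+ 2)%:C \*o e j = (fun z => (s j ^+ 2)%:C * e j z) by [].
by rewrite (dotZr _ (singular_H2 i) (singular_H2 j)) conj_rC.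
Qed.

(** Computing the image pairing with either vector on the right gives the factor s i ^ 2 or s j ^ 2,
    by conjugate symmetry. *)
Lemma singular_orth i j : s i ^+ 2 != s j ^+ 2 -> dot (e i) (e j) = 0.
Proof.
move=> sij; have hi := singular_H2 i; have hj := singular_H2 j.
have := singular_gram i j; rewrite (dotC (H2_comp hj) (H2_comp hi)) singular_gram.
rewrite rmorphM /= conj_rC -(dotC hj hi) => /eqP.
rewrite -subr_eq0 -mulrBl mulf_eq0 => /orP[|/eqP//].
rewrite -rmorphB /= => /eqP /(congr1 (@complex.Re R)) /= /eqP.
by rewrite subr_eq0 (negPf sij).
Qed.

(* Comparing [dot (T f) (T f)] with [sigma ^ 2 * dot f f] for a combination [f]
   of singular vectors: the difference is the square of the norm of the
   combination with weights [sqrt (s i ^ 2 - sigma ^ 2)]. *)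
Lemma singular_bound sigma N k :
  (forall c : I -> R[i], (forall z, disk z -> \sum_i c i * e i z = 0) -> forall i, c i = 0) ->
  (forall i, sigma <= s i) -> 0 <= sigma -> (N < #|I|)%N ->
  sigma ^+ 2 <= decay R k / N.+1%:R ^+ k.
Proof.
move=> free sg sg0 NI.
have He i := singular_H2 i.
(* The family has more than N members, so some nontrivial combination has its first N coefficients
   zero and [comp_h2le] applies to it. *)
have [c [i0 ci0] cn] := kernel_family (fun i (n : 'I_N) => coef (e i) n) NI.
pose f z := \sum_i c i * e i z; have hf : H2 f by exact: H2_sum.
have fa := proj1 hf.
have f0 n : (n < N)%N -> coef f n = 0.
  by move=> nN; rewrite /f coef_sum// (cn (Ordinal nN)).
have A0 : 0 < nrm2 f.
  rewrite lt_neqAle nrm2_ge0 andbT eq_sym; apply/eqP => z0.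
  by move: ci0; rewrite (free c (nrm2_eq0 hf z0)) eqxx.
have hTf : H2 (f \o phi) := H2_comp hf.
have up := nrm2_le (proj1 hTf) (@comp_h2le _ f _ N k fa A0 (nrm2_h2le hf) f0).
pose tau i := Num.sqrt (s i ^+ 2 - sigma ^+ 2).
pose g z := \sum_i (c i * (tau i)%:C) * e i z; have hg : H2 g by exact: H2_sum.
have E : dot (f \o phi) (f \o phi) - (sigma ^+ 2)%:C * dot f f = dot g g.
  have -> : dot (f \o phi) (f \o phi) = dot (fun z => \sum_i c i * (e i \o phi) z)
    (fun z => \sum_i c i * (e i \o phi) z) by [].
  rewrite (dot_sum c c (fun i => H2_comp (He i))) /f /g (dot_sum c c He) (dot_sum _ _ He).
  rewrite mulr_sumr -sumrB; apply: eq_bigr => i _; rewrite mulr_sumr -sumrB.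
  apply: eq_bigr => j _; rewrite singular_gram.
  (* Different singular values pair to zero; for equal ones the product of the weights is s^2 -
     sigma^2. *)
  have [sij|/singular_orth->] := eqVneq (s i ^+ 2) (s j ^+ 2); last by rewrite !mulr0 subr0.
  have tt : (tau i)%:C * (tau j)%:C = (s j ^+ 2)%:C - (sigma ^+ 2)%:C.
    rewrite -rmorphM /= -rmorphB /= /tau sij -expr2 sqr_sqrtr//.
    by rewrite subr_ge0 lerXn2r ?nnegrE ?(le_trans sg0).
  rewrite [(c j * _)^*]rmorphM /= conj_rC; set x := c i; set y := (c j)^*.
  have -> : x * (tau i)%:C * (y * (tau j)%:C) * dot (e i) (e j) =
    ((tau i)%:C * (tau j)%:C) * (x * y * dot (e i) (e j)) by ring.
  by rewrite tt; ring.
have := nrm2_ge0 g; move: E; rewrite !dot_self// -rmorphM /= -rmorphB /= => /rC_inj <-.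
rewrite subr_ge0 => low; have := le_trans low up.
by rewrite [leLHS]mulrC (ler_pM2l A0).
Qed.

End Family.

(** Let h be the block of the combination belonging to one singular value. Pairing the vanishing
    combination with h leaves only this block, by orthogonality: h has norm 0, hence vanishes on the
    disk, and freeness within the block concludes. *)
Lemma free_union (I : finType) (m : I -> nat) (s : I -> R) (e : forall i, 'I_(m i) -> fct) :
  injective (fun i => s i ^+ 2) ->
  (forall i j, singular_space (composition_operator phi) (s i) (e i j)) ->
  (forall i, free_on_disk (e i)) ->
  forall c : {i : I & 'I_(m i)} -> R[i],
  (forall z, disk z -> \sum_u c u * e (tag u) (tagged u) z = 0) -> forall u, c u = 0.
Proof.
move=> sinj es fr c c0 u.
pose J : finType := {i : I & 'I_(m i)}.
pose s' (u : J) := s (tag u); pose e' (u : J) := e (tag u) (tagged u).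
have es' : forall u, singular_space (composition_operator phi) (s' u) (e' u) by move=> v; exact: es.
have hh v := singular_H2 es' v.
have hi i j : H2 (e i j) by have [h _] := es i j; exact/hardy2P.
case: u => i j.
pose h z := \sum_(l : 'I_(m i)) c (Tagged (fun i => 'I_(m i)) l) * e i l z.
have hH : H2 h by exact: H2_sum.
have orth v : tag v != i -> dot (e' v) h = 0.
  move=> vi; rewrite (dotC hH (hh v)) dot_suml// big1 ?rmorph0// => l _.
  have -> : e i l = e' (Tagged (fun i => 'I_(m i)) l) by [].
  rewrite (singular_orth es') ?mulr0//.
  by apply: contraNneq vi => /sinj /= ->.
have hh0 : dot h h = 0.
  have <- : dot (fun z => \sum_u c u * e' u z) h = 0 by apply: dot_0disk => z z1; exact: c0.
  rewrite [RHS]dot_suml// {1}/h dot_suml//.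
  have -> : \sum_u c u * dot (e' u) h = \sum_(u : J | xpredT (tag u) && true)
      c (Tagged (fun i => 'I_(m i)) (tagged u)) * dot (e (tag u) (tagged u)) h.
    by apply: eq_bigr => -[i' l] _.
  rewrite -(@sig_big_dep _ _ _ I (fun i => 'I_(m i)) xpredT (fun _ _ => true)
    (fun i l => c (Tagged (fun i => 'I_(m i)) l) * dot (e i l) h)) /=.
  rewrite (bigD1 i)//= [X in _ = _ + X]big1 ?addr0// => i' ii'.
  apply: big1 => l _; have -> : e i' l = e' (Tagged (fun i => 'I_(m i)) l) by [].
  by rewrite orth ?mulr0.
have := nrm2_eq0 hH; move: hh0; rewrite dot_self// => /rC_inj -> /(_ erefl) hz.
by apply: (fr i (fun l => c (Tagged (fun i => 'I_(m i)) l))) => z z1; exact: hz.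
Qed.

(** [singular_bound] with exponent 1 bounds the size of free families of singular vectors for x, so
    the supremum defining the multiplicity is attained by a family that later steps can use. *)
Lemma finite_multiplicity x : 0 < x ->
  exists ne : {n : nat & 'I_n -> fct},
  [/\ singular_multiplicity (composition_operator phi) x = (tag ne)%:R%:E,
    (forall i, singular_space (composition_operator phi) x (tagged ne i)) &
    free_on_disk (tagged ne)].
Proof.
move=> x0.
pose Q n := exists e : 'I_n -> fct,
  (forall i, singular_space (composition_operator phi) x (e i)) /\ free_on_disk e.
pose P n := `[< Q n >].
have P0 : exists n, P n.
  exists 0%N; apply/asboolP; exists (fun _ => fun=> 0); split; first by case.
  by move=> c _; case.
have [N HN] : exists N, decay R 1 / N.+1%:R ^+ 1 < x ^+ 2.
  have D0 : 0 <= decay R 1 / x ^+ 2 by rewrite divr_ge0 ?decay_ge0// sqr_ge0.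
  exists (Num.bound (decay R 1 / x ^+ 2)).
  have h := archi_boundP D0; rewrite ltr_pdivrMr ?exprn_gt0// in h.
  rewrite expr1 ltr_pdivrMr ?ltr0n//.
  by apply: lt_le_trans h _; rewrite mulrC ler_pM2l ?exprn_gt0// ler_nat.
have Pb n : P n -> (n <= N)%N.
  move=> /asboolP[e [es fr]]; rewrite leqNgt; apply/negP => Nn.
  have := @singular_bound 'I_n (fun=> x) e es x N 1 fr (fun=> lexx _) (ltW x0).
  by rewrite card_ord => /(_ Nn); rewrite leNgt HN.
have := ex_maxnP P0 Pb; case: ex_maxnP => n /asboolP[e [es fr]] nmax _.
exists (Tagged (fun n => 'I_n -> fct) e); split=> //=.
apply/eqP; rewrite eq_le; apply/andP; split.
  apply: ge_ereal_sup => _ [l Ql <-]; rewrite lee_fin ler_nat.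
  by apply: nmax; apply/asboolP.
by apply: ereal_sup_ubound; exists n => //; exists e.
Qed.

Lemma sum_inv_sqr M : \sum_(j < M) (j.+1%:R ^- 2 : R) <= 2.
Proof.
suff : \sum_(j < M) (j.+1%:R ^- 2 : R) <= 2 - 2 / M.+1%:R.
  by move=> /le_trans; apply; rewrite gerBl divr_ge0.
elim: M => [|M IH]; first by rewrite big_ord0 divr1 subrr.
rewrite big_ord_recr /=; apply: le_trans (lerD IH (lexx _)) _.
have a0 : 0 < M.+1%:R :> R by rewrite ltr0n.
have -> : M.+2%:R = M.+1%:R + 1 :> R by rewrite -natr1.
set a := M.+1%:R in a0 *; have a1 : 1 <= a by rewrite ler1n.
rewrite -subr_ge0.
have -> : 2 - 2 / (a + 1) - (2 - 2 / a + a ^- 2) = (a - 1) / (a ^+ 2 * (a + 1)).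
  by field; rewrite !gt_eqF// addr_gt0.
by rewrite divr_ge0 ?subr_ge0// mulr_ge0 ?sqr_ge0// addr_ge0// ltW.
Qed.

Lemma power_decay p : 0 < p -> exists2 B : R, 0 <= B & exists k, forall x j,
  0 < x -> x ^+ 2 <= decay R k / j.+1%:R ^+ k -> x `^ p <= B * j.+1%:R ^- 2.
Proof.
(* Then k p / 2 >= 2, so the p/2-th power of (j+1)^(-k) is summable in j. *)
move=> p0; pose k := Num.bound (4 / p).
have kp : 2 <= k%:R * (p / 2).
  have h0 : 0 <= 4 / p by rewrite divr_ge0// ltW.
  by have := ltW (archi_boundP h0); rewrite ler_pdivrMr// -/k; lra.
have p20 : 0 <= p / 2 by rewrite divr_ge0// ltW.
exists (decay R k `^ (p / 2)); first exact: powR_ge0.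
exists k => x j x0 xj.
have a1 : 1 <= j.+1%:R :> R by rewrite ler1n.
have a0 : 0 <= j.+1%:R :> R by [].
have -> : x `^ p = (x ^+ 2) `^ (p / 2).
  by rewrite -powR_mulrn ?(ltW x0)// -powRrM; congr powR; field.
have ak0 : 0 < j.+1%:R ^+ k :> R by rewrite exprn_gt0.
apply: le_trans (ge0_ler_powR p20 _ _ xj) _; rewrite ?nnegrE ?sqr_ge0//.
  by rewrite divr_ge0 ?decay_ge0// ltW.
rewrite powRM ?decay_ge0 ?invr_ge0 ?(ltW ak0)//; apply: ler_wpM2l; first exact: powR_ge0.
have -> : (j.+1%:R ^- k) `^ (p / 2) = (((j.+1%:R : R) ^+ k) `^ (p / 2))^-1.
  have q0 : ((j.+1%:R : R) ^+ k) `^ (p / 2) != 0 by rewrite gt_eqF// powR_gt0.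
  apply: (mulIf q0); rewrite mulVf// -powRM ?invr_ge0 ?(ltW ak0)//.
  by rewrite mulVf ?gt_eqF// powR1.
rewrite lef_pV2 ?posrE ?powR_gt0 ?exprn_gt0//.
by rewrite -!powR_mulrn// -powRrM ler_powR.
Qed.

(** With values in decreasing order and repeated n x times, the block of x occupies the ranks from
    the sum over its predecessors to that sum plus n x; the hypothesis bounds each such rank, and
    blocks are compared one by one. Ranging over all decreasing lists inside r lets the induction
    remove the last value. *)
Lemma sum_sorted (p : R) (n : R -> nat) (b : nat -> R) (r : seq R) :
  pairwise >=%R r -> uniq r ->
  (forall r' x, pairwise >=%R (rcons r' x) -> uniq (rcons r' x) -> {subset rcons r' x <= r} -> (0 < n x)%N ->
   forall j, (j < \sum_(y <- rcons r' x) n y)%N -> x `^ p <= b j) ->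
  (forall j, 0 <= b j) ->
  \sum_(x <- r) x `^ p * (n x)%:R <= \sum_(j < \sum_(x <- r) n x) b j.
Proof.
move=> + + H b0; elim/last_ind: r => [_ _|r x IH] in H *.
  by rewrite !big_nil big_ord0.
move=> rx ux; have := rx; rewrite pairwise_rcons => /andP[_ rp].
have := ux; rewrite rcons_uniq => /andP[_ ru].
have := H r x rx ux (fun _ h => h).
rewrite -cats1 !big_cat !big_seq1 /= => Hx.
rewrite -(big_mkord xpredT b) (big_cat_nat (leq0n (\sum_(i <- r) n i)) (leq_addr _ _)) /=.
apply: lerD.
  rewrite big_mkord; apply: IH rp ru => r' y ry uy sub.
  by apply: H ry uy _ => z /sub zr; rewrite mem_rcons inE zr orbT.
have [->|nx] := posnP (n x); first by rewrite addn0 mulr0 big_geq.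
have := Hx nx => {}Hx; set M := \sum_(i <- r) n i.
apply: (@le_trans _ _ (\sum_(M <= j < M + n x) x `^ p)).
  by rewrite sumr_const_nat addKn mulr_natr.
by apply: ler_sum_nat => j /andP[_ jM]; exact: Hx.
Qed.

(** The sum is a supremum over finite sets of values, each of which is sorted. The value x of rank j
    has more than j independent singular vectors with values at least x, so [singular_bound] and
    [power_decay] give x^p <= B / (j+1)^2, and the sum is at most 2 B. *)
Lemma schatten_phi p : 0 < p -> schatten p (composition_operator phi).
Proof.
move=> p0; split; first exact: compact_hardy2.
have [B B0 [k Hk]] := power_decay p0.
have prex (x : R) : exists ne : {n : nat & 'I_n -> fct}, 0 < x ->
  [/\ singular_multiplicity (composition_operator phi) x = (tag ne)%:R%:E,
    (forall i, singular_space (composition_operator phi) x (tagged ne i)) &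
    free_on_disk (tagged ne)].
  have [x0|_] := ltP 0 x; first by have [ne H] := finite_multiplicity x0; exists ne.
  by exists (Tagged (fun n => 'I_n -> fct) (fun _ : 'I_0 => (fun=> 0) : fct)).
have [ne Hne] := choice prex.
pose n x := tag (ne x).
apply: (@le_lt_trans _ _ (B * 2)%:E); last exact: ltry.
apply: ge_ereal_sup => _ [A [fA Ap] <-]; rewrite fsbig_finite//.
set r0 := finmap.enum_fset _.
have r0P x : x \in r0 -> 0 < x.
  by rewrite in_fset_set// inE => /Ap.
have r0u : uniq r0 by exact: finmap.fset_uniq.
have -> : (\sum_(x <- r0) (x `^ p)%:E * singular_multiplicity (composition_operator phi) x =
    (\sum_(x <- r0) x `^ p * (n x)%:R)%R%:E)%E.
  rewrite -sumEFin big_seq [RHS]big_seq; apply: eq_bigr => x /r0P x0.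
  by have [-> _ _] := Hne x x0; rewrite EFinM.
rewrite lee_fin; pose r := sort >=%R r0.
have rP x : x \in r -> 0 < x by rewrite mem_sort => /r0P.
have ru : uniq r by rewrite sort_uniq.
rewrite -(perm_big r0 (_ : perm_eq r r0)) /=; last by rewrite perm_sort.
have rs : pairwise >=%R r.
  by rewrite -sorted_pairwise; [exact/sort_sorted/ge_total|exact: ge_trans].
apply: (@le_trans _ _ (\sum_(j < \sum_(x <- r) n x) B * j.+1%:R ^- 2)); last first.
  by rewrite -mulr_sumr; apply: ler_wpM2l => //; exact: sum_inv_sqr.
apply: (@sum_sorted p n (fun j => B * j.+1%:R ^- 2) r rs ru) => [r' x r'p r'u sub nx j jM|j]; last first.
  by rewrite mulr_ge0// invr_ge0 exprn_ge0.
have x0 : 0 < x by apply/rP/sub; rewrite mem_rcons inE eqxx.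
apply: Hk => //.
set q := rcons r' x in r'p r'u sub jM.
have qx y : y \in q -> x <= y.
  rewrite mem_rcons inE => /predU1P[->//|]; move: r'p; rewrite pairwise_rcons => /andP[/allP + _].
  exact.
pose t := tnth (in_tuple q).
have tq i : t i \in q by exact: mem_tnth.
have tx i : x <= t i by exact/qx/tq.
have t0 i : 0 < t i by exact: lt_le_trans (tx i).
have tinj : injective (fun i => t i ^+ 2).
  move=> i j' /eqP; rewrite eqrXn2 ?(ltW (t0 _))// /t !(tnth_nth 0) /= nth_uniq//.
  by move=> /eqP /val_inj.
pose J : finType := {i : 'I_(size q) & 'I_(n (t i))}.
have es (u : J) : singular_space (composition_operator phi) (t (tag u)) (tagged (ne (t (tag u))) (tagged u)).
  by have [_ H _] := Hne _ (t0 (tag u)); exact: H.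
have fr := @free_union 'I_(size q) (fun i => n (t i)) t (fun i => tagged (ne (t i))) tinj
  (fun i => let: And3 _ H _ := Hne _ (t0 i) in H) (fun i => let: And3 _ _ H := Hne _ (t0 i) in H).
apply: (@singular_bound J _ _ es x j k fr (fun u => tx _) (ltW x0)).
apply: leq_trans jM _; rewrite card_tagged sumnE big_map big_enum /= (big_tnth _ _ q).
by apply: leq_sum => i _; rewrite card_ord.
Qed.

End Schatten.

(** * Failure of compactness on the Bergman-Orlicz space *)

Section Bergman.
Variable R : realType.
Local Notation mu := (@lebesgue_measure R).
Local Notation mR := (measurableTypeR R).
Local Notation T := (mR * mR)%type.
Local Notation am := (area_measure R).
Local Notation pd := (@plane_disk R : set T).
Local Notation cop := (@complex_of_pair R).
Local Notation phi := (@phi R).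
Local Notation Psi := (@Psi R).
Local Notation seg a b := (`[a, b]%classic : set mR).
Implicit Types (z : R[i]) (w : T) (D : set T).

Lemma area_rect (a b c d : R) : a <= b -> c <= d ->
  am (seg a b `*` seg c d) = (pi^-1 * ((b - a) * (d - c)))%:E.
Proof.
move=> ab cd.
have E (x y : R) : x <= y -> mu (seg x y) = (y - x)%:E.
  move=> xy; have := lebesgue_measure_itv `[x, y] => /= ->; rewrite lte_fin.
  by case: ltgtP xy => // ->; rewrite subrr.
have -> : am (seg a b `*` seg c d) =
  ((pi^-1)%:E * product_measure1 mu mu (seg a b `*` seg c d))%E by [].
transitivity ((pi^-1)%:E * (mu (seg a b) * mu (seg c d)))%E; last by rewrite !E.
by congr (_ * _)%E; apply: product_measure1E; exact: measurable_itv.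
Qed.

Definition cmf D (h : T -> R[i]) :=
  measurable_fun D (fun w => Re (h w)) /\ measurable_fun D (fun w => Im (h w)).

Lemma cmf_cabs D h : cmf D h -> measurable_fun D (fun w => cabs (h w)).
Proof.
move=> [m1 m2]; under eq_fun do rewrite cabsE !expr2.
have ms : measurable_fun setT (@Num.sqrt R).
  exact: continuous_measurable_fun (@sqrt_continuous R).
apply: (measurableT_comp ms).
by apply: measurable_funD; exact: measurable_funM.
Qed.

Lemma cmfM D h1 h2 : cmf D h1 -> cmf D h2 -> cmf D (fun w => h1 w * h2 w).
Proof.
move=> [m1 m2] [n1 n2]; split.
  by under eq_fun do rewrite cReM; apply: measurable_funB; exact: measurable_funM.
by under eq_fun do rewrite cImM; apply: measurable_funD; exact: measurable_funM.
Qed.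

Lemma cmfB D h1 h2 : cmf D h1 -> cmf D h2 -> cmf D (fun w => h1 w - h2 w).
Proof.
move=> [m1 m2] [n1 n2]; split.
  by under eq_fun do rewrite cReB; exact: measurable_funB.
by under eq_fun do rewrite cImB; exact: measurable_funB.
Qed.

Lemma cmf_cst D (c : R[i]) : cmf D (fun=> c).
Proof. by split; exact: measurable_cst. Qed.

Lemma cmf_cop D : cmf D cop.
Proof.
split; apply: measurable_funTS; [exact: measurable_fst|exact: measurable_snd].
Qed.

Lemma cmfV D h : cmf D h -> cmf D (fun w => (h w)^-1).
Proof.
move=> mh; have [m1 m2] := mh; have ma := cmf_cabs mh.
have mi : measurable_fun D (fun w => (cabs (h w) * cabs (h w)) `^ (-1)).
  apply: (measurableT_comp (@measurable_powR R (-1))); exact: measurable_funM.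
(* The inverse as conj(h) / |h|^2, a product of measurable functions; both sides are 0 where h
   vanishes. *)
have E w : (h w)^-1 = ((cabs (h w) * cabs (h w)) `^ (-1))%:C * (h w)^*.
  rewrite powR_inv1 ?mulr_ge0 ?cabs_ge0//.
  have [->|h0] := eqVneq (h w) 0; first by rewrite cabs0 mulr0 !invr0 mul0r.
  apply: (mulfI h0); rewrite mulfV// mulrCA mul_conj -rmorphM /= -expr2 mulVf ?rmorph1//.
  by rewrite expf_neq0// cabs_eq0.
split; under eq_fun do rewrite E rC_mul /=.
  by under eq_fun do rewrite cRe_conj; exact: measurable_funM.
have mN : measurable_fun D (fun w => - Im (h w)).
  by under eq_fun do rewrite -mulN1r; apply: measurable_funM => //; exact: measurable_cst.
by under eq_fun do rewrite cIm_conj; exact: measurable_funM.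
Qed.

Lemma mpd : measurable pd.
Proof.
have h : measurable_fun setT (fun w : T => cabs (cop w)) by exact: cmf_cabs (cmf_cop _).
have := h measurableT `]-oo, 1[%classic (measurable_itv _).
rewrite setTI; congr measurable; apply/seteqP; split => w /=; rewrite in_itv //=.
Qed.

Lemma Psi_measurable D (h : T -> R) : measurable_fun D h -> (forall w, 0 <= h w) ->
  measurable_fun D (fun w => Psi (h w)).
Proof.
move=> mh h0; have -> : (fun w => Psi (h w)) = (fun w => Psi (Num.max 0 (h w))).
  by apply: funext => w; congr Psi; apply/esym/max_idPr.
have mP : measurable_fun setT (fun x : R => Psi (Num.max 0 x)).
  apply: nondecreasing_measurable => // x y xy /=.
  by apply: Psi_homo; [rewrite le_max lexx|rewrite ge_max !le_max lexx xy orbT].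
exact: measurableT_comp mP mh.
Qed.

Lemma Psi_scale (t x : R) : 0 <= t -> t <= 1 -> 0 <= x -> Psi (t * x) <= t * Psi x.
Proof.
move=> t0 t1 x0; have := orlicz_convex (Psi_orlicz R) x0 (lexx 0) t0 t1.
by rewrite !mulr0 !addr0 Psi0 mulr0 addr0.
Qed.

(** * Test functions peaking at the point 1 *)

Definition eps n : R := (lev R n)^-1.
Definition pole n z : R[i] := (1 + eps n)%:C - z.
(** The fourth power decays as 16^(-j) at distance 2^j eps, faster than the area 4^j eps^2 grows;
    the factor 1/8 normalizes the modular. *)
Definition test n z : R[i] := (n`!%:R / 8 * eps n ^+ 4)%:C * (pole n z)^-1 ^+ 4.

Lemma eps_gt0 n : 0 < eps n.
Proof. by rewrite invr_gt0 lev_gt0. Qed.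

Lemma eps_le1 n : eps n <= 1.
Proof. by rewrite invf_le1 ?lev_gt0// lev_ge1. Qed.

Lemma pole_ge n z : cabs z < 1 -> eps n <= cabs (pole n z).
Proof.
move=> z1; have := ler_cabsB (1 + eps n)%:C z; have e0 := eps_gt0 n.
by rewrite /pole cabs_real gtr0_norm ?addr_gt0//; move: z1; clear; lra.
Qed.

Lemma pole_gt0 n z : cabs z < 1 -> 0 < cabs (pole n z).
Proof. by move=> z1; apply: lt_le_trans (pole_ge n z1); exact: eps_gt0. Qed.

Lemma cabs_test n z : cabs (test n z) = n`!%:R / 8 * (eps n / cabs (pole n z)) ^+ 4.
Proof.
rewrite /test cabsM cabs_real ger0_norm; last first.
  by apply: mulr_ge0; [rewrite divr_ge0|rewrite exprn_ge0// ltW// eps_gt0].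
have E : (eps n / cabs (pole n z)) ^+ 4 = eps n ^+ 4 * (cabs (pole n z))^-1 ^+ 4 by exact: exprMn.
by rewrite cabsX cabsV E; exact: esym (mulrA _ _ _).
Qed.

Lemma analytic_test n : analytic (test n).
Proof.
apply: analytic_cdiffP => z z1.
have h : cdiff (fun w : R[i] => (pole n w)^-1) z.
  apply: (@cdiff_local R (fun w : R[i] => 1 / pole n w) _ _ 1) => [//|w _|]; first by rewrite mul1r.
  apply: cdiff_div; [by rewrite -cabs_gt0 pole_gt0|exact: cdiff_cst|].
  by apply: cdiffB; [exact: cdiff_cst|exact: cdiff_id].
by apply: cdiffM; [exact: cdiff_cst|exact: cdiffX 4 h].
Qed.

Lemma cmf_test n : cmf pd (test n \o cop).
Proof.
have m1 : cmf pd (fun w => (pole n (cop w))^-1).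
  by apply: cmfV; apply: cmfB; [exact: cmf_cst|exact: cmf_cop].
have m2 := cmfM m1 m1; have m4 := cmfM m2 m2.
have -> : test n \o cop = (fun w => (n`!%:R / 8 * eps n ^+ 4)%:C *
    ((pole n (cop w))^-1 * (pole n (cop w))^-1 * ((pole n (cop w))^-1 * (pole n (cop w))^-1))).
  by apply: funext => w; rewrite /test /=; set q := (pole n (cop w))^-1; ring.
exact: cmfM (cmf_cst _ _) m4.
Qed.

(** If v lies in the shell 2^j e <= v < 2^(j+1) e, the term of index j alone is at least (e /
    v)^4. *)
Lemma ratio_dyadic (v e : R) J : 0 < e -> e <= v -> v < 2 ^+ J * e ->
  (e / v) ^+ 4 <= \sum_(j < J) (if v < 2 ^+ j.+1 * e then 16^-1 ^+ j else 0).
Proof.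
move=> e0 ev; have v0 : 0 < v by apply: lt_le_trans ev.
elim: J => [|J IH]; first by rewrite expr0 mul1r ltNge ev.
move=> vJ; rewrite big_ord_recr /= vJ.
have [h|h] := ltP v (2 ^+ J * e).
  by apply: le_trans (IH h) _; rewrite lerDl exprn_ge0// invr_ge0.
rewrite -[leLHS]add0r; apply: lerD.
  by apply: sumr_ge0 => j _; case: ifP => // _; rewrite exprn_ge0// invr_ge0.
have -> : 16^-1 ^+ J = (2^-1 ^+ J) ^+ 4 :> R.
  have -> : 16^-1 = 2^-1 ^+ 4 :> R by field.
  by rewrite -!exprM mulnC.
rewrite lerXn2r ?nnegrE ?exprn_ge0 ?invr_ge0 ?divr_ge0 ?(ltW e0) ?(ltW v0)//.
rewrite ler_pdivrMr// exprVn mulrC ler_pdivlMr ?exprn_gt0//.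
by rewrite mulrC.
Qed.

(** Convexity with Psi 0 = 0 gives Psi (t n!) <= t Psi (n!) for t in [0, 1], and Psi (n!) <=
    lev^2. *)
Lemma Psi_test n z : cabs z < 1 ->
  Psi (cabs (test n z)) <= lev R n ^+ 2 / 8 * (eps n / cabs (pole n z)) ^+ 4.
Proof.
move=> z1; have v0 := pole_gt0 n z1; have e0 := eps_gt0 n.
set q := (eps n / cabs (pole n z)) ^+ 4.
have q0 : 0 <= q by rewrite exprn_ge0// divr_ge0// ltW.
have q1 : q <= 1.
  by rewrite exprn_ile1 ?divr_ge0 ?(ltW e0) ?(ltW v0)// ler_pdivrMr// mul1r pole_ge.
rewrite cabs_test -/q; have -> : n`!%:R / 8 * q = q / 8 * n`!%:R by ring.
apply: le_trans (Psi_scale _ _ _) _ => //; first by rewrite divr_ge0.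
  by rewrite ler_pdivrMr//; move: q1; clear; lra.
have := Psi_fact R n; have -> : lev R n ^+ 2 / 8 * q = q / 8 * lev R n ^+ 2 by ring.
by move=> h; apply: ler_wpM2l => //; rewrite divr_ge0.
Qed.

(** A rectangle containing the points of the disk at distance less than 2^(j+1) eps from the pole 1
    + eps. *)
Definition box n j : set T :=
  seg (1 - 2 ^+ j.+1 * eps n) 1 `*` seg (- (2 ^+ j.+1 * eps n)) (2 ^+ j.+1 * eps n).

Lemma mbox n j : measurable (box n j).
Proof. by apply: measurableX; exact: measurable_itv. Qed.

Lemma area_box n j : am (box n j) = (pi^-1 * (8 * 4 ^+ j * eps n ^+ 2))%:E.
Proof.
have b0 : 0 <= 2 ^+ j.+1 * eps n by rewrite mulr_ge0 ?exprn_ge0// ltW// eps_gt0.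
rewrite area_rect; [|by rewrite gerBl|by rewrite ge0_cp].
congr (_%:E); congr (_ * _).
have -> : 4 ^+ j = 2 ^+ j * 2 ^+ j :> R by rewrite -exprMn; congr (_ ^+ _); ring.
by rewrite exprS; ring.
Qed.

Lemma in_box n j w : pd w -> cabs (pole n (cop w)) < 2 ^+ j.+1 * eps n -> box n j w.
Proof.
case: w => x y; rewrite /plane_disk /disk /= => z1 v1; have e0 := eps_gt0 n.
have := Re_le_cabs (pole n (x +i* y)); have := Im_le_cabs (pole n (x +i* y)).
rewrite /pole cReB cImB /= sub0r normrN -/(pole n _) => h1 h2.
have x1 := Re_le (x +i* y); rewrite /= in x1.
have := le_lt_trans h1 v1; have := le_lt_trans h2 v1; rewrite !ltr_norml.
move=> /andP[a1 a2] /andP[b1 b2]; split; rewrite /= in_itv /=; apply/andP; split.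
- by move: a2 e0; clear; lra.
- exact: le_trans x1 (ltW z1).
- exact: ltW.
- exact: ltW.
Qed.

(** On the box of index j the bound lev^2 / 8 * 16^(-j) meets the area 8 * 4^j eps^2 / pi; as lev *
    eps = 1, the contribution is 4^(-j) / pi, and the sum is at most 2 / pi <= 1. *)
Lemma test_modular n : (orlicz_modular am pd Psi (test n \o cop) 1 <= 1)%E.
Proof.
have e0 := eps_gt0 n; have e1 := eps_le1 n; have l0 := lev_gt0 R n.
have [J HJ] : exists J, 3 < 2 ^+ J * eps n.
  exists (Num.bound (3 / eps n)); rewrite -ltr_pdivrMr//.
  have h0 : 0 <= 3 / eps n by rewrite divr_ge0// ltW.
  apply: lt_le_trans (archi_boundP h0) _.
  by rewrite -natrX ler_nat ltnW// ltn_expl.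
pose c j : R := lev R n ^+ 2 / 8 * 16^-1 ^+ j.
have c0 j : 0 <= c j by rewrite mulr_ge0 ?divr_ge0 ?exprn_ge0 ?invr_ge0// ltW.
have pw w : pd w -> Psi (cabs (test n (cop w)) / 1) <= \sum_(j < J) c j * \1_(box n j) w.
  move=> wd; rewrite divr1; apply: le_trans (Psi_test n wd) _.
  set v := cabs (pole n (cop w)).
  have vJ : v < 2 ^+ J * eps n.
    apply: le_lt_trans HJ; apply: le_trans (cabsB _ _) _.
    rewrite cabs_real gtr0_norm ?addr_gt0//.
    by move: wd e1; rewrite /plane_disk /disk /=; clear; lra.
  apply: (@le_trans _ _ (lev R n ^+ 2 / 8 * \sum_(j < J) (if v < 2 ^+ j.+1 * eps n then 16^-1 ^+ j else 0))).
    by apply: ler_wpM2l; [rewrite divr_ge0// sqr_ge0|exact: ratio_dyadic e0 (pole_ge n wd) vJ].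
  rewrite mulr_sumr; apply: ler_sum => j _; rewrite /c -[leRHS]mulrA.
  apply: ler_wpM2l; first by rewrite divr_ge0// sqr_ge0.
  case: ifP => [vj|_]; last by rewrite mulr_ge0// exprn_ge0// invr_ge0.
  by rewrite indicE mem_set ?mulr1//; exact: in_box.
have mt : measurable_fun pd (fun w => Psi (cabs (test n (cop w)) / 1)).
  under eq_fun do rewrite divr1.
  by apply: Psi_measurable; [exact: cmf_cabs (cmf_test n)|move=> w; exact: cabs_ge0].
have mi j : measurable_fun pd (fun w => \1_(box n j) w : R).
  by apply: measurable_indic; exact: mbox.
have mc j : measurable_fun pd (fun w => c j * \1_(box n j) w : R).
  by apply: measurable_funM => //; exact: measurable_cst.
apply: (@le_trans _ _ (\int[am]_(w in pd) (\sum_(j < J) (c j * \1_(box n j) w)%:E))%E).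
  apply: ge0_le_integral; first exact: mpd.
  - by move=> w _; rewrite lee_fin; apply: le_trans (Psi_ge _); rewrite divr_ge0// cabs_ge0.
  - exact/measurable_EFinP.
  - by apply: emeasurable_sum => j; exact/measurable_EFinP.
  - by move=> w wd; rewrite sumEFin lee_fin; exact: pw.
rewrite ge0_integral_sum; first last.
- by move=> j w _; rewrite lee_fin mulr_ge0.
- by move=> j; exact/measurable_EFinP.
- exact: mpd.
apply: (@le_trans _ _ (\sum_(j < J) (c j * (pi^-1 * (8 * 4 ^+ j * eps n ^+ 2)))%:E)%E).
  apply: lee_sum => j _; under eq_integral do rewrite EFinM.
  rewrite ge0_integralZl_EFin; [|exact: mpd|by move=> w _; rewrite lee_fin|exact/measurable_EFinP|exact: c0].
  rewrite integral_indic; [|exact: mpd|exact: mbox].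
  rewrite [leRHS]EFinM; apply: lee_wpmul2l; first by rewrite lee_fin.
  rewrite -area_box; apply: le_measure; rewrite ?inE; [|exact: mbox|exact: subIsetl].
  by apply: measurableI; [exact: mbox|exact: mpd].
rewrite sumEFin lee_fin.
have -> : \sum_(j < J) c j * (pi^-1 * (8 * 4 ^+ j * eps n ^+ 2)) = pi^-1 * \sum_(j < J) 4^-1 ^+ j.
  rewrite mulr_sumr; apply: eq_bigr => j _; rewrite /c /eps.
  have -> : 16^-1 ^+ j = 4^-1 ^+ j * 4^-1 ^+ j :> R by rewrite -exprMn; congr (_ ^+ _); field.
  have h : 4^-1 ^+ j * 4 ^+ j = 1 :> R by rewrite -exprMn mulVf ?expr1n.
  set x := 4^-1 ^+ j in h *; set y := 4 ^+ j in h *.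
  have -> : lev R n ^+ 2 / 8 * (x * x) * (pi^-1 * (8 * y * (lev R n)^-1 ^+ 2)) =
    pi^-1 * x * (x * y) by set q := pi^-1; field; rewrite gt_eqF.
  by rewrite h mulr1.
have s2 : \sum_(j < J) 4^-1 ^+ j <= 2 :> R.
  suff : \sum_(j < J) 4^-1 ^+ j <= 2 - 2 * 4^-1 ^+ J :> R.
    by move=> /le_trans; apply; rewrite gerBl mulr_ge0// exprn_ge0// invr_ge0.
  clear; elim: J => [|J IH]; first by rewrite big_ord0 expr0 mulr1 subrr.
  rewrite big_ord_recr /= exprS; have : 0 <= 4^-1 ^+ J :> R by rewrite exprn_ge0// invr_ge0.
  by move: IH; set q := 4^-1 ^+ J; lra.
rewrite mulrC ler_pdivrMr ?pi_gt0// mul1r; exact: le_trans s2 (pi_ge2 R).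
Qed.

Lemma test_bergman n : bergman_orlicz Psi (test n) /\ (bergman_orlicz_norm Psi (test n) <= 1)%E.
Proof.
have m1 := test_modular n; have [r1 r2] := cmf_test n; split; last first.
  by apply: ereal_inf_lbound; exists 1.
split; first exact: analytic_test.
by split => //; exists 1 => //; apply: le_lt_trans m1 _; exact: ltry.
Qed.

Lemma test_upper n z : cabs z < 1 -> cabs (test n z) <= n`!%:R / 8.
Proof.
move=> z1; have v0 := pole_gt0 n z1; have e0 := eps_gt0 n.
rewrite cabs_test ler_piMr ?divr_ge0// exprn_ile1 ?divr_ge0 ?(ltW e0) ?(ltW v0)//.
by rewrite ler_pdivrMr// mul1r pole_ge.
Qed.

(** [phi z] is within eps of 1, hence within 2 eps of the pole: the ratio is at least 1/2, and 128 =
    8 * 2^4. *)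
Lemma test_lower n z : cabs z < 1 -> cabs (1 - z) <= expR (- lev R n) ->
  n`!%:R / 128 <= cabs (test n (phi z)).
Proof.
move=> z1 zl; have w1 : cabs (phi z) < 1 by have [_] := phi_self R; apply.
have v0 := pole_gt0 n w1; have e0 := eps_gt0 n.
have v2 : cabs (pole n (phi z)) <= 2 * eps n.
  have -> : pole n (phi z) = (eps n)%:C + (1 - phi z).
    by rewrite /pole rmorphD /= rmorph1; ring.
  apply: le_trans (cabsD _ _) _; rewrite cabs_real (gtr0_norm e0).
  have := phi_near (lev_gt0 R n) z1 zl; rewrite -/(eps n); lra.
rewrite cabs_test.
have h : 2^-1 <= eps n / cabs (pole n (phi z)).
  by rewrite ler_pdivlMr// ler_pdivrMl.
have h4 : 2^-1 ^+ 4 <= (eps n / cabs (pole n (phi z))) ^+ 4.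
  by rewrite lerXn2r ?nnegrE ?invr_ge0 ?divr_ge0 ?(ltW e0) ?(ltW v0).
have -> : n`!%:R / 128 = n`!%:R / 8 * 2^-1 ^+ 4 :> R by field.
by apply: ler_wpM2l => //; rewrite divr_ge0.
Qed.

(** A rectangle inside the disk and within r = e^(-lev) of 1, with sides r/4 and r/2, so that its
    area is computed exactly. *)
Definition corner n : set T := let r := expR (- lev R n) in
  seg (1 - r / 2) (1 - r / 4) `*` seg (- (r / 4)) (r / 4).

Lemma corner_disk n w : corner n w -> cabs (cop w) < 1 /\ cabs (1 - cop w) <= expR (- lev R n).
Proof.
case: w => x y; rewrite /corner; have r0 := expR_gt0 (- lev R n).
have r1 : expR (- lev R n) <= 1.
  by rewrite -expR0 ler_expR oppr_le0 ltW// lev_gt0.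
move: (expR _) r0 r1 => r r0 r1 [/=]; rewrite !in_itv /= => /andP[x1 x2] /andP[y1 y2].
split.
  rewrite -(@expr_lt1 _ 2)// ?cabs_ge0// sqr_cabs /=; rewrite !expr2; nra.
apply: le_trans (cabs_le_ReIm _) _; rewrite cReB cImB /= sub0r normrN.
have : `|1 - x| <= r / 2 by rewrite ler_norml; apply/andP; split; lra.
have : `|y| <= r / 4 by rewrite ler_norml; apply/andP; split; lra.
lra.
Qed.

Lemma ecvg0_lt (x : nat -> \bar R) e : x @ \oo --> 0%E -> 0 < e ->
  exists N, forall n, (N <= n)%N -> (x n < e%:E)%E.
Proof.
move=> /fine_cvgP[[N1 _ H1]] /cvgrPdist_lt H e0; have [N2 _ H2] := H e e0.
exists (maxn N1 N2) => n; rewrite geq_max => /andP[n1 n2].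
rewrite -(fineK (H1 n n1)) lte_fin; have := H2 n n2; rewrite /= sub0r normrN.
exact/le_lt_trans/ler_norm.
Qed.

Lemma modular_norm_lt f C : (bergman_orlicz_norm Psi f < C%:E)%E ->
  exists C', [/\ 0 < C', C' < C & (orlicz_modular am pd Psi (f \o cop) C' <= 1)%E].
Proof.
by move=> /ereal_inf_lt[_ [C' [C0 h] <-]]; rewrite lte_fin => CC; exists C'.
Qed.

(** 512 d is at most the midpoint of 1024 a and 1024 b, which lie below a / C1 and b / C2; convexity
    does the rest. *)
Lemma Psi_mid (a b d C1 C2 : R) : 0 <= a -> 0 <= b -> 0 <= d -> d <= a + b ->
  0 < C1 -> 0 < C2 -> C1 < 1 / 1024 -> C2 < 1 / 1024 ->
  2 * Psi (512 * d) <= Psi (a / C1) + Psi (b / C2).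
Proof.
move=> a0 b0 d0 dab c1 c2 h1 h2.
have q (c x : R) : 0 < c -> c < 1 / 1024 -> 0 <= x -> 1024 * x <= x / c.
  move=> c0 hc x0; rewrite ler_pdivlMr//; have := ler_wpM2l x0 (ltW hc).
  by set y := x * c => h; rewrite -mulrA -/y; move: h; clear; lra.
have t0 : 0 <= 2^-1 :> R by [].
have t1 : 2^-1 <= 1 :> R by rewrite invf_le1 ?ltr0n ?ler1n.
have k1 : 0 <= 1024 * a := mulr_ge0 (ler0n R 1024) a0.
have k2 : 0 <= 1024 * b := mulr_ge0 (ler0n R 1024) b0.
have := orlicz_convex (Psi_orlicz R) k1 k2 t0 t1.
have := Psi_homo k1 (q _ _ c1 h1 a0); have := Psi_homo k2 (q _ _ c2 h2 b0).
have d5 : 0 <= 512 * d := mulr_ge0 (ler0n R 512) d0.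
have : Psi (512 * d) <= Psi (2^-1 * (1024 * a) + (1 - 2^-1) * (1024 * b)).
  by apply: Psi_homo; [exact: d5|move: dab; clear; lra].
move: (Psi (512 * d)) (Psi (1024 * a)) (Psi (1024 * b)) (Psi (a / C1)) (Psi (b / C2)).
by move: (Psi _); clear=> *; lra.
Qed.

(** Two terms of a convergent subsequence would both be close to g. On the corner of the later one
    they differ by at least N!/256, and [Psi] at 512 times this, that is at 2 N!, exceeds the
    reciprocal of the area of the corner by too large a factor for both modulars to be at most 1. *)
Lemma not_compact_bergman :
  ~ compact_operator (bergman_orlicz Psi) (bergman_orlicz_norm Psi) (composition_operator phi).
Proof.
move=> [stable rc].
have [k [g [kh [ga [g1 g2 _]] cv]]] := rc (fun n => test n \o phi) (fun n =>
  ex_intro2 _ _ (test n) (test_bergman n) erefl).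
(* 1024 = 2 * 512, where 512 / 256 = 2 sends the gap N!/256 to 2 N!, and the other 2 is lost in the
   midpoint convexity. *)
have e0 : 0 < 1 / 1024 :> R by apply: divr_gt0 ltr01 _; rewrite ltr0n.
have [m Hm] := ecvg0_lt cv e0.
have kn i : (i <= k i)%N by elim: i => // i IH; apply: leq_ltn_trans IH _; exact: kh.
(* A lag of 32 makes N! >= 32 (k m)!, so the earlier function, at most (k m)!/8, takes away no more
   than half of N!/128. *)
pose n := maxn m (k m + 32).
have nm : (m <= n)%N by rewrite leq_maxl.
have kmn : (k m + 32 <= k n)%N by apply: leq_trans (kn n); rewrite leq_maxr.
have [C1 [c1 h1 M1]] := modular_norm_lt (Hm n nm).
have [C2 [c2 h2 M2]] := modular_norm_lt (Hm m (leqnn m)).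
have mg : cmf pd (g \o cop) by split.
have mt i : cmf pd (test i \o phi \o cop).
  by have [_ [r1 r2 _]] := stable _ (test_bergman i).1; split.
pose G C i w := Psi (cabs (test (k i) (phi (cop w)) - g (cop w)) / C).
have mG C i : 0 < C -> measurable_fun pd (G C i).
  move=> C0; apply: Psi_measurable.
    apply: measurable_funM; last exact: measurable_cst.
    exact: cmf_cabs (cmfB (mt (k i)) mg).
  by move=> w; rewrite divr_ge0 ?cabs_ge0// ltW.
have G0 C i w : 0 < C -> 0 <= G C i w.
  by move=> C0; apply: le_trans (Psi_ge _); rewrite divr_ge0 ?cabs_ge0// ltW.
set N := k n in kmn M1; set L := lev R N; set r := expR (- L).
have r0 : 0 < r by exact: expR_gt0.
have mc : measurable (corner N) by apply: measurableX; exact: measurable_itv.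
have cpd : corner N `<=` pd by move=> w /corner_disk[].
have fact32 : 32 * (k m)`!%:R <= N`!%:R :> R.
  have : (k m + 32)`!%:R <= N`!%:R :> R by rewrite ler_nat leq_fact.
  apply: le_trans; rewrite addnS factS natrM; apply: ler_pM => //.
    by rewrite ler_nat -addnS leq_addl.
  by rewrite ler_nat leq_fact// leq_addr.
have pw w : corner N w -> 2 * Psi (2 * N`!%:R) <= G C1 n w + G C2 m w.
  move=> cw; have [z1 zl] := corner_disk cw; set z := cop w in z1 zl.
  have w1 : cabs (phi z) < 1 by have [_] := phi_self R; apply.
  have lo := test_lower z1 zl; have up := test_upper (k m) w1.
  apply: le_trans (_ : _ <= 2 * Psi (512 * (N`!%:R / 256))) _.
    have -> : 512 * (N`!%:R / 256) = 2 * N`!%:R :> R by field.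
    exact: lexx.
  apply: (Psi_mid _ _ _ _ c1 c2 h1 h2); [exact: cabs_ge0|exact: cabs_ge0|exact: divr_ge0 (ler0n _ _) (ler0n _ _)|].
  have := cabsB (test N (phi z) - g z) (test (k m) (phi z) - g z).
  have -> : test N (phi z) - g z - (test (k m) (phi z) - g z) = test N (phi z) - test (k m) (phi z) by ring.
  have := ler_cabsB (test N (phi z)) (test (k m) (phi z)).
  move: lo up fact32; rewrite -/(cop w) -/z.
  move: (cabs (test N _)) (cabs (test (k m) _)) (cabs (_ - test (k m) _)).
  move: (cabs _) (cabs _) (N`!%:R : R) ((k m)`!%:R : R); clear=> *; lra.
(* Integrating the pointwise bound over the corner compares with the sum of two modulars, each at
   most 1. *)
have I2 : ((2 * Psi (2 * N`!%:R))%:E * am (corner N) <= 2%:E)%E.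
  rewrite -integral_cst//.
  apply: (@le_trans _ _ (\int[am]_(w in pd) ((G C1 n w)%:E + (G C2 m w)%:E))%E).
    apply: (@le_trans _ _ (\int[am]_(w in corner N) ((G C1 n w)%:E + (G C2 m w)%:E))%E).
      apply: ge0_le_integral; first exact: mc.
      - move=> w _; rewrite lee_fin mulr_ge0//; apply: le_trans (Psi_ge _).
        by rewrite mulr_ge0.
      - exact: measurable_cst.
      - apply: (@measurable_funS _ _ _ _ pd) => //; first exact: mpd.
        by apply: emeasurable_funD; apply/measurable_EFinP; exact: mG.
      - by move=> w cw; rewrite -EFinD lee_fin; exact: pw.
    apply: ge0_subset_integral => //; first exact: mpd.
      by apply: emeasurable_funD; apply/measurable_EFinP; exact: mG.
    by move=> w _; rewrite adde_ge0// lee_fin G0.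
  rewrite ge0_integralD; first last.
  - by apply/measurable_EFinP; exact: mG.
  - by move=> w _; rewrite lee_fin G0.
  - by apply/measurable_EFinP; exact: mG.
  - by move=> w _; rewrite lee_fin G0.
  - exact: mpd.
  by have -> : 2%:E = (1 + 1)%E :> \bar R; [rewrite -EFinD|exact: leeD].
move: I2; rewrite /corner -/L -/r area_rect; first last.
- by rewrite ge0_cp// divr_ge0// ltW.
- by move: r0; clear; lra.
rewrite -EFinM lee_fin.
have -> : 1 - r / 4 - (1 - r / 2) = r / 4 by field.
have -> : r / 4 - - (r / 4) = r / 2 by field.
have big := Psi_2fact R N; rewrite -/L in big.
have er : expR (2 * L) * (r * r) = 1.
  by rewrite /r -expRD -expRD -[RHS]expR0; congr expR; ring.
have p0 := pi_gt0 R; have /andP[_ p4] := pihalf_02 R.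
have ip : 4^-1 <= pi^-1 :> R.
  by rewrite lef_pV2 ?posrE//; move: p4; clear; lra.
have rr : 0 < r * r by rewrite mulr_gt0.
have : 40 <= Psi (2 * N`!%:R) * (r * r).
  have : 40 * expR (2 * L) * (r * r) <= Psi (2 * N`!%:R) * (r * r) by rewrite ler_pM2r.
  by rewrite -mulrA er mulr1.
(* The left-hand side of the bound is Psi(2 N!) r^2 / (4 pi), at least 40 / 16 because Psi(2 N!) r^2
   >= 40 and pi <= 4, whereas it should be at most 2. *)
move: ip; set q := pi^-1; set y := Psi _.
have -> : 2 * y * (q * (r / 4 * (r / 2))) = (y * (r * r)) * q / 4 by field.
move: (y * (r * r)) q; clear=> x y h1 h2 h3.
have : 40 * 4^-1 <= x * y by apply: ler_pM.
lra.
Qed.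

End Bergman.

Theorem theorem3p5 (R : realType) :
  exists (phi : R[i] -> R[i]) (Psi : R -> R),
    [/\ analytic_self_map phi,
        orlicz_function Psi,
        compact_operator (hardy_orlicz Psi) (hardy_orlicz_norm Psi)
          (composition_operator phi),
        forall p : R, 0 < p -> schatten p (composition_operator phi) &
        ~ compact_operator (bergman_orlicz Psi) (bergman_orlicz_norm Psi)
            (composition_operator phi)].
Proof.
exists (@phi R), (@Psi R); split.
- exact: phi_self.
- exact: Psi_orlicz.
- exact: compact_hardy_orlicz.
- by move=> p p0; exact: schatten_phi.
- exact: not_compact_bergman.
Qed.
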